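(* Let $n\in\mathbb Z^d\setminus\{0\}$ and $\lambda\in\mathbb C$ with $\operatorname{Re}\lambda>0$. If the linearized eigenvalue problem $$(\lambda-\mathcal B_n)\varphi=\varrho_0g_0g_1\widehat W_n\,\rho[\varphi]\,\Delta_{y^K}M_0$$ has a solution $\varphi$ in the domain of $\mathcal B_n$ with $\rho[\varphi]\neq0$, then $\lambda$ satisfies the dispersion relation $$-\varrho_0\,g_0\,g_1\,\widehat W_n|q_n|^2\int_0^\infty e^{-\lambda t}\,C_K(t)^2\exp\Big(-\frac{|q_n|^2}{2}V(t)\Big)\,dt=1 .$$ Conversely, if $\lambda$ satisfies this dispersion relation, then the eigenvalue problem has a solution $\varphi$ with $\rho[\varphi]\ne0$ (so that the $n$-th Fourier mode induces a spatially inhomogeneous linear instability).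
   Context: $d,K\ge1$ are integers; $\Omega=(0,1)^d$ is the torus. $\mathbf y=(y^1,\dots,y^K)\in\mathbb R^{dK}$, $y^k\in\mathbb R^d$; $\mathbf y_\ell=(y^1_\ell,\dots,y^K_\ell)^T\in\mathbb R^K$ for $\ell\in\{1,\dots,d\}$. $\alpha_1,\dots,\alpha_K>0$; $A\in\mathbb R^{K\times K}$ has $A_{kk}=-\alpha_k$, $A_{k,k+1}=1$, all other entries zero; $e_K=(0,\dots,0,1)^T$. $(A\mathbf y)_\ell:=A\mathbf y_\ell$. $\varrho_0>0$ is fixed, $G:\mathbb R^+\to\mathbb R^+$ is bounded, positive, decreasing and differentiable at $\varrho_0$, $g_0:=G(\varrho_0)>0$, $g_1:=G'(\varrho_0)<0$. $W$ is nonnegative, bounded, radially symmetric, nonincreasing in $|x|$, compactly supported, periodically extended to $\Omega$, with $\int_\Omega W=1$. $q_n:=2\pi n$ and $\widehat W_n:=\int_\Omega W(x)e^{-iq_n\cdot x}\,dx\in\mathbb R$. $M_0(\mathbf y)=(2\pi)^{-dK/2}(\det\Sigma)^{-d/2}\exp(-\frac12\sum_{\ell=1}^d\mathbf y_\ell^T\Sigma^{-1}\mathbf y_\ell)$ with $\Sigma=g_0^2\int_0^\infty e^{tA}e_Ke_K^Te^{tA^T}dt$. $\rho[\varphi]:=\int_{\mathbb R^{dK}}\varphi(\mathbf y)\,d\mathbf y$. $\mathcal B_n h:=-\nabla_{\mathbf y}\cdot(A\mathbf yh)+\frac{g_0^2}{2}\Delta_{y^K}h-i(q_n\cdot y^1)h$,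 considered on the complex Hilbert space $H=L^2(\mathbb R^{dK};M_0^{-1}d\mathbf y)$, with domain the closure of $C_c^\infty(\mathbb R^{dK})$ in the graph norm $\|h\|_H+\|\mathcal B_nh\|_H$. The eigenvalue problem arises by inserting $e^{\lambda t}\varphi(\mathbf y)$ in the $n$-th spatial Fourier mode of the linearization, around $f_0=\varrho_0M_0$, of the equation $\partial_tf+y^1\cdot\nabla_xf=-\nabla_{\mathbf y}\cdot(A\mathbf yf)+\frac12G(W\ast\rho[f])^2\Delta_{y^K}f$. $C_K(t):=\int_0^t(e^{sA})_{1K}\,ds$, and $V(t):=\operatorname{Var}\big(\int_0^tY^1_s\,ds\big)$, where $(Y_s)_{s\ge0}$ is the stationary $\mathbb R^K$-valued Ornstein--Uhlenbeck process $dY_s=AY_s\,ds+g_0e_K\,dB_s$ with $B$ a one-dimensional Brownian motion and $Y_0\sim\mathcal N(0,\Sigma)$ independent of $B$; $Y^1$ is its first component. *)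

(* Defs.v *)
From HB Require Import structures.
From mathcomp Require Import all_boot all_order all_algebra.
From mathcomp Require Import all_classical all_reals all_analysis.
From mathcomp.real_closed Require Export complex.

Set Implicit Arguments.
Unset Strict Implicit.
Unset Printing Implicit Defensive.

Import Order.TTheory GRing.Theory Num.Theory.
Import numFieldNormedType.Exports.

Local Open Scope classical_set_scope.
Local Open Scope ring_scope.
Local Open Scope complex_scope.

Section matrix_measurable.
Context {d} {T : sigmaRingType d} (m n : nat).

Definition mx_cylinders : set (set 'M[T]_(m, n)) :=
  [set A | exists i j, exists2 D : set T, measurable D &
             A = (fun M : 'M[T]_(m, n) => M i j) @^-1` D].

Let mx_set0 : <<s mx_cylinders >> set0.
Proof. exact: sigma_algebra0. Qed.

Let mx_setC A : <<s mx_cylinders >> A -> <<s mx_cylinders >> (~` A).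
Proof. exact: sigma_algebraC. Qed.

Let mx_bigcup (F : _^nat) : (forall i, <<s mx_cylinders >> (F i)) ->
  <<s mx_cylinders >> (\bigcup_i (F i)).
Proof. exact: sigma_algebra_bigcup. Qed.

HB.instance Definition _ := @isMeasurable.Build (measure_tuple_display d)
  'M[T]_(m, n) <<s mx_cylinders >> mx_set0 mx_setC mx_bigcup.

End matrix_measurable.

Section lebesgue_matrix.
Context {R : realType}.

Definition tcons n (p : n.-tuple R * R) : n.+1.-tuple R :=
  [the n.+1.-tuple R of p.2 :: p.1].

Lemma measurable_tcons n : measurable_fun setT (@tcons n).
Proof. exact: measurable_cons. Qed.

Definition mx_of_tuple m n (t : (m * n).-tuple R) : 'M[R]_(m, n) :=
  \matrix_(i, j) tnth t (mxvec_index i j).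

Lemma measurable_mx_of_tuple m n : measurable_fun setT (@mx_of_tuple m n).
Proof.
apply: (@measurability _ _ _ _ _ _ (@mx_cylinders _ R m n)) => //.
move=> _ [_ [i [j [D mD ->]]] <-]; rewrite setTI.
have -> : @mx_of_tuple m n @^-1` ((fun M : 'M[R]_(m, n) => M i j) @^-1` D) =
    (fun t => tnth t (mxvec_index i j)) @^-1` D.
  by apply/seteqP; split => t /=; rewrite mxE.
by rewrite -[X in measurable X]setTI; apply: measurable_tnth.
Qed.

Definition pushforward_measure d1 d2 (T1 : measurableType d1)
    (T2 : measurableType d2) (mu : {measure set T1 -> \bar R}) (f : T1 -> T2)
    (mf : measurable_fun setT f) : {measure set T2 -> \bar R} :=
  measure_function_pushforward__canonical__measure_function_Measure mu mf.

Fixpoint leb_tuple n : {measure set (n.-tuple R) -> \bar R} :=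
  match n with
  | 0 => dirac ([tuple] : 0.-tuple R)
  | n'.+1 => pushforward_measure (leb_tuple n' \x @lebesgue_measure R)%E
               (@measurable_tcons n')
  end.

Definition leb_mx m n : {measure set 'M[R]_(m, n) -> \bar R} :=
  pushforward_measure (leb_tuple (m * n)) (@measurable_mx_of_tuple m n).

End lebesgue_matrix.

Section complex_functions.
Context {R : realType}.

Definition cexp (z : R[i]) : R[i] :=
  (expR (complex.Re z))%:C * (cos (complex.Im z) +i* sin (complex.Im z)).

Definition cintegral d (T : measurableType d) (mu : {measure set T -> \bar R})
    (D : set T) (f : T -> R[i]) : R[i] :=
  (\int[mu]_(x in D) complex.Re (f x)) +i* (\int[mu]_(x in D) complex.Im (f x)).

Definition cmeasurable d (T : measurableType d) (f : T -> R[i]) : Prop :=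
  measurable_fun setT (fun x => complex.Re (f x)) /\
  measurable_fun setT (fun x => complex.Im (f x)).

Definition cderive (V : normedModType R) (f : V -> R[i]) (v : V) (x : V) : R[i] :=
  ('D_v (fun z => complex.Re (f z) : R^o) x) +i*
  ('D_v (fun z => complex.Im (f z) : R^o) x).

End complex_functions.

Section test_functions.
Context {R : realType} (m n : nat).

(* [iter_partial s f] is the iterated partial derivative of [f] in the
   coordinates listed in [s]. *)
Definition iter_partial (s : seq ('I_m * 'I_n)) (f : 'M[R]_(m, n) -> R) :
    'M[R]_(m, n) -> R :=
  foldr (fun ij (g : 'M[R]_(m, n) -> R) =>
           fun x => 'D_(delta_mx ij.1 ij.2) (g : _ -> R^o) x) f s.

Definition smooth (f : 'M[R]_(m, n) -> R) : Prop :=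
  forall s, continuous (iter_partial s f) /\
    forall i j x, derivable (iter_partial s f : _ -> R^o) x (delta_mx i j).

Definition test_function (h : 'M[R]_(m, n) -> R[i]) : Prop :=
  [/\ smooth (fun x => complex.Re (h x)),
      smooth (fun x => complex.Im (h x)) &
      compact (closure [set x | h x != 0])].

End test_functions.

Section chain.
Context {R : realType}.
Notation leb := (@lebesgue_measure R).

Definition mexp N (M : 'M[R]_N) : 'M[R]_N :=
  limn (series (fun k => k`!%:R^-1 *: M ^+ k)).

Context {K : nat}.

Definition drift (alpha : 'I_K.+1 -> R) : 'M[R]_K.+1 :=
  \matrix_(i, j) if i == j then - alpha i
                 else if j == i.+1 :> nat then 1 else 0.

Definition e_last : 'cV[R]_K.+1 := delta_mx ord_max 0.

Definition OU_cov (A : 'M[R]_K.+1) (g0 : R) : 'M[R]_K.+1 :=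
  \matrix_(i, j) (g0 ^+ 2 * \int[leb]_(t in `[0, +oo[)
    (mexp (t *: A) *m e_last *m e_last^T *m mexp (t *: A^T)) i j).

Definition C_first (A : 'M[R]_K.+1) (t : R) : R :=
  \int[leb]_(s in `[0, t]) mexp (s *: A) ord0 ord_max.

End chain.

Section stochastic.
Context {R : realType} {dsp : measure_display} {T : measurableType dsp}.
Variable P : probability T R.
Notation leb := (@lebesgue_measure R).

Definition sigma_of (I : Type) (D : set I) (X : I -> T -> R) : set (set T) :=
  <<s [set E | exists2 i, D i & exists2 C : set R, measurable C &
         E = X i @^-1` C] >>.

Definition independent_sigma (F G : set (set T)) : Prop :=
  forall E1 E2, F E1 -> G E2 -> P (E1 `&` E2) = (P E1 * P E2)%E.

(* Only meaningful for [s != 0]: [normal_prob m 0] is not a Dirac mass. *)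
Definition has_normal_law (X : T -> R) (m s : R) : Prop :=
  forall D : set R, measurable D -> P (X @^-1` D) = normal_prob m s D.

Definition brownian_motion (B : R -> T -> R) : Prop :=
  [/\ (forall t, 0 <= t -> measurable_fun setT (B t)) /\
        {ae P, forall w, B 0 w = 0},
      forall w, {within `[0, +oo[, continuous (fun t => B t w)},
      forall s t, 0 <= s -> s < t ->
        has_normal_law (fun w => B t w - B s w) 0 (Num.sqrt (t - s)) &
      forall s t, 0 <= s -> s < t ->
        independent_sigma
          (sigma_of [set: unit] (fun _ w => B t w - B s w))
          (sigma_of `[0, s] B)].

(* N(0, Sigma), through its one-dimensional projections; [Sigma] is meant to be
   positive definite, so that every projection below is non-degenerate. *)
Definition has_centered_normal_law N (X : T -> 'cV[R]_N) (Sigma : 'M[R]_N) :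
    Prop :=
  forall u : 'cV[R]_N, u != 0 ->
    has_normal_law (fun w => (u^T *m X w) 0 0)
      0 (Num.sqrt ((u^T *m Sigma *m u) 0 0)).

(* [Y] solves dY = A Y ds + g0 e_K dB with Y_0 ~ N(0, OU_cov A g0) independent
   of [B]; the noise being additive, the equation is an ordinary integral
   equation along each path. *)
Definition stationary_OU K (A : 'M[R]_K.+1) (g0 : R) (B : R -> T -> R)
    (Y : R -> T -> 'cV[R]_K.+1) : Prop :=
  [/\ brownian_motion B,
      (forall t k, 0 <= t -> measurable_fun setT (fun w => Y t w k 0)) /\
        (forall w k, {within `[0, +oo[, continuous (fun t => Y t w k 0)}),
      has_centered_normal_law (Y 0) (OU_cov A g0),
      independent_sigma
        (sigma_of [set: 'I_K.+1] (fun k w => Y 0 w k 0))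
        (sigma_of `[0, +oo[ B) &
      {ae P, forall w, forall t k, 0 <= t ->
         Y t w k 0 = Y 0 w k 0 + \int[leb]_(s in `[0, t]) (A *m Y s w) k 0
                     + g0 * e_last k 0 * B t w}].

Definition V_first K (Y : R -> T -> 'cV[R]_K.+1) (t : R) : R :=
  fine ('V_P[fun w => (\int[leb]_(s in `[0, t]) Y s w ord0 0)%R])%E.

End stochastic.

Section kernel.
Context {R : realType} {d : nat}.

Definition dotp (u v : 'rV[R]_d) : R := \sum_j u 0 j * v 0 j.

Definition euclidean (u : 'rV[R]_d) : R := Num.sqrt (dotp u u).

Definition unit_cell : set 'rV[R]_d := [set x | forall j, 0 < x 0 j < 1].

Definition wave (n : 'rV[int]_d) : 'rV[R]_d := \row_j (2 * pi * (n 0 j)%:~R).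

(* A finitely supported sum, as [w] is compactly supported; when the support of
   [w] lies in a cell of side 1 this is the periodic extension of [w]. *)
Definition periodize (w : 'rV[R]_d -> R) (x : 'rV[R]_d) : R :=
  \sum_(m \in [set: 'rV[int]_d]) w (x + \row_j (m 0 j)%:~R).

Definition interaction_profile (w : 'rV[R]_d -> R) : Prop :=
  [/\ forall x, 0 <= w x,
      exists M, forall x, w x <= M,
      forall x y, euclidean x = euclidean y -> w x = w y,
      forall x y, euclidean x <= euclidean y -> w y <= w x &
      compact (closure [set x | w x != 0])].

Definition fourier_coeff (W : 'rV[R]_d -> R) (n : 'rV[int]_d) : R[i] :=
  cintegral (leb_mx 1 d) unit_cell
    (fun x => (W x)%:C * cexp (- ('i * (dotp (wave n) x)%:C))).

End kernel.

(* A point y of R^(dK) is a matrix whose row k is y^k and whose column l is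
   y_l, so that (A y)_l = A y_l reads [A *m y]. The number of rows is written
   [K.+1]: it is at least 1, and [ord0], [ord_max] index y^1 and y^K. *)

Section linearized.
Context {R : realType} {d K : nat}.
Notation phase := ('M[R]_(K.+1, d)).
Notation leb := (leb_mx K.+1 d).
Notation E k l := (delta_mx k l : phase).

Definition maxwellian (Sigma : 'M[R]_K.+1) (y : phase) : R :=
  (2 * pi) `^ (- ((d * K.+1)%:R / 2)) * (\det Sigma) `^ (- (d%:R / 2)) *
  expR (- (1 / 2) *
        \sum_(l < d) ((col l y)^T *m invmx Sigma *m col l y) 0 0).

Definition rho (phi : phase -> R[i]) : R[i] := cintegral leb setT phi.

Definition laplacian_last (h : phase -> R[i]) (y : phase) : R[i] :=
  \sum_(l < d) cderive (cderive h (E ord_max l)) (E ord_max l) y.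

(* The action of B_n on twice differentiable functions, for q = q_n. *)
Definition B_expr (A : 'M[R]_K.+1) (g0 : R) (q : 'rV[R]_d)
    (h : phase -> R[i]) (y : phase) : R[i] :=
  - (\sum_(k < K.+1) \sum_(l < d)
       cderive (fun z => ((A *m z) k l)%:C * h z) (E k l) y)
  + (g0 ^+ 2 / 2)%:C * laplacian_last h y
  - 'i * (dotp q (row ord0 y))%:C * h y.

Definition H_normsq (M0 : phase -> R) (h : phase -> R[i]) : \bar R :=
  (\int[leb]_y (ComplexField.Normc.normc (h y) ^+ 2 / M0 y)%:E)%E.

Definition in_H (M0 : phase -> R) (h : phase -> R[i]) : Prop :=
  cmeasurable h /\ (H_normsq M0 h < +oo)%E.

(* The closure in H x H of the graph of an operator given on test functions:
   [phi] is in the domain of the closed operator, which maps it to [psi]. *)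
Definition closure_graph (M0 : phase -> R)
    (L : (phase -> R[i]) -> (phase -> R[i])) (phi psi : phase -> R[i]) : Prop :=
  [/\ in_H M0 phi, in_H M0 psi &
      exists h_ : nat -> phase -> R[i],
        [/\ forall j, test_function (h_ j),
            H_normsq M0 (fun y => h_ j y - phi y) @[j --> \oo] --> 0%E &
            H_normsq M0 (fun y => L (h_ j) y - psi y) @[j --> \oo] --> 0%E]].

(* [phi] is in the domain of B_n and solves
   (lambda - B_n) phi = c rho[phi] Delta_{y^K} M0 in H. *)
Definition eigen_solution (A : 'M[R]_K.+1) (g0 : R) (q : 'rV[R]_d)
    (c lambda : R[i]) (phi : phase -> R[i]) : Prop :=
  let M0 := maxwellian (OU_cov A g0) in
  exists2 psi, closure_graph M0 (B_expr A g0 q) phi psi &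
    {ae leb, forall y, lambda * phi y - psi y =
       c * rho phi * laplacian_last (fun z => (M0 z)%:C) y}.

End linearized.

(* Main.v *)
Require Import Defs.
From HB Require Import structures.
From mathcomp Require Import all_boot all_order all_algebra.
From mathcomp Require Import all_classical all_reals all_analysis.
From mathcomp Require Import measurable_realfun.
From mathcomp Require Import ring lra.
Set Implicit Arguments.
Unset Strict Implicit.
Unset Printing Implicit Defensive.
Import Order.TTheory GRing.Theory Num.Theory.
Import numFieldNormedType.Exports.
Local Open Scope classical_set_scope.
Local Open Scope ring_scope.
Local Open Scope complex_scope.

(* Only if: let th(t) = (int_0^t e^(sA) ds)^T e_1 q_n. Along this curve the adjoint
   of B_n acts on the plane wave e^(-i th . y) as a time derivative plus a
   multiplication by -g0^2 |q_n|^2 C_K(t)^2 / 2, and the latter is the derivative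
   of the Gaussian factor exp(-|q_n|^2 v(t) / 2), v being the conditional
   variance of int_0^t Y^1 given Y_0. Pairing the equation with these weighted
   plane waves and integrating in t over (0, oo), where e^(-lambda t) kills the
   boundary term at infinity, gives rho[phi] as the integral of the Fourier
   transform of the right-hand side, a Gaussian; the two Gaussian factors
   multiply to exp(-|q_n|^2 V(t) / 2). On test functions this uses only
   integration by parts, and it passes to the closure because L^2(1 / M_0)
   embeds in L^1.

   If: phi = c int_0^oo e^(-lambda t) u(t) dt, where u solves d_t u = B_n u with
   u(0) = Delta_{y^K} M_0. Conjugation by M_0 turns B_n into the time-reversed
   generator, and u / M_0 is a complex exponential in y times a
   quadratic polynomial, both with explicit coefficients. Riemann sums of the time integral,
   cut off in y, are test functions whose images converge in H by dominated
   convergence, so phi is in the domain of the closed operator; the first part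
   then computes rho[phi] = 1. *)

(** The variance is pinned down by a path identity: the noise is additive, so X = int Y solves a
    linear ODE driven by B, and V(t) is reached with ordinary integrals and the covariance min(s, r)
    of B. Nearly everything else rests on the Lyapunov equation A Sigma + Sigma A^T = - g0^2 e_K
    e_K^T: it makes v' equal to g0^2 C_K^2, makes Sigma invertible (a controllability argument), and
    makes M_0 stationary. A solution phi is known only as a limit of test functions in the graph
    norm, so no derivative of phi is ever taken: identities are proved for test functions with an
    error bound in L^1, then passed to the limit. The explicit solution u comes from shifted
    Gaussians: started from M_0(y - e_K p), the pair (Y_t, int Y^1) stays Gaussian, and the
    Laplacian in p at p = 0 gives u. The existence half solves the equation with an arbitrary
    constant kappa in front of the source; the dispersion relation says exactly that the kappa of
    the problem yields rho[phi] = 1. Complex functions are pairs of real ones, and a phase c in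
    cos(th . y + c) treats real and imaginary parts at once. *)

Section sf.
Context d (T : measurableType d) (R : realType) (mu : {measure set T -> \bar R}).
(* [leb_tuple] is a bare measure: this copy carries the sigma-finiteness needed
   for Fubini. *)
Definition sf_of (H : sigma_finite setT mu) : set T -> \bar R := mu.
Variable H : sigma_finite setT mu.
HB.instance Definition _ := Measure.on (sf_of H).
HB.instance Definition _ := @Measure_isSigmaFinite.Build _ _ _ (sf_of H) H.
End sf.

(** * Lebesgue measure on tuples and matrices *)

Section lebesgue_shift.
Context {R : realType}.
Notation leb := (@lebesgue_measure R).
Local Open Scope ereal_scope.

(* Lebesgue measure lives on [measurableTypeR R], which is not convertible to
   the default measurable structure on [R]. *)
Lemma measurable_shift (c : R) :
  measurable_fun [set: measurableTypeR R] (fun x : measurableTypeR R => (x + c)%R : measurableTypeR R).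
Proof. exact: measurable_funD. Qed.

(** The pushforward of Lebesgue measure under a translation agrees with it on half-open intervals,
    and these determine it. *)
Lemma lebesgue_shift (c : R) (A : set (measurableTypeR R)) : measurable A ->
  leb A = leb ((fun x => (x + c)%R) @^-1` A).
Proof.
pose mu := pushforward_measure leb (measurable_shift c).
move=> mA; rewrite (lebesgue_measure_unique (mu := mu)) // => X [[a b] _ <-].
rewrite /mu/= /pushforward.
have -> : (fun x : R => (x + c)%R) @^-1` `]a, b] = `](a - c)%R, (b - c)%R]%classic.
  by apply/seteqP; split=> x /=; rewrite !in_itv/= ltrBlDr lerBrDr.
have e : ((b - c) - (a - c) = b - a)%R by ring.
rewrite !lebesgue_measure_itv/= !lte_fin ltrD2r; case: ifP => // _.
by rewrite -!EFinB e.
Qed.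

Lemma ge0_integral_shift (c : R) (f : measurableTypeR R -> \bar R) :
  measurable_fun setT f -> (forall x, 0 <= f x) ->
  \int[leb]_x f (x + c)%R = \int[leb]_x f x.
Proof.
move=> mf f0.
rewrite [RHS](eq_measure_integral (pushforward_measure leb (measurable_shift c))).
  by rewrite [RHS](ge0_integral_pushforward (measurable_shift c)).
by move=> A mA _; exact: lebesgue_shift.
Qed.

End lebesgue_shift.

Section leb_tuple_theory.
Context {R : realType}.
Notation leb := (@lebesgue_measure R).
Local Open Scope ereal_scope.

Definition tbox n (j : R) : set (n.-tuple R) :=
  [set t | forall i, (`|tnth t i| <= j)%R].

Lemma measurable_tbox n j : measurable (@tbox n j).
Proof.
have -> : @tbox n j = \bigcap_(i in [set: 'I_n]) ((fun t => tnth t i) @^-1` `[(- j)%R, j]).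
  apply/seteqP; split => t /=.
    by move=> h i _ /=; rewrite in_itv/= -ler_norml.
  by move=> h i; have := h i I; rewrite /= in_itv/= -ler_norml.
apply: fin_bigcap_measurable => [|i _]; first exact: finite_finset.
by rewrite -[X in measurable X]setTI; apply: measurable_tnth.
Qed.

Lemma tnth_tcons0 n (p : n.-tuple R * R) : tnth (tcons p) ord0 = p.2.
Proof. by rewrite (tnth_nth 0%R). Qed.

Lemma tnth_tconsS n (p : n.-tuple R * R) i :
  tnth (tcons p) (lift ord0 i) = tnth p.1 i.
Proof. by rewrite !(tnth_nth 0%R). Qed.

Lemma leb_tuple_tbox n j : leb_tuple n (@tbox n j) < +oo.
Proof.
elim: n => [|n IH] /=.
  by rewrite diracE; case: (_ \in _); rewrite ltry.
rewrite /pushforward.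
have -> : tcons (n:=n) @^-1` @tbox n.+1 j = @tbox n j `*` `[(-j)%R, j].
  apply/seteqP; split => -[t x] /=.
    move=> h; split=> [i|]; first by have := h (lift ord0 i); rewrite tnth_tconsS.
    by have := h ord0; rewrite tnth_tcons0 in_itv/= -ler_norml.
  move=> [h]; rewrite /= in_itv/= -ler_norml => hx i.
  by case: (unliftP ord0 i) => [k|] ->; rewrite ?tnth_tconsS ?tnth_tcons0.
rewrite product_measure1E//; last exact: measurable_tbox.
apply: lte_mul_pinfty => //.
  by rewrite ge0_fin_numE.
by rewrite [X in X < _](lebesgue_measure_itv `[(-j)%R, j]%R)/=; case: ifP; rewrite ltry.
Qed.

Lemma sigma_finite_leb_tuple n : sigma_finite setT (@leb_tuple R n).
Proof.
exists (fun k => @tbox n k%:R).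
  apply/seteqP; split=> // t _; exists (Num.truncn (\sum_(i < n) `|tnth t i|)).+1 => //= i.
  apply: (@le_trans _ _ (\sum_(i < n) `|tnth t i|)%R).
    by rewrite (bigD1 i)//= lerDl sumr_ge0.
  by apply/ltW; exact: truncnS_gt.
by move=> k; split; [exact: measurable_tbox|exact: leb_tuple_tbox].
Qed.

Definition lebt n : {sigma_finite_measure set (n.-tuple R) -> \bar R} :=
  sf_of (sigma_finite_leb_tuple n).

Let mtcons n : measurable_fun [set: n.-tuple R * measurableTypeR R]
  (@tcons R n : n.-tuple R * measurableTypeR R -> n.+1.-tuple R).
Proof. exact: measurable_tcons. Qed.

Let mfc n (f : n.+1.-tuple R -> \bar R) : measurable_fun [set: n.+1.-tuple R] f ->
  measurable_fun [set: n.-tuple R * measurableTypeR R] (fun p => f (tcons p)).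
Proof. by move=> mf; apply: (measurableT_comp mf); exact: mtcons. Qed.

Lemma ge0_integral_leb_tupleS n (f : n.+1.-tuple R -> \bar R) :
  measurable_fun [set: n.+1.-tuple R] f -> (forall x, 0 <= f x) ->
  \int[leb_tuple n.+1]_t f t = \int[leb_tuple n]_t \int[leb]_x f (tcons (t, x)).
Proof.
move=> mf f0.
etransitivity.
  exact: (ge0_integral_pushforward (@mtcons n) (leb_tuple n \x leb)%E
    measurableT mf (fun x _ => f0 x)).
exact: (fubini_tonelli1 (m1 := @lebt n) (m2 := leb) _ (mfc mf) (fun x => f0 (tcons x))).
Qed.

Lemma measurable_leb_tupleS n (f : n.+1.-tuple R -> \bar R) :
  measurable_fun [set: n.+1.-tuple R] f -> (forall x, 0 <= f x) ->
  measurable_fun [set: n.-tuple R] (fun t => \int[leb]_x f (tcons (t, x))).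
Proof.
move=> mf f0.
exact: (measurable_fun_fubini_tonelli_F (m2 := leb) _ (mfc mf) (fun x => f0 (tcons x))).
Qed.

Definition tshift n (c : 'I_n -> R) (t : n.-tuple R) : n.-tuple R :=
  [tuple (tnth t i + c i)%R | i < n].

Lemma measurable_tshift n (c : 'I_n -> R) :
  measurable_fun [set: n.-tuple R] (tshift c : n.-tuple R -> n.-tuple R).
Proof.
apply/measurable_fun_tnthP => i.
rewrite (_ : _ \o _ = (fun t => (tnth t i + c i)%R)); last first.
  by apply/funext => t /=; rewrite tnth_mktuple.
by apply: measurable_funD => //; exact: measurable_tnth.
Qed.

Lemma tshift_tcons n (c : 'I_n.+1 -> R) (p : n.-tuple R * R) :
  tshift c (tcons p) =
  tcons (tshift (c \o lift ord0) p.1, (p.2 + c ord0)%R).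
Proof.
apply: eq_from_tnth => i; rewrite tnth_mktuple.
case: (unliftP ord0 i) => [k|] ->; last by rewrite !tnth_tcons0.
by rewrite !tnth_tconsS tnth_mktuple.
Qed.

(** Induction on the number of coordinates: Tonelli peels off the head, which one-dimensional
    invariance handles. *)
Lemma ge0_integral_tshift n (c : 'I_n -> R) (f : n.-tuple R -> \bar R) :
  measurable_fun [set: n.-tuple R] f -> (forall x, 0 <= f x) ->
  \int[leb_tuple n]_t f (tshift c t) = \int[leb_tuple n]_t f t.
Proof.
elim: n c f => [|n IH] c f mf f0.
  by apply: eq_integral => t _; congr f; apply: eq_from_tnth => -[].
rewrite !ge0_integral_leb_tupleS//; last first.
  by apply: measurableT_comp => //; exact: measurable_tshift.
under eq_integral => t _ do under eq_integral => x _ do rewrite tshift_tcons/=.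
rewrite -(IH (c \o lift ord0) (fun t => \int[leb]_x f (tcons (t, x)))); last 2 first.
- exact: measurable_leb_tupleS.
- by move=> t; exact: integral_ge0.
apply: eq_integral => t _.
rewrite (ge0_integral_shift (c ord0) (f := fun x => f (tcons (tshift (c \o lift ord0) t, x))))//.
apply: measurableT_comp => //; apply: measurableT_comp; first exact: measurable_tcons.
exact: measurable_pair1.
Qed.

End leb_tuple_theory.

(** * The fundamental theorem of calculus and measure-preserving flows *)

Lemma FTC2_itv {R : realType} (F g : R -> R) (a b : R) : a <= b ->
  continuous (g : R -> R^o) ->
  (forall x : R, a <= x <= b -> is_derive x 1 (F : R -> R^o) (g x)) ->
  (\int[@lebesgue_measure R]_(x in `[a, b]) (g x)%:E = (F b - F a)%:E)%E.
Proof.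
rewrite le_eqVlt => /predU1P[<- _ _|ab cg dF].
  by rewrite set_itv1 integral_set1 subrr.
have dvb x : a <= x <= b -> derivable (F : R -> R^o) x 1.
  by move=> xab; exact: (@ex_derive _ _ _ _ _ _ _ (dF x xab)).
have oo x : x \in `]a, b[ -> a <= x <= b.
  by rewrite in_itv/= => /andP[/ltW-> /ltW->].
rewrite (@continuous_FTC2 _ g F)//.
- exact: continuous_subspaceT.
- have cF x : a <= x <= b -> {for x, continuous (F : R -> R^o)}.
    by move=> xab; apply: differentiable_continuous; apply/derivable1_diffP; exact: dvb.
  split=> [x /oo/dvb//||].
  + by apply: cvg_at_right_filter; apply: cF; rewrite lexx ltW.
  + by apply: cvg_at_left_filter; apply: cF; rewrite lexx ltW.
- by move=> x /oo xab; rewrite derive1E (@derive_val _ _ _ _ _ _ _ (dF x xab)).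
Qed.

Lemma FTC2_is_derive {R : realType} (F g : R -> R) (a b : R) : a <= b ->
  continuous (g : R -> R^o) ->
  (forall x : R, is_derive x 1 (F : R -> R^o) (g x)) ->
  (\int[@lebesgue_measure R]_(x in `[a, b]) (g x)%:E = (F b - F a)%:E)%E.
Proof. by move=> ab cg dF; apply: FTC2_itv. Qed.

Lemma integral_indic01 {R : realType} :
  (\int[@lebesgue_measure R]_x (\1_(`[0, 1]%classic : set (measurableTypeR R)) x)%:E = 1)%E.
Proof.
rewrite integral_indic// setIT.
by apply: etrans (lebesgue_measure_itv `[0, 1]%R) _; rewrite /= lte01 oppr0 adde0.
Qed.

Lemma integrable_indic01 {R : realType} : (@lebesgue_measure R).-integrable setT
  (fun x => (\1_(`[0, 1]%classic : set (measurableTypeR R)) x)%:E).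
Proof.
apply/integrableP; split.
  by apply/measurable_EFinP; apply: measurable_indic; exact: measurable_itv.
under eq_integral => x _ do rewrite gee0_abs ?lee_fin//.
by rewrite integral_indic01 ltry.
Qed.

Section flow.
Context {R : realType} d (T : measurableType d).
Variable mu : {sigma_finite_measure set T -> \bar R}.
Notation leb := (@lebesgue_measure R).
Variable tau : R -> T -> T.
Hypothesis mtau : measurable_fun setT (fun p : measurableTypeR R * T => tau p.1 p.2).
Hypothesis tau0 : forall y, tau 0 y = y.
Hypothesis tau_inv : forall s (f : T -> \bar R), measurable_fun setT f ->
  (forall x, 0 <= f x)%E -> (\int[mu]_y f (tau s y) = \int[mu]_y f y)%E.

Let mtaus s : measurable_fun setT (tau s).
Proof.
have := measurableT_comp mtau (measurable_pair1 (s : measurableTypeR R)).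
by apply.
Qed.

Lemma integrable_flow s (f : T -> R) : mu.-integrable setT (EFin \o f) ->
  mu.-integrable setT (EFin \o (fun y => f (tau s y))).
Proof.
move=> /integrableP[mf fi]; apply/integrableP; split.
  exact: (measurableT_comp mf (mtaus s)).
rewrite /= (tau_inv s (f := fun y => `|(f y)%:E|%E))//.
exact: (measurableT_comp (@abse_measurable _ _) mf).
Qed.

Lemma integral_flow s (f : T -> R) : mu.-integrable setT (EFin \o f) ->
  \int[mu]_y f (tau s y) = \int[mu]_y f y.
Proof.
move=> fi; rewrite /Rintegral; congr fine.
have mf := measurable_int mu fi.
rewrite [LHS]integralE [RHS]integralE.
have -> : (fun x => (f (tau s x))%:E) = (EFin \o f) \o tau s by [].
rewrite funepos_comp funeneg_comp; congr (_ - _)%E.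
  by apply: (tau_inv s (f := (EFin \o f)^\+%E)); [apply: measurable_funepos|].
by apply: (tau_inv s (f := (EFin \o f)^\-%E)); [apply: measurable_funeneg|].
Qed.

Variables f g : T -> R.
Hypothesis fi : mu.-integrable setT (EFin \o f).
Hypothesis gi : mu.-integrable setT (EFin \o g).
Hypothesis cg : forall y, continuous (fun s : R => g (tau s y) : R^o).
Hypothesis fg : forall y (s : R), is_derive s 1 (fun r : R => f (tau r y) : R^o) (g (tau s y)).

(** Along each orbit, f(tau_1 y) - f(y) is the integral of g(tau_s y) over s in [0, 1]. Integrating
    in y, the left side vanishes by invariance, and by Fubini the right side is the integral of g.
    This is the source of every integration by parts below. *)
Lemma integral_flow_derive : \int[mu]_y g y = 0.
Proof.
have mg := measurable_int mu gi.
(* The indicator of [0, 1] turns the double integral into one over the whole product space, where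
   Fubini is applied. *)
pose h (p : measurableTypeR R * T) : \bar R := (\1_(`[0, 1]%classic : set (measurableTypeR R)) p.1 * g (tau p.1 p.2))%:E.
have mh : measurable_fun setT h.
  apply/measurable_EFinP; apply: measurable_funM.
    apply: (measurableT_comp _ measurable_fst).
    by apply: measurable_indic; exact: measurable_itv.
  apply: (measurableT_comp _ mtau); exact/measurable_EFinP.
have gfin : (\int[mu]_y `|(g y)%:E| < +oo)%E by case/integrableP: gi.
have hi : (leb \x mu)%E.-integrable setT h.
  apply/integrable12ltyP => //.
  rewrite (eq_integral (fun s => (\1_(`[0, 1]%classic : set (measurableTypeR R)) s)%:E * \int[mu]_y `|(g y)%:E|)%E); last first.
    move=> s _; rewrite /h /=.
    rewrite -(tau_inv s (f := fun y => `|(g y)%:E|%E))//; last first.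
      exact: (measurableT_comp (@abse_measurable _ _) mg).
    rewrite -ge0_integralZl//; last first.
      exact: (measurableT_comp (@abse_measurable _ _) (measurableT_comp mg (mtaus s))).
    by apply: eq_integral => y _; rewrite normrM [X in (X * _)%R]ger0_norm.
  rewrite ge0_integralZr//; last 2 first.
  - by apply/measurable_EFinP; apply: measurable_indic; exact: measurable_itv.
  - exact: integral_ge0.
  by rewrite [X in (X * _)%E](_ : _ = 1%E) ?mul1e//; exact: integral_indic01.
have := Fubini hi.
rewrite (eq_integral (fun s => (\1_(`[0, 1]%classic : set (measurableTypeR R)) s)%:E * (\int[mu]_y g y)%:E)%E); last first.
  move=> s _; rewrite /h /=; under eq_integral do rewrite EFinM.
  rewrite integralZl//; last exact: (integrable_flow s gi).
  rewrite -(integral_flow s gi) fineK//.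
  by apply: integrable_fin_num => //; exact: (integrable_flow s gi).
rewrite integralZr//; last first.
  exact: integrable_indic01.
rewrite [X in (X * _)%E](_ : _ = 1%E) ?mul1e; last exact: integral_indic01.
rewrite (eq_integral (fun y => (f (tau 1 y))%:E - (f y)%:E)%E); last first.
  move=> y _; rewrite -EFinB -[in X in _ - X](tau0 y).
  rewrite -(FTC2_is_derive (F := fun r => f (tau r y)) ler01 (@cg y) (@fg y)).
  rewrite [RHS]integral_mkcond; apply: eq_integral => s _.
  by rewrite /h patchE/= indicE; case: (_ \in _); rewrite ?mul1r ?mul0r.
rewrite integralB//; last exact: (integrable_flow 1 fi).
have e (u : T -> R) : mu.-integrable setT (EFin \o u) ->
    (\int[mu]_y (u y)%:E)%E = (\int[mu]_y u y)%:E.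
  by move=> ui; rewrite fineK//; exact: integrable_fin_num.
rewrite (e _ fi) (e _ (integrable_flow 1 fi)) (integral_flow 1 fi).
by rewrite -EFinB subrr => -[].
Qed.

End flow.

(** * Measure, topology and integration by parts on matrices *)

Section mxmeas.
Context {R : realType} {m n : nat}.
Notation M := 'M[R]_(m, n).
Notation leb := (@leb_mx R m n).

Lemma measurable_mx_coord i j : measurable_fun [set: M] (fun y : M => y i j).
Proof.
move=> _ D mD; rewrite setTI; apply: sub_sigma_algebra.
by exists i, j, D.
Qed.

Lemma measurable_fun_mxP d (X : measurableType d) (f : X -> M) :
  (forall i j, measurable_fun setT (fun x => f x i j)) -> measurable_fun setT f.
Proof.
move=> mf; apply: (@measurability _ _ _ _ _ _ (@mx_cylinders _ R m n)) => //.
move=> _ [_ [i [j [D mD ->]]] <-]; rewrite setTI.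
by have := mf i j measurableT D mD; rewrite setTI.
Qed.

Lemma measurable_mx_of_tupleT : measurable_fun [set: (m * n).-tuple R]
  (@mx_of_tuple R m n : (m * n).-tuple R -> M).
Proof. exact: measurable_mx_of_tuple. Qed.

Lemma ge0_integral_leb_mx (f : M -> \bar R) : measurable_fun [set: M] f ->
  (forall y, 0 <= f y)%E ->
  (\int[leb]_y f y = \int[leb_tuple (m * n)]_t f (mx_of_tuple t))%E.
Proof.
move=> mf f0; etransitivity.
  exact: (ge0_integral_pushforward measurable_mx_of_tupleT (leb_tuple (m * n))
    measurableT mf (fun x _ => f0 x)).
by rewrite preimage_setT.
Qed.

Definition mbox (r : R) : set M := [set y | forall i j, `|y i j| <= r].

Lemma measurable_mbox r : measurable (mbox r).
Proof.
have -> : mbox r = \bigcap_(p in [set: 'I_m * 'I_n])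
    ((fun y : M => y p.1 p.2) @^-1` `[- r, r]).
  apply/seteqP; split => y /=.
    by move=> h p _ /=; rewrite in_itv/= -ler_norml.
  by move=> h i j; have := h (i, j) I; rewrite /= in_itv/= -ler_norml.
apply: fin_bigcap_measurable => [|p _]; first exact: finite_finset.
by rewrite -[X in measurable X]setTI; apply: measurable_mx_coord.
Qed.

Lemma leb_mx_mbox r : (leb (mbox r) < +oo)%E.
Proof.
apply: le_lt_trans (leb_tuple_tbox (m * n) r).
rewrite /= /pushforward; apply: le_measure.
- rewrite inE -[X in measurable X]setTI; apply: measurable_mx_of_tupleT => //.
  exact: measurable_mbox.
- by rewrite inE; exact: measurable_tbox.
- move=> t /= h i; case/mxvec_indexP: i => i j.
  by have := h i j; rewrite mxE.
Qed.

Lemma in_mbox (y : M) : mbox `|y| y.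
Proof.
move=> i j; apply: (@le_trans _ _ (mx_norm y)) => //; rewrite mx_normrE.
exact: (le_bigmax _ (fun ij => `|y ij.1 ij.2|) (i, j)).
Qed.

Lemma mbox_norm r (y : M) : `|y| <= r -> mbox r y.
Proof. by move=> yr i j; apply: le_trans yr; exact: in_mbox. Qed.

Lemma sigma_finite_leb_mx : sigma_finite setT leb.
Proof.
exists (fun k => mbox k%:R).
  apply/seteqP; split=> // y _; exists (Num.truncn `|y|).+1 => //=.
  by apply: mbox_norm; apply: ltW; exact: truncnS_gt.
by move=> k; split; [exact: measurable_mbox|exact: leb_mx_mbox].
Qed.

Definition lebM : {sigma_finite_measure set M -> \bar R} := sf_of sigma_finite_leb_mx.

Lemma ge0_integral_mxshift (C : M) (f : M -> \bar R) : measurable_fun [set: M] f ->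
  (forall y, 0 <= f y)%E -> (\int[leb]_y f (y + C)%R = \int[leb]_y f y)%E.
Proof.
move=> mf f0.
have ms : measurable_fun [set: M] (fun y : M => y + C).
  apply: measurable_fun_mxP => i j.
  rewrite (_ : (fun _ => _) = fun x : M => x i j + C i j); last first.
    by apply/funext => x; rewrite mxE.
  by apply: measurable_funD => //; exact: measurable_mx_coord.
rewrite ge0_integral_leb_mx//; last exact: (measurableT_comp mf ms).
rewrite ge0_integral_leb_mx//.
pose c (i : 'I_(m * n)) : R := mxvec C 0 i.
rewrite -(ge0_integral_tshift c (f := fun t => f (mx_of_tuple t)))//; last first.
  exact: (measurableT_comp mf measurable_mx_of_tupleT).
apply: eq_integral => t _; congr f; apply/matrixP => i j.
by rewrite !mxE tnth_mktuple /c mxvecE.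
Qed.

(** The sigma-algebra is generated by the coordinates, not by the topology. An open set is the
    countable union of the boxes with rational centre and radius 1 / (k + 1) that it contains; a
    centre within 1 / (k + 1) of x gives a box inside the ball of radius e as soon as 2 / (k + 1) <
    e. *)
Lemma open_measurable_mx (U : set M) : open U -> measurable U.
Proof.
move=> oU.
pose B (p : 'M[rat]_(m, n) * nat) : set M :=
  [set y | mbox p.2.+1%:R^-1 (y - map_mx ratr p.1)].
have mB p : measurable (B p).
  rewrite -[X in measurable X]setTI.
  apply: (_ : measurable_fun setT (fun y : M => y - map_mx ratr p.1)) => //.
    apply: measurable_fun_mxP => i j.
    rewrite (_ : (fun _ => _) = fun x : M => x i j - ratr (p.1 i j)); last first.
      by apply/funext => x; rewrite !mxE.
    by apply: measurable_funB => //; exact: measurable_mx_coord.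
  exact: measurable_mbox.
have -> : U = \bigcup_(p in [set p | B p `<=` U]) B p.
  apply/seteqP; split => [x Ux|x [p /= pU]]; last exact: pU.
  have /nbhs_ballP[e /= e0 eU] : nbhs x U by exact: open_nbhs_nbhs.
  have [k ke] : exists k : nat, 2 * k.+1%:R^-1 < e.
    exists (Num.truncn (2 / e)).
    by rewrite ltr_pdivrMr// -ltr_pdivrMl// mulrC; exact: truncnS_gt.
  have k0 : 0 < k.+1%:R^-1 :> R by rewrite invr_gt0.
  have q_ (ij : 'I_m * 'I_n) : exists q : rat, `|x ij.1 ij.2 - ratr q| < k.+1%:R^-1.
    have [q] := @rat_in_itvoo R (x ij.1 ij.2 - k.+1%:R^-1) (x ij.1 ij.2 + k.+1%:R^-1) (ltac:(by rewrite ltrD2l -subr_gt0 opprK addr_gt0)).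
    by rewrite in_itv/= => /andP[a b]; exists q; rewrite distrC ltr_distl a b.
  have [q hq] := choice q_.
  exists (\matrix_(i, j) q (i, j), k) => /=.
    move=> y; rewrite /B/= => hy; apply: eU.
    split => // i j; rewrite /ball/=.
    have h1 := hq (i, j); have := hy i j; rewrite !mxE/= => h2.
    move: h1 h2 ke; rewrite /= ltr_norml ler_norml ltr_norml.
    move: (k.+1%:R^-1) => c /andP[? ?] /andP[? ?] ?.
    by apply/andP; split; lra.
  by rewrite /B/= => i j; rewrite !mxE; apply: ltW; exact: (hq (i, j)).
rewrite bigcup_mkcond; apply: countable_bigcupT_measurable => [|p].
  exact: countableP.
by case: ifP.
Qed.

Lemma continuous_measurable_mx (f : M -> R) : continuous (f : M -> R^o) ->
  measurable_fun [set: M] f.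
Proof.
move=> cf; apply: (measurability _ (RGenOpens.measurableE R)).
move=> _ [_ [a [b ->] <-]]; rewrite setTI; apply: open_measurable_mx.
by apply: open_comp => // x _; exact: cf.
Qed.

(** Compactness bounds f and puts its support in a box of finite measure. *)
Lemma integrable_compact (f : M -> R) (K : set M) :
  continuous (f : M -> R^o) -> compact K -> (forall y, ~ K y -> f y = 0) ->
  leb.-integrable setT (EFin \o f).
Proof.
move=> cf cK f0.
have mf := continuous_measurable_mx cf.
have [C hC] : exists C : R, forall y, `|f y| <= C.
  have /compact_bounded : compact ((f : M -> R^o) @` K).
    by apply: continuous_compact => //; exact: continuous_subspaceT.
  move=> [C [_ hC]]; exists (`|C| + 1) => y.
  have [Ky|/f0 ->] := pselect (K y); last by rewrite normr0 addr_ge0.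
  by apply: (hC _ _ (f y)); [rewrite (le_lt_trans (ler_norm _))// ltrDl|exists y].
have [r hr] : exists r, K `<=` mbox r.
  move: cK => /compact_bounded[r [_ hr]]; exists (`|r| + 1) => y Ky.
  apply: mbox_norm; apply: hr => //.
  by rewrite (le_lt_trans (ler_norm _))// ltrDl.
apply: (@le_integrable _ _ _ _ _ measurableT _ (fun y => (C * \1_(mbox r) y)%:E)).
- exact/measurable_EFinP.
- move=> y _ /=; rewrite lee_fin normrM [X in _ * X]ger0_norm//.
  have C0 : 0 <= C by exact: le_trans (hC y).
  rewrite ger0_norm// indicE; case: (boolP (y \in _)) => yr; first by rewrite mulr1.
  rewrite mulr0 f0 ?normr0// => Ky; move: yr; rewrite notin_setE; apply.
  exact: hr.
- under eq_fun do rewrite EFinM.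
  apply: integrableZl => //.
  apply/integrableP; split.
    by apply/measurable_EFinP; apply: measurable_indic; exact: measurable_mbox.
  under eq_integral => x _ do rewrite gee0_abs ?lee_fin//.
  rewrite integral_indic//; last exact: measurable_mbox.
  rewrite setIT; exact: leb_mx_mbox.
Qed.

End mxmeas.

Section mx_ibp.
Context {R : realType} {m n : nat}.
Notation M := 'M[R]_(m, n).
Notation leb := (@leb_mx R m n).

Lemma measurable_mxline (V : M) :
  measurable_fun setT (fun p : measurableTypeR R * M => p.1 *: V + p.2).
Proof.
apply: measurable_fun_mxP => i j.
rewrite (_ : (fun _ => _) = fun p : measurableTypeR R * M => p.1 * V i j + p.2 i j); last first.
  by apply/funext => x; rewrite !mxE.
apply: measurable_funD; first by apply: measurable_funM => //; exact: measurable_fst.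
exact: (measurableT_comp (measurable_mx_coord i j) measurable_snd).
Qed.

Lemma is_derive_line (f : M -> R) (V y : M) (s : R) :
  derivable (f : M -> R^o) (s *: V + y) V ->
  is_derive s 1 (fun r : R => f (r *: V + y) : R^o) ('D_V (f : M -> R^o) (s *: V + y)).
Proof.
have e : (fun h : R => h^-1 *: ((((fun r : R => f (r *: V + y)) : R -> R^o) \o shift s) (h *: (1 : R)) - f (s *: V + y))) =
   (fun h : R => h^-1 *: (((f : M -> R^o) \o shift (s *: V + y)) (h *: V) - f (s *: V + y))).
  by apply/funext => h; congr (_ *: (f _ - _)); rewrite /= scalerDl -addrA [h *: 1]mulr1.
by move=> df; split; [rewrite /derivable e|rewrite /derive e].
Qed.

(** Translation along V preserves Lebesgue measure, so [integral_flow_derive] applies to this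
    flow. *)
Lemma integral_derive0 (f : M -> R) (V : M) :
  (forall y, derivable (f : M -> R^o) y V) ->
  continuous (f : M -> R^o) ->
  continuous ('D_V (f : M -> R^o)) ->
  leb.-integrable setT (EFin \o f) ->
  leb.-integrable setT (EFin \o 'D_V (f : M -> R^o)) ->
  \int[leb]_y 'D_V (f : M -> R^o) y = 0.
Proof.
move=> df cf cdf fi dfi.
have mV : measurable_fun setT (fun p : measurableTypeR R * M => p.1 *: V + p.2).
  exact: measurable_mxline.
apply: (integral_flow_derive (mu := lebM) (tau := fun s y => s *: V + y) mV _ _ fi dfi).
- by move=> y; rewrite scale0r add0r.
- move=> s g mg g0; rewrite -[RHS](ge0_integral_mxshift (s *: V) mg g0).
  by apply: eq_integral => y _; rewrite addrC.
- move=> y s; have cl : {for s, continuous (fun s : R => s *: V + y)}.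
    by apply: cvgD; [exact: scalel_continuous|exact: cvg_cst].
  exact: (continuous_comp cl (cdf _)).
- by move=> y s; exact: is_derive_line.
Qed.

End mx_ibp.

(** * Matrix exponentials *)

Section mexp_theory.
Context {R : realType}.

Lemma cvg_sumR {T : Type} {F : set_system T} {FF : Filter F} (I : Type) (r : seq I)
    (f : I -> T -> R) (l : I -> R) :
  (forall i, f i x @[x --> F] --> l i) ->
  \sum_(i <- r) f i x @[x --> F] --> \sum_(i <- r) l i.
Proof.
move=> h; elim: r => [|i r IH].
  rewrite big_nil (_ : (fun x => _) = cst 0); first exact: cvg_cst.
  by apply/funext => x; rewrite big_nil.
rewrite big_cons (_ : (fun x => _) = (fun x => f i x + \sum_(j <- r) f j x)).
  exact: cvgD.
by apply/funext => x; rewrite big_cons.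
Qed.

Lemma cvg_mxP m n {T : Type} {F : set_system T} {FF : Filter F}
    (u : T -> 'M[R]_(m, n)) (L : 'M[R]_(m, n)) :
  (forall i j, (fun k => u k i j : R^o) @ F --> (L i j : R^o)) -> u @ F --> L.
Proof.
move=> h; apply/cvgrPdist_lt => e e0.
have : \forall k \near F, forall ij : 'I_m * 'I_n, `|L ij.1 ij.2 - u k ij.1 ij.2| < e.
  apply: filter_forall => -[i j].
  by move: (h i j) => /cvgrPdist_lt; exact.
apply: filterS => k hk.
apply: (@le_lt_trans _ _ (mx_norm (L - u k))) => //.
rewrite mx_normrE; apply/bigmax_ltP; split => // ij _.
by rewrite !mxE; exact: hk.
Qed.

Context {N : nat}.
Implicit Types A B : 'M[R]_N.+1.

Let rs A i := \sum_j `|A i j|.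

(** Absolute row sums grow at most geometrically, with the sum of all absolute entries of A as
    ratio. The entrywise exponential series is thereby dominated by a scalar one. *)
Let rs_exp B A i k : rs (B *m A ^+ k) i <= rs B i * (\sum_l rs A l) ^+ k.
Proof.
elim: k => [|k IH]; first by rewrite expr0 mulmx1 expr0 mulr1.
rewrite exprSr mulmxA exprSr mulrA.
apply: le_trans (ler_wpM2r _ IH); last by apply: sumr_ge0 => l _; exact: sumr_ge0.
set X := B *m A ^+ k.
apply: (@le_trans _ _ (\sum_j \sum_l `|X i l| * `|A l j|)).
  apply: ler_sum => j _; rewrite mxE; apply: le_trans (ler_norm_sum _ _ _) _.
  by apply: ler_sum => l _; rewrite normrM.
rewrite exchange_big/= mulr_suml; apply: ler_sum => l _.
rewrite -mulr_sumr; apply: ler_wpM2l => //.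
by rewrite [leRHS](bigD1 l)//= lerDl; apply: sumr_ge0 => l' _; exact: sumr_ge0.
Qed.

(** Power series coefficients of an entry of B e^(tA). The factor B keeps the family closed under
    differentiation, which merely replaces B by B A. *)
Let cf B A i j : nat -> R := fun k => k`!%:R^-1 * (B *m A ^+ k) i j.

Let cf_diffs B A i j : pseries_diffs (cf B A i j) = cf (B *m A) A i j.
Proof.
apply/funext => k; rewrite /pseries_diffs /cf factS natrM invfM mulrA mulrA mulfV// mul1r.
by rewrite exprS mulmxA.
Qed.

Let is_cvg_cf B A i j x : cvgn (pseries (cf B A i j) x).
Proof.
apply: normed_cvg.
pose c := rs B i; pose a := (\sum_l rs A l) * `|x|.
apply: (@series_le_cvg _ _ (fun k => c * exp_coeff a k)).
- by move=> k; rewrite normr_ge0.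
- move=> k; apply: mulr_ge0; first exact: sumr_ge0.
  apply: exp_coeff_ge0; apply: mulr_ge0 => //.
  by apply: sumr_ge0 => l _; exact: sumr_ge0.
- move=> k; rewrite /cf /exp_coeff/= !normrM normfV normr_nat normrX exprMn.
  have e := rs_exp B A i k.
  have {e} : `|(B *m A ^+ k) i j| <= c * (\sum_l rs A l) ^+ k.
    apply: le_trans e; rewrite /rs [leRHS](bigD1 j)//= lerDl; exact: sumr_ge0.
  move: (k`!%:R^-1) (invr_ge0 (k`!%:R : R)) => y; rewrite ler0n => y0 e.
  rewrite [y * _]mulrC -mulrA [leRHS](_ : _ = c * (\sum_l rs A l) ^+ k * (y * `|x| ^+ k)); last by ring.
  by apply: ler_wpM2r => //; rewrite mulr_ge0// exprn_ge0.
- apply: is_cvg_seriesZ; exact: is_cvg_series_exp_coeff.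
Qed.

Let cvg_mexp A : series (fun k => k`!%:R^-1 *: A ^+ k) @ \oo -->
  (\matrix_(i, j) limn (pseries (cf 1 A i j) 1) : 'M[R]_N.+1).
Proof.
apply: cvg_mxP => i j; rewrite mxE.
have := is_cvg_cf (B := 1) (A := A) (i := i) (j := j) (x := 1).
rewrite (_ : pseries _ _ = (fun k => series (fun k => k`!%:R^-1 *: A ^+ k) k i j)) //.
apply/funext => k; rewrite /pseries /series/= summxE; apply: eq_bigr => l _.
by rewrite /cf expr1n mulr1 mul1mx mxE.
Qed.

Let mexpE A i j t : mexp (t *: A) i j = limn (pseries (cf 1 A i j) t).
Proof.
rewrite /mexp (cvg_lim _ (cvg_mexp (A := _)))// mxE.
rewrite (_ : pseries (cf 1 (t *: A) i j) 1 = pseries (cf 1 A i j) t) //.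
apply/funext => k; rewrite /pseries /series/=; apply: eq_bigr => l _.
by rewrite /cf expr1n mulr1 !mul1mx exprZn mxE -mulrA; congr (_ * _); rewrite mulrC.
Qed.

Let lim_cf B A i j t : limn (pseries (cf B A i j) t) = (B *m mexp (t *: A)) i j.
Proof.
rewrite mxE; under eq_bigr do rewrite mexpE.
apply: cvg_lim => //.
rewrite (_ : pseries _ _ = fun k => \sum_l B i l * pseries (cf 1 A l j) t k); last first.
  apply/funext => k; rewrite /pseries /series/=.
  under [RHS]eq_bigr do rewrite mulr_sumr.
  rewrite exchange_big/=; apply: eq_bigr => l _.
  rewrite /cf mxE mulr_sumr mulr_suml; apply: eq_bigr => l' _.
  by rewrite mul1mx; ring.
apply: cvg_sumR => l.
by apply: cvgMl_tmp; exact: is_cvg_cf.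
Qed.

Lemma mexp0 : mexp (0 : 'M[R]_N.+1) = 1.
Proof.
rewrite -(scale0r 1); apply/matrixP => i j; rewrite mexpE.
apply: cvg_lim => //.
rewrite -(cvg_shiftS (pseries _ _)).
rewrite (_ : (fun n => _) = cst ((1 : 'M[R]_N.+1) i j)); first exact: cvg_cst.
apply/funext => k; rewrite /pseries /series/= big_nat_recl//= big1 ?addr0.
  by rewrite /cf !expr0 mulr1 fact0 invr1 mul1r mul1mx.
by move=> l _; rewrite exprS mul0r mulr0.
Qed.

Lemma mexp_comm A t : A *m mexp (t *: A) = mexp (t *: A) *m A.
Proof.
apply/matrixP => i j; rewrite -lim_cf mxE.
under eq_bigr do rewrite mexpE.
apply: cvg_lim => //.
rewrite (_ : pseries _ _ = fun k => \sum_l pseries (cf 1 A i l) t k * A l j); last first.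
  apply/funext => k; rewrite /pseries /series/=.
  under [RHS]eq_bigr do rewrite mulr_suml.
  rewrite exchange_big/=; apply: eq_bigr => l _.
  rewrite /cf (_ : A *m A ^+ l = A ^+ l *m A); last by rewrite -[LHS]/(A * A ^+ l) -exprS exprSr.
  rewrite [in LHS]mxE mulr_sumr mulr_suml; apply: eq_bigr => l' _.
  by rewrite mul1mx; ring.
apply: cvg_sumR => l.
by apply: cvgMr_tmp; exact: is_cvg_cf.
Qed.

(** Termwise differentiation of the entry's power series; it converges everywhere, so the point
    [|t| + 1] lying beyond t serves as radius. *)
Lemma is_derive_mexp A i j (t : R) :
  is_derive t 1 (fun s : R => mexp (s *: A) i j : R^o) ((A *m mexp (t *: A)) i j).
Proof.
rewrite (_ : (fun s => _) = (fun x => limn (pseries (cf 1 A i j) x))); last first.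
  by apply/funext => s; rewrite mexpE.
rewrite -lim_cf (_ : cf A A i j = pseries_diffs (cf 1 A i j)); last by rewrite cf_diffs mul1mx.
apply: (@pseries_snd_diffs _ _ (`|t| + 1)); rewrite ?cf_diffs //.
by rewrite [ltRHS]ger0_norm ?ltrDl// addr_ge0.
Qed.

Lemma mexp_tr A : mexp A^T = (mexp A)^T.
Proof.
rewrite -[A^T]scale1r -[in RHS](scale1r A); apply/matrixP => i j; rewrite mxE !mexpE.
congr (limn _); apply/funext => k; rewrite /pseries /series/=; apply: eq_bigr => l _.
rewrite /cf !mul1mx; congr (_ * _ * _).
have -> : A^T ^+ l = (A ^+ l)^T.
  elim: l => [|l IH]; first by rewrite !expr0 trmx1.
  by rewrite exprS IH exprSr -[RHS]/((A ^+ l *m A)^T) trmx_mul.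
by rewrite mxE.
Qed.

End mexp_theory.

(** * Calculus on the half-line *)

Section real_tools.
Context {R : realType}.
Notation leb := (@lebesgue_measure R).
Implicit Types f g : R -> R.

Lemma is_deriveMR f g (df dg t : R) : is_derive t 1 (f : R -> R^o) df ->
  is_derive t 1 (g : R -> R^o) dg ->
  is_derive t 1 (fun s => f s * g s : R^o) (df * g t + f t * dg).
Proof.
move=> hf hg; apply: is_derive_eq (is_deriveM hf hg) _.
by rewrite addrC /GRing.scale/=; congr (_ + _); rewrite mulrC.
Qed.

Lemma is_deriveZR f (c df t : R) : is_derive t 1 (f : R -> R^o) df ->
  is_derive t 1 (fun s => c * f s : R^o) (c * df).
Proof. by move=> hf; exact: (is_deriveZ c hf). Qed.

Lemma is_derive_sumR (I : Type) (r : seq I) (h : I -> R -> R) (dh : I -> R) (t : R) :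
  (forall i, is_derive t 1 (h i : R -> R^o) (dh i)) ->
  is_derive t 1 (fun s => \sum_(i <- r) h i s : R^o) (\sum_(i <- r) dh i).
Proof.
move=> H; elim: r => [|i r IH].
  rewrite big_nil (_ : (fun s => _) = cst 0); first exact: is_derive_cst.
  by apply/funext => s; rewrite big_nil.
rewrite big_cons (_ : (fun s => _) = (fun s => h i s + \sum_(j <- r) h j s)).
  exact: is_deriveD (H i) IH.
by apply/funext => s; rewrite big_cons.
Qed.

Lemma is_derive_linear (c t : R) : is_derive t 1 (fun s : R => c * s : R^o) c.
Proof. by have := is_deriveZR c (is_derive_id t 1); rewrite mulr1. Qed.

Lemma is_derive_expRc (c t : R) :
  is_derive t 1 (fun s : R => expR (c * s) : R^o) (c * expR (c * t)).
Proof.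
have h := @is_derive1_comp _ (@expR R) (fun s => c * s) t _ _ (is_derive_expR _) (is_derive_linear c t).
by apply: is_derive_eq h _; rewrite mulrC.
Qed.

Lemma is_derive_cont f (df : R -> R) : (forall t : R, is_derive t 1 (f : R -> R^o) (df t)) ->
  continuous (f : R -> R^o).
Proof.
move=> h x; apply: differentiable_continuous; apply/derivable1_diffP.
exact: (@ex_derive _ _ _ _ _ _ _ (h x)).
Qed.

Lemma is_derive_MVT f (df : R -> R) (a b : R) : a <= b ->
  (forall t : R, is_derive t 1 (f : R -> R^o) (df t)) ->
  exists2 c, a <= c <= b & f b - f a = df c * (b - a).
Proof.
move=> ab h.
have cf : {within `[a, b], continuous f}.
  by apply: continuous_subspaceT; exact: is_derive_cont h.
have [c] := MVT_segment ab (fun x _ => h x) cf.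
by rewrite in_itv/= => cab e; exists c.
Qed.

Lemma is_derive_nincr f (df : R -> R) (s t : R) : s <= t ->
  (forall t : R, is_derive t 1 (f : R -> R^o) (df t)) ->
  (forall r, s <= r -> df r <= 0) -> f t <= f s.
Proof.
move=> st h df0; have [c /andP[sc ct] e] := is_derive_MVT st h.
by rewrite -subr_le0 e mulr_le0_ge0 ?subr_ge0 ?df0.
Qed.

Lemma is_derive_eq0 f (s t : R) : (forall t : R, is_derive t 1 (f : R -> R^o) 0) -> f s = f t.
Proof.
move=> h; wlog st : s t / s <= t.
  by move=> w; have [/w //|/ltW /w ->] := leP s t.
by have [c _ /eqP] := is_derive_MVT st h; rewrite mul0r subr_eq0 => /eqP.
Qed.

Lemma cvgy_nat f (l : R) : f x @[x --> +oo] --> l -> f n%:R @[n --> \oo] --> l.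
Proof. by move=> h; apply: (cvg_comp _ _ cvgr_idn h). Qed.

Lemma cvg_expRNc (a : R) : 0 < a -> expR (- a * x) @[x --> +oo] --> (0 : R).
Proof.
move=> a0; rewrite (_ : (fun x => _) = (fun x => expR (- x)) \o (fun x => a * x)).
  by apply: cvg_comp (@cvgr_expR R); apply: gt0_cvgMry.
by apply/funext => x /=; rewrite mulNr.
Qed.

Lemma integrable_expRN (a : R) : 0 < a ->
  leb.-integrable `[0, +oo[ (fun t => (expR (- a * t))%:E).
Proof.
move=> a0; apply/integrableP; split.
  apply/measurable_EFinP; apply: measurable_funTS; apply: continuous_measurable_fun.
  exact: is_derive_cont (is_derive_expRc (- a)).
under eq_integral => x _ do rewrite gee0_abs ?lee_fin ?expR_ge0//.
have h (t : R) := is_deriveZR (- a^-1) (is_derive_expRc (- a) t).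
rewrite (@ge0_continuous_FTC2y _ _ (fun t => - a^-1 * expR (- a * t)) 0 0); first by rewrite -EFinB ltry.
- by move=> x _; exact: expR_ge0.
- by apply: continuous_subspaceT; exact: is_derive_cont (is_derive_expRc (- a)).
- rewrite -(mulr0 (- a^-1)); apply: cvgMl_tmp; exact: cvg_expRNc.
- by move=> x _; exact: (@ex_derive _ _ _ _ _ _ _ (h x)).
- by apply: cvg_at_right_filter; exact: (is_derive_cont h).
- move=> x _; rewrite derive1E (@derive_val _ _ _ _ _ _ _ (h x)).
  by rewrite mulrA mulrNN mulVf ?mul1r// gt_eqF.
Qed.

Lemma integrable_exp_bound f (a C : R) : 0 < a -> measurable_fun (`[0, +oo[%classic : set R) f ->
  (forall t, 0 <= t -> `|f t| <= C * expR (- a * t)) ->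
  leb.-integrable `[0, +oo[ (EFin \o f).
Proof.
move=> a0 mf hf.
have mD : measurable (`[0, +oo[%classic : set (measurableTypeR R)) by exact: measurable_itv.
apply: (le_integrable mD (g := fun t => (C%:E * (expR (- a * t))%:E)%E)).
- exact/measurable_EFinP.
- move=> t /=; rewrite in_itv/= andbT => t0; rewrite lee_fin.
  by apply: le_trans (hf t t0) _; exact: ler_norm.
- by apply: integrableZl => //; exact: integrable_expRN.
Qed.

(** Dominated convergence for the truncations of f to [0, n], with |f| as bound. *)
Lemma cvg_Rintegral_nat f : leb.-integrable `[0, +oo[ (EFin \o f) ->
  (\int[leb]_(t in `[0, n%:R]) f t) @[n --> \oo] --> \int[leb]_(t in `[0, +oo[) f t.
Proof.
move=> fi; have mf := measurable_int _ fi.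
pose D : set R := `[0, +oo[%classic.
pose fn (n : nat) : R -> \bar R := (EFin \o f) \_ `[0, n%:R].
have sub n : `[0, n%:R]%classic `<=` D by move=> x; rewrite /D/= !in_itv/= andbT => /andP[].
have [] := @dominated_convergence _ _ _ leb D _ fn (EFin \o f) (abse \o (EFin \o f)).
- exact: measurable_itv.
- move=> n; have mD : measurable (D : set (measurableTypeR R)) by exact: measurable_itv.
  apply/(measurable_restrict (D := (`[0, n%:R]%classic : set (measurableTypeR R)))) => //.
  by apply: measurable_funS mf => // x [].
- exact: mf.
- apply: aeW => x Dx; apply: cvg_near_cst.
  exists (Num.truncn x).+1 => // k /= xk; rewrite /fn patchE mem_set//=.
  move: Dx; rewrite /D/= !in_itv/= andbT => ->/=.
  apply/ltW/(lt_le_trans (truncnS_gt _)); by rewrite ler_nat.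
- exact: integrable_abse.
- apply: aeW => x n Dx; rewrite /fn patchE; case: ifP => // _.
  by rewrite abse0 abse_ge0.
move=> _ _ h.
have e n : (\int[leb]_(t in D) fn n t = \int[leb]_(t in `[0%R, n%:R%R]) (f t)%:E)%E.
  rewrite -integral_mkcondr; congr (integral _ _ _).
  exact/setIidPr/sub.
have fi' n : leb.-integrable `[0, n%:R] (EFin \o f).
  by apply: integrableS fi => //; exact: sub.
apply: fine_cvg.
rewrite fineK; last by apply: integrable_fin_num.
by rewrite (_ : (fun n : nat => _) = (fun n => (\int[leb]_(t in D) fn n t)%E)) //; apply/funext => n; rewrite e.
Qed.

Lemma Rintegral_FTC2y F f (l : R) : leb.-integrable `[0, +oo[ (EFin \o f) ->
  continuous (f : R -> R^o) ->
  (forall t : R, is_derive t 1 (F : R -> R^o) (f t)) -> F n%:R @[n --> \oo] --> l ->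
  \int[leb]_(t in `[0, +oo[) f t = l - F 0.
Proof.
move=> fi cf dF Fl; apply: (cvg_unique _ (cvg_Rintegral_nat fi)) => //.
rewrite (_ : (fun n : nat => _) = (fun n : nat => F n%:R - F 0)).
  by apply: cvgB => //; exact: cvg_cst.
by apply/funext => n; rewrite /Rintegral (FTC2_is_derive (ler0n _ n) cf dF).
Qed.

End real_tools.

Section mder.
Context {R : realType}.

(** Entrywise, so that every entry feeds directly into the scalar rules and no norm on matrices
    enters. *)
Definition mder m n (F : R -> 'M[R]_(m, n)) (t : R) (F' : 'M[R]_(m, n)) :=
  forall i j, is_derive t 1 (fun s => F s i j : R^o) (F' i j).

Lemma mder_eq m n (F : R -> 'M[R]_(m, n)) t F' F'' : mder F t F' -> F' = F'' -> mder F t F''.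
Proof. by move=> h <-. Qed.

Lemma mder_cst m n (C : 'M[R]_(m, n)) t : mder (fun=> C) t 0.
Proof. by move=> i j; rewrite mxE; exact: is_derive_cst. Qed.

Lemma mderD m n (F G : R -> 'M[R]_(m, n)) t F' G' : mder F t F' -> mder G t G' ->
  mder (fun s => F s + G s) t (F' + G').
Proof.
move=> f g i j; rewrite mxE (_ : (fun s => _) = (fun s => F s i j + G s i j)).
  exact: is_deriveD (f i j) (g i j).
by apply/funext => s; rewrite mxE.
Qed.

Lemma mderZ m n (F : R -> 'M[R]_(m, n)) t F' c : mder F t F' ->
  mder (fun s => c *: F s) t (c *: F').
Proof.
move=> f i j; rewrite mxE (_ : (fun s => _) = (fun s => c * F s i j)).
  exact: is_deriveZR.
by apply/funext => s; rewrite mxE.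
Qed.

Lemma mderN m n (F : R -> 'M[R]_(m, n)) t F' : mder F t F' ->
  mder (fun s => - F s) t (- F').
Proof.
move=> f; rewrite -scaleN1r (_ : (fun s => _) = (fun s => -1 *: F s)); first exact: mderZ.
by apply/funext => s; rewrite scaleN1r.
Qed.

Lemma mderB m n (F G : R -> 'M[R]_(m, n)) t F' G' : mder F t F' -> mder G t G' ->
  mder (fun s => F s - G s) t (F' - G').
Proof. by move=> f g; apply: mderD => //; exact: mderN. Qed.

Lemma mderM m n p (F : R -> 'M[R]_(m, n)) (G : R -> 'M[R]_(n, p)) t F' G' :
  mder F t F' -> mder G t G' -> mder (fun s => F s *m G s) t (F' *m G t + F t *m G').
Proof.
move=> f g i j; rewrite (_ : (fun s => _) = (fun s => \sum_k F s i k * G s k j)); last first.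
  by apply/funext => s; rewrite mxE.
rewrite !mxE -big_split/=; apply: is_derive_sumR => k; exact: is_deriveMR.
Qed.

Lemma mderMl m n p (C : 'M[R]_(m, n)) (G : R -> 'M[R]_(n, p)) t G' :
  mder G t G' -> mder (fun s => C *m G s) t (C *m G').
Proof.
by move=> g; apply: mder_eq (mderM (mder_cst C t) g) _; rewrite mul0mx add0r.
Qed.

Lemma mderMr m n p (F : R -> 'M[R]_(m, n)) (C : 'M[R]_(n, p)) t F' :
  mder F t F' -> mder (fun s => F s *m C) t (F' *m C).
Proof.
by move=> f; apply: mder_eq (mderM f (mder_cst C t)) _; rewrite mulmx0 addr0.
Qed.

Lemma mderT m n (F : R -> 'M[R]_(m, n)) t F' : mder F t F' ->
  mder (fun s => (F s)^T) t F'^T.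
Proof.
move=> f i j; rewrite mxE (_ : (fun s => _) = (fun s => F s j i)); first exact: f.
by apply/funext => s; rewrite mxE.
Qed.

Lemma mder_scalar n (t : R) : mder (fun s : R => s%:M : 'M[R]_n) t 1%:M.
Proof.
move=> i j; rewrite mxE; have [->|ij] := eqVneq i j.
  rewrite (_ : (fun s => _) = id) ?mulr1n; first exact: is_derive_id.
  by apply/funext => s; rewrite mxE eqxx mulr1n.
rewrite (_ : (fun s => _) = cst 0) ?mulr0n; first exact: is_derive_cst.
by apply/funext => s; rewrite mxE (negbTE ij) mulr0n.
Qed.

End mder.

Section integrable_tools.
Context {R : realType} d (T : measurableType d) (mu : {measure set T -> \bar R}).
Variables (D : set T) (mD : measurable D).
Implicit Types f g : T -> R.

Lemma integrableDR f g : mu.-integrable D (EFin \o f) -> mu.-integrable D (EFin \o g) ->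
  mu.-integrable D (EFin \o (fun x => f x + g x)).
Proof. by move=> fi gi; exact: (integrableD mD fi gi). Qed.

Lemma integrableBR f g : mu.-integrable D (EFin \o f) -> mu.-integrable D (EFin \o g) ->
  mu.-integrable D (EFin \o (fun x => f x - g x)).
Proof. by move=> fi gi; exact: (integrableB mD fi gi). Qed.

Lemma integrableZR c f : mu.-integrable D (EFin \o f) ->
  mu.-integrable D (EFin \o (fun x => c * f x)).
Proof. by move=> fi; exact: (integrableZl mD _ fi). Qed.

Lemma integrable_sumR (I : Type) (s : seq I) (f : I -> T -> R) :
  (forall i, mu.-integrable D (EFin \o f i)) ->
  mu.-integrable D (EFin \o (fun x => \sum_(i <- s) f i x)).
Proof.
move=> fi; rewrite (_ : _ \o _ = (fun x => \sum_(i <- s) (EFin \o f i) x)%E).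
  by apply: integrable_sum.
by apply/funext => x /=; rewrite sumEFin.
Qed.

Lemma Rintegral_sum (I : Type) (s : seq I) (f : I -> T -> R) :
  (forall i, mu.-integrable D (EFin \o f i)) ->
  \int[mu]_(x in D) (\sum_(i <- s) f i x) = \sum_(i <- s) \int[mu]_(x in D) f i x.
Proof.
move=> fi; elim: s => [|i s IH].
  by rewrite big_nil; under eq_Rintegral do rewrite big_nil; rewrite Rintegral_cst// mul0r.
rewrite big_cons -IH -RintegralD//; last exact: integrable_sumR.
by apply: eq_Rintegral => x _; rewrite big_cons.
Qed.

End integrable_tools.

(** At most one index satisfies the condition. *)
Lemma sum_ord_eq_le {R : realType} N m (c : R) : 0 <= c ->
  \sum_(l < N | l == m :> nat) c <= c.
Proof.
move=> c0; have [mN|mN] := ltnP m N.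
  rewrite (eq_bigl (pred1 (Ordinal mN))); first by rewrite big_pred1_eq.
  by move=> l; rewrite /= -val_eqE.
by rewrite big_pred0// => l; apply/negbTE; rewrite neq_ltn (leq_trans (ltn_ord l) mN).
Qed.

Lemma sum_ord_succ_le {R : realType} N m (c : R) : 0 <= c ->
  \sum_(k < N | m == k.+1 :> nat) c <= c.
Proof.
case: m => [|m] c0; first by rewrite big_pred0.
by apply: le_trans (sum_ord_eq_le N m c0); under eq_bigl do rewrite eqSS eq_sym.
Qed.

(** * The drift matrix and the stationary covariance *)

Section drift_theory.
Context {R : realType} {K : nat} (alpha : 'I_K.+1 -> R).
Hypothesis alpha_gt0 : forall k, 0 < alpha k.
Notation A := (drift alpha).
Let E (t : R) := mexp (t *: A).

(** The superdiagonal term is a sum over the indices l = k + 1, which is empty for the last row; no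
    case distinction is then needed. *)
Lemma drift_mul m (X : 'M[R]_(K.+1, m)) k j :
  (A *m X) k j = - alpha k * X k j + \sum_(l < K.+1 | l == k.+1 :> nat) X l j.
Proof.
rewrite mxE (bigD1 k)//= mxE eqxx; congr (_ + _).
rewrite big_mkcond [RHS]big_mkcond/=; apply: eq_bigr => l _; rewrite mxE eq_sym.
have [->|lk] := eqVneq l k; first by rewrite /= eqn_leq ltnn andbF.
by case: ifP => //= _; rewrite ?mul1r ?mul0r.
Qed.

(** Lyapunov functional: the weighted square norm V of a column of e^(tA) satisfies V' <= - 2 a V.
    The damping contributes at most - 4 a V, and the weights are chosen so that the coupling along
    the chain costs at most 2 a V. *)
Lemma mexp_decay : exists a C : R, [/\ 0 < a, 0 <= C &
  forall t i j, 0 <= t -> `|E t i j| <= C * expR (- a * t)].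
Proof.
(* The inverse of this sum is a lower bound for every alpha_k, hence a = 1 / (2 s) satisfies 2 a <=
   alpha_k. *)
pose s := \sum_k (alpha k)^-1.
have s0 : 0 < s.
  rewrite /s (bigD1 ord0)//= ltr_pwDl ?invr_gt0//.
  by apply: sumr_ge0 => k _; rewrite invr_ge0 ltW.
pose a := s^-1 / 2.
have a0 : 0 < a by rewrite divr_gt0// invr_gt0.
have aa k : 2 * a <= alpha k.
  rewrite /a mulrC divfK// -[leRHS]invrK lef_pV2 ?posrE ?invr_gt0//.
  rewrite /s (bigD1 k)//= lerDl.
  by apply: sumr_ge0 => l _; rewrite invr_ge0 ltW.
(* The weights satisfy a^2 w_(k+1) = w_k, so that 2 w_k x z <= a (w_k x^2 + w_(k+1) z^2). *)
pose w (k : nat) := (a ^+ 2)^-1 ^+ k.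
have w0 k : 0 < w k by rewrite exprn_gt0// invr_gt0 exprn_gt0.
have wS k : a ^+ 2 * w k.+1 = w k by rewrite /w [X in _ * X]exprS mulrA mulfV ?mul1r// gt_eqF// exprn_gt0.
pose V j t := \sum_(k < K.+1) w k * (E t k j) ^+ 2.
pose V' j t := \sum_(k < K.+1) w k * (2 * E t k j * (A *m E t) k j).
have dV j (t : R) : is_derive t 1 (V j : R -> R^o) (V' j t).
  apply: is_derive_sumR => k; apply: is_deriveZR.
  apply: is_derive_eq (is_deriveMR (is_derive_mexp A k j t) (is_derive_mexp A k j t)) _.
  by rewrite -/(E t); ring.
have V'le j t : V' j t <= - (2 * a) * V j t.
  have h1 : V' j t <= \sum_(k < K.+1) (- (4 * a) * (w k * E t k j ^+ 2)) +
     (\sum_(k < K.+1) \sum_(l < K.+1 | l == k.+1 :> nat) a * (w k * E t k j ^+ 2) +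
      \sum_(k < K.+1) \sum_(l < K.+1 | l == k.+1 :> nat) a * (w l * E t l j ^+ 2)).
    rewrite -!big_split/=; apply: ler_sum => k _.
    rewrite drift_mul mulrDr mulrDr; apply: lerD.
      rewrite (_ : w k * _ = - (2 * alpha k) * (w k * E t k j ^+ 2)); last by ring.
      apply: ler_wpM2r; first by rewrite mulr_ge0 ?sqr_ge0// ltW.
      by rewrite lerN2; have := aa k; lra.
    rewrite mulr_sumr mulr_sumr -big_split/=; apply: ler_sum => l /eqP lk.
    rewrite lk; move: (E t k j) (E t l j) => x z.
    rewrite -(wS k); rewrite -subr_ge0.
    (* With w_k = a^2 w_(k+1) the defect of this inequality is a perfect square. *)
    rewrite (_ : _ - _ = a * w k.+1 * (a * x - z) ^+ 2); last by ring.
    by rewrite mulr_ge0 ?sqr_ge0// mulr_ge0// ltW.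
  apply: le_trans h1 _.
  have h2 : \sum_(k < K.+1) \sum_(l < K.+1 | l == k.+1 :> nat) a * (w k * E t k j ^+ 2) <= a * V j t.
    rewrite mulr_sumr; apply: ler_sum => k _; apply: sum_ord_eq_le.
    by rewrite mulr_ge0 ?(ltW a0)// mulr_ge0 ?sqr_ge0// ltW.
  have h3 : \sum_(k < K.+1) \sum_(l < K.+1 | l == k.+1 :> nat) a * (w l * E t l j ^+ 2) <= a * V j t.
    rewrite (exchange_big_dep xpredT)//= mulr_sumr; apply: ler_sum => l _; apply: sum_ord_succ_le.
    by rewrite mulr_ge0 ?(ltW a0)// mulr_ge0 ?sqr_ge0// ltW.
  rewrite -mulr_sumr -/(V j t); lra.
have Vb j t : 0 <= t -> V j t <= V j 0 * expR (- (2 * a) * t).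
  move=> t0.
  have H : expR (2 * a * t) * V j t <= expR (2 * a * 0) * V j 0.
    apply: (is_derive_nincr t0 (fun r => is_deriveMR (is_derive_expRc (2 * a) r) (dV j r))) => r _.
    have := V'le j r; have := expR_gt0 (2 * a * r).
    move: (V' j r) (V j r) (expR _) => x z e e0 h; nra.
  move: H; rewrite mulr0 expR0 mul1r mulNr expRN => H.
  by rewrite ler_pdivlMr ?expR_gt0// mulrC.
pose C := \sum_j \sum_(k < K.+1) Num.sqrt (V j 0 / w k).
exists a, C; split=> //.
  by apply: sumr_ge0 => j _; apply: sumr_ge0 => k _; exact: sqrtr_ge0.
move=> t i j t0.
have V0 : 0 <= V j 0 by apply: sumr_ge0 => k _; rewrite mulr_ge0 ?sqr_ge0// ltW.
have h : w i * E t i j ^+ 2 <= V j 0 * expR (- (2 * a) * t).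
  apply: le_trans (Vb j t t0); rewrite /V (bigD1 i)//= lerDl.
  by apply: sumr_ge0 => k _; rewrite mulr_ge0 ?sqr_ge0// ltW.
apply: (@le_trans _ _ (Num.sqrt (V j 0 / w i) * expR (- a * t))).
  rewrite -(@ler_pXn2r _ 2)// ?nnegrE ?mulr_ge0 ?sqrtr_ge0 ?expR_ge0//.
  rewrite real_normK ?num_real// exprMn sqr_sqrtr; last by rewrite divr_ge0// ltW.
  rewrite -expRM_natl mulrA mulrAC ler_pdivlMr// mulrC.
  by apply: le_trans h _; rewrite le_eqVlt; apply/orP; left; apply/eqP; congr (_ * expR _); ring.
apply: ler_wpM2r; first exact: expR_ge0.
rewrite /C (bigD1 j)//= (bigD1 i)//= -addrA lerDl addr_ge0//.
  by apply: sumr_ge0 => k _; exact: sqrtr_ge0.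
by apply: sumr_ge0 => l _; apply: sumr_ge0 => k _; exact: sqrtr_ge0.
Qed.

Lemma drift_unit : A \in unitmx.
Proof.
rewrite unitmxE unitfE -det_tr det_trig.
  apply/prodf_neq0 => k _; rewrite !mxE eqxx oppr_eq0 gt_eqF//.
apply/is_trig_mxP => i j ij; rewrite !mxE.
have -> : j == i = false by apply/negbTE; rewrite -val_eqE neq_ltn ij orbT.
by case: eqP => // e; move: ij; rewrite e ltnNge ltnW.
Qed.

Variable g0 : R.
Hypothesis g0_gt0 : 0 < g0.
Notation Sigma := (OU_cov A g0).
Notation leb := (@lebesgue_measure R).
Let D0y : set (measurableTypeR R) := `[0, +oo[%classic.
Let mD0y : measurable D0y. Proof. exact: measurable_itv. Qed.
Let u i t := E t i ord_max.

Lemma OU_covE i j : Sigma i j = g0 ^+ 2 * \int[leb]_(t in `[0, +oo[) (u i t * u j t).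
Proof.
rewrite mxE; congr (_ * _); apply: eq_Rintegral => t _.
rewrite (_ : t *: A^T = (t *: A)^T); last by rewrite linearZ.
rewrite mexp_tr -/(E t) -mulmxA -trmx_mul.
have Ee k : (E t *m e_last) k ord0 = u k t.
  rewrite mxE (bigD1 ord_max)//= big1 ?addr0 => [|l /negbTE h].
    by rewrite mxE !eqxx mulr1.
  by rewrite mxE h mulr0.
by rewrite mxE big_ord1 Ee [X in _ * X]mxE Ee.
Qed.

Let du i (t : R) : is_derive t 1 (u i : R -> R^o) ((A *m E t) i ord_max).
Proof. exact: is_derive_mexp. Qed.

Let cu i : continuous (u i : R -> R^o).
Proof. exact: is_derive_cont (du i). Qed.

Let uu_int i j : leb.-integrable D0y (EFin \o (fun t => u i t * u j t)).
Proof.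
have [a [C [a0 C0 h]]] := mexp_decay.
apply: (@integrable_exp_bound _ _ (2 * a) (C ^+ 2)).
- by rewrite mulr_gt0.
- apply: measurable_funTS; apply: continuous_measurable_fun => t.
  by apply: continuousM; exact: cu.
- move=> t t0; rewrite normrM (_ : _ * _ = (C * expR (- a * t)) * (C * expR (- a * t))).
    by apply: ler_pM => //; exact: h.
  rewrite (_ : - (2 * a) * t = - a * t + - a * t); last by ring.
  by rewrite expRD; ring.
Qed.

Lemma OU_cov_sym : Sigma^T = Sigma.
Proof.
apply/matrixP => i j; rewrite mxE !OU_covE; congr (_ * _).
by apply: eq_Rintegral => t _; rewrite mulrC.
Qed.

Lemma OU_cov_quad (v : 'cV[R]_K.+1) : (v^T *m Sigma *m v) 0 0 =
  g0 ^+ 2 * \int[leb]_(t in `[0, +oo[) (\sum_i v i 0 * u i t) ^+ 2.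
Proof.
have -> : (v^T *m Sigma *m v) 0 0 = \sum_i \sum_j (v i 0 * v j 0) * Sigma i j.
  rewrite -mulmxA mxE; apply: eq_bigr => i _.
  rewrite !mxE mulr_sumr; apply: eq_bigr => j _; ring.
under eq_bigr => i _ do under eq_bigr => j _ do rewrite OU_covE mulrCA.
under eq_bigr do rewrite -mulr_sumr.
rewrite -mulr_sumr; congr (_ * _).
under eq_bigr => i _ do under eq_bigr => j _ do rewrite -RintegralZl//.
under eq_bigr => i _.
  rewrite -Rintegral_sum//; last by move=> j; exact: integrableZR.
  over.
rewrite -Rintegral_sum//; last first.
  by move=> i; apply: integrable_sumR => // j; exact: integrableZR.
apply: eq_Rintegral => t _; rewrite expr2 mulr_suml; apply: eq_bigr => i _.
by rewrite mulr_sumr; apply: eq_bigr => j _; ring.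
Qed.

Lemma OU_cov_ge0 (v : 'cV[R]_K.+1) : 0 <= (v^T *m Sigma *m v) 0 0.
Proof.
rewrite OU_cov_quad mulr_ge0 ?sqr_ge0//; apply: Rintegral_ge0 => t _.
exact: sqr_ge0.
Qed.

(** Integrate the time derivative of e^(tA) e e^T e^(tA^T) over the half-line: the value at infinity
    is 0 by exponential decay, and the value at 0 is e e^T. *)
Lemma OU_lyapunov : A *m Sigma + Sigma *m A^T = - (g0 ^+ 2 *: (e_last *m e_last^T)).
Proof.
apply/matrixP => i j.
have [a [C [a0 C0 h]]] := mexp_decay.
pose f t := (A *m E t) i ord_max * u j t + u i t * (A *m E t) j ord_max.
have df (t : R) : is_derive t 1 (fun s => u i s * u j s : R^o) (f t).
  exact: is_deriveMR (du i t) (du j t).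
have fE t : f t = \sum_k (A i k * (u k t * u j t)) + \sum_k (A j k * (u i t * u k t)).
  rewrite /f !mxE mulr_suml mulr_sumr; congr (_ + _); apply: eq_bigr => k _; rewrite -/(u k t); ring.
have fi : leb.-integrable D0y (EFin \o f).
  rewrite (_ : f = (fun t => \sum_k (A i k * (u k t * u j t)) + \sum_k (A j k * (u i t * u k t)))); last first.
    by apply/funext => t; exact: fE.
  by apply: integrableDR => //; apply: integrable_sumR => // k; exact: integrableZR.
have cf : continuous (f : R -> R^o).
  rewrite (_ : f = (fun t => \sum_k (A i k * (u k t * u j t)) + \sum_k (A j k * (u i t * u k t)))); last first.
    by apply/funext => t; exact: fE.
  move=> t; apply: (@cvgD _ R^o); apply: cvg_sumR => k; apply: cvgMl_tmp;
    by apply: (@cvgM R); exact: cu.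
have lim0 : (u i n%:R * u j n%:R) @[n --> \oo] --> (0 : R).
  apply: (@cvgy_nat _ (fun t => u i t * u j t)).
  apply/cvgrPdist_le => e e0.
  (* Each factor is at most C x with x = e^(-a t) <= 1, so the product is at most C^2 x; the 1 in
     the denominator keeps it positive when C = 0. *)
  have := @cvg_expRNc R a a0 => /cvgrPdist_le /(_ (e / (C ^+ 2 + 1))).
  have p : 0 < e / (C ^+ 2 + 1) by rewrite divr_gt0// ltr_pwDr// sqr_ge0.
  move=> /(_ p); apply: filter_app; near=> t; rewrite !sub0r !normrN.
  rewrite [X in X <= _ -> _]ger0_norm ?expR_ge0// => h1.
  have t0 : 0 <= t by near: t; exact: nbhs_pinfty_ge.
  have e1 : expR (- a * t) <= 1 by rewrite -expR0 ler_expR mulNr oppr_le0 mulr_ge0// ltW.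
  rewrite normrM; apply: (@le_trans _ _ ((C * expR (- a * t)) * (C * expR (- a * t)))).
    by apply: ler_pM => //; exact: h.
  move: h1; rewrite ler_pdivlMr; last by rewrite ltr_pwDr// sqr_ge0.
  have := expR_ge0 (- a * t); move: (expR _) e1 => x x1 x0 h1; nra.
have := @Rintegral_FTC2y _ _ _ _ fi cf df lim0.
rewrite sub0r.
under eq_Rintegral do rewrite fE.
rewrite RintegralD//; try by apply: integrable_sumR => // k; exact: integrableZR.
rewrite !Rintegral_sum//; try by move=> k; exact: integrableZR.
under eq_bigr => k _ do rewrite RintegralZl//.
under [X in _ + X = _]eq_bigr => k _ do rewrite RintegralZl//.
move=> H.
have -> : (A *m Sigma + Sigma *m A^T) i j = g0 ^+ 2 *
  (\sum_k A i k * \int[leb]_(t in `[0, +oo[) (u k t * u j t) +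
   \sum_k A j k * \int[leb]_(t in `[0, +oo[) (u i t * u k t)).
  rewrite !mxE mulrDr !mulr_sumr; congr (_ + _); apply: eq_bigr => k _; rewrite OU_covE.
    by ring.
  by rewrite mxE; ring.
rewrite [X in _ * X]H /u /E scale0r mexp0 !mxE big_ord1 !mxE mulrN; congr (- (_ * _)).
by rewrite (ord1 ord0) eqxx !andbT.
Unshelve. all: by end_near. Qed.

End drift_theory.

Lemma trmx11 {R : comPzRingType} (M : 'M[R]_1) : M^T = M.
Proof. by rewrite [M]mx11_scalar tr_scalar_mx. Qed.

Section mx_entries.
Context {V : zmodType} {R : comPzRingType} {m n : nat}.
Lemma mxaddE (M N : 'M[V]_(m, n)) i j : (M + N) i j = M i j + N i j.
Proof. by rewrite mxE. Qed.
Lemma mxoppE (M : 'M[V]_(m, n)) i j : (- M) i j = - M i j.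
Proof. by rewrite mxE. Qed.
Lemma mxscaleE (c : R) (M : 'M[R]_(m, n)) i j : (c *: M) i j = c * M i j.
Proof. by rewrite mxE. Qed.
End mx_entries.

Section mbounded.
Context {R : realType}.

Definition mbnd m n (F : R -> 'M[R]_(m, n)) :=
  exists2 C, 0 <= C & forall t i j, 0 <= t -> `|F t i j| <= C.

Lemma mbnd_cst m n (M : 'M[R]_(m, n)) : mbnd (fun=> M).
Proof. by exists `|M| => // t i j _; exact: (@in_mbox R m n M). Qed.

Lemma mbndD m n (F G : R -> 'M[R]_(m, n)) : mbnd F -> mbnd G -> mbnd (fun t => F t + G t).
Proof.
move=> [C C0 hC] [D D0 hD]; exists (C + D) => [|t i j t0]; first exact: addr_ge0.
by rewrite mxE (le_trans (ler_normD _ _))// lerD ?hC ?hD.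
Qed.

Lemma mbndM m n p (F : R -> 'M[R]_(m, n)) (G : R -> 'M[R]_(n, p)) :
  mbnd F -> mbnd G -> mbnd (fun t => F t *m G t).
Proof.
move=> [C C0 hC] [D D0 hD]; exists (n%:R * (C * D)) => [|t i j t0].
  by rewrite mulr_ge0 ?mulr_ge0.
rewrite mxE (le_trans (ler_norm_sum _ _ _))//.
rewrite mulr_natl -[n in leRHS]card_ord -sumr_const; apply: ler_sum => k _.
by rewrite normrM ler_pM ?hC ?hD.
Qed.

Lemma mbndT m n (F : R -> 'M[R]_(m, n)) : mbnd F -> mbnd (fun t => (F t)^T).
Proof. by move=> [C C0 hC]; exists C => // t i j t0; rewrite mxE hC. Qed.

End mbounded.

(** * Positive definite quadratic forms *)

Section outer.
Context {R : comPzRingType} {N : nat}.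

Lemma mul_outer (a b c d : 'cV[R]_N) :
  (a^T *m (b *m c^T) *m d) 0 0 = (a^T *m b) 0 0 * (c^T *m d) 0 0.
Proof. by rewrite mulmxA -mulmxA mxE big_ord1. Qed.

Lemma dot_sym (a b : 'cV[R]_N) : (a^T *m b) 0 0 = (b^T *m a) 0 0.
Proof. by rewrite -[a^T *m b]trmx11 trmx_mul trmxK. Qed.

Lemma quad_scal (M w : 'cV[R]_N) :
  (w^T *m (M *m M^T) *m w) 0 0 = ((M^T *m w) 0 0) ^+ 2.
Proof. by rewrite mul_outer dot_sym expr2. Qed.

Lemma bilin_symR (S : 'M[R]_N) (v w : 'rV[R]_N) : S^T = S ->
  (v *m S *m w^T) 0 0 = (w *m S *m v^T) 0 0.
Proof. by move=> h; rewrite -[v *m S *m w^T]trmx11 !trmx_mul trmxK h mulmxA. Qed.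

End outer.

Section spd.
Context {R : realType} {N : nat}.
Implicit Types (S : 'M[R]_N) (v w : 'cV[R]_N).

Definition quad S v : R := (v^T *m S *m v) 0 0.

Definition spd S := S^T = S /\ forall v, v != 0 -> 0 < quad S v.

Lemma quad0 S : quad S 0 = 0. Proof. by rewrite /quad mulmx0 mxE. Qed.

Lemma spd_ge0 S v : spd S -> 0 <= quad S v.
Proof.
by move=> [_ h]; have [->|/h/ltW//] := eqVneq v 0; rewrite quad0.
Qed.

Lemma bilin_sym S v w : S^T = S -> (v^T *m S *m w) 0 0 = (w^T *m S *m v) 0 0.
Proof. by move=> h; rewrite -[v^T *m S *m w]trmx11 !trmx_mul trmxK h mulmxA. Qed.

Lemma quadD S v w (s : R) : S^T = S ->
  quad S (v + s *: w) = quad S v + 2 * s * (v^T *m S *m w) 0 0 + s ^+ 2 * quad S w.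
Proof.
have -> : quad S (v + s *: w) = ((v^T + s *: w^T) *m S *m (v + s *: w)) 0 0.
  by rewrite /quad; congr ((_ *m _ *m _) _ _); apply/matrixP => i j; rewrite !mxE.
move=> h; rewrite /quad !mulmxDl !mulmxDr -!scalemxAl -!scalemxAr scalerA.
by rewrite !mxaddE !mxscaleE (bilin_sym w v h); ring.
Qed.

(** A null vector v of a nonnegative form lies in the kernel: otherwise moving v slightly against w
    = S v makes the form negative. *)
Lemma spd_ker S : S^T = S -> (forall v, 0 <= quad S v) ->
  (forall v, S *m v = 0 -> v = 0) -> spd S.
Proof.
move=> sS pS kS; split=> // v v0; rewrite lt_neqAle pS andbT eq_sym.
apply: contra v0 => /eqP qv; apply/eqP/kS.
set w := S *m v.
have b : (v^T *m S *m w) 0 0 = \sum_i w i 0 ^+ 2.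
  rewrite -{1}sS -trmx_mul -/w mxE; apply: eq_bigr => i _; by rewrite mxE expr2.
have c0 := pS w; set c := quad S w in c0.
have b0 : \sum_i w i 0 ^+ 2 <= 0.
  (* With B = |w|^2 and c the form at w, this step gives 2 s B + s^2 c = - (B / (c + 1))^2 (c + 2);
     the 1 added to c avoids dividing by 0. *)
  have := pS (v + (- (\sum_i w i 0 ^+ 2) / (c + 1)) *: w).
  rewrite quadD// b qv add0r -/c; set B := \sum_i _.
  have c1 : 0 < c + 1 by rewrite ltr_pwDr.
  rewrite leNgt => h; apply/negP => B0; move: h.
  rewrite (_ : _ + _ = - (B / (c + 1)) ^+ 2 * (c + 2)); last by field; rewrite gt_eqF.
  move=> /negP; apply; rewrite mulNr oppr_lt0 mulr_gt0// ?ltr_pwDr// exprn_gt0// divr_gt0//.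
  by rewrite ltNge; apply/negP.
apply/colP => i; rewrite [RHS]mxE.
have /(_ i isT)/eqP := psumr_eq0P (F := fun i => w i 0 ^+ 2) (fun i _ => sqr_ge0 _)
   (le_anti (introT andP (conj b0 (sumr_ge0 _ (fun i _ => sqr_ge0 _))))).
by rewrite sqrf_eq0 => /eqP.
Qed.

Lemma spd_unit S : spd S -> S \in unitmx.
Proof.
move=> [sS pS]; rewrite -row_free_unit -kermx_eq0; apply: contraT => /matrix0Pn [i [j kj]].
pose v := (row i (kermx S))^T.
have v0 : v != 0.
  apply/eqP => v0; move: kj; have <- : v j 0 = kermx S i j by rewrite mxE mxE.
  by rewrite v0 mxE eqxx.
by have := pS v v0; rewrite /quad trmxK -row_mul mulmx_ker row0 mul0mx mxE ltxx.
Qed.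

Lemma spd_inv S : spd S -> spd (invmx S).
Proof.
move=> sp; have uS := spd_unit sp; case: (sp) => sS pS.
have sI : (invmx S)^T = invmx S by rewrite trmx_inv sS.
split=> // v v0.
have -> : quad (invmx S) v = quad S (invmx S *m v).
  by rewrite /quad trmx_mul sI -!mulmxA mulKVmx.
by apply: pS; apply: contra v0 => /eqP h; rewrite -(mulKVmx uS v) h mulmx0.
Qed.

Lemma spd_CS S v w : spd S -> ((v^T *m S *m w) 0 0) ^+ 2 <= quad S v * quad S w.
Proof.
move=> sp; case: (sp) => sS pS.
have [->|w0] := eqVneq w 0; first by rewrite mulmx0 mxE expr0n mulr_ge0 ?spd_ge0.
have qw := pS w w0; set b := (_ 0 0).
have := spd_ge0 (v + (- b / quad S w) *: w) sp; rewrite quadD// -/b.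
rewrite (_ : _ + _ = (quad S v * quad S w - b ^+ 2) / quad S w); last by field; rewrite gt_eqF.
by rewrite pmulr_lge0 ?invr_gt0// subr_ge0.
Qed.

(** Cauchy-Schwarz for the form S between the i-th basis vector and S^-1 v. *)
Lemma spd_coord S v i : spd S -> v i 0 ^+ 2 <= S i i * quad (invmx S) v.
Proof.
move=> sp; have uS := spd_unit sp; case: (sp) => sS _.
have sI : (invmx S)^T = invmx S by rewrite trmx_inv sS.
have := spd_CS (delta_mx i 0) (invmx S *m v) sp.
rewrite -[_ *m S *m (_ *m _)]mulmxA mulKVmx// trmx_delta -rowE.
rewrite {1}/quad trmx_delta -[_ *m S]rowE -colE !mxE.
by rewrite /quad [(invmx S *m v)^T]trmx_mul sI -!mulmxA mulKVmx.
Qed.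

End spd.
(** * Covariances of the Ornstein-Uhlenbeck process *)

Section OU_paths.
Context {R : realType} {K : nat} (alpha : 'I_K.+1 -> R).
Hypothesis alpha_gt0 : forall k, 0 < alpha k.
Variable g0 : R.
Hypothesis g0_gt0 : 0 < g0.
Notation A := (drift alpha).
Notation Sigma := (OU_cov A g0).
Notation e := (@e_last R K).
Notation leb := (@lebesgue_measure R).

Definition e_first : 'rV[R]_K.+1 := delta_mx 0 ord0.

(** Controllability. If Sigma w = 0, the Lyapunov equation tested with w on both sides forces w_K =
    0; applied to w alone it then gives Sigma A^T w = 0. The kernel is thus stable under A^T, and
    the ones above the diagonal carry the vanishing of the last coordinate back to all the
    others. *)
Lemma OU_ker (v : 'cV[R]_K.+1) : Sigma *m v = 0 -> v = 0.
Proof.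
have sS := OU_cov_sym alpha g0; have ly := OU_lyapunov alpha_gt0 g0.
have step (w : 'cV[R]_K.+1) : Sigma *m w = 0 -> w ord_max 0 = 0 /\ Sigma *m (A^T *m w) = 0.
  move=> Sw; have wS : w^T *m Sigma = 0.
    by rewrite -[Sigma]sS -trmx_mul Sw trmx0.
  have ew : e^T *m w = (w ord_max 0)%:M.
    apply/matrixP => i j; rewrite !ord1 mxE (bigD1 ord_max)//= big1 ?addr0.
      by rewrite !mxE !eqxx mul1r mulr1n.
    by move=> l /negbTE h; rewrite !mxE h mul0r.
  have w0 : w ord_max 0 = 0.
    have := congr1 (fun M => (w^T *m M *m w) 0 0) ly.
    rewrite mulmxDr mulmxDl mulmxA -[w^T *m A *m Sigma *m w]mulmxA Sw mulmx0 add0r.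
    rewrite mulmxA wS !mul0mx mxE mulmxN mulNmx -scalemxAr -scalemxAl.
    rewrite mxoppE mxscaleE quad_scal ew mxE eqxx mulr1n => /esym/eqP.
    by rewrite oppr_eq0 mulf_eq0 !sqrf_eq0 gt_eqF//= => /eqP.
  split=> //; have := congr1 (fun M => M *m w) ly.
  rewrite mulmxDl -mulmxA Sw mulmx0 add0r mulmxA => ->.
  by rewrite mulNmx -scalemxAl -mulmxA ew w0 raddf0 mulmx0 scaler0 oppr0.
(* Induction on the distance to the last coordinate, for all kernel vectors together: at k both w
   and A^T w are used at k + 1. *)
suff h m (w : 'cV[R]_K.+1) (k : 'I_K.+1) : Sigma *m w = 0 -> (K - k)%N = m -> w k 0 = 0.
  by move=> Sv; apply/colP => k; rewrite mxE; exact: (h (K - k)%N).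
elim: m w k => [|m IH] w k Sw km.
  have -> : k = ord_max.
    by apply/val_inj/eqP; rewrite /= eqn_leq -ltnS ltn_ord/= -subn_eq0 km.
  by have [] := step w Sw.
have kK : (k < K)%N by rewrite -subn_gt0 km.
pose l : 'I_K.+1 := Ordinal (kK : (k.+1 < K.+1)%N).
have lm : (K - l)%N = m by rewrite /= subnS km.
have [_ Sw'] := step w Sw.
have := IH _ l Sw' lm.
have kl : k != l by rewrite -val_eqE /= neq_ltn ltnSn.
rewrite mxE (bigD1 k)//= (bigD1 l)//=; last by rewrite eq_sym.
rewrite (IH w l Sw lm) mulr0 add0r big1 ?addr0.
  by rewrite !mxE (negbTE kl) eqxx mul1r.
move=> j /andP[jk jl]; rewrite !mxE (negbTE jl).
have -> : (l == j.+1 :> nat) = false by rewrite /= eqSS eq_sym; apply: contraNF jk => /eqP/val_inj->.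
by rewrite mul0r.
Qed.

Lemma OU_spd : spd Sigma.
Proof.
apply: spd_ker; [exact: OU_cov_sym|move=> v|exact: OU_ker].
by rewrite /quad; exact: OU_cov_ge0.
Qed.

Notation S := (invmx Sigma).
Let uSig : Sigma \in unitmx. Proof. exact: spd_unit OU_spd. Qed.
Let uA : A \in unitmx. Proof. exact: drift_unit. Qed.
Let SigT : Sigma^T = Sigma. Proof. exact: OU_cov_sym. Qed.
Let ST : S^T = S. Proof. by rewrite trmx_inv SigT. Qed.

(** The Lyapunov equation multiplied by Sigma^-1 on both sides, the form met after conjugation by
    M_0, whose exponent involves Sigma^-1. *)
Lemma lyap_inv : S *m A + A^T *m S = - (g0 ^+ 2 *: (S *m e *m (S *m e)^T)).
Proof.
have := congr1 (fun M => S *m M *m S) (OU_lyapunov alpha_gt0 g0).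
rewrite mulmxDr mulmxDl !mulmxA mulVmx// mul1mx -mulmxA mulmxV// mulmx1 => ->.
by rewrite mulmxN mulNmx -scalemxAr -scalemxAl trmx_mul ST !mulmxA.
Qed.

(* [OU_V] is a closed form of the variance of the integral of Y^1 and [OU_v] of
   its conditional variance given Y_0; the later definitions are the
   coefficients of the explicit solution [vRe], [vIm] below. *)
Definition OUexp t := mexp (t *: A).
Definition OUint t := invmx A *m (OUexp t - 1).
Definition OU_L t : 'rV[R]_K.+1 := e_first *m OUint t.
Definition OU_CK t : R := (OU_L t *m e) 0 0.
Definition OU_V t : R := 2 * (e_first *m invmx A *m (OUint t - t%:M) *m Sigma *m e_first^T) 0 0.
Definition OU_v t : R := OU_V t - (OU_L t *m Sigma *m (OU_L t)^T) 0 0.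
(** Covariance of Y_t with I_t = int_0^t Y^1. Accordingly [OU_sg] is the regression coefficient of
    I_t on Y_t and [OU_om] the conditional variance of I_t given Y_t. [OU_u] is the displacement of
    Y_t caused by a unit shift of the last coordinate of Y_0, and [OU_CK] that of I_t; [OU_m] is the
    part of the latter that Y_t does not explain. *)
Definition OU_c t : 'cV[R]_K.+1 := OUint t *m Sigma *m e_first^T.
Definition OU_u t : 'cV[R]_K.+1 := OUexp t *m e.
Definition OU_sg t : 'cV[R]_K.+1 := S *m OU_c t.
Definition OU_r t : 'cV[R]_K.+1 := S *m OU_u t.
Definition OU_m t : R := OU_CK t - ((OU_u t)^T *m S *m OU_c t) 0 0.
Definition OU_tau t : R := ((OU_u t)^T *m S *m OU_u t) 0 0.
Definition OU_om t : R := OU_V t - ((OU_c t)^T *m S *m OU_c t) 0 0.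

Lemma OUexp0 : OUexp 0 = 1. Proof. by rewrite /OUexp scale0r mexp0. Qed.
Lemma OUint0 : OUint 0 = 0. Proof. by rewrite /OUint OUexp0 subrr mulmx0. Qed.

Lemma AOUint t : A *m OUint t = OUexp t - 1.
Proof. by rewrite /OUint mulKVmx. Qed.

Lemma OUintA t : OUint t *m A = OUexp t - 1.
Proof.
by rewrite /OUint -mulmxA mulmxBl mul1mx -mexp_comm -[X in _ - X]mulmx1 -mulmxBr mulKmx.
Qed.

Lemma mder_exp (t : R) : mder OUexp t (A *m OUexp t).
Proof. by move=> i j; exact: is_derive_mexp. Qed.

Lemma mder_int (t : R) : mder OUint t (OUexp t).
Proof.
apply: mder_eq (mderMl _ (mderB (mder_exp t) (mder_cst 1 t))) _.
by rewrite subr0 mulKmx.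
Qed.

Lemma mder_L (t : R) : mder OU_L t (e_first + OU_L t *m A).
Proof.
apply: mder_eq (mderMl _ (mder_int t)) _.
by rewrite /OU_L -mulmxA OUintA mulmxBr mulmx1 addrC subrK.
Qed.

Lemma is_derive_CK (t : R) : is_derive t 1 (OU_CK : R -> R^o) ((e_first *m OU_u t) 0 0).
Proof.
have := mderMr e (mderMl e_first (mder_int t)) => /(_ 0 0).
by rewrite /OU_u mulmxA.
Qed.

Lemma mder_c (t : R) : mder OU_c t (Sigma *m e_first^T + A *m OU_c t).
Proof.
apply: mder_eq (mderMr _ (mderMr _ (mder_int t))) _.
rewrite (_ : A *m OU_c t = (A *m OUint t) *m Sigma *m e_first^T); last by rewrite /OU_c !mulmxA.
by rewrite AOUint !mulmxBl mul1mx addrC subrK.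
Qed.

Lemma mder_u (t : R) : mder OU_u t (A *m OU_u t).
Proof. by apply: mder_eq (mderMr _ (mder_exp t)) _; rewrite mulmxA. Qed.

Lemma mder_sg (t : R) : mder OU_sg t (S *m A *m Sigma *m OU_sg t + e_first^T).
Proof.
apply: mder_eq (mderMl _ (mder_c t)) _.
by rewrite mulmxDr mulKmx// addrC /OU_sg -!mulmxA mulKVmx.
Qed.

Lemma mder_r (t : R) : mder OU_r t (S *m A *m Sigma *m OU_r t).
Proof.
by apply: mder_eq (mderMl _ (mder_u t)) _; rewrite /OU_r -!mulmxA mulKVmx.
Qed.

Lemma is_derive_V (t : R) :
  is_derive t 1 (OU_V : R -> R^o) (2 * (OU_L t *m Sigma *m e_first^T) 0 0).
Proof.
apply: is_deriveZR.
have := mderMr e_first^T (mderMr Sigma (mderMl (e_first *m invmx A) (mderB (mder_int t) (@mder_scalar R _ t)))).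
by move=> /(_ 0 0); rewrite -[e_first *m _ *m _]mulmxA.
Qed.

(** The terms with [e_first] in the derivative of L Sigma L^T cancel V', and the Lyapunov equation
    evaluates what remains. Hence v(t) is g0^2 times the integral of C_K^2 and is nonnegative. *)
Lemma is_derive_v (t : R) :
  is_derive t 1 (OU_v : R -> R^o) (g0 ^+ 2 * OU_CK t ^+ 2).
Proof.
have h := mderM (mderMr Sigma (mder_L t)) (mderT (mder_L t)).
apply: is_derive_eq (is_deriveB (is_derive_V t) (h 0 0)) _.
set L := OU_L t; rewrite mxaddE.
have s : (e_first *m Sigma *m L^T) 0 0 = (L *m Sigma *m e_first^T) 0 0.
  exact: bilin_symR.
have q := quad_scal e L^T; rewrite trmxK in q.
have c : (e^T *m L^T) 0 0 = OU_CK t by rewrite -trmx_mul trmx11.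
have l : (L *m (A *m Sigma) *m L^T) 0 0 + (L *m (Sigma *m A^T) *m L^T) 0 0 =
    - (g0 ^+ 2 * OU_CK t ^+ 2).
  have := congr1 (fun M => (L *m M *m L^T) 0 0) (OU_lyapunov alpha_gt0 g0).
  by rewrite mulmxN mulNmx -scalemxAr -scalemxAl mulmxDr mulmxDl mxaddE mxoppE mxscaleE q c.
have e1 : ((e_first + L *m A) *m Sigma *m L^T) 0 0 =
   (e_first *m Sigma *m L^T) 0 0 + (L *m (A *m Sigma) *m L^T) 0 0.
  by rewrite !mulmxDl mxaddE !mulmxA.
have e2 : (L *m Sigma *m (e_first + L *m A)^T) 0 0 =
   (L *m Sigma *m e_first^T) 0 0 + (L *m (Sigma *m A^T) *m L^T) 0 0.
  by rewrite linearD/= trmx_mul mulmxDr mxaddE !mulmxA.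
rewrite e1 e2 s; lra.
Qed.

(** One computation for two coefficients: x = [OU_c] with b = Sigma e_1 gives the derivative of m,
    and x = [OU_u] with b = 0 that of tau. *)
Lemma is_derive_uSx (x : R -> 'cV[R]_K.+1) (b : 'cV[R]_K.+1) (t : R) :
  mder x t (b + A *m x t) ->
  is_derive t 1 (fun s => ((OU_u s)^T *m S *m x s) 0 0 : R^o)
    (((OU_u t)^T *m S *m b) 0 0 - g0 ^+ 2 * ((e^T *m OU_r t) 0 0 * (e^T *m (S *m x t)) 0 0)).
Proof.
move=> hx; have h := mderM (mderMr S (mderT (mder_u t))) hx.
apply: is_derive_eq (h 0 0) _.
rewrite trmx_mul mulmxDr addrCA mxE; congr (_ + _).
have := congr1 (fun M => ((OU_u t)^T *m M *m x t) 0 0) lyap_inv.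
rewrite mulmxDr mulmxDl mxaddE mulmxN mulNmx -scalemxAr -scalemxAl mxoppE mxscaleE mul_outer.
have -> : ((OU_u t)^T *m (S *m e)) 0 0 = (e^T *m OU_r t) 0 0.
  by rewrite dot_sym trmx_mul ST -mulmxA.
have -> : (S *m e)^T *m x t = e^T *m (S *m x t) by rewrite trmx_mul ST mulmxA.
by move=> <-; rewrite mxaddE addrC !mulmxA.
Qed.

Lemma is_derive_m (t : R) : is_derive t 1 (OU_m : R -> R^o)
  (g0 ^+ 2 * ((e^T *m OU_r t) 0 0 * (e^T *m OU_sg t) 0 0)).
Proof.
apply: is_derive_eq (is_deriveB (is_derive_CK t) (is_derive_uSx (mder_c t))) _.
rewrite -[(OU_u t)^T *m S *m _]mulmxA mulKmx// -(trmx11 ((OU_u t)^T *m _)) trmx_mul !trmxK.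
by rewrite opprB addrCA subrr addr0.
Qed.

Lemma is_derive_tau (t : R) : is_derive t 1 (OU_tau : R -> R^o)
  (- (g0 ^+ 2 * ((e^T *m OU_r t) 0 0) ^+ 2)).
Proof.
have h : mder OU_u t (0 + A *m OU_u t) by rewrite add0r; exact: mder_u.
apply: is_derive_eq (is_derive_uSx h) _.
by rewrite mulmx0 mxE sub0r expr2.
Qed.

Lemma is_derive_om (t : R) : is_derive t 1 (OU_om : R -> R^o)
  (g0 ^+ 2 * ((e^T *m OU_sg t) 0 0) ^+ 2).
Proof.
have h := mderM (mderMr S (mderT (mder_c t))) (mder_c t).
apply: is_derive_eq (is_deriveB (is_derive_V t) (h 0 0)) _.
set c := OU_c t.
have l : (c^T *m (S *m A) *m c) 0 0 + (c^T *m (A^T *m S) *m c) 0 0 =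
   - (g0 ^+ 2 * ((e^T *m OU_sg t) 0 0) ^+ 2).
  have := congr1 (fun M => (c^T *m M *m c) 0 0) lyap_inv.
  rewrite mulmxDr mulmxDl mxaddE mulmxN mulNmx -scalemxAr -scalemxAl mxoppE mxscaleE quad_scal.
  have -> : (S *m e)^T *m c = e^T *m OU_sg t by rewrite [(S *m e)^T]trmx_mul ST -mulmxA.
  by [].
have h1 : ((Sigma *m e_first^T)^T *m S *m c) 0 0 = (e_first *m c) 0 0.
  by rewrite trmx_mul trmxK SigT -mulmxA [e_first *m _ *m _]mulmxA mulmxK.
have h2 : (c^T *m S *m (Sigma *m e_first^T)) 0 0 = (e_first *m c) 0 0.
  by rewrite -[c^T *m S *m _]mulmxA mulKmx// dot_sym trmxK.
have h3 : (OU_L t *m Sigma *m e_first^T) 0 0 = (e_first *m c) 0 0.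
  by rewrite /OU_L /c /OU_c !mulmxA.
rewrite [(Sigma *m e_first^T + _)^T]linearD/= [(A *m c)^T]trmx_mul !mulmxDl mulmxDr !mxaddE h1 h2 h3.
move: l; rewrite !mulmxA; lra.
Qed.

Lemma mder0_eq0 : OU_u 0 = e /\ OU_c 0 = 0 /\ OU_L 0 = 0.
Proof.
by rewrite /OU_u /OU_c /OU_L OUexp0 OUint0 mul1mx !mul0mx mulmx0.
Qed.

Lemma OU_sg0 : OU_sg 0 = 0.
Proof. by case: mder0_eq0 => _ [c0 _]; rewrite /OU_sg c0 mulmx0. Qed.

Lemma OU_r0 : OU_r 0 = S *m e.
Proof. by case: mder0_eq0 => u0 _; rewrite /OU_r u0. Qed.

Lemma OU_m0 : OU_m 0 = 0.
Proof.
by case: mder0_eq0 => _ [c0 L0]; rewrite /OU_m /OU_CK c0 L0 mul0mx mulmx0 mxE subrr.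
Qed.

Lemma OU_V0 : OU_V 0 = 0.
Proof. by rewrite /OU_V OUint0 raddf0 subrr mulmx0 !mul0mx mxE mulr0. Qed.

Lemma OU_om0 : OU_om 0 = 0.
Proof. by case: mder0_eq0 => _ [c0 _]; rewrite /OU_om OU_V0 c0 mulmx0 mxE subrr. Qed.

Lemma OU_v0 : OU_v 0 = 0.
Proof. by case: mder0_eq0 => _ [_ L0]; rewrite /OU_v OU_V0 L0 !mul0mx mxE subrr. Qed.

Lemma OU_tau0 : OU_tau 0 = (e^T *m S *m e) 0 0.
Proof. by case: mder0_eq0 => u0 _; rewrite /OU_tau u0. Qed.

Lemma OU_om_ge0 t : 0 <= t -> 0 <= OU_om t.
Proof.
move=> t0; have [c _] := is_derive_MVT t0 is_derive_om.
by rewrite OU_om0 !subr0 => ->; rewrite mulr_ge0// mulr_ge0 ?sqr_ge0.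
Qed.

Lemma OU_v_ge0 t : 0 <= t -> 0 <= OU_v t.
Proof.
move=> t0; have [c _] := is_derive_MVT t0 is_derive_v.
by rewrite OU_v0 !subr0 => ->; rewrite mulr_ge0// mulr_ge0 ?sqr_ge0.
Qed.

Lemma OU_V_decomp t : OU_V t = OU_v t + (OU_L t *m Sigma *m (OU_L t)^T) 0 0.
Proof. by rewrite /OU_v subrK. Qed.

Lemma mbnd_exp : mbnd OUexp.
Proof.
have [a [C [a0 C0 h]]] := mexp_decay alpha_gt0; exists C => // t i j t0.
apply: le_trans (h t i j t0) _; rewrite ler_piMr// -expR0 ler_expR.
by rewrite mulNr oppr_le0 mulr_ge0// ltW.
Qed.

Lemma mbnd_int : mbnd OUint.
Proof.
apply: mbndM (mbnd_cst _) _; apply: mbndD mbnd_exp _; exact: mbnd_cst.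
Qed.

Lemma mbnd_L : mbnd OU_L.
Proof. by apply: mbndM mbnd_int; exact: mbnd_cst. Qed.

Lemma mbnd_sg : mbnd OU_sg.
Proof.
apply: mbndM; first exact: mbnd_cst.
by apply: mbndM (mbnd_cst _); apply: mbndM mbnd_int (mbnd_cst _).
Qed.

Lemma mbnd_u : mbnd OU_u.
Proof. by apply: mbndM mbnd_exp (mbnd_cst _). Qed.

Lemma mbnd_r : mbnd OU_r.
Proof. by apply: mbndM (mbnd_cst _) mbnd_u. Qed.

Lemma mbnd11 (F : R -> 'M[R]_1) : mbnd F -> exists C, forall t, 0 <= t -> `|F t 0 0| <= C.
Proof. by move=> [C _ h]; exists C => t t0; exact: h. Qed.

Lemma bnd_CK : exists C, forall t, 0 <= t -> `|OU_CK t| <= C.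
Proof. by apply: mbnd11; apply: mbndM mbnd_L (mbnd_cst _). Qed.

Lemma bnd_tau : exists C, forall t, 0 <= t -> `|OU_tau t| <= C.
Proof.
by apply: mbnd11; apply: mbndM mbnd_u; apply: mbndM (mbndT mbnd_u) (mbnd_cst _).
Qed.

Lemma bnd_m : exists C, forall t, 0 <= t -> `|OU_m t| <= C.
Proof.
have [C hC] := bnd_CK.
have [|C' hC'] := @mbnd11 (fun t => (OU_u t)^T *m S *m OU_c t).
  apply: mbndM; first by apply: mbndM (mbndT mbnd_u) (mbnd_cst _).
  by apply: mbndM (mbnd_cst _); apply: mbndM mbnd_int (mbnd_cst _).
exists (C + C') => t t0; rewrite /OU_m (le_trans (ler_normB _ _))// lerD ?hC//.
exact: hC'.
Qed.

Lemma C_firstE t : 0 <= t -> C_first A t = OU_CK t.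
Proof.
move=> t0; have d (s : R) : is_derive s 1 (OU_CK : R -> R^o) (mexp (s *: A) ord0 ord_max).
  apply: is_derive_eq (is_derive_CK s) _.
  by rewrite /OU_u /e_first /e_last mulmxA -rowE -colE !mxE.
rewrite /C_first /Rintegral (FTC2_is_derive t0 _ d); last exact: is_derive_cont (is_derive_mexp _ _ _).
by case: mder0_eq0 => _ [_ L0]; rewrite {2}/OU_CK L0 mul0mx mxE subr0.
Qed.

End OU_paths.

(** * Integration against a density *)

Section density.
Local Open Scope ereal_scope.
Context d (T : measurableType d) (R : realType).
Variables (mu nu : {measure set T -> \bar R}) (p : T -> R).
Hypothesis p0 : forall x, (0 <= p x)%R.
Hypothesis mp : measurable_fun setT p.
Hypothesis nuE : forall A, measurable A -> nu A = \int[mu]_(x in A) (p x)%:E.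

Import HBNNSimple.

Let integral_density_nnsfun (h : {nnsfun T >-> R}) :
  \int[nu]_x (h x)%:E = \int[mu]_x (h x * p x)%:E.
Proof.
under eq_integral do rewrite fimfunE -fsumEFin//.
rewrite ge0_integral_fsum//; last 2 first.
- by move=> y; exact/measurable_EFinP/measurable_funM.
- by move=> y x _; rewrite nnfun_muleindic_ge0.
under [RHS]eq_integral => x _.
  rewrite fimfunE mulrC EFinM -fsumEFin// ge0_mule_fsumr; last first.
    by move=> r; rewrite EFinM nnfun_muleindic_ge0.
  over.
rewrite ge0_integral_fsum//; last 2 first.
- move=> y; apply: emeasurable_funM; first exact/measurable_EFinP.
  by apply/measurable_EFinP/measurable_funM.
- move=> y x _; apply: mule_ge0; first by rewrite lee_fin.
  by rewrite EFinM nnfun_muleindic_ge0.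
apply: eq_fsbigr => r rh; rewrite integralZl_indic_nnsfun// integral_indic//= setIT.
have mA : measurable (h @^-1` [set r]) by [].
rewrite nuE//.
have r0 : (0 <= r)%R by move: rh; rewrite inE => -[x _ <-].
rewrite -ge0_integralZl//; last 2 first.
- by apply: measurable_funTS; apply/measurable_EFinP.
- by move=> x _; rewrite lee_fin.
rewrite integral_mkcond; apply: eq_integral => x _.
rewrite patchE indicE; case: ifPn => xA; rewrite ?mulr1 ?mulr0 ?mule0//.
by rewrite -EFinM mulrC.
Qed.

(** Simple functions come first, then monotone convergence along an increasing approximation of
    f. *)
Lemma ge0_integral_density (f : T -> R) : measurable_fun setT f -> (forall x, 0 <= f x)%R ->
  \int[nu]_x (f x)%:E = \int[mu]_x (f x * p x)%:E.
Proof.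
move=> mf f0.
have mfE : measurable_fun setT (EFin \o f) by exact/measurable_EFinP.
pose f_ := nnsfun_approx measurableT mfE.
have cf x : (f_ n x)%:E @[n --> \oo] --> (f x)%:E.
  by apply: (cvg_nnsfun_approx measurableT mfE) => // y _; rewrite lee_fin.
transitivity (lim (\int[nu]_x (f_ n x)%:E @[n --> \oo])).
  rewrite -monotone_convergence//=.
  - by apply: eq_integral => x _; apply/esym/cvg_lim => //; exact: cf.
  - by move=> n; exact/measurable_EFinP/measurable_funTS.
  - by move=> n ? _; rewrite lee_fin.
  - by move=> ? _ ? ? mn; rewrite lee_fin; exact/lefP/nd_nnsfun_approx.
rewrite [X in lim (X @ \oo)](_ : _ = (fun n => \int[mu]_x (f_ n x * p x)%:E)); last first.
  by apply/funext => n; exact: integral_density_nnsfun.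
rewrite -monotone_convergence//=.
- apply: eq_integral => x _; apply/cvg_lim => //.
  have H : (f_ n x)%:E * (p x)%:E @[n --> \oo] --> (f x)%:E * (p x)%:E.
    by apply: cvgeZr => //; exact: cf.
  exact: H.
- by move=> n; apply/measurable_EFinP/measurable_funM.
- by move=> n ? _; rewrite lee_fin mulr_ge0.
- move=> x _ m n mn; rewrite lee_fin; apply: ler_wpM2r => //.
  exact/lefP/nd_nnsfun_approx.
Qed.

Lemma integral_density (f : T -> R) : measurable_fun setT f ->
  mu.-integrable setT (fun x => (f x * p x)%:E) ->
  nu.-integrable setT (EFin \o f) /\
  \int[nu]_x (f x)%:E = \int[mu]_x (f x * p x)%:E.
Proof.
move=> mf fpi; have fi : nu.-integrable setT (EFin \o f).
  apply/integrableP; split; first exact/measurable_EFinP.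
  rewrite (ge0_integral_density (f := fun x => `|f x|%R))//; last exact: measurableT_comp.
  case/integrableP : fpi => _; apply: le_lt_trans.
  rewrite le_eqVlt; apply/orP; left; apply/eqP/eq_integral => x _.
  by rewrite /= normrM (ger0_norm (p0 x)).
split=> //; rewrite integralE [RHS]integralE.
have pos (g : T -> R) : measurable_fun setT g -> \int[nu]_x ((EFin \o g)^\+ x) = \int[mu]_x ((fun x => (g x * p x)%:E)^\+ x).
  move=> mg.
  transitivity (\int[nu]_x (Num.max (g x) 0)%:E).
    by apply: eq_integral => x _; rewrite funeposE /= EFin_max.
  rewrite ge0_integral_density//.
  - apply: eq_integral => x _; rewrite funeposE -EFin_max maxr_pMl//.
    by rewrite mul0r.
  - exact: measurable_maxr.
  - by move=> x; rewrite le_max lexx orbT.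
rewrite pos//.
have neg (g : T -> R) : (EFin \o g)^\- = (EFin \o (\- g)%R)^\+ by rewrite -funeposN.
rewrite neg pos; last exact: measurable_funN.
congr (_ - _); apply: eq_integral => x _.
by rewrite -funeposN !funeposE /= mulNr EFinN.
Qed.

End density.

(** * Variance of the integrated first component *)

Section moments.
Context {R : realType}.
Notation leb := (@lebesgue_measure R).
Variable s : R.
Hypothesis s_gt0 : 0 < s.
Let p := normal_pdf 0 s.
Let s0 : s != 0. Proof. by rewrite gt_eqF. Qed.

Let pE x : p x = normal_peak s * expR (- (s ^+ 2 *+ 2)^-1 * x ^+ 2).
Proof.
rewrite /p normal_pdfE// /normal_fun subr0; congr (_ * expR _).
by rewrite mulNr mulNr mulrC.
Qed.

Let dp (x : R) : is_derive x 1 (p : R -> R^o) (- (x / s ^+ 2) * p x).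
Proof.
rewrite (_ : p = fun x => normal_peak s * expR (- (s ^+ 2 *+ 2)^-1 * x ^+ 2)); last first.
  by apply/funext => y; rewrite pE.
pose a := - (s ^+ 2 *+ 2)^-1.
have h2 : is_derive x 1 (fun y : R => a * y ^+ 2 : R^o) (a * (1 * x + x * 1)).
  by apply: is_deriveZR; exact: (is_deriveMR (is_derive_id x 1) (is_derive_id x 1)).
have h := @is_derive1_comp _ (@expR R) (fun y => a * y ^+ 2) x _ _ (is_derive_expR _) h2.
apply: is_derive_eq (is_deriveZR (normal_peak s) h) _.
rewrite /a.
by rewrite -mulr_natr; field; exact: s0.
Qed.

Let p0 x : 0 <= p x. Proof. exact: normal_pdf_ge0. Qed.

Let mT : measurable [set: measurableTypeR R]. Proof. by []. Qed.

(** With u = x^2 / (4 s^2), half of the Gaussian exponent absorbs x^2 = 4 s^2 u because u <= e^u;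
    what is left is a Gaussian of variance 2 s^2. *)
Let dom x : x ^+ 2 * p x <= 4 * s ^+ 2 * (Num.sqrt 2 * normal_pdf 0 (Num.sqrt 2 * s) x).
Proof.
have s2 : Num.sqrt 2 * s != 0 :> R by rewrite mulf_neq0// gt_eqF// sqrtr_gt0.
rewrite normal_pdfE// pE /normal_fun subr0 /normal_peak exprMn sqr_sqrtr// .
have q0 : 0 < s ^+ 2 by rewrite exprn_gt0.
rewrite (_ : (2 * s ^+ 2 * pi *+ 2) = 2 * (s ^+ 2 * pi *+ 2)); last by rewrite -!mulrA mulrnAr.
rewrite sqrtrM// invfM.
have n0 : 0 <= (Num.sqrt (s ^+ 2 * pi *+ 2))^-1 :> R by rewrite invr_ge0 sqrtr_ge0.
have r2 : Num.sqrt 2 != 0 :> R by rewrite gt_eqF// sqrtr_gt0.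
move: (Num.sqrt 2) r2 (Num.sqrt _)^-1 n0 => r r2 n n0.
rewrite [leRHS](_ : _ = n * (4 * s ^+ 2 * expR (- x ^+ 2 / (2 * s ^+ 2 *+ 2)))); last by field.
rewrite mulrCA; apply: ler_wpM2l => //.
set u := x ^+ 2 / (4 * s ^+ 2).
have -> : - x ^+ 2 / (2 * s ^+ 2 *+ 2) = - u.
  by rewrite /u -mulr_natr; field; rewrite gt_eqF.
have -> : - (s ^+ 2 *+ 2)^-1 * x ^+ 2 = - u - u.
  by rewrite /u -mulr_natr; field; rewrite gt_eqF.
have -> : x ^+ 2 = 4 * s ^+ 2 * u by rewrite /u; field; rewrite gt_eqF.
rewrite -[leLHS]mulrA; apply: ler_wpM2l; first by rewrite mulr_ge0// ltW.
rewrite expRD mulrA; apply: ler_piMl; first exact: expR_ge0.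
rewrite expRN ler_pdivrMr ?expR_gt0// mul1r.
by have := expR_ge1Dx u; lra.
Qed.

Let x2i : leb.-integrable setT (fun x => (x ^+ 2 * p x)%:E).
Proof.
apply: (le_integrable mT (g := fun x => (4 * s ^+ 2 * Num.sqrt 2)%:E * (normal_pdf 0 (Num.sqrt 2 * s) x)%:E)%E).
- apply/measurable_EFinP; apply: measurable_funM; last exact: measurable_normal_pdf.
  exact: measurable_funX.
- move=> x _; rewrite /= lee_fin ger0_norm; last by rewrite mulr_ge0 ?sqr_ge0.
  by apply: le_trans (dom x) _; rewrite mulrA ler_norm.
- by apply: integrableZl => //; exact: integrable_normal_pdf.
Qed.

Let pi_int : leb.-integrable setT (fun x => (p x)%:E).
Proof. exact: integrable_normal_pdf. Qed.

Let xi : leb.-integrable setT (fun x => (x * p x)%:E).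
Proof.
apply: (le_integrable mT (g := fun x => ((x ^+ 2 * p x)%:E + (p x)%:E)%E)).
- by apply/measurable_EFinP; apply: measurable_funM => //; exact: measurable_normal_pdf.
- move=> x _; rewrite /= lee_fin normrM (ger0_norm (p0 x)).
  rewrite [leRHS]ger0_norm; last by rewrite addr_ge0// mulr_ge0 ?sqr_ge0.
  rewrite -[X in _ + X]mul1r -mulrDl; apply: ler_wpM2r => //.
  rewrite -(real_normK (num_real x)).
  by have := normr_ge0 x; move: `|x| => y y0; nra.
- exact: integrableD.
Qed.

(** The one-dimensional case of [integral_flow_derive], for translations of the line. *)
Let flowR (f g : R -> R) : leb.-integrable setT (EFin \o f) -> leb.-integrable setT (EFin \o g) ->
  continuous (g : R -> R^o) -> (forall x : R, is_derive x 1 (f : R -> R^o) (g x)) ->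
  \int[leb]_x g x = 0.
Proof.
move=> fi gi cg fg.
have mt : measurable_fun setT (fun q : measurableTypeR R * measurableTypeR R => (q.2 + q.1)%R : measurableTypeR R).
  apply: (@measurable_funD _ _ R _ snd fst); [exact: measurable_snd|exact: measurable_fst].
apply: (integral_flow_derive (mu := leb) (tau := fun r x => x + r) mt _ _ fi gi).
- by move=> y; rewrite addr0.
- by move=> r h mh h0; exact: (ge0_integral_shift r mh h0).
- move=> y x; have cl : {for x, continuous (fun r : R => y + r : R^o)}.
    by apply: (@cvgD _ R^o); [exact: cvg_cst|exact: cvg_id].
  exact: (continuous_comp cl (cg _)).
- move=> y r.
  have h := @is_derive1_comp _ f (fun r => y + r) r _ _ (fg (y + r)) (is_deriveD (is_derive_cst y r 1) (is_derive_id r 1)).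
  by apply: is_derive_eq h _; rewrite add0r mulr1.
Qed.

Let cp : continuous (p : R -> R^o). Proof. exact: continuous_normal_pdf. Qed.

Lemma normal_mean : (\int[leb]_x (x * p x)%:E = 0)%E.
Proof.
have gi : leb.-integrable setT (EFin \o (fun x => - (x / s ^+ 2) * p x)).
  rewrite (_ : (fun x => - (x / s ^+ 2) * p x) = (fun x => - (s ^+ 2)^-1 * (x * p x))); first exact: (integrableZR mT _ xi).
  by apply/funext => x /=; ring.
have cg : continuous ((fun x => - (x / s ^+ 2) * p x) : R -> R^o).
  move=> x; apply: (@cvgM R); last exact: cp.
  by apply: (@cvgN _ R^o); apply: cvgMr_tmp; exact: cvg_id.
have := flowR pi_int gi cg dp.
rewrite (_ : Rintegral _ _ _ = \int[leb]_x (- (s ^+ 2)^-1 * (x * p x))); last first.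
  by apply: eq_Rintegral => x _; ring.
rewrite RintegralZl// => /eqP; rewrite mulf_eq0 oppr_eq0 invr_eq0 expf_eq0/= (negbTE s0)/= => /eqP h.
by rewrite -[LHS]fineK; [rewrite -/(Rintegral _ _ _) h|exact: integrable_fin_num].
Qed.

(** The derivative of x p(x) is p - x^2 p / s^2 and integrates to 0, while p has mass 1. *)
Lemma normal_second : (\int[leb]_x (x ^+ 2 * p x)%:E = (s ^+ 2)%:E)%E.
Proof.
pose g x := p x - (s ^+ 2)^-1 * (x ^+ 2 * p x).
have gi : leb.-integrable setT (EFin \o g).
  by apply: (integrableBR mT pi_int); exact: (integrableZR mT _ x2i).
have cg : continuous (g : R -> R^o).
  move=> x; apply: (@cvgB _ R^o); first exact: cp.
  apply: cvgMl_tmp; apply: (@cvgM R); last exact: cp.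
  exact: exprn_continuous.
have dg (x : R) : is_derive x 1 (fun x => x * p x : R^o) (g x).
  apply: is_derive_eq (is_deriveM (is_derive_id x 1) (dp x)) _.
  by rewrite /GRing.scale/= /g; ring.
have := flowR xi gi cg dg.
rewrite /g RintegralB//; last exact: (integrableZR mT _ x2i).
rewrite RintegralZl// {1}/Rintegral integral_normal_pdf /= => /eqP; rewrite subr_eq0 => /eqP h.
rewrite -[LHS]fineK; last exact: integrable_fin_num.
congr (_ %:E); rewrite -/(Rintegral _ _ _).
have q0 : s ^+ 2 != 0 by rewrite expf_neq0.
by rewrite -[LHS]mul1r -(mulfV q0) -mulrA -h mulr1.
Qed.

Context d (T : measurableType d) (P : probability T R).

Lemma normal_law_moments (X : T -> R) : measurable_fun setT X -> has_normal_law P X 0 s ->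
  [/\ P.-integrable setT (EFin \o X), P.-integrable setT (EFin \o (fun w => X w ^+ 2)),
    \int[P]_w X w = 0 & \int[P]_w (X w ^+ 2) = s ^+ 2].
Proof.
move=> mX nX.
pose nu : {measure set (measurableTypeR R) -> \bar R} := pushforward_measure P (mX : measurable_fun setT (X : T -> measurableTypeR R)).
have nuE (A : set (measurableTypeR R)) : measurable A -> (nu A = \int[leb]_(x in A) (p x)%:E)%E.
  by move=> mA; rewrite /nu/= /pushforward nX.
have mp : measurable_fun setT (p : measurableTypeR R -> R) by exact: measurable_normal_pdf.
have tr (f : R -> R) : measurable_fun setT f -> leb.-integrable setT (fun x => (f x * p x)%:E) ->
    P.-integrable setT (EFin \o (f \o X)) /\ (\int[P]_w (f (X w))%:E = \int[leb]_x (f x * p x)%:E)%E.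
  move=> mf fi; have [fn fE] := integral_density (mu := leb) (nu := nu) p0 mp nuE mf fi.
  have i : P.-integrable setT (EFin \o (f \o X)).
    apply/integrableP; split; first by apply/measurable_EFinP; exact: measurableT_comp.
    case/integrableP: fn => mfn; apply: le_lt_trans.
    rewrite [leRHS](ge0_integral_pushforward (mX : measurable_fun setT (X : T -> measurableTypeR R)))//.
    exact: measurableT_comp.
  split=> //; rewrite -fE.
  rewrite (integral_pushforward (mX : measurable_fun setT (X : T -> measurableTypeR R)))//.
  exact/measurable_EFinP.
have [i1 e1] := tr id (@measurable_id _ _ _) xi.
have [i2 e2] := tr (fun x => x ^+ 2) (exprn_measurable 2) x2i.
split=> //.
- by rewrite /Rintegral e1 normal_mean.
- by rewrite /Rintegral e2 normal_second.
Qed.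

End moments.

Lemma floor_scale_itv {R : realType} (c s : R) (z : int) : 0 < c ->
  (Num.floor (c * s) == z) = (c^-1 * z%:~R <= s < c^-1 * (z + 1)%:~R).
Proof.
by move=> c0; rewrite floor_eq ler_pdivrMl// ltr_pdivlMl.
Qed.

Lemma cvg_floor_scale {R : realType} (s : R) :
  (n.+1%:R^-1 * (Num.floor (n.+1%:R * s))%:~R) @[n --> \oo] --> s.
Proof.
apply/cvgrPdist_lt => e e0.
have := @near_infty_natSinv_lt R (PosNum e0) => /=.
apply: filterS => n; apply: le_lt_trans.
have c0 : 0 < n.+1%:R :> R by [].
have /andP[] : n.+1%:R^-1 * (Num.floor (n.+1%:R * s))%:~R <= s <
    n.+1%:R^-1 * (Num.floor (n.+1%:R * s) + 1)%:~R by rewrite -floor_scale_itv.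
rewrite rmorphD/= mulrDr mulr1.
have : 0 < n.+1%:R^-1 :> R by rewrite invr_gt0.
move: (n.+1%:R^-1) (_ * _) => i z i0 h1 h2.
by rewrite ler_norml; apply/andP; split; lra.
Qed.

(** Time is rounded down to the grid of step 1 / (n + 1). The rounded function is measurable, being
    given on countably many strips by a single f(s), and converges pointwise by continuity in
    time. *)
Lemma measurable_fun_carath {R : realType} d (T : measurableType d) (f : R -> T -> R) :
  (forall w, continuous (fun s => f s w : R^o)) -> (forall s, measurable_fun setT (f s)) ->
  measurable_fun setT (fun p : T * measurableTypeR R => f p.2 p.1).
Proof.
move=> cf mf.
pose a (n : nat) (s : R) : R := n.+1%:R^-1 * (Num.floor (n.+1%:R * s))%:~R.
apply: (@measurable_fun_cvg _ _ _ _ (fun n p => f (a n p.2) p.1)).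
- move=> n _ D mD; rewrite setTI.
  have c0 : 0 < n.+1%:R :> R by [].
  have -> : (fun p : T * measurableTypeR R => f (a n p.2) p.1) @^-1` D =
      \bigcup_(z in [set: int]) ((f (n.+1%:R^-1 * z%:~R) @^-1` D) `*`
        (`[n.+1%:R^-1 * z%:~R, n.+1%:R^-1 * (z + 1)%:~R[%classic : set (measurableTypeR R))).
    apply/seteqP; split=> [[w s]/= h|[w s]/= [z _ [/= h]]].
      exists (Num.floor (n.+1%:R * s)) => //; split=> //=.
      by rewrite in_itv/= -floor_scale_itv.
    by rewrite in_itv/= -floor_scale_itv// /a => /eqP ->.
  apply: countable_bigcupT_measurable; first exact: countableP.
  move=> z; apply: measurableX.
    by rewrite -[X in measurable X]setTI; exact: mf.
  exact: measurable_itv.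
- move=> [w s] _ /=.
  apply: (cvg_comp (a ^~ s) (fun r => f r w)); last exact: cf.
  exact: cvg_floor_scale.
Qed.

(** * Independence and time integrals of processes *)

Section indep_mean.
Context {R : realType} d (T : measurableType d) (P : probability T R).

(** Independence identifies the joint law with the product of the marginal laws, where Fubini
    separates the variables. *)
Lemma indep_mean (X Y : T -> R) : measurable_fun setT X -> measurable_fun setT Y ->
  P.-integrable setT (EFin \o X) -> P.-integrable setT (EFin \o Y) ->
  (forall C D : set R, measurable C -> measurable D ->
     P (X @^-1` C `&` Y @^-1` D) = (P (X @^-1` C) * P (Y @^-1` D))%E) ->
  P.-integrable setT (EFin \o (fun w => X w * Y w)) /\
  \int[P]_w (X w * Y w) = (\int[P]_w X w) * (\int[P]_w Y w).
Proof.
move=> mX mY iX iY ind.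
have fin (Z : T -> R) (mZ : measurable_fun setT Z) :
    fin_num_fun (pushforward_measure P mZ).
  by move=> A mA; rewrite /= /pushforward fin_num_measure// -[X in measurable X]setTI; exact: mZ.
have mu0 (Z : T -> R) (mZ : measurable_fun setT Z) : (pushforward_measure P mZ set0 < +oo)%E by rewrite measure0.
pose m1 : {sigma_finite_measure set R -> \bar R} := sf_of (fin_num_fun_sigma_finite (mu0 X mX) (fin X mX)).
pose m2 : {sigma_finite_measure set R -> \bar R} := sf_of (fin_num_fun_sigma_finite (mu0 Y mY) (fin Y mY)).
have mXY : measurable_fun setT (fun w => (X w, Y w)) by exact: measurable_fun_pair.
pose nu : {measure set (R * R) -> \bar R} := pushforward_measure P mXY.
(* The two measures agree on rectangles, which determines them. *)
have nuE A : measurable A -> (m1 \x m2)%E A = nu A.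
  apply: product_measure_unique => C D mC mD.
  exact: ind.
pose f (p : R * R) : R := p.1 * p.2.
have mf : measurable_fun setT f by apply: measurable_funM; [exact: measurable_fst|exact: measurable_snd].
have tr (Z : T -> R) (mZ : measurable_fun setT Z) (h : R -> \bar R) : measurable_fun setT h ->
    (forall x, 0 <= h x)%E -> (\int[pushforward_measure P mZ]_x h x = \int[P]_w h (Z w))%E.
  by move=> mh h0; rewrite (ge0_integral_pushforward mZ).
have e1 : (\int[m1]_x `|x%:E| < +oo)%E.
  rewrite (tr X mX (fun x => `|x%:E|%E))//; first by case/integrableP: iX.
  exact: measurableT_comp.
have e2 : (\int[m2]_x `|x%:E| < +oo)%E.
  rewrite (tr Y mY (fun x => `|x%:E|%E))//; first by case/integrableP: iY.
  exact: measurableT_comp.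
have i1 : m1.-integrable setT (EFin : R -> \bar R) by apply/integrableP; split.
have i2 : m2.-integrable setT (EFin : R -> \bar R) by apply/integrableP; split.
have fi : (m1 \x m2)%E.-integrable setT (EFin \o f).
  apply/integrable12ltyP; first exact/measurable_EFinP.
  rewrite (eq_integral (fun x : R => `|x%:E| * (\int[m2]_y `|(y : R)%:E|))%E); last first.
    move=> x _; rewrite -ge0_integralZl//; last exact: measurableT_comp.
    by apply: eq_integral => y _; rewrite /f/= normrM.
  rewrite ge0_integralZr//; last 2 first.
  - exact: measurableT_comp.
  - exact: integral_ge0.
  by apply: lte_mul_pinfty => //; [exact: integral_ge0|rewrite ge0_fin_numE//; exact: integral_ge0].
have fnu : nu.-integrable setT (EFin \o f).
  case/integrableP: fi => mfE h; apply/integrableP; split=> //.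
  by rewrite (eq_measure_integral (m1 \x m2)%E)// => A mA _; exact: (esym (nuE _ mA)).
have i12 : P.-integrable setT (EFin \o (fun w => X w * Y w)).
  case/integrableP: fnu => mfE h; apply/integrableP; split.
    by apply/measurable_EFinP; exact: measurable_funM.
  move: h; rewrite (ge0_integral_pushforward mXY)//; last exact: (measurableT_comp (measurableT_comp (@abse_measurable R setT) mfE)).
split=> //.
have : (\int[P]_w (X w * Y w)%:E = \int[nu]_p (f p)%:E)%E.
  rewrite (integral_pushforward mXY (D := setT) (f := EFin \o f))//.
  exact/measurable_EFinP.
rewrite (eq_measure_integral (m1 \x m2)%E); last by move=> A mA _; exact: (esym (nuE _ mA)).
rewrite -(integral12_prod_meas1 fi)/=.
rewrite (eq_integral (fun x : R => x%:E * (\int[m2]_y (y : R)%:E))%E); last first.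
  by move=> x _; rewrite -integralZl.
have q2 : (\int[m2]_y (y : R)%:E = (\int[P]_w Y w)%:E)%E.
  rewrite (integral_pushforward mY (D := setT) (f := EFin : R -> \bar R))//.
  by rewrite /Rintegral fineK//; exact: integrable_fin_num.
have q1 : (\int[m1]_y (y : R)%:E = (\int[P]_w X w)%:E)%E.
  rewrite (integral_pushforward mX (D := setT) (f := EFin : R -> \bar R))//.
  by rewrite /Rintegral fineK//; exact: integrable_fin_num.
rewrite q2 integralZr// q1 -EFinM => h.
by rewrite /Rintegral h.
Qed.

End indep_mean.

Section process.
Context {R : realType} d1 d2 (T1 : measurableType d1) (T2 : measurableType d2).
Variables (P : probability T1 R) (nu : {sigma_finite_measure set T2 -> \bar R}).
Hypothesis nu_fin : (nu setT < +oo)%E.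
Variable b : T1 * T2 -> R.
Hypothesis mb : measurable_fun setT b.
Hypothesis b2w : forall w, nu.-integrable setT (EFin \o (fun s => b (w, s) ^+ 2)).
Variable C : R.
Hypothesis b2s : forall s, P.-integrable setT (EFin \o (fun w => b (w, s) ^+ 2)).
Hypothesis b2C : forall s, \int[P]_w (b (w, s) ^+ 2) <= C.

Let nu1 : nu.-integrable setT (EFin \o cst (1 : R)).
Proof.
apply/integrableP; split; first exact/measurable_EFinP.
by under eq_integral do rewrite /= normr1; rewrite integral_cst// mul1e.
Qed.

Let mbw w : measurable_fun setT (fun s => b (w, s)).
Proof. exact: (measurableT_comp mb (measurable_pair1 w)). Qed.

Let mbs s : measurable_fun setT (fun w => b (w, s)).
Proof. exact: (measurableT_comp mb (measurable_pair2 s)). Qed.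

Let norm_sq (x : R) : `|x| <= x ^+ 2 + 1.
Proof. by rewrite -(real_normK (num_real x)); have := normr_ge0 x; move: `|x| => y y0; nra. Qed.

Let bw w : nu.-integrable setT (EFin \o (fun s => b (w, s))).
Proof.
apply: (le_integrable measurableT (g := EFin \o (fun s => b (w, s) ^+ 2 + 1))).
- exact/measurable_EFinP.
- by move=> s _; rewrite /= lee_fin [leRHS]ger0_norm ?addr_ge0 ?sqr_ge0.
- exact: integrableDR.
Qed.

Definition proc_int w := \int[nu]_s b (w, s).

Section mixed.
Variable M : T1 -> R.
Hypothesis mM : measurable_fun setT M.
Hypothesis M2 : P.-integrable setT (EFin \o (fun w => M w ^+ 2)).

Let h (p : T1 * T2) : R := M p.1 * b p.

Let mh : measurable_fun setT h.
Proof. by apply: measurable_funM => //; exact: (measurableT_comp mM measurable_fst). Qed.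

Let hi : (P \x nu)%E.-integrable setT (EFin \o h).
Proof.
apply/integrable21ltyP; first exact/measurable_EFinP.
pose D := \int[P]_w (M w ^+ 2) + C.
apply: (@le_lt_trans _ _ (\int[nu]_s D%:E)%E); last first.
  by rewrite integral_cst// lte_mul_pinfty ?lee_fin// addr_ge0//; [apply: Rintegral_ge0 => w _; exact: sqr_ge0|
   apply: le_trans (b2C point); apply: Rintegral_ge0 => w _; exact: sqr_ge0].
apply: ge0_le_integral => //.
- by move=> s _; exact: integral_ge0.
- apply: (measurable_fun_fubini_tonelli_G (m1 := P) (fun p => `|(h p)%:E|%E)) => //.
  by apply: measurableT_comp => //; exact/measurable_EFinP.
move=> s _.
apply: (@le_trans _ _ (\int[P]_w (M w ^+ 2 + b (w, s) ^+ 2)%:E)%E).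
  apply: ge0_le_integral => //.
  - by apply: measurableT_comp => //; apply/measurable_EFinP; exact: (measurable_funM mM (mbs s)).
  - apply/measurable_EFinP; apply: measurable_funD; first exact: measurable_funX.
    exact: measurable_funX.
  - move=> w _; rewrite lee_fin /h/= normrM.
    rewrite -(real_normK (num_real (M w))) -(real_normK (num_real (b (w, s)))).
    have := normr_ge0 (M w); have := normr_ge0 (b (w, s)).
    move: `|M w| `|b (w, s)| => x y x0 y0; nra.
have i := integrableDR measurableT M2 (b2s s).
rewrite (_ : (\int[P]_w _)%E = (\int[P]_w (M w ^+ 2 + b (w, s) ^+ 2))%:E); last first.
  by rewrite /Rintegral fineK//; exact: integrable_fin_num.
by rewrite RintegralD// lee_fin lerD2l.
Qed.

(** The factor M lets one Fubini argument serve several purposes: M = 1 gives the mean, M =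
    [proc_int] the second moment, and M = [OU_init] the correlation with the initial value. *)
Lemma proc_mixed :
  \int[P]_w (M w * proc_int w) = \int[nu]_s \int[P]_w (M w * b (w, s)).
Proof.
have F := Fubini hi.
rewrite /Rintegral; congr fine.
rewrite (eq_integral (fun w => \int[nu]_s (h (w, s))%:E)%E); last first.
  move=> w _; rewrite /proc_int -RintegralZl// /Rintegral fineK//.
  by apply: integrable_fin_num => //; exact: integrableZR.
rewrite [LHS]F; apply: eq_integral => s _; rewrite /Rintegral fineK//.
apply: integrable_fin_num => //.
apply: (le_integrable measurableT (g := EFin \o (fun w => M w ^+ 2 + b (w, s) ^+ 2))).
- by apply/measurable_EFinP; exact: measurable_funM.
- move=> w _; rewrite /= lee_fin [leRHS]ger0_norm ?addr_ge0 ?sqr_ge0// normrM.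
  rewrite -(real_normK (num_real (M w))) -(real_normK (num_real (b (w, s)))).
  have := normr_ge0 (M w); have := normr_ge0 (b (w, s)).
  move: `|M w| `|b (w, s)| => x y x0 y0; nra.
- exact: integrableDR.
Qed.

Lemma measurable_proc_mixed : measurable_fun setT (fun w => M w * proc_int w).
Proof.
apply/measurable_EFinP.
rewrite (_ : _ \o _ = fubini_F nu (EFin \o h)); first exact: measurable_fubini_F hi.
apply/funext => w; rewrite /fubini_F/= /proc_int -RintegralZl// /Rintegral fineK//.
by apply: integrable_fin_num => //; exact: integrableZR.
Qed.

End mixed.

Lemma measurable_proc_int : measurable_fun setT proc_int.
Proof.
have i : P.-integrable setT (EFin \o (fun w : T1 => (1 : R) ^+ 2)).
  exact: finite_measure_integrable_cst.
have := @measurable_proc_mixed (cst 1) (@measurable_cst _ _ _ _ _ _) i.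
by under eq_fun do rewrite /= mul1r.
Qed.

Lemma proc_mean : \int[P]_w proc_int w = \int[nu]_s \int[P]_w b (w, s).
Proof.
have i : P.-integrable setT (EFin \o (fun w : T1 => (1 : R) ^+ 2)).
  exact: finite_measure_integrable_cst.
have := @proc_mixed (cst 1) (@measurable_cst _ _ _ _ _ _) i.
under eq_Rintegral do rewrite /= mul1r.
by under [RHS]eq_Rintegral => s _ do under eq_Rintegral do rewrite /= mul1r.
Qed.

Let m := fine (nu setT).
Let m0 : 0 <= m. Proof. exact: fine_ge0. Qed.

(** Cauchy-Schwarz obtained by expanding the integral of (b - c)^2 with c = Z / (m + 1), m being the
    mass of [nu]; the 1 allows for zero mass. *)
Let proc_CS w : proc_int w ^+ 2 <= (m + 1) * \int[nu]_s (b (w, s) ^+ 2).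
Proof.
set Z := proc_int w; set Q := Rintegral _ _ _.
pose c := Z / (m + 1).
have m1 : 0 < m + 1 by rewrite ltr_pwDr.
have : 0 <= \int[nu]_s ((b (w, s) - c) ^+ 2) by apply: Rintegral_ge0 => s _; exact: sqr_ge0.
rewrite (_ : Rintegral _ _ _ = \int[nu]_s ((b (w, s) ^+ 2 + (- (2 * c)) * b (w, s)) + c ^+ 2 * 1)); last first.
  by apply: eq_Rintegral => s _; ring.
rewrite RintegralD//; last 2 first.
- by apply: integrableDR => //; exact: integrableZR.
- exact: (integrableZR measurableT (c ^+ 2) nu1).
rewrite RintegralD//; last exact: integrableZR.
rewrite RintegralZl// RintegralZl// -/Q -/(proc_int w) -/Z Rintegral_cst// mul1r -/m => H.
have e : (Q + - (2 * c) * Z + c ^+ 2 * m) * (m + 1) ^+ 2 =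
   Q * (m + 1) ^+ 2 - Z ^+ 2 * (m + 2) by rewrite /c; field; rewrite gt_eqF.
have : 0 <= (Q + - (2 * c) * Z + c ^+ 2 * m) * (m + 1) ^+ 2 by rewrite mulr_ge0// sqr_ge0.
rewrite e => H2; rewrite -(ler_pM2r m1).
have := sqr_ge0 Z; move: H2; move: (Z ^+ 2) => z; nra.
Qed.

Lemma proc_sq_integrable : P.-integrable setT (EFin \o (fun w => proc_int w ^+ 2)).
Proof.
have mp := measurable_proc_int.
apply/integrableP; split; first by apply/measurable_EFinP; exact: measurable_funX.
apply: (@le_lt_trans _ _ (\int[P]_w ((m + 1)%:E * \int[nu]_s (b (w, s) ^+ 2)%:E))%E).
  apply: ge0_le_integral => //.
  - by apply: measurableT_comp => //; apply/measurable_EFinP; exact: measurable_funX.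
  - apply: measurable_funeM.
    apply: (measurable_fun_fubini_tonelli_F (m2 := nu) (fun p => (b p ^+ 2)%:E)) => //.
      by apply/measurable_EFinP; exact: measurable_funX.
    by move=> p; rewrite lee_fin sqr_ge0.
  - move=> w _; rewrite /= ger0_norm ?sqr_ge0//.
    rewrite (_ : (\int[nu]_s _)%E = (\int[nu]_s (b (w, s) ^+ 2))%:E); last first.
      by rewrite /Rintegral fineK//; exact: (integrable_fin_num measurableT (b2w w)).
    by rewrite -EFinM lee_fin.
have mb2 : measurable_fun setT (fun p => (b p ^+ 2)%:E).
  by apply/measurable_EFinP; exact: measurable_funX.
have b20 p : (0 <= (b p ^+ 2)%:E)%E by rewrite lee_fin sqr_ge0.
rewrite ge0_integralZl//; last 3 first.
- exact: (measurable_fun_fubini_tonelli_F (m2 := nu) (fun p => (b p ^+ 2)%:E)).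
- by move=> w _; apply: integral_ge0.
- by rewrite lee_fin addr_ge0.
apply: lte_mul_pinfty => //; first by rewrite lee_fin addr_ge0.
have := fubini_tonelli (m1 := P) (m2 := nu) _ mb2 b20; rewrite /fubini_F /fubini_G => ->.
apply: (@le_lt_trans _ _ (\int[nu]_s C%:E)%E).
  have C0 : 0 <= C by apply: le_trans (b2C point); apply: Rintegral_ge0 => w _; exact: sqr_ge0.
  apply: ge0_le_integral => //.
  - by move=> s _; apply: integral_ge0.
  - exact: (measurable_fun_fubini_tonelli_G (m1 := P) (fun p => (b p ^+ 2)%:E)).
  - move=> s _; rewrite (_ : (\int[P]_w _)%E = (\int[P]_w (b (w, s) ^+ 2))%:E) ?lee_fin//.
    by rewrite /Rintegral fineK//; exact: (integrable_fin_num measurableT (b2s s)).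
rewrite integral_cst//; apply: lte_mul_pinfty => //.
by rewrite lee_fin; apply: le_trans (b2C point); apply: Rintegral_ge0 => w _; exact: sqr_ge0.
Qed.

Lemma proc_second : \int[P]_w (proc_int w ^+ 2) =
  \int[nu]_s \int[nu]_r \int[P]_w (b (w, s) * b (w, r)).
Proof.
have := proc_mixed measurable_proc_int proc_sq_integrable.
under eq_Rintegral do rewrite -expr2.
move=> ->; apply: eq_Rintegral => s _.
under eq_Rintegral do rewrite mulrC.
exact: proc_mixed (mbs s) (b2s s).
Qed.

End process.

(** For T0 >= 0, the projection of the line onto [0, T0]. Composing with it turns a path known to be
    continuous on the half-line into a continuous function on all of R. *)
Definition clip {R : realType} (T0 s : R) : R := Num.min (Num.max s 0) T0.

Lemma clip_ge0 {R : realType} (T0 s : R) : 0 <= T0 -> 0 <= clip T0 s.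
Proof. by move=> T00; rewrite /clip le_min T00 le_max lexx orbT. Qed.

Lemma clip_le {R : realType} (T0 s : R) : clip T0 s <= T0.
Proof. by rewrite /clip ge_min lexx orbT. Qed.

Lemma clip_id {R : realType} (T0 s : R) : 0 <= s <= T0 -> clip T0 s = s.
Proof. by move=> /andP[s0 sT]; rewrite /clip max_l// min_l. Qed.

Lemma continuous_clip_id {R : realType} (T0 : R) : continuous (clip T0 : R -> R^o).
Proof.
move=> y; apply: (@continuous_min R _ (fun s : R => Num.max s 0) (cst T0)); last exact: cvg_cst.
by apply: (@continuous_max R _ (fun s : R => s : R^o) (cst (0 : R))); [exact: cvg_id|exact: cvg_cst].
Qed.

Lemma continuous_clip {R : realType} (f : R -> R) (T0 : R) : 0 <= T0 ->
  {within `[0, +oo[, continuous f} ->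
  continuous (fun s : R => f (clip T0 s) : R^o).
Proof.
move=> T00 /subspace_continuousP cf x.
apply: (@cvg_comp _ _ _ (clip T0) f _ (within `[0, +oo[%classic (nbhs (clip T0 x)))); last first.
  by apply: cf; rewrite /= in_itv/= andbT; exact: clip_ge0.
move=> A hA.
have h : \forall y \near x, (`[0, +oo[%classic : set R) (clip T0 y) -> A (clip T0 y).
  exact: (@continuous_clip_id _ T0 x _ hA).
change (\forall y \near x, A (clip T0 y)); apply: filterS h => y; apply.
by rewrite /= in_itv/= andbT; exact: clip_ge0.
Qed.

Section restriction.
Context {R : realType} (T0 : R).
Notation leb := (@lebesgue_measure R).
Let D : set (measurableTypeR R) := `[0, T0]%classic.
Let mD : measurable D. Proof. exact: measurable_itv. Qed.

Let lebD_fin A : measurable A -> mrestr leb mD A \is a fin_num.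
Proof.
move=> mA; rewrite ge0_fin_numE//; apply: (@le_lt_trans _ _ (leb D)).
  by apply: le_measure; rewrite ?inE//; exact: measurableI.
rewrite lebesgue_measure_itv/=; case: ifP => // _.
by rewrite -EFinB ltry.
Qed.

Let lebD0 : (mrestr leb mD set0 < +oo)%E. Proof. by rewrite measure0. Qed.

(** Lebesgue measure restricted to [0, T0] as a finite measure on the whole line, the setting
    required for integrated processes. *)
Definition leb_itv : {sigma_finite_measure set (measurableTypeR R) -> \bar R} :=
  sf_of (fin_num_fun_sigma_finite lebD0 lebD_fin).

Lemma leb_itv_fin : (leb_itv setT < +oo)%E.
Proof. by have := lebD_fin measurableT; rewrite ge0_fin_numE. Qed.

Lemma leb_itv_integral (f : R -> R) : measurable_fun [set: measurableTypeR R] f ->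
  leb.-integrable D (EFin \o f) ->
  leb_itv.-integrable setT (EFin \o f) /\ \int[leb_itv]_x f x = \int[leb]_(x in D) f x.
Proof.
move=> mf fi.
have e A : measurable A -> leb_itv A = (\int[leb]_(x in A) (\1_D x)%:E)%E.
  by move=> mA; rewrite integral_indic// setIC.
have i : leb.-integrable setT (fun x => (f x * \1_D x)%:E).
  have := fi; rewrite (integrable_mkcond _ mD); congr (integrable _ _).
  by apply/funext => x; rewrite patchE indicE; case: ifP => _; rewrite ?mulr1 ?mulr0.
have [i' e'] := integral_density (fun x => ler0n _ (x \in D)) (measurable_indic mD) e mf i.
split=> //; rewrite /Rintegral e' [in RHS]integral_mkcond; congr fine.
apply: eq_integral => x _.
by rewrite patchE; case: ifP => _; rewrite ?mulr1 ?mulr0.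
Qed.

Lemma leb_itv_cont (f : R -> R) : continuous (f : R -> R^o) ->
  leb_itv.-integrable setT (EFin \o f) /\ \int[leb_itv]_x f x = \int[leb]_(x in D) f x.
Proof.
move=> cf; apply: leb_itv_integral; first exact: continuous_measurable_fun.
by apply: continuous_compact_integrable; [exact: segment_compact|exact: continuous_subspaceT].
Qed.

End restriction.

Section generated.
Context {R : realType} {dsp : measure_display} {T : measurableType dsp}.

(** The generators behind [sigma_of], named so that functions can be measurable for the generated
    sigma-algebra and be combined by the usual rules. *)
Definition sigma_gen (I : Type) (D : set I) (X : I -> T -> R) : set (set T) :=
  [set E | exists2 i, D i & exists2 C : set R, measurable C & E = X i @^-1` C].

Lemma sigma_of_coord (I : Type) (D : set I) (X : I -> T -> R) i : D i ->
  measurable_fun [set: g_sigma_algebraType (sigma_gen D X)]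
    (X i : g_sigma_algebraType (sigma_gen D X) -> R).
Proof.
move=> Di _ C mC; rewrite setTI; apply: sub_sigma_algebra.
by exists i => //; exists C.
Qed.

Lemma sigma_of_fun (I : Type) (D : set I) (X : I -> T -> R) (f : T -> R) (C : set R) :
  measurable_fun [set: g_sigma_algebraType (sigma_gen D X)]
    (f : g_sigma_algebraType (sigma_gen D X) -> R) ->
  measurable C -> sigma_of D X (f @^-1` C).
Proof. by move=> mf mC; rewrite -[_ @^-1` _]setTI; exact: mf. Qed.

End generated.

Lemma Rintegral_split {R : realType} (f : R -> R) (a s b : R) : a <= s <= b ->
  continuous (f : R -> R^o) ->
  \int[@lebesgue_measure R]_(x in `[a, b]) f x =
  \int[@lebesgue_measure R]_(x in `[a, s]) f x + \int[@lebesgue_measure R]_(x in `[s, b]) f x.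
Proof.
move=> /andP[as_ sb] cf.
have i (u v : R) : (@lebesgue_measure R).-integrable `[u, v] (EFin \o f).
  by apply: continuous_compact_integrable; [exact: segment_compact|exact: continuous_subspaceT].
rewrite -[X in _ = _ + X]Rintegral_itv_obnd_cbnd; last first.
  apply: (integrableS _ _ _ (i s b)) => //; try exact: measurable_itv.
  by apply: subset_itv => //; rewrite bnd_simp.
by rewrite -(Rintegral_itvB (i a b)) ?bnd_simp// addrC subrK.
Qed.

Lemma Rintegral_FTC2 {R : realType} (F g : R -> R) (a b : R) : a <= b ->
  continuous (g : R -> R^o) ->
  (forall x : R, a <= x <= b -> is_derive x 1 (F : R -> R^o) (g x)) ->
  \int[@lebesgue_measure R]_(x in `[a, b]) (g x) = F b - F a.
Proof. by move=> ab cg dF; rewrite /Rintegral (FTC2_itv ab cg dF). Qed.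

Lemma is_derive_rev {R : realType} (f : R -> R) (df T0 t : R) :
  is_derive (T0 - t) 1 (f : R -> R^o) df ->
  is_derive t 1 (fun s : R => f (T0 - s) : R^o) (- df).
Proof.
move=> h.
have h2 : is_derive t 1 (fun s : R => T0 - s : R^o) (-1).
  apply: is_derive_eq (is_deriveB (is_derive_cst T0 t 1) (is_derive_id t 1)) _.
  by rewrite sub0r.
apply: is_derive_eq (@is_derive1_comp _ f (fun s => T0 - s) t _ _ h h2) _.
by rewrite mulrN1.
Qed.

Section min_kernel.
Context {R : realType} (T0 : R) (k C Q w : R -> R).
Notation leb := (@lebesgue_measure R).
Hypothesis T0_ge0 : 0 <= T0.
Hypothesis ck : continuous (k : R -> R^o).
Hypothesis dC : forall t : R, is_derive t 1 (C : R -> R^o) (k t).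
Hypothesis dQ : forall t : R, is_derive t 1 (Q : R -> R^o) (C t).
Hypothesis dw : forall t : R, is_derive t 1 (w : R -> R^o) (C t ^+ 2).
Hypothesis C0 : C 0 = 0.
Hypothesis w0 : w 0 = 0.

Let crev (f : R -> R) : continuous (f : R -> R^o) -> continuous (fun s : R => f (T0 - s) : R^o).
Proof.
move=> cf x; apply: (@cvg_comp _ _ _ (fun s : R => T0 - s : R^o) f); last exact: cf.
by apply: cvgB; [exact: cvg_cst|exact: cvg_id].
Qed.

(** Split at r = s, where the minimum changes branch; in both pieces C is a primitive of k, and the
    boundary terms s C(T0 - s) cancel. *)
Lemma min_kernel_inner s : 0 <= s <= T0 ->
  \int[leb]_(r in `[0, T0]) (k (T0 - r) * Num.min s r) = Q T0 - Q (T0 - s).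
Proof.
move=> sT; have /andP[s0 sT0] := sT.
rewrite (Rintegral_split sT); last first.
  move=> x; apply: cvgM; first exact: (crev ck).
  by apply: (@continuous_min R _ (cst s) (fun r : R => r : R^o)); [exact: cvg_cst|exact: cvg_id].
rewrite (_ : Rintegral _ _ _ = \int[leb]_(r in `[0, s]) (k (T0 - r) * r)); last first.
  by apply: eq_Rintegral => r; rewrite inE/= in_itv/= => /andP[_ rs]; rewrite min_r.
rewrite (_ : \int[leb]_(r in `[s, T0]) _ = \int[leb]_(r in `[s, T0]) (k (T0 - r) * s)); last first.
  by apply: eq_Rintegral => r; rewrite inE/= in_itv/= => /andP[rs _]; rewrite min_l.
have drC (x : R) := is_derive_rev (dC (T0 - x)).
have drQ (x : R) := is_derive_rev (dQ (T0 - x)).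
pose F1 r := - (C (T0 - r) * r + Q (T0 - r)).
have -> : \int[leb]_(r in `[0, s]) (k (T0 - r) * r) = F1 s - F1 0.
  apply: Rintegral_FTC2 => //; first by move=> x; apply: cvgM; [exact: (crev ck)|exact: cvg_id].
  move=> x _; apply: is_derive_eq (is_deriveN (is_deriveD (is_deriveMR (drC x) (is_derive_id x 1)) (drQ x))) _.
  ring.
pose F2 r := (- s) * C (T0 - r).
have -> : \int[leb]_(r in `[s, T0]) (k (T0 - r) * s) = F2 T0 - F2 s.
  apply: Rintegral_FTC2 => //; first by move=> x; apply: cvgM; [exact: (crev ck)|exact: cvg_cst].
  by move=> x _; apply: is_derive_eq (is_deriveZR (- s) (drC x)) _; ring.
by rewrite /F1 /F2 subrr C0 subr0; ring.
Qed.

(** Integration by parts in s leaves C(T0 - s)^2, whose primitive is given by w. Together with the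
    inner integral this evaluates the variance of int k(T0 - s) B_s ds, since min(s, r) is the
    covariance of B. *)
Lemma min_kernel_outer :
  \int[leb]_(s in `[0, T0]) (k (T0 - s) * (Q T0 - Q (T0 - s))) = w T0.
Proof.
pose F s := - (C (T0 - s) * (Q T0 - Q (T0 - s)) + w (T0 - s)).
rewrite [LHS](_ : _ = F T0 - F 0); first by rewrite /F !subrr C0 w0 subr0 subrr; ring.
apply: Rintegral_FTC2 => //.
- move=> x; apply: cvgM; first exact: (crev ck).
  by apply: cvgB; [exact: cvg_cst|exact: (crev (is_derive_cont dQ))].
- move=> x _.
  have drQ := is_deriveB (is_derive_cst (Q T0) x 1) (is_derive_rev (dQ (T0 - x))).
  apply: is_derive_eq (is_deriveN (is_deriveD (is_deriveMR (is_derive_rev (dC (T0 - x))) drQ) (is_derive_rev (dw (T0 - x))))) _.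
  by rewrite (_ : (cst (Q T0) - _) x = Q T0 - Q (T0 - x))//; ring.
Qed.

End min_kernel.

Lemma measurable_Rintegral_param {R : realType} d1 d2 (T1 : measurableType d1)
  (T2 : measurableType d2) (nu : {sigma_finite_measure set T2 -> \bar R}) (f : T1 * T2 -> R) :
  measurable_fun setT f -> measurable_fun setT (fun w => \int[nu]_s f (w, s)).
Proof.
move=> mf; have mfE : measurable_fun setT (EFin \o f) by exact/measurable_EFinP.
apply: measurableT_comp => //.
rewrite (_ : (fun _ => _) = (fun w => (\int[nu]_s ((EFin \o f)^\+ (w, s)) - \int[nu]_s ((EFin \o f)^\- (w, s)))%E)).
  apply: emeasurable_funB.
  - apply: (measurable_fun_fubini_tonelli_F (m2 := nu) ((EFin \o f)^\+%E)) => //; exact: measurable_funepos.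
  - apply: (measurable_fun_fubini_tonelli_F (m2 := nu) ((EFin \o f)^\-%E)) => //; exact: measurable_funeneg.
apply/funext => w; rewrite integralE; congr (_ - _)%E; apply: eq_integral => s _; rewrite ?funeposE ?funenegE//.
Qed.

Lemma Rintegral_clip {R : realType} (T0 : R) (f : R -> R) : 0 <= T0 ->
  {within `[0, +oo[, continuous f} ->
  \int[@lebesgue_measure R]_(s in `[0, T0]) f s = \int[leb_itv T0]_s f (clip T0 s).
Proof.
move=> T00 cf; have [_ ->] := leb_itv_cont T0 (continuous_clip T00 cf).
by apply: eq_Rintegral => s; rewrite inE/= in_itv/= => h; rewrite clip_id.
Qed.

Lemma centered_variance {R : realType} d (T : measurableType d) (P : probability T R) (X : T -> R) :
  (\int[P]_w (X w)%:E = 0)%E -> covariance P X X = (\int[P]_w (X w ^+ 2)%:E)%E.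
Proof.
move=> X0; rewrite covariance.unlock expectation.unlock; apply: eq_integral => w _.
rewrite X0 -[LHS]/(((X w - 0) * (X w - 0))%:E).
by rewrite subr0 -expr2.
Qed.

(** * The integrated Ornstein-Uhlenbeck path *)

Section variance.
Context {R : realType} {dsp : measure_display} {T : measurableType dsp} (P : probability T R).
Context {K : nat} (alpha : 'I_K.+1 -> R).
Hypothesis alpha_gt0 : forall k, 0 < alpha k.
Variable g0 : R.
Hypothesis g0_gt0 : 0 < g0.
Notation A := (drift alpha).
Notation Sigma := (OU_cov A g0).
Notation e := (@e_last R K).
Notation leb := (@lebesgue_measure R).
Variables (B : R -> T -> R) (Y : R -> T -> 'cV[R]_K.+1).
Hypothesis OUY : stationary_OU P A g0 B Y.
Variable T0 : R.
Hypothesis T0_ge0 : 0 <= T0.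

Let cl s := clip T0 s.
Let cl0 s : 0 <= cl s. Proof. exact: clip_ge0. Qed.
Let clT s : cl s <= T0. Proof. exact: clip_le. Qed.
Let uA : A \in unitmx. Proof. exact: drift_unit. Qed.

Let mB t : 0 <= t -> measurable_fun setT (B t).
Proof. by case: OUY => [[[h _] _ _ _] _ _ _ _]; exact: h. Qed.

Let B0 : {ae P, forall w, B 0 w = 0}.
Proof. by case: OUY => [[[_ h] _ _ _] _ _ _ _]. Qed.

Let cB w : {within `[0, +oo[, continuous (fun t => B t w)}.
Proof. by case: OUY => [[_ h _ _] _ _ _ _]. Qed.

Let mY t k : 0 <= t -> measurable_fun setT (fun w => Y t w k 0).
Proof. by case: OUY => [_ [h _] _ _ _]; exact: h. Qed.

Let cY w k : {within `[0, +oo[, continuous (fun t => Y t w k 0)}.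
Proof. by case: OUY => [_ [_ h] _ _ _]. Qed.

(* [B 0] vanishes only almost surely. *)
Definition BM0 s w := B s w - B 0 w.

Let mBM s : 0 <= s -> measurable_fun setT (BM0 s).
Proof. by move=> s0; apply: measurable_funB; exact: mB. Qed.

Let cBM w : {within `[0, +oo[, continuous (BM0 ^~ w)}.
Proof. by move=> x; apply: cvgB; [exact: cB|exact: cvg_cst]. Qed.

Let inc_moments s t : 0 <= s -> 0 <= t ->
  P.-integrable setT (EFin \o (fun w => BM0 t w - BM0 s w)) /\
  P.-integrable setT (EFin \o (fun w => (BM0 t w - BM0 s w) ^+ 2)) /\
  \int[P]_w (BM0 t w - BM0 s w) = 0 /\
  \int[P]_w ((BM0 t w - BM0 s w) ^+ 2) = `|t - s|.
Proof.
wlog st : s t / s <= t.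
  move=> h s0 t0; have [/h|/ltW /h] := leP s t; first exact.
  move=> /(_ t0 s0)[i1 [i2 [e1 e2]]].
  have e w : BM0 t w - BM0 s w = - (BM0 s w - BM0 t w) by ring.
  rewrite (_ : (fun w => BM0 t w - _) = (fun w => -1 * (BM0 s w - BM0 t w))); last first.
    by apply/funext => w; rewrite e mulN1r.
  rewrite (_ : (fun w => (BM0 t w - _) ^+ 2) = (fun w => (BM0 s w - BM0 t w) ^+ 2)); last first.
    by apply/funext => w; rewrite e sqrrN.
  split; first exact: integrableZR.
  split=> //; split; last by rewrite e2 distrC.
  by rewrite RintegralZl// e1 mulr0.
(* Increments have a normal law only for s < t; the zero increment is treated by hand. *)
move=> s0 t0; have [<-|ne] := eqVneq s t.
  have -> : (fun w => BM0 s w - BM0 s w) = cst 0 by apply/funext => w; rewrite subrr.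
  have -> : (fun w => (BM0 s w - BM0 s w) ^+ 2) = cst 0 by apply/funext => w; rewrite subrr expr0n.
  have i : P.-integrable setT (EFin \o cst (0 : R)) by exact: finite_measure_integrable_cst.
  by rewrite subrr normr0 Rintegral_cst// mul0r; split.
have {}st : s < t by rewrite lt_neqAle ne.
have rt : 0 < Num.sqrt (t - s) by rewrite sqrtr_gt0 subr_gt0.
have e w : BM0 t w - BM0 s w = B t w - B s w by rewrite /BM0; ring.
have [_ _ h _] : brownian_motion P B by case: OUY.
have [|i1 i2 e1 e2] := normal_law_moments rt _ (h s t s0 st).
  by apply: measurable_funB; exact: mB.
rewrite (_ : (fun w => BM0 t w - _) = (fun w => B t w - B s w)); last by apply/funext.
rewrite (_ : (fun w => (BM0 t w - _) ^+ 2) = (fun w => (B t w - B s w) ^+ 2)); last by apply/funext => w; rewrite e.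
split=> //; split=> //; split=> //.
by rewrite e2 sqr_sqrtr ?subr_ge0 ?ltW// ger0_norm// subr_ge0 ltW.
Qed.

Let BM_0 w : BM0 0 w = 0. Proof. by rewrite /BM0 subrr. Qed.

Let BM_moments t : 0 <= t ->
  P.-integrable setT (EFin \o BM0 t) /\
  P.-integrable setT (EFin \o (fun w => BM0 t w ^+ 2)) /\
  \int[P]_w BM0 t w = 0 /\ \int[P]_w (BM0 t w ^+ 2) = t.
Proof.
move=> t0; have := inc_moments (lexx 0) t0.
rewrite subr0 ger0_norm//.
rewrite (_ : (fun w => BM0 t w - _) = BM0 t); last by apply/funext => w; rewrite BM_0 subr0.
by rewrite (_ : (fun w => (BM0 t w - _) ^+ 2) = (fun w => BM0 t w ^+ 2)); last by apply/funext => w; rewrite BM_0 subr0.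
Qed.

(** Polarisation: 2 B_s B_t = B_s^2 + B_t^2 - (B_t - B_s)^2, with the known second moments. *)
Let BM_cov s t : 0 <= s -> 0 <= t -> \int[P]_w (BM0 s w * BM0 t w) = Num.min s t.
Proof.
move=> s0 t0.
have [_ [is_ [_ es]]] := BM_moments s0.
have [_ [it [_ et]]] := BM_moments t0.
have [_ [id [_ ed]]] := inc_moments s0 t0.
rewrite (_ : (fun w => _) = (fun w => 2^-1 * ((BM0 s w ^+ 2 + BM0 t w ^+ 2) - (BM0 t w - BM0 s w) ^+ 2))); last first.
  by apply/funext => w; field.
have i1 := integrableDR measurableT is_ it.
rewrite RintegralZl//; last exact: (integrableBR measurableT i1 id).
rewrite RintegralB// RintegralD// es et ed.
have [st|/ltW st] := leP s t.
  by rewrite ger0_norm ?subr_ge0//; field.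
by rewrite ler0_norm ?subr_le0//; field.
Qed.

Let L := OU_L alpha T0.
Definition OU_init w := (L *m Y 0 w) 0 0.

Let initE w : OU_init w = \sum_k L 0 k * Y 0 w k 0.
Proof. by rewrite /OU_init mxE. Qed.

Let m_init : measurable_fun setT OU_init.
Proof.
rewrite (_ : OU_init = fun w => \sum_k L 0 k * Y 0 w k 0); last exact/funext.
by apply: measurable_sum => k; apply: measurable_funM => //; exact: mY.
Qed.

Let init_moments : P.-integrable setT (EFin \o OU_init) /\
  P.-integrable setT (EFin \o (fun w => OU_init w ^+ 2)) /\
  \int[P]_w OU_init w = 0 /\ \int[P]_w (OU_init w ^+ 2) = (L *m Sigma *m L^T) 0 0.
Proof.
(* Projections of Y_0 are assumed normal for nonzero vectors only; for L = 0 the initial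
   contribution is the constant 0. *)
have [L0|L0] := eqVneq L 0.
  have -> : OU_init = cst 0 by apply/funext => w; rewrite /OU_init L0 mul0mx mxE.
  have -> : (fun w => cst 0 w ^+ 2) = cst (0 : R) :> (T -> R) by apply/funext => w; rewrite /= expr0n.
  have i : P.-integrable setT (EFin \o cst (0 : R)) by exact: finite_measure_integrable_cst.
  by rewrite L0 !mul0mx mxE Rintegral_cst// mul0r; split.
have LT0 : L^T != 0 by rewrite trmx_eq0.
have [_ _ h _ _] := OUY; have := h _ LT0; rewrite trmxK => hn.
have sp : 0 < (L *m Sigma *m L^T) 0 0.
  by have [_ /(_ _ LT0)] := OU_spd alpha_gt0 g0_gt0; rewrite /quad trmxK.
have rt : 0 < Num.sqrt ((L *m Sigma *m L^T) 0 0) by rewrite sqrtr_gt0.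
have [i1 i2 e1 e2] := normal_law_moments rt m_init hn.
by split=> //; split=> //; split=> //; rewrite e2 sqr_sqrtr// ltW.
Qed.

(** The factors are measurable for the two independent sigma-algebras; B_0 belongs to the second one
    as well, so [BM0] does. *)
Let init_indep s : 0 <= s -> \int[P]_w (OU_init w * BM0 s w) = 0.
Proof.
move=> s0.
have [i1 [_ [e1 _]]] := init_moments.
have [i2 [_ [e2 _]]] := BM_moments s0.
have [|_ ->] := indep_mean m_init (mBM s0) i1 i2; last by rewrite e1 mul0r.
move=> C D mC mD; have [_ _ _ ind _] := OUY; apply: ind.
- apply: sigma_of_fun => //.
  rewrite (_ : OU_init = fun w => \sum_k L 0 k * Y 0 w k 0); last exact/funext.
  apply: measurable_sum => k; apply: measurable_funM => //.
  exact: (@sigma_of_coord _ _ _ _ setT (fun k w => Y 0 w k 0) k).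
- apply: sigma_of_fun => //; apply: measurable_funB; apply: (@sigma_of_coord _ _ _ _ `[0, +oo[%classic B);
    by rewrite /= in_itv/= ?lexx ?s0.
Qed.

(* By variation of constants, the integral of Y^1 over [0, T0] is [OU_init]
   plus [g0] times the integral of [OU_k (T0 - s) * BM0 s]. *)
Definition OU_k t := (e_first *m OU_u alpha t) 0 0 : R.

Let ck : continuous (OU_k : R -> R^o).
Proof. exact: is_derive_cont (fun t => mderMl _ (mder_u alpha t) 0 0). Qed.

Let Q t := (e_first *m invmx A *m (OUint alpha t - t%:M) *m e) 0 0 : R.

Let dQ (t : R) : is_derive t 1 (Q : R -> R^o) (OU_CK alpha t).
Proof.
apply: is_derive_eq (mderMr e (mderMl (e_first *m invmx A) (mderB (mder_int alpha_gt0 t) (@mder_scalar R _ t))) 0 0) _.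
by rewrite /OU_CK /OU_L !mulmxA.
Qed.

Let b (p : T * measurableTypeR R) : R := OU_k (T0 - cl p.2) * BM0 (cl p.2) p.1.

Let ckcl : continuous (fun s : R => OU_k (T0 - cl s) : R^o).
Proof.
move=> x; apply: (@cvg_comp _ _ _ (fun s : R => T0 - cl s : R^o) OU_k); last exact: ck.
by apply: cvgB; [exact: cvg_cst|exact: continuous_clip_id].
Qed.

Let cb w : continuous (fun s : R => b (w, s) : R^o).
Proof.
move=> x; apply: cvgM; first exact: ckcl.
exact: (continuous_clip T0_ge0 (@cBM w)).
Qed.

Let mb : measurable_fun setT b.
Proof.
have h := @measurable_fun_carath R _ T (fun s w => b (w, s)) cb.
have m s : measurable_fun setT (fun w => OU_k (T0 - cl s) * BM0 (cl s) w).
  by apply: measurable_funM => //; exact: mBM.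
exact: (h m).
Qed.

Let b2w w : (leb_itv T0).-integrable setT (EFin \o (fun s => b (w, s) ^+ 2)).
Proof.
have [|i _] := @leb_itv_cont R T0 (fun s => b (w, s) ^+ 2); last exact: i.
by move=> x; apply: (@cvg_comp _ _ _ (fun s : R => b (w, s) : R^o) (fun x : R => x ^+ 2)); [exact: cb|exact: exprn_continuous].
Qed.

Let b2s s : P.-integrable setT (EFin \o (fun w => b (w, s) ^+ 2)).
Proof.
rewrite (_ : (fun w => _) = (fun w => OU_k (T0 - cl s) ^+ 2 * BM0 (cl s) w ^+ 2)); last first.
  by apply/funext => w; rewrite /b exprMn.
by apply: integrableZR => //; have [_ []] := BM_moments (cl0 s).
Qed.

Let b2C : exists C, forall s, \int[P]_w (b (w, s) ^+ 2) <= C.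
Proof.
have [C hC] := mbnd11 (mbndM (mbnd_cst (e_first)) (mbnd_u alpha_gt0)).
exists (C ^+ 2 * T0) => s.
rewrite (_ : (fun w => _) = (fun w => OU_k (T0 - cl s) ^+ 2 * BM0 (cl s) w ^+ 2)); last first.
  by apply/funext => w; rewrite /b exprMn.
have [_ [i [_ E]]] := BM_moments (cl0 s).
rewrite RintegralZl// E; apply: ler_pM => //; first exact: sqr_ge0.
have h := hC (T0 - cl s); rewrite -[leLHS](real_normK (num_real _)).
by rewrite lerXn2r ?nnegrE// ?(le_trans _ (h _))// ?h// subr_ge0.
Qed.

Let Z w := \int[leb_itv T0]_s b (w, s).

(** The covariance of the integrand is k(T0 - s) k(T0 - r) min(s, r), so the [min_kernel] lemmas
    apply with w = v / g0^2, whose derivative is C_K^2. *)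
Let Z_second : \int[P]_w (Z w ^+ 2) = OU_v alpha g0 T0 / g0 ^+ 2.
Proof.
have [C hC] := b2C.
rewrite (proc_second (leb_itv_fin T0) mb b2w b2s hC).
have cov s r : \int[P]_w (b (w, s) * b (w, r)) =
    OU_k (T0 - cl s) * (OU_k (T0 - cl r) * Num.min (cl s) (cl r)).
  rewrite (_ : (fun w => _) = (fun w => (OU_k (T0 - cl s) * OU_k (T0 - cl r)) * (BM0 (cl s) w * BM0 (cl r) w))); last first.
    by apply/funext => w; rewrite /b/=; ring.
  rewrite RintegralZl// ?BM_cov// ?mulrA//.
  have [_ [is_ _]] := BM_moments (cl0 s).
  have [_ [ir _]] := BM_moments (cl0 r).
  apply: (le_integrable measurableT (g := EFin \o (fun w => BM0 (cl s) w ^+ 2 + BM0 (cl r) w ^+ 2))).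
  - by apply/measurable_EFinP; apply: measurable_funM; exact: mBM.
  - move=> w _; rewrite /= lee_fin [leRHS]ger0_norm ?addr_ge0 ?sqr_ge0// normrM.
    rewrite -(real_normK (num_real (BM0 (cl s) w))) -(real_normK (num_real (BM0 (cl r) w))).
    have := normr_ge0 (BM0 (cl s) w); have := normr_ge0 (BM0 (cl r) w).
    move: `|BM0 (cl s) w| `|BM0 (cl r) w| => x y x0 y0; nra.
  - exact: integrableDR.
have cmin s : continuous (fun r : R => OU_k (T0 - cl r) * Num.min (cl s) (cl r) : R^o).
  move=> x; apply: cvgM; first exact: ckcl.
  by apply: (@continuous_min R _ (cst (cl s)) (fun r : R => cl r : R^o)); [exact: cvg_cst|exact: continuous_clip_id].
under eq_Rintegral => s _ do under eq_Rintegral => r _ do rewrite cov.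
have inner s : \int[leb_itv T0]_r (OU_k (T0 - cl s) * (OU_k (T0 - cl r) * Num.min (cl s) (cl r))) =
   OU_k (T0 - cl s) * (Q T0 - Q (T0 - cl s)).
  have [i E] := leb_itv_cont T0 (cmin s).
  rewrite RintegralZl// E; congr (_ * _).
  have cs : 0 <= cl s <= T0 by rewrite cl0 clT.
  rewrite -(min_kernel_inner ck (is_derive_CK alpha_gt0) dQ _ cs); last first.
    by rewrite /OU_CK; have [_ [_ ->]] := mder0_eq0 alpha g0; rewrite mul0mx mxE.
  by apply: eq_Rintegral => r; rewrite inE/= in_itv/= => h; rewrite /cl (clip_id h).
under eq_Rintegral => s _ do rewrite inner.
have cQ : continuous (fun s : R => OU_k (T0 - cl s) * (Q T0 - Q (T0 - cl s)) : R^o).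
  move=> x; apply: cvgM; first exact: ckcl.
  apply: cvgB; first exact: cvg_cst.
  apply: (@cvg_comp _ _ _ (fun s : R => T0 - cl s : R^o) Q); last exact: (is_derive_cont dQ).
  by apply: cvgB; [exact: cvg_cst|exact: continuous_clip_id].
have [_ ->] := leb_itv_cont T0 cQ.
have CK0 : OU_CK alpha 0 = 0 by rewrite /OU_CK; have [_ [_ ->]] := mder0_eq0 alpha g0; rewrite mul0mx mxE.
have dw (t : R) : is_derive t 1 (fun t => OU_v alpha g0 t / g0 ^+ 2 : R^o) (OU_CK alpha t ^+ 2).
  rewrite (_ : (fun t => _) = (fun t => (g0 ^+ 2)^-1 * OU_v alpha g0 t)); last by apply/funext => x; rewrite mulrC.
  apply: is_derive_eq (is_deriveZR _ (is_derive_v alpha_gt0 g0 t)) _.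
  by rewrite mulrA mulVf ?mul1r// sqrf_eq0 gt_eqF.
have w0 : OU_v alpha g0 0 / g0 ^+ 2 = 0 by rewrite OU_v0 mul0r.
have <- := min_kernel_outer T0_ge0 ck (is_derive_CK alpha_gt0) dQ dw CK0 w0.
by apply: eq_Rintegral => s; rewrite inE/= in_itv/= => h; rewrite /cl (clip_id h).
Qed.

Let mder_rev m n (F : R -> 'M[R]_(m, n)) F' t : mder F (T0 - t) F' ->
  mder (fun s => F (T0 - s)) t (- F').
Proof. by move=> h i j; rewrite mxE; exact: is_derive_rev (h i j). Qed.

(** Integrated once, the equation is the linear ODE X' = Y_0 + A X + g0 B e for X = int Y, with a
    continuous forcing term. It is solved path by path with ordinary calculus. *)
Lemma OU_pathwise w : B 0 w = 0 ->
  (forall t k, 0 <= t -> Y t w k 0 = Y 0 w k 0 + \int[leb]_(s in `[0, t]) (A *m Y s w) k 0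
     + g0 * e_last k 0 * B t w) ->
  \int[leb]_(s in `[0, T0]) Y s w ord0 0 = OU_init w + g0 * Z w.
Proof.
move=> B0w eqY.
pose y k s := Y (cl s) w k 0.
have cy k : continuous (y k : R -> R^o) by exact: (continuous_clip T0_ge0 (@cY w k)).
(* The base point -1 makes 0 an interior point, so that F has a two-sided derivative on all of
   [0, T0]. *)
pose F k x := \int[leb]_(s in `[-1, x]) y k s.
have dF k (s : R) : 0 <= s <= T0 -> is_derive s 1 (F k : R -> R^o) (y k s).
  move=> /andP[s0 sT].
  have i : leb.-integrable `[-1, T0 + 1] (EFin \o y k).
    by apply: continuous_compact_integrable; [exact: segment_compact|exact: continuous_subspaceT].
  have [||d e1] := @continuous_FTC1_closed R (y k) (-1) s (T0 + 1) _ i _ (@cy k s); [lra|lra|].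
  by rewrite -e1 derive1E; apply: DeriveDef => //; exact: derivable1_diffP.
pose X s : 'cV[R]_K.+1 := \col_k (F k s - F k 0).
pose yc s : 'cV[R]_K.+1 := \col_k y k s.
have mX (s : R) : 0 <= s <= T0 -> mder X s (yc s).
  move=> hs k j; rewrite mxE (_ : (fun s => _) = (fun s => F k s - F k 0)); last first.
    by apply/funext => r; rewrite mxE.
  by apply: is_derive_eq (is_deriveB (dF k s hs) (is_derive_cst (F k 0) s 1)) _; rewrite subr0.
have X0 : X 0 = 0 by apply/matrixP => i j; rewrite !mxE subrr.
have Yyc s : 0 <= s <= T0 -> yc s = Y s w.
  by move=> hs; apply/matrixP => i j; rewrite mxE /y /cl (clip_id hs) ord1.
have cAy k : continuous (fun s : R => (A *m yc s) k 0 : R^o).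
  move=> x; rewrite (_ : (fun s => _) = (fun s => \sum_j A k j * y j s)); last first.
    by apply/funext => s; rewrite mxE; apply: eq_bigr => j _; rewrite [yc s j 0]mxE.
  by apply: cvg_sumR => j; apply: cvgM; [exact: cvg_cst|exact: cy].
have eqy s : 0 <= s <= T0 -> yc s = Y 0 w + A *m X s + (g0 * B s w) *: e.
  move=> hs; apply/matrixP => k j; rewrite ord1 Yyc// eqY; last by case/andP: hs.
  rewrite !mxaddE mxscaleE; congr (_ + _ + _); last by rewrite mulrAC.
  have -> : \int[leb]_(r in `[0, s]) (A *m Y r w) k 0 = \int[leb]_(r in `[0, s]) (A *m yc r) k 0.
    apply: eq_Rintegral => r; rewrite inE/= in_itv/= => /andP[r0 rs].
    by rewrite Yyc// r0 (le_trans rs)//; case/andP: hs.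
  rewrite [LHS](_ : _ = (A *m X s) k 0 - (A *m X 0) k 0); last apply: (@Rintegral_FTC2 _ (fun s => (A *m X s) k 0)) => //.
  - by rewrite X0 mulmx0 [in X in _ - X]mxE subr0.
  - by case/andP: hs.
  - move=> r /andP[r0 rs]; apply: mderMl; apply: mX.
    by rewrite r0 (le_trans rs)//; case/andP: hs.
(* In G' the contributions of X and Y_0 cancel and only the noise remains; G(0) is L Y_0 and G(T0)
   is the first component of X(T0). *)
pose G s := (e_first *m OUexp alpha (T0 - s) *m X s + OU_L alpha (T0 - s) *m Y 0 w) 0 0.
have dG (s : R) : 0 <= s <= T0 -> is_derive s 1 (G : R -> R^o) (g0 * b (w, s)).
  move=> hs.
  have h1 := mderM (mderMl e_first (mder_rev (mder_exp alpha (T0 - s)))) (mX s hs).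
  have h2 := mderMr (Y 0 w) (mder_rev (mder_L alpha_gt0 (T0 - s))).
  apply: is_derive_eq (mderD h1 h2 0 0) _.
  rewrite eqy//.
  have -> : e_first + OU_L alpha (T0 - s) *m A = e_first *m OUexp alpha (T0 - s).
    by rewrite /OU_L -mulmxA OUintA// mulmxBr mulmx1 addrC subrK.
  rewrite mulmxDr mulmxDr mulmxN !mulNmx -/(OUexp _ _).
  rewrite (mexp_comm A (T0 - s)) !mulmxA -!addrA.
  set a := (_ *m _ *m X s); set c := (_ *m Y 0 w); set f := (_ *m (_ *: _)).
  rewrite (_ : - a + (c + (a + (f - c))) = f); last by rewrite addrCA addKr addrC subrK.
  rewrite /f -scalemxAr mxscaleE /b /OU_k /OU_u /= /cl (clip_id hs) /BM0 B0w subr0 mulmxA.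
  by ring.
have E1 : \int[leb]_(s in `[0, T0]) (g0 * b (w, s)) = G T0 - G 0.
  apply: Rintegral_FTC2 => //.
  by move=> x; apply: cvgM; [exact: cvg_cst|exact: cb].
have E2 : \int[leb]_(s in `[0, T0]) Y s w ord0 0 = X T0 ord0 0.
  rewrite mxE; have <- : \int[leb]_(s in `[0, T0]) y ord0 s = F ord0 T0 - F ord0 0.
    by apply: Rintegral_FTC2 => //; exact: dF.
  by apply: eq_Rintegral => s; rewrite inE/= in_itv/= => hs; rewrite /y /cl (clip_id hs).
have [_ E3] := leb_itv_cont T0 (@cb w).
have E4 : g0 * Z w = G T0 - G 0.
  rewrite -E1 RintegralZl//; first by rewrite /Z E3.
  by apply: continuous_compact_integrable; [exact: segment_compact|exact: continuous_subspaceT].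
have GT : G T0 = X T0 ord0 0.
  have [_ [_ L0]] := mder0_eq0 alpha g0.
  by rewrite /G subrr OUexp0 mulmx1 L0 mul0mx addr0 /e_first -rowE mxE.
have G0 : G 0 = OU_init w by rewrite /G subr0 X0 mulmx0 add0r.
by rewrite E2 E4 GT G0 [RHS]addrC subrK.
Qed.

Let X1 w := \int[leb]_(s in `[0, T0]) Y s w ord0 0.
Let X2 w := OU_init w + g0 * Z w.

Let mZ : measurable_fun setT Z.
Proof. exact: measurable_Rintegral_param mb. Qed.

Let mX1 : measurable_fun setT X1.
Proof.
rewrite (_ : X1 = fun w => \int[leb_itv T0]_s (Y (cl s) w ord0 0)); last first.
  by apply/funext => w; exact: Rintegral_clip.
apply: (@measurable_Rintegral_param R _ _ T _ (leb_itv T0) (fun p => Y (cl p.2) p.1 ord0 0)).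
have cc w : continuous (fun s : R => Y (cl s) w ord0 0 : R^o).
  exact: (continuous_clip T0_ge0 (@cY w ord0)).
have h := @measurable_fun_carath R _ T (fun s w => Y (cl s) w ord0 0) cc.
have m s : measurable_fun setT (fun w => Y (cl s) w ord0 0) by exact: mY.
exact: (h m).
Qed.

Let mX2 : measurable_fun setT X2.
Proof. by apply: measurable_funD => //; exact: measurable_funM. Qed.

Let X12 : ae_eq P setT X1 X2.
Proof.
have [_ _ _ _ h] := OUY.
by apply: filterS2 B0 h => w h1 h2 _; exact: OU_pathwise.
Qed.

Let Rint_ae (f g : T -> R) : measurable_fun setT f -> measurable_fun setT g ->
  ae_eq P setT f g -> (\int[P]_w (f w)%:E = \int[P]_w (g w)%:E)%E.
Proof.
move=> mf mg fg; apply: ae_eq_integral => //; [exact/measurable_EFinP|exact/measurable_EFinP|].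
by apply: filterS fg => w h /h /= ->.
Qed.

Let Z2i : P.-integrable setT (EFin \o (fun w => Z w ^+ 2)).
Proof. by have [C hC] := b2C; exact: (proc_sq_integrable (leb_itv_fin T0) mb b2w b2s hC). Qed.

Let sq_int1 (f : T -> R) : measurable_fun setT f -> P.-integrable setT (EFin \o (fun w => f w ^+ 2)) ->
  P.-integrable setT (EFin \o f).
Proof.
move=> mf i; have i1 : P.-integrable setT (EFin \o cst (1 : R)) by exact: finite_measure_integrable_cst.
apply: (le_integrable measurableT (g := EFin \o (fun w => f w ^+ 2 + 1))).
- exact/measurable_EFinP.
- move=> w _; rewrite /= lee_fin [leRHS]ger0_norm ?addr_ge0 ?sqr_ge0//.
  rewrite -(real_normK (num_real (f w))); have := normr_ge0 (f w); move: `|f w| => x x0; nra.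
- exact: integrableDR.
Qed.

Let Z_mean : \int[P]_w Z w = 0.
Proof.
have [C hC] := b2C.
rewrite (proc_mean (leb_itv_fin T0) mb b2w b2s hC).
rewrite (_ : Rintegral _ _ _ = \int[leb_itv T0]_s cst 0 s); last first.
  apply: eq_Rintegral => s _; rewrite /b/=; have [i [_ [e1 _]]] := BM_moments (cl0 s).
  by rewrite RintegralZl// e1 mulr0.
by rewrite Rintegral_cst// mul0r.
Qed.

Let initZ : P.-integrable setT (EFin \o (fun w => OU_init w * Z w)) /\
  \int[P]_w (OU_init w * Z w) = 0.
Proof.
have [_ [i2 _]] := init_moments.
split.
  apply: (le_integrable measurableT (g := EFin \o (fun w => OU_init w ^+ 2 + Z w ^+ 2))).
  - by apply/measurable_EFinP; exact: measurable_funM.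
  - move=> w _; rewrite /= lee_fin [leRHS]ger0_norm ?addr_ge0 ?sqr_ge0// normrM.
    rewrite -(real_normK (num_real (OU_init w))) -(real_normK (num_real (Z w))).
    have := normr_ge0 (OU_init w); have := normr_ge0 (Z w).
    move: `|OU_init w| `|Z w| => x y x0 y0; nra.
  - exact: integrableDR.
have [C hC] := b2C.
rewrite (proc_mixed (leb_itv_fin T0) mb b2w b2s hC m_init i2).
rewrite (_ : Rintegral _ _ _ = \int[leb_itv T0]_s cst 0 s); last first.
  apply: eq_Rintegral => s _; rewrite /b/=.
  rewrite (_ : (fun w => _) = (fun w => OU_k (T0 - cl s) * (OU_init w * BM0 (cl s) w))); last first.
    by apply/funext => w; ring.
  rewrite RintegralZl ?init_indep ?mulr0//.
  have [i1 [_ [e1 _]]] := init_moments; have [i3 [i4 _]] := BM_moments (cl0 s).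
  apply: (le_integrable measurableT (g := EFin \o (fun w => OU_init w ^+ 2 + BM0 (cl s) w ^+ 2))).
  - by apply/measurable_EFinP; apply: measurable_funM => //; exact: mBM.
  - move=> w _; rewrite /= lee_fin [leRHS]ger0_norm ?addr_ge0 ?sqr_ge0// normrM.
    rewrite -(real_normK (num_real (OU_init w))) -(real_normK (num_real (BM0 (cl s) w))).
    have := normr_ge0 (OU_init w); have := normr_ge0 (BM0 (cl s) w).
    move: `|OU_init w| `|BM0 (cl s) w| => x y x0 y0; nra.
  - exact: integrableDR.
by rewrite Rintegral_cst// mul0r.
Qed.

(** The initial part and the noise part are uncorrelated: they contribute L Sigma L^T and v, which
    add up to V. All integrals are taken of the representation that holds almost surely. *)
Lemma V_firstE : V_first P Y T0 = OU_V alpha g0 T0.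
Proof.
have [i1 [i2 [e1 e2]]] := init_moments.
have Zi := sq_int1 mZ Z2i.
have [iZ eZ] := initZ.
have m : (\int[P]_w (X1 w)%:E = 0)%E.
  rewrite (Rint_ae mX1 mX2 X12) -[LHS]fineK.
    rewrite -[fine _]/(\int[P]_w X2 w) RintegralD ?RintegralZl ?e1 ?Z_mean ?mulr0 ?addr0//.
    exact: integrableZR.
  by apply: integrable_fin_num => //; apply: integrableDR => //; exact: integrableZR.
have -> : V_first P Y T0 = \int[P]_w (X2 w ^+ 2).
  have e : V_first P Y T0 = fine (covariance P X1 X1) by [].
  rewrite e (centered_variance m) (@Rint_ae (fun w => X1 w ^+ 2) (fun w => X2 w ^+ 2))//.
  - exact: measurable_funX.
  - exact: measurable_funX.
  - by apply: filterS X12 => w h /h ->.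
rewrite (_ : (fun w => _) = (fun w => (OU_init w ^+ 2 + (2 * g0) * (OU_init w * Z w)) + g0 ^+ 2 * Z w ^+ 2)); last first.
  by apply/funext => w; rewrite /X2; ring.
have i3 := integrableZR measurableT (2 * g0) iZ.
rewrite RintegralD//; [|exact: integrableDR|exact: integrableZR].
rewrite RintegralD// !RintegralZl// e2 eZ Z_second OU_V_decomp mulr0 addr0 addrC; congr (_ + _).
by rewrite mulrC divfK// sqrf_eq0 gt_eqF.
Qed.

End variance.

(** * Directional derivatives and a smooth bump *)

Section directional.
Context {R : realType} {m n : nat}.
Notation M := 'M[R]_(m, n).
Implicit Types (f g : M -> R) (V y : M).

(** A directional derivative is the derivative along a line, so the one-variable rules carry
    over. *)
Lemma is_derive_lineE f V y d :
  is_derive y V (f : M -> R^o) d <-> is_derive (0 : R) 1 (fun r : R => f (r *: V + y) : R^o) d.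
Proof.
have e : (fun h : R => h^-1 *: ((((fun r : R => f (r *: V + y)) : R -> R^o) \o shift (0 : R)) (h *: (1 : R)) - f ((0 : R) *: V + y))) =
   (fun h : R => h^-1 *: (((f : M -> R^o) \o shift y) (h *: V) - f y)).
  by apply/funext => h; congr (_ *: (f _ - f _)); rewrite /= ?scale0r ?add0r// addr0 [h *: 1]mulr1.
split=> -[h1 h2].
  by split; [rewrite /derivable e|rewrite /derive e].
by split; [rewrite /derivable -e|rewrite /derive -e].
Qed.

Lemma is_deriveDV f g y V df dg : is_derive y V (f : M -> R^o) df ->
  is_derive y V (g : M -> R^o) dg -> is_derive y V (fun z => f z + g z : R^o) (df + dg).
Proof. by move=> hf hg; exact: (is_deriveD hf hg). Qed.

Lemma is_deriveMV f g y V df dg : is_derive y V (f : M -> R^o) df ->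
  is_derive y V (g : M -> R^o) dg ->
  is_derive y V (fun z => f z * g z : R^o) (df * g y + f y * dg).
Proof.
move=> hf hg; apply: is_derive_eq (is_deriveM hf hg) _.
by rewrite [X in X + _]/(f y * dg) [X in _ + X]/(g y * df) addrC mulrC.
Qed.

Lemma is_deriveZV f y V c df : is_derive y V (f : M -> R^o) df ->
  is_derive y V (fun z => c * f z : R^o) (c * df).
Proof. by move=> hf; exact: (is_deriveZ c hf). Qed.

Lemma is_derive_compV (g : R -> R) f y V dg df : is_derive (f y) 1 (g : R -> R^o) dg ->
  is_derive y V (f : M -> R^o) df -> is_derive y V (fun z => g (f z) : R^o) (dg * df).
Proof.
move=> hg /is_derive_lineE hf; apply/is_derive_lineE.
have hg' : is_derive ((fun r : R => f (r *: V + y)) 0) 1 (g : R -> R^o) dg.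
  by rewrite scale0r add0r.
by have := @is_derive1_comp _ g (fun r => f (r *: V + y)) 0 _ _ hg' hf; rewrite mulrC.
Qed.

Lemma is_derive_coord i j y V : is_derive y V (fun z : M => z i j : R^o) (V i j).
Proof.
apply/is_derive_lineE; rewrite (_ : (fun r => _) = (fun r => V i j * r + y i j)).
  have h1 := is_derive_linear (V i j) 0.
  have h2 : is_derive (0 : R) 1 (fun=> y i j : R^o) 0 by exact: is_derive_cst.
  by rewrite -[X in is_derive _ _ _ X]addr0; exact: (is_deriveD h1 h2).
by apply/funext => r; rewrite !mxE mulrC.
Qed.

Lemma is_derive_sumV (I : Type) (r : seq I) (h : I -> M -> R) (dh : I -> R) y V :
  (forall i, is_derive y V (h i : M -> R^o) (dh i)) ->
  is_derive y V (fun z => \sum_(i <- r) h i z : R^o) (\sum_(i <- r) dh i).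
Proof.
move=> hh; apply/is_derive_lineE; apply: is_derive_sumR => i.
exact/is_derive_lineE.
Qed.

End directional.

Lemma continuous_compR {R : realType} {T : topologicalType} (g : R -> R) (f : T -> R) :
  continuous (g : R -> R^o) -> continuous (f : T -> R^o) -> continuous ((fun y => g (f y)) : T -> R^o).
Proof. by move=> cg cf x; exact: (@continuous_comp _ _ _ f g x (cf x) (cg (f x))). Qed.

Section expbump.
Context {R : realType}.
Implicit Types (p : {poly R}).

Lemma exprn_le_expR (z : R) k : 0 <= z -> z ^+ k <= k`!%:R * expR z.
Proof.
case: k => [|k] z0; first by rewrite expr0 mul1r -expR0 ler_expR.
have f0 : 0 < k.+1`!%:R :> R by rewrite ltr0n fact_gt0.
rewrite -ler_pdivrMl// mulrC; apply: le_trans (expR_ge1Dxn k z0).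
by rewrite lerDr.
Qed.

Lemma poly_expRN_bounded p : exists2 C, 0 <= C & forall z, 0 <= z -> `|p.[z] * expR (- z)| <= C.
Proof.
exists (\sum_(i < size p) `|p`_i| * i`!%:R); first by apply: sumr_ge0 => i _; rewrite mulr_ge0.
move=> z z0; rewrite horner_coef mulr_suml (le_trans (ler_norm_sum _ _ _))// ler_sum// => i _.
rewrite -mulrA normrM ler_wpM2l// ger0_norm ?mulr_ge0 ?exprn_ge0 ?expR_ge0//.
rewrite -ler_pdivlMr ?expR_gt0// -expRN opprK.
exact: exprn_le_expR.
Qed.

(* The functions p(1/x) e^(-1/x), extended by 0 to x <= 0, are closed under
   differentiation. *)
Definition expbump p (x : R) : R := if 0 < x then p.[x^-1] * expR (- x^-1) else 0.

Definition expbump_deriv p : {poly R} := 'X^2 * (p - p^`()).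

(** The exponential bound applied to X^2 p(X) at 1 / x gives quadratic decay near 0. This forces the
    derivative at 0 to exist and vanish. *)
Let bump_sq p : exists2 C, 0 <= C & forall x, `|expbump p x| <= C * x ^+ 2.
Proof.
have [C C0 h] := poly_expRN_bounded ('X^2 * p); exists C => // x.
rewrite /expbump; case: ifPn => x0; last by rewrite normr0 mulr_ge0// sqr_ge0.
have := h x^-1; rewrite invr_ge0 => /(_ (ltW x0)).
rewrite hornerM hornerXn -mulrA normrM ger0_norm ?exprn_ge0 ?invr_ge0 ?(ltW x0)//.
by rewrite exprVn ler_pdivrMl ?exprn_gt0// [x ^+ 2 * C]mulrC.
Qed.

Lemma is_derive_bump p (x : R) : is_derive x 1 (expbump p : R -> R^o) (expbump (expbump_deriv p) x).
Proof.
have [x0|x0|->] := ltgtP x 0.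
- rewrite {2}/expbump ltNge ltW//=.
  have h0 : is_derive x 1 (cst 0 : R -> R^o) 0 by exact: is_derive_cst.
  apply: near_eq_is_derive h0.
  by near=> y; rewrite /expbump ltNge ltW//=; near: y; exact: lt_nbhsl.
- rewrite {2}/expbump x0.
  have xn : x != 0 by rewrite gt_eqF.
  have di : is_derive x 1 (fun y : R => y^-1 : R^o) (- x ^- 2).
    by apply: is_derive_eq (is_deriveV xn (is_derive_id x 1)) _; rewrite [LHS]mulr1.
  have dp := @is_derive1_comp _ (horner p) (fun y => y^-1) x _ _ (is_derive_poly p x^-1) di.
  have de := @is_derive1_comp _ (@expR R) (fun y => - y^-1) x _ _ (is_derive_expR _) (is_deriveN di).
  apply: (@near_eq_is_derive _ _ _ (fun y : R => p.[y^-1] * expR (- y^-1) : R^o) (expbump p : R -> R^o)).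
    by near=> y; rewrite /expbump ifT//; near: y; exact: lt_nbhsr.
  apply: is_derive_eq (is_deriveMR dp de) _.
  rewrite /expbump_deriv hornerM hornerXn hornerD hornerN exprVn /=.
  ring.
- rewrite {2}/expbump ltxx.
  have [C C0 h] := bump_sq p.
  have b0 : expbump p 0 = 0 by rewrite /expbump ltxx.
  have c : h^-1 *: ((expbump p : R -> R^o) (h *: (1 : R) + 0) - expbump p 0) @[h --> (0 : R)^'] --> (0 : R).
    apply/cvgrPdist_le => e e0; near=> y.
    rewrite sub0r normrN b0 subr0 addr0 [y *: 1]mulr1 [_ *: _]/(_ * _) normrM.
    have yn : y != 0 by near: y; exact: nbhs_dnbhs_neq.
    rewrite normfV ler_pdivrMl ?normr_gt0//; apply: le_trans (h y) _.
    rewrite -(real_normK (num_real y)) expr2 mulrA mulrC ler_wpM2l//.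
    have : `|y| <= e / (C + 1).
      by near: y; apply: dnbhs0_le; rewrite divr_gt0// ltr_pwDr.
    rewrite ler_pdivlMr ?ltr_pwDr// => h1; apply: le_trans h1.
    by rewrite mulrC ler_wpM2l// lerDl.
  split; first by apply/cvg_ex; exists 0.
  exact: (cvg_lim _ c).
Unshelve. all: by end_near. Qed.

End expbump.

(** * Smooth functions and Gaussian integrals *)

Section smooth_class.
Context {R : realType} {m n : nat}.
Notation M := 'M[R]_(m, n).

(* A class of functions closed under partial derivatives, hence of smooth
   functions. *)
Inductive sm1 : (R -> R) -> Prop :=
| sm1_exp : sm1 expR
| sm1_cos : sm1 cos
| sm1_sin : sm1 sin
| sm1_bump p : sm1 (expbump p).

Inductive cls : (M -> R) -> Prop :=
| cls_cst c : cls (fun=> c)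
| cls_coord i j : cls (fun y => y i j)
| clsD f g : cls f -> cls g -> cls (fun y => f y + g y)
| clsM f g : cls f -> cls g -> cls (fun y => f y * g y)
| cls_comp g f : sm1 g -> cls f -> cls (fun y => g (f y)).

Lemma sm1_cont g : sm1 g -> continuous (g : R -> R^o).
Proof.
case=> [|||p]; [exact: continuous_expR|exact: continuous_cos|exact: continuous_sin|].
by apply: is_derive_cont => t; exact: is_derive_bump.
Qed.

Lemma cls_cont f : cls f -> continuous (f : M -> R^o).
Proof.
elim=> {f} [c|i j|f g _ cf _ cg|f g _ cf _ cg|g f hg _ cf] x.
- exact: cst_continuous.
- exact: coord_continuous.
- exact: (@continuousD R R^o M f g x (cf x) (cg x)).
- exact: (@continuousM R M f g x (cf x) (cg x)).
- move: x; exact: (continuous_compR (sm1_cont hg) cf).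
Qed.

Lemma cls_der f V : cls f -> exists2 g, cls g & forall y, is_derive y V (f : M -> R^o) (g y).
Proof.
elim=> {f} [c|i j|f g cf [f' cf' hf] cg [g' cg' hg]|f g cf [f' cf' hf] cg [g' cg' hg]|g f hg cf [f' cf' hf]].
- by exists (fun=> 0); [exact: cls_cst|move=> y; exact: is_derive_cst].
- by exists (fun=> V i j); [exact: cls_cst|move=> y; exact: is_derive_coord].
- by exists (fun y => f' y + g' y); [exact: clsD|move=> y; exact: is_deriveDV].
- exists (fun y => f' y * g y + f y * g' y); last by move=> y; exact: is_deriveMV.
  by apply: clsD; apply: clsM.
- case: hg => [|||p].
  + exists (fun y => expR (f y) * f' y); last by move=> y; apply: is_derive_compV.
    by apply: clsM => //; apply: cls_comp => //; exact: sm1_exp.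
  + exists (fun y => (-1 * sin (f y)) * f' y); last first.
      by move=> y; apply: is_derive_compV => //; rewrite mulN1r; exact: is_derive_cos.
    by apply: clsM => //; apply: clsM; [exact: cls_cst|apply: cls_comp => //; exact: sm1_sin].
  + exists (fun y => cos (f y) * f' y); last by move=> y; apply: is_derive_compV.
    by apply: clsM => //; apply: cls_comp => //; exact: sm1_cos.
  + exists (fun y => expbump (expbump_deriv p) (f y) * f' y); last by move=> y; apply: is_derive_compV => //; exact: is_derive_bump.
    by apply: clsM => //; apply: cls_comp => //; exact: sm1_bump.
Qed.

Lemma cls_eq f g : cls f -> f =1 g -> cls g.
Proof. by move=> cf /funext <-. Qed.

Lemma cls_derive f V : cls f -> cls ('D_V (f : M -> R^o)).
Proof. by move=> /(cls_der V)[g cg hg]; apply: (cls_eq cg) => y; rewrite derive_val. Qed.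

Lemma cls_derivable f V y : cls f -> derivable (f : M -> R^o) y V.
Proof. by move=> /(cls_der V)[g _ hg]; have [] := hg y. Qed.

Lemma cls_is_derive f V y : cls f -> is_derive y V (f : M -> R^o) ('D_V (f : M -> R^o) y).
Proof. by move=> cf; split=> //; exact: cls_derivable. Qed.

Lemma cls_sum (I : Type) (r : seq I) (h : I -> M -> R) :
  (forall i, cls (h i)) -> cls (fun y => \sum_(i <- r) h i y).
Proof.
move=> ch; elim: r => [|i r IH].
  by apply: (cls_eq (cls_cst 0)) => y; rewrite big_nil.
by apply: (cls_eq (clsD (ch i) IH)) => y; rewrite big_cons.
Qed.

Lemma clsZ c f : cls f -> cls (fun y => c * f y).
Proof. by apply: clsM; exact: cls_cst. Qed.

Lemma cls_smooth f : cls f -> smooth f.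
Proof.
move=> cf s; have cs : cls (iter_partial s f).
  by elim: s => [|ij s IH] //=; exact: cls_derive.
by split; [exact: cls_cont|move=> i j x; exact: cls_derivable].
Qed.

End smooth_class.

Section row_major.

Lemma nth_allpairs_pair (S T : Type) (s : seq S) (t : seq T) x y a b : (a < size s)%N -> (b < size t)%N ->
  nth (x, y) [seq (u, v) | u <- s, v <- t] (a * size t + b) = (nth x s a, nth y t b).
Proof.
elim: s a => [|u s IH] [|a]//= ha hb; rewrite nth_cat size_map.
  by rewrite mul0n add0n hb (nth_map y).
rewrite mulSn -addnA ltnNge leq_addr/= addKn; exact: IH.
Qed.

(** Entries are enumerated row by row, so the first n coordinates of a tuple form the first row.
    This is what lets the Gaussian integral be computed by removing one row at a time. *)
Lemma mxvec_index_val m n (i : 'I_m) (j : 'I_n) : mxvec_index i j = (i * n + j)%N :> nat.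
Proof.
have lt : (i * n + j < #|{: 'I_m * 'I_n}|)%N.
  rewrite card_prod !card_ord; apply: (@leq_trans (i * n + n)); first by rewrite ltn_add2l.
  by rewrite -mulSnr leq_mul2r ltn_ord orbT.
rewrite /mxvec_index /= (_ : enum_rank (i, j) = Ordinal lt)//.
apply: enum_val_inj; rewrite enum_rankK (enum_val_nth (i, j)) /=.
rewrite enumT unlock /= /prod_enum.
have := @nth_allpairs_pair _ _ (enum 'I_m) (enum 'I_n) i j i j.
by rewrite !size_enum_ord => ->//; rewrite !nth_ord_enum.
Qed.

Context {R : realType}.

Lemma mx_of_tuple_cat m n (v : n.-tuple R) (u : (m * n).-tuple R) :
  @mx_of_tuple R m.+1 n (cat_tuple v u) = col_mx (\row_l tnth v l) (@mx_of_tuple R m n u).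
Proof.
apply/matrixP => i j; rewrite mxE (tnth_nth 0) mxvec_index_val /= nth_cat size_tuple.
case: (splitP (i : 'I_(1 + m))) => k ik.
  have -> : i = lshift m k by apply/val_inj.
  by rewrite (@col_mxEu R 1 m n) mxE ord1/= mul0n add0n ltn_ord (tnth_nth 0).
have -> : i = rshift 1 k by apply/val_inj.
rewrite (@col_mxEd R 1 m n) mxE (tnth_nth 0) mxvec_index_val /=.
by rewrite mulnDl mul1n -addnA ltnNge leq_addr/= addKn.
Qed.

End row_major.

Section tuple_cat.
Context {R : realType}.
Local Open Scope ereal_scope.

Lemma measurable_tuple_cat a b : measurable_fun [set: a.-tuple R * b.-tuple R]
  (fun p : a.-tuple R * b.-tuple R => cat_tuple p.1 p.2).
Proof.
apply/measurable_fun_tnthP => i.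
case: (splitP i) => k ik.
  rewrite (_ : _ \o _ = (fun p => tnth p.1 k)); last first.
    apply/funext => p /=; rewrite !(tnth_nth 0%R) /= nth_cat size_tuple ik.
    by rewrite ltn_ord.
  exact: (measurableT_comp (measurable_tnth k) measurable_fst).
rewrite (_ : _ \o _ = (fun p => tnth p.2 k)); last first.
  apply/funext => p /=; rewrite !(tnth_nth 0%R) /= nth_cat size_tuple ik.
  by rewrite ltnNge leq_addr/= addKn.
exact: (measurableT_comp (measurable_tnth k) measurable_snd).
Qed.

Lemma ge0_integral_leb_tuple_cat a b (f : (a + b).-tuple R -> \bar R) :
  measurable_fun [set: (a + b).-tuple R] f -> (forall x, 0 <= f x) ->
  \int[leb_tuple (a + b)]_t f t =
  \int[leb_tuple b]_u \int[leb_tuple a]_v f (cat_tuple v u).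
Proof.
elim: a b f => [|a IH] b f mf f0.
  apply: eq_integral => u _.
  rewrite (eq_integral (fun=> f u)); last first.
    by move=> v _; congr f; apply/val_inj; rewrite /= (tuple0 v).
  by rewrite integral_cst//= diracT mule1.
rewrite [LHS](@ge0_integral_leb_tupleS _ (a + b))//.
rewrite IH; last 2 first.
- exact: measurable_leb_tupleS.
- by move=> x; exact: integral_ge0.
apply: eq_integral => u _.
rewrite ge0_integral_leb_tupleS//; last first.
  have h := measurableT_comp mf (@measurable_tuple_cat a.+1 b).
  have h2 := measurableT_comp h (measurable_pair2 u).
  exact: h2.
apply: eq_integral => v _; apply: eq_integral => x _; congr f.
exact/val_inj.
Qed.

End tuple_cat.

Section gaussian.
Context {R : realType}.
Notation leb := (@lebesgue_measure R).

(** Completing the square produces a normal density with mean - c / s and variance 1 / s. *)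
Lemma gauss1 (s c : R) : 0 < s ->
  (\int[leb]_x (expR (- (1 / 2) * (s * x ^+ 2 + 2 * x * c)))%:E =
   (Num.sqrt (2 * pi / s) * expR (1 / 2 * (c ^+ 2 / s)))%:E)%E.
Proof.
move=> s0; have sn : s != 0 by rewrite gt_eqF.
pose sg := Num.sqrt s^-1.
have sg0 : sg != 0 by rewrite gt_eqF// sqrtr_gt0 invr_gt0.
have sg2 : sg ^+ 2 = s^-1 by rewrite sqr_sqrtr// invr_ge0 ltW.
have pk0 := normal_peak_gt0 sg0.
have e x : expR (- (1 / 2) * (s * x ^+ 2 + 2 * x * c)) =
    (normal_peak sg)^-1 * expR (1 / 2 * (c ^+ 2 / s)) * normal_pdf (- (c / s)) sg x.
  have q (p E F : R) : p != 0 -> p^-1 * E * (p * F) = E * F by move=> *; field.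
  rewrite normal_pdfE// /normal_fun sg2 q ?gt_eqF// -expRD.
  congr expR; rewrite -mulr_natr; field.
  by rewrite sn.
rewrite (eq_integral (fun x : measurableTypeR R => ((normal_peak sg)^-1 * expR (1 / 2 * (c ^+ 2 / s)))%:E * (normal_pdf (- (c / s)) sg x)%:E))%E; last first.
  by move=> x _; rewrite -EFinM e.
rewrite ge0_integralZl//.
- rewrite integral_normal_pdf mule1; congr (_ * _)%:E.
  rewrite /normal_peak invrK sg2; congr Num.sqrt; rewrite -mulr_natr; field.
  by rewrite sn.
- by apply/measurable_EFinP; exact: measurable_normal_pdf.
- by move=> x _; rewrite lee_fin normal_pdf_ge0.
- by rewrite lee_fin mulr_ge0 ?expR_ge0// invr_ge0 ltW.
Qed.

Let mtn n l : measurable_fun [set: n.-tuple R] (fun v => tnth v l).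
Proof. exact: measurable_tnth. Qed.

Lemma gauss_row n (s : R) (c : 'I_n -> R) : 0 < s ->
  (\int[leb_tuple n]_v (expR (- (1 / 2) * \sum_l (s * tnth v l ^+ 2 + 2 * tnth v l * c l)))%:E =
   (Num.sqrt (2 * pi / s) ^+ n * expR (1 / 2 * \sum_l (c l ^+ 2 / s)))%:E)%E.
Proof.
move=> s0; elim: n c => [|n IH] c.
  rewrite (eq_integral (fun=> 1%:E)); last by move=> v _; rewrite big_ord0 mulr0 expR0.
  by rewrite integral_cst//= diracT mule1 big_ord0 mulr0 expR0 expr0 mul1r.
have m k (d : 'I_k -> R) : measurable_fun [set: k.-tuple R]
    (fun v => (expR (- (1 / 2) * \sum_l (s * tnth v l ^+ 2 + 2 * tnth v l * d l)))%:E).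
  apply/measurable_EFinP; apply: measurableT_comp => //; apply: measurable_funM => //.
  apply: measurable_sum => l; apply: measurable_funD; apply: measurable_funM => //.
    by apply: measurable_funX; exact: mtn.
  by apply: measurable_funM => //; exact: mtn.
rewrite ge0_integral_leb_tupleS//.
pose cl := c \o lift ord0.
rewrite (eq_integral (fun t : n.-tuple R => (Num.sqrt (2 * pi / s) * expR (1 / 2 * (c ord0 ^+ 2 / s)))%:E *
    (expR (- (1 / 2) * \sum_l (s * tnth t l ^+ 2 + 2 * tnth t l * cl l)))%:E))%E; last first.
  move=> t _; rewrite muleC -gauss1// -ge0_integralZl//; last first.
    apply/measurable_EFinP; apply: measurableT_comp => //; apply: measurable_funM => //.
    by apply: measurable_funD; apply: measurable_funM.
  apply: eq_integral => x _; rewrite -EFinM -expRD -mulrDr addrC.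
  rewrite big_ord_recl tnth_tcons0; congr (expR (_ * (_ + _)))%:E.
  by apply: eq_bigr => l _; rewrite tnth_tconsS.
rewrite ge0_integralZl//; last exact: m.
rewrite IH -EFinM big_ord_recl [1 / 2 * (_ + _)]mulrDr expRD [_ ^+ n.+1]exprS; congr EFin.
rewrite /cl /=; ring.
Qed.

End gaussian.

Section gaussian_mx.
Context {R : realType}.

Definition qform m n (S : 'M[R]_m) (y : 'M[R]_(m, n)) : R := \sum_l quad S (col l y).

Lemma qformE m n (S : 'M[R]_m) (y : 'M[R]_(m, n)) :
  qform S y = \sum_l \sum_i \sum_j y i l * S i j * y j l.
Proof.
apply: eq_bigr => l _; rewrite /quad mxE exchange_big; apply: eq_bigr => j _.
rewrite mxE mulr_suml; apply: eq_bigr => i _.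
by rewrite !mxE.
Qed.

Lemma cls_qform m n (S : 'M[R]_m) : cls (@qform m n S).
Proof.
apply: (@cls_eq _ _ _ (fun y => \sum_l \sum_i \sum_j y i l * S i j * y j l)).
  apply: cls_sum => l; apply: cls_sum => i; apply: cls_sum => j.
  by apply: clsM; [apply: clsM; [exact: cls_coord|exact: cls_cst]|exact: cls_coord].
by move=> y; rewrite qformE.
Qed.

Lemma cls_gauss m n (a : R) (S : 'M[R]_m) : cls (fun y : 'M[R]_(m, n) => expR (a * qform S y)).
Proof. by apply: cls_comp; [exact: sm1_exp|apply: clsZ; exact: cls_qform]. Qed.

Lemma qform_ge0 m n (S : 'M[R]_m) (y : 'M[R]_(m, n)) : spd S -> 0 <= qform S y.
Proof. by move=> sS; apply: sumr_ge0 => l _; exact: spd_ge0. Qed.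

Section schur.
Variables (m : nat) (S : 'M[R]_(1 + m)).
Hypothesis sS : spd S.
Let s := S 0 0.
Let b := dlsubmx S.
(** Schur complement of the top left entry: the quadratic form that remains once the first
    coordinate has been integrated out. *)
Definition schur : 'M[R]_m := drsubmx S - s^-1 *: (b *m b^T).

Let ST : S^T = S. Proof. by case: sS. Qed.

Let ur : ursubmx S = b^T.
Proof. by rewrite /b -{1}ST; apply/matrixP => i j; rewrite !mxE. Qed.

Let ul : ulsubmx S = s%:M.
Proof. by apply/matrixP => i j; rewrite !mxE !ord1 eqxx mulr1n; congr (S _ _); apply/val_inj. Qed.

Let SE : S = block_mx s%:M b^T b (drsubmx S).
Proof. by rewrite -ul -ur submxK. Qed.

Lemma schur_pivot : 0 < S 0 0.
Proof.
have d : delta_mx 0 0 != 0 :> 'cV[R]_(1 + m).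
  by apply/eqP => /matrixP/(_ 0 0)/eqP; rewrite !mxE eqxx oner_eq0.
have [_ /(_ _ d)] := sS; rewrite /quad trmx_delta -rowE.
by rewrite (_ : (row 0 S *m delta_mx 0 0) 0 0 = S 0 0)// -colE !mxE.
Qed.

Let s0 : s != 0. Proof. by rewrite gt_eqF// schur_pivot. Qed.

Lemma schur_quad (x : R) (u : 'cV[R]_m) : quad S (col_mx x%:M u) =
  s * x ^+ 2 + 2 * x * (b^T *m u) 0 0 + (quad schur u + s^-1 * ((b^T *m u) 0 0) ^+ 2).
Proof.
have e1 : (u^T *m b) 0 0 = (b^T *m u) 0 0 by exact: dot_sym.
have e2 : quad schur u = (u^T *m drsubmx S *m u) 0 0 - s^-1 * ((b^T *m u) 0 0) ^+ 2.
  rewrite /quad /schur mulmxBr mulmxBl mxaddE mxoppE -scalemxAr -scalemxAl mxscaleE.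
  by rewrite quad_scal.
rewrite e2 /quad {1}SE tr_col_mx mul_row_block mul_row_col tr_scalar_mx.
rewrite !mul_scalar_mx !mulmxDl !mxaddE -!scalemxAl !mxscaleE.
rewrite !mul_mx_scalar !mxscaleE e1 !mxE eqxx mulr1n -/s.
ring.
Qed.

Lemma schur_spd : spd schur.
Proof.
split.
  by rewrite /schur linearB/= linearZ/= trmx_mul trmxK trmx_drsub ST.
move=> u u0; set x := - (s^-1 * (b^T *m u) 0 0).
have c0 : col_mx x%:M u != 0.
  by apply: contraNneq u0; rewrite -col_mx0 => /eq_col_mx[_ ->].
have [_ /(_ _ c0)] := sS; rewrite schur_quad.
suff -> : s * x ^+ 2 + 2 * x * (b^T *m u) 0 0 + (quad schur u + s^-1 * ((b^T *m u) 0 0) ^+ 2) = quad schur u by [].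
by rewrite /x; field.
Qed.

Lemma schur_det : \det S = s * \det schur.
Proof.
have -> : S = block_mx 1%:M 0 (s^-1 *: b) 1%:M *m block_mx s%:M b^T 0 schur.
  rewrite mulmx_block !mul1mx !mul0mx !addr0 {1}SE; congr block_mx.
    by rewrite mul_mx_scalar scalerA mulfV// scale1r.
  by rewrite /schur -scalemxAl addrC subrK.
by rewrite det_mulmx det_lblock det_ublock !det1 !mul1r det_scalar1.
Qed.

End schur.

(** Induction on the number of rows. With the other rows fixed, the first row carries n independent
    one-dimensional Gaussian integrals; their exponential factors cancel the terms left by
    completing the square, and the Schur complement remains. Its determinant is that of S divided by
    the pivot. *)
Lemma gauss_mx m n (S : 'M[R]_m) : spd S -> 0 < \det S /\
  (\int[leb_mx m n]_y (expR (- (1 / 2) * qform S y))%:E =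
   (Num.sqrt ((2 * pi) ^+ m / \det S) ^+ n)%:E)%E.
Proof.
elim: m S => [|m IH] S sS.
  rewrite det_mx00 expr0 divr1 sqrtr1 expr1n; split=> //.
  rewrite ge0_integral_leb_mx//; last by apply/measurable_EFinP; apply: continuous_measurable_mx; apply: cls_cont; exact: cls_gauss.
  rewrite (eq_integral (fun=> 1%:E)); last first.
    by move=> v _; rewrite qformE big1 ?mulr0 ?expR0// => l _; rewrite big_ord0.
  by rewrite integral_cst//= diracT mule1.
have [d0 {}IH] := IH _ (schur_spd sS).
have s0 := schur_pivot sS.
have dS := schur_det sS.
split; first by rewrite dS mulr_gt0.
have mg k (S' : 'M[R]_k) : measurable_fun [set: 'M[R]_(k, n)] (fun y => (expR (- (1 / 2) * qform S' y))%:E).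
  by apply/measurable_EFinP; apply: continuous_measurable_mx; apply: cls_cont; exact: cls_gauss.
have mgt : measurable_fun [set: (n + m * n).-tuple R]
   (fun t => (expR (- (1 / 2) * qform S (@mx_of_tuple R m.+1 n t)))%:E).
  exact: (measurableT_comp (mg _ S) (@measurable_mx_of_tupleT R m.+1 n)).
rewrite ge0_integral_leb_mx//.
rewrite (@ge0_integral_leb_tuple_cat _ n (m * n) (fun t => (expR (- (1 / 2) * qform S (@mx_of_tuple R m.+1 n t)))%:E))//.
pose b := dlsubmx (S : 'M[R]_(1 + m)).
pose c (u : (m * n).-tuple R) l := (b^T *m col l (mx_of_tuple u)) 0 0.
rewrite (eq_integral (fun u => (Num.sqrt (2 * pi / S 0 0) ^+ n)%:E *
    (expR (- (1 / 2) * qform (schur S) (mx_of_tuple u)))%:E))%E; last first.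
  move=> u _; set q := qform _ _.
  transitivity (\int[leb_tuple n]_v ((expR (- (1 / 2) * (q + \sum_l ((c u l) ^+ 2 / S 0 0))))%:E *
      (expR (- (1 / 2) * \sum_l (S 0 0 * tnth v l ^+ 2 + 2 * tnth v l * c u l)))%:E))%E.
    apply: eq_integral => v _; rewrite -EFinM -expRD -mulrDr mx_of_tuple_cat.
    rewrite /q /qform -!big_split/=; congr (expR (_ * _))%:E; apply: eq_bigr => l _.
    have -> : col l (col_mx (\row_l0 tnth v l0) (mx_of_tuple u)) = col_mx (tnth v l)%:M (col l (mx_of_tuple u)).
      by rewrite col_col_mx; congr col_mx; apply/matrixP => i j; rewrite !mxE !ord1 eqxx mulr1n.
    by rewrite schur_quad// addrC /c mulrC; congr (_ + _ + _); rewrite mulrC.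
  rewrite ge0_integralZl//; last first.
    apply/measurable_EFinP; apply: measurableT_comp => //; apply: measurable_funM => //.
    apply: measurable_sum => l; apply: measurable_funD; apply: measurable_funM => //.
      by apply: measurable_funX; exact: measurable_tnth.
    by apply: measurable_funM => //; exact: measurable_tnth.
  rewrite gauss_row// -!EFinM mulrCA -expRD; congr ((_ * expR _)%:E).
  by ring.
rewrite ge0_integralZl//; last exact: (measurableT_comp (mg _ (schur S)) (@measurable_mx_of_tupleT R m n)).
have e := ge0_integral_leb_mx (mg _ (schur S)) (fun y => expR_ge0 _).
rewrite -[X in (_ * X)%E]e IH -EFinM dS -exprMn; congr ((_ ^+ _)%:E).
rewrite -sqrtrM; last by rewrite divr_ge0 ?ltW// mulr_gt0// pi_gt0.
by congr Num.sqrt; rewrite exprS invfM; ring.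
Qed.

End gaussian_mx.

Lemma is_derive_integral {R : realType} d (Y : measurableType d) (mu : {measure set Y -> \bar R})
  (f df : R -> Y -> R) (G : Y -> R) (a : R) :
  (forall x, mu.-integrable setT (EFin \o f x)) ->
  (forall (x : R) y, is_derive x 1 (f ^~ y : R -> R^o) (df x y)) ->
  (forall y, 0 <= G y) -> mu.-integrable setT (EFin \o G) ->
  (forall x y, a - 1 < x < a + 1 -> `|df x y| <= G y) ->
  is_derive a 1 (fun x => \int[mu]_y f x y : R^o) (\int[mu]_y df a y).
Proof.
move=> fi fd G0 Gi Gu.
have Ia : `]a - 1, a + 1[%classic a by rewrite /= in_itv/=; apply/andP; split; lra.
have d1 x y : derive1 (f ^~ y : R -> R^o) x = df x y by rewrite derive1E; exact: derive_val.
have Gu' x y : `]a - 1, a + 1[%classic x -> setT y -> `|partial1of2 f x y| <= G y.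
  by rewrite /= in_itv/= => h _; rewrite /partial1of2 d1; exact: Gu.
have fd' x y : `]a - 1, a + 1[%classic x -> setT y -> derivable (f ^~ y : R -> R^o) x 1.
  by move=> _ _; have [] := fd x y.
split; first exact: (@derivable_under_integral _ _ _ mu f setT measurableT a _ _ Ia (fun x _ => fi x) fd' G G0 Gi Gu').
rewrite -derive1E (@differentiation_under_integral _ _ _ mu f setT measurableT a _ _ Ia (fun x _ => fi x) fd' G G0 Gi Gu').
by apply: eq_Rintegral => y _; rewrite /partial1of2 d1.
Qed.

Section mdot.
Context {R : realType} {m n : nat}.
Notation M := 'M[R]_(m, n).
Implicit Types (th y V : M).

Definition mdot th y : R := \sum_i \sum_j th i j * y i j.

Lemma mdotE th y : mdot th y = \tr (th^T *m y).
Proof.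
rewrite /mxtrace /mdot exchange_big; apply: eq_bigr => j _; rewrite mxE.
by apply: eq_bigr => i _; rewrite mxE.
Qed.

Lemma mdotC th y : mdot th y = mdot y th.
Proof. by apply: eq_bigr => i _; apply: eq_bigr => j _; rewrite mulrC. Qed.

Lemma mdotZl c th y : mdot (c *: th) y = c * mdot th y.
Proof. by rewrite !mdotE linearZ/= -scalemxAl mxtraceZ. Qed.

Lemma mdotDl th th' y : mdot (th + th') y = mdot th y + mdot th' y.
Proof. by rewrite !mdotE linearD/= mulmxDl mxtraceD. Qed.

Lemma mdotMr th (A : 'M[R]_m) y : mdot th (A *m y) = mdot (A^T *m th) y.
Proof. by rewrite !mdotE trmx_mul trmxK mulmxA. Qed.

Lemma mdot0l y : mdot 0 y = 0.
Proof. by rewrite mdotE trmx0 mul0mx mxtrace0. Qed.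

Lemma mdot_delta i j y : mdot (delta_mx i j) y = y i j.
Proof.
rewrite /mdot (bigD1 i)//= (bigD1 j)//= mxE !eqxx mul1r !big1 ?addr0//.
  by move=> k ki; rewrite big1// => l _; rewrite mxE (negbTE ki) mul0r.
by move=> k kj; rewrite mxE (negbTE kj) andbF mul0r.
Qed.

Lemma cls_mdot th : cls (mdot th).
Proof.
by apply: cls_sum => i; apply: cls_sum => j; apply: clsZ; exact: cls_coord.
Qed.

Lemma is_derive_mdot th y V : is_derive y V (mdot th : M -> R^o) (mdot th V).
Proof.
apply: is_derive_sumV => i; apply: is_derive_sumV => j.
apply: is_deriveZV; exact: is_derive_coord.
Qed.

End mdot.

Section ibp.
Context {R : realType} {m n : nat}.
Notation M := 'M[R]_(m, n).
Notation leb := (@leb_mx R m n).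

Lemma integral_by_parts_mx (f g df dg : M -> R) (V : M) :
  (forall y, is_derive y V (f : M -> R^o) (df y)) ->
  (forall y, is_derive y V (g : M -> R^o) (dg y)) ->
  continuous (f : M -> R^o) -> continuous (g : M -> R^o) ->
  continuous (df : M -> R^o) -> continuous (dg : M -> R^o) ->
  leb.-integrable setT (EFin \o (fun y => f y * g y)) ->
  leb.-integrable setT (EFin \o (fun y => df y * g y)) ->
  leb.-integrable setT (EFin \o (fun y => f y * dg y)) ->
  \int[leb]_y (df y * g y) = - \int[leb]_y (f y * dg y).
Proof.
move=> hf hg cf cg cdf cdg i0 i1 i2.
have h y := is_deriveMV (hf y) (hg y).
have dE : 'D_V (fun y => f y * g y : R^o) = (fun y => df y * g y + f y * dg y).
  by apply/funext => y; exact: derive_val.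
have := @integral_derive0 R m n (fun y => f y * g y) V.
rewrite dE => H.
have {H} : \int[leb]_y (df y * g y + f y * dg y) = 0.
  apply: H => //.
  - by move=> y; exact: (@continuousM R M f g y (cf y) (cg y)).
  - move=> y; apply: (@continuousD R R^o M (fun y => df y * g y) (fun y => f y * dg y)).
      exact: (@continuousM R M df g y (cdf y) (cg y)).
    exact: (@continuousM R M f dg y (cf y) (cdg y)).
  - exact: integrableDR.
by rewrite RintegralD// => /eqP; rewrite addr_eq0 => /eqP.
Qed.

End ibp.

(** * Gaussian weights and their Fourier transform *)

Section gaussian_weight.
Context {R : realType} {m n : nat}.
Notation M := 'M[R]_(m, n).
Notation leb := (@leb_mx R m n).
Variable Sg : 'M[R]_m.
Hypothesis sS : spd Sg.
Notation S := (invmx Sg).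
Let sI : spd S. Proof. exact: spd_inv. Qed.
Let uS : Sg \in unitmx. Proof. exact: spd_unit. Qed.

Definition gw (y : M) : R := expR (- (1 / 2) * qform S y).

Lemma gw_gt0 y : 0 < gw y. Proof. exact: expR_gt0. Qed.

Lemma cls_gw : cls gw. Proof. exact: cls_gauss. Qed.

(** Gauge of polynomial growth: it is at least 1, its powers increase with the exponent, and it
    dominates every coordinate up to a constant. *)
Definition qw (y : M) : R := 1 + qform S y.

Lemma qw_ge1 y : 1 <= qw y. Proof. by rewrite /qw lerDl qform_ge0. Qed.
Lemma qw_ge0 y : 0 <= qw y. Proof. exact: le_trans ler01 (qw_ge1 y). Qed.

Let half_spd : spd (2^-1 *: S).
Proof.
case: sI => sT sp; split; first by rewrite linearZ/= sT.
by move=> v v0; rewrite /quad -scalemxAr -scalemxAl mxscaleE mulr_gt0// sp.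
Qed.

(** Half of the Gaussian exponent is spent on the polynomial: qw^k <= 4^k k! e^(qw / 4), and e^(qw /
    4) times the weight is e^(1 / 4) times the Gaussian of the halved form. *)
Lemma integrable_qw_gw k (c : R) : leb.-integrable setT (EFin \o (fun y => c * qw y ^+ k * gw y)).
Proof.
have [_ e] := gauss_mx n half_spd.
have i : leb.-integrable setT (EFin \o (fun y => (`|c| * 4 ^+ k * k`!%:R * expR (1 / 4)) * expR (- (1 / 2) * qform (2^-1 *: S) y))).
  apply: integrableZR => //; apply/integrableP; split.
    by apply/measurable_EFinP; apply: continuous_measurable_mx; apply: cls_cont; exact: cls_gauss.
  under eq_integral do rewrite /= ger0_norm ?expR_ge0//.
  by rewrite e ltry.
apply: le_integrable i => //.
  apply/measurable_EFinP; apply: continuous_measurable_mx; apply: cls_cont.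
  apply: clsM; last exact: cls_gw; apply: clsZ.
  elim: k => [|k IH]; first by apply: (cls_eq (cls_cst 1)) => y; rewrite expr0.
  apply: (cls_eq (f := fun y => qw y * qw y ^+ k)); last by move=> y; rewrite exprS.
  by apply: clsM => //; apply: clsD; [exact: cls_cst|exact: cls_qform].
move=> y _; rewrite /= lee_fin [leRHS]ger0_norm; last by rewrite !mulr_ge0 ?exprn_ge0 ?expR_ge0.
rewrite !normrM [`|gw y|]ger0_norm ?expR_ge0// [`|qw y ^+ k|]ger0_norm ?exprn_ge0 ?qw_ge0//.
rewrite -!mulrA ler_wpM2l//.
have -> : qform (2^-1 *: S) y = 2^-1 * qform S y.
  by rewrite /qform mulr_sumr; apply: eq_bigr => l _; rewrite /quad -scalemxAr -scalemxAl mxscaleE.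
have h := @exprn_le_expR R (qw y / 4) k (divr_ge0 (qw_ge0 y) (ler0n _ _)).
have -> : qw y ^+ k = 4 ^+ k * (qw y / 4) ^+ k.
  by rewrite -exprMn; congr (_ ^+ k); field.
rewrite -mulrA ler_wpM2l ?exprn_ge0//.
apply: le_trans (ler_wpM2r (ltW (gw_gt0 y)) h) _.
rewrite -mulrA ler_wpM2l// /gw -!expRD ler_expR /qw; lra.
Qed.

Lemma integrable_gw_dom (f : M -> R) k c : measurable_fun setT f ->
  (forall y, `|f y| <= c * qw y ^+ k * gw y) -> leb.-integrable setT (EFin \o f).
Proof.
move=> mf h; apply: (le_integrable measurableT _ _ (integrable_qw_gw k c)).
  exact/measurable_EFinP.
by move=> y _; rewrite /= lee_fin (le_trans (h y))// ler_norm.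
Qed.

Lemma coord_sq_qform (y : M) i l : y i l ^+ 2 <= Sg i i * qform S y.
Proof.
have h := spd_coord (col l y) i sS; rewrite mxE in h; apply: le_trans h _.
have s0 : 0 <= Sg i i.
  have := spd_ge0 (delta_mx i 0) sS; rewrite /quad trmx_delta -rowE.
  by rewrite (_ : (row i Sg *m delta_mx i 0) 0 0 = Sg i i)// -colE !mxE.
rewrite ler_wpM2l// /qform (bigD1 l)//= lerDl.
by apply: sumr_ge0 => k _; exact: spd_ge0.
Qed.

Lemma coord_le_qw (i : 'I_m) : exists2 C, 0 <= C & forall (y : M) l, `|y i l| <= C * qw y.
Proof.
exists (1 + `|Sg i i|) => [|y l]; first by rewrite addr_ge0.
have h := coord_sq_qform y i l; have q0 := qform_ge0 y sI.
have : `|y i l| ^+ 2 <= `|Sg i i| * qform S y.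
  by rewrite real_normK ?num_real//; apply: le_trans h _; rewrite ler_wpM2r// ler_norm.
rewrite /qw; have := normr_ge0 (y i l); have := normr_ge0 (Sg i i).
move: `|y i l| `|Sg i i| (qform S y) q0 => a b q q0 b0 a0; nra.
Qed.

Lemma mdot_le_qw (th : M) : exists2 C, 0 <= C & forall y, `|mdot th y| <= C * qw y.
Proof.
have /choice[C hC] i : exists C, 0 <= C /\ forall (y : M) l, `|y i l| <= C * qw y.
  by have [C C0 h] := coord_le_qw i; exists C.
exists (\sum_i \sum_j `|th i j| * C i).
  by apply: sumr_ge0 => i _; apply: sumr_ge0 => j _; rewrite mulr_ge0//; have [] := hC i.
move=> y; rewrite /mdot mulr_suml (le_trans (ler_norm_sum _ _ _))// ler_sum// => i _.
rewrite mulr_suml (le_trans (ler_norm_sum _ _ _))// ler_sum// => j _.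
by rewrite normrM -mulrA ler_wpM2l//; have [_] := hC i; apply.
Qed.

Lemma is_derive_qform y (V : M) : is_derive y V (qform S : M -> R^o) (2 * mdot (S *m V) y).
Proof.
have [sT _] := sI.
have -> : @qform R m n S = fun z => \sum_i \sum_j z i j * (S *m z) i j.
  apply/funext => z; rewrite /qform exchange_big; apply: eq_bigr => l _.
  rewrite /quad -mulmxA mxE; apply: eq_bigr => i _; rewrite !mxE.
  by congr (_ * _); apply: eq_bigr => j _; rewrite mxE.
have hS i j : is_derive y V (fun z : M => (S *m z) i j : R^o) ((S *m V) i j).
  rewrite (_ : (fun z => _) = (fun z : M => \sum_k S i k * z k j)); last first.
    by apply/funext => z; rewrite mxE.
  rewrite mxE; apply: is_derive_sumV => k; apply: is_deriveZV; exact: is_derive_coord.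
apply: is_derive_eq (is_derive_sumV _ (fun i => is_derive_sumV _ (fun j => is_deriveMV (is_derive_coord i j y V) (hS i j)))) _.
have -> : 2 * mdot (S *m V) y = mdot V (S *m y) + mdot y (S *m V).
  by rewrite mdotMr sT [mdot y _]mdotC mulr2n mulrDl mul1r.
rewrite /mdot -big_split/=; apply: eq_bigr => i _.
by rewrite -big_split.
Qed.

Lemma is_derive_gw y V : is_derive y V (gw : M -> R^o) (- mdot (S *m V) y * gw y).
Proof.
have h := is_derive_compV (is_derive_expR (- (1 / 2) * qform S y)) (is_deriveZV (- (1 / 2)) (is_derive_qform y V)).
by apply: is_derive_eq h _; rewrite /gw; field.
Qed.

(** The phase c makes one formula cover the cosine transform (c = 0) and the sine transform (c = -
    pi / 2). *)
Definition gft c th := \int[leb]_y (gw y * cos (mdot th y + c)).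

Let cls_trig g th c : sm1 g -> cls (fun y : M => g (mdot th y + c)).
Proof. by move=> sg; apply: cls_comp => //; apply: clsD; [exact: cls_mdot|exact: cls_cst]. Qed.

Let meas f : cls f -> measurable_fun [set: M] f.
Proof. by move=> cf; apply: continuous_measurable_mx; exact: cls_cont. Qed.

Let trig_le1 (x : R) : `|cos x| <= 1 /\ `|sin x| <= 1.
Proof. by rewrite !ler_norml cos_geN1 cos_le1 sin_geN1 sin_le1. Qed.

(** Integration by parts in the direction Sigma th, along which the weight has derivative - (th . y)
    times itself. *)
Lemma gft_ode_step c th : \int[leb]_y (mdot th y * gw y * sin (mdot th y + c)) =
  mdot th (Sg *m th) * gft c th.
Proof.
have [C C0 hC] := mdot_le_qw th.
have cg := cls_gw; have cm := cls_mdot th.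
have csn := cls_trig th c (@sm1_sin R); have ccs := cls_trig th c (@sm1_cos R).
pose V := Sg *m th.
have SV : S *m V = th by rewrite mulKmx.
have h := @integral_by_parts_mx R m n gw (fun y => sin (mdot th y + c)) (fun y => - mdot th y * gw y)
  (fun y => cos (mdot th y + c) * mdot th V) V.
have : \int[leb]_y (- mdot th y * gw y * sin (mdot th y + c)) =
       - \int[leb]_y (gw y * (cos (mdot th y + c) * mdot th V)).
  apply: h.
  - by move=> y; have := is_derive_gw y V; rewrite SV.
  - move=> y; apply: (@is_derive_compV _ _ _ (@sin R) (fun y => mdot th y + c)).
    by rewrite -[X in is_derive _ _ _ X]addr0; apply: is_deriveDV (is_derive_mdot th y V) (is_derive_cst c y V).
  - exact: cls_cont.
  - exact: cls_cont.
  - apply: cls_cont; apply: clsM => //; apply: (cls_eq (clsZ (-1) cm)) => y; exact: mulN1r.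
  - by apply: cls_cont; apply: clsM => //; exact: cls_cst.
  - apply: (@integrable_gw_dom _ 0 1); first exact: meas (clsM cg csn).
    move=> y; rewrite expr0 mulr1 mul1r normrM ger0_norm ?expR_ge0// ler_piMr ?expR_ge0//.
    by have [] := trig_le1 (mdot th y + c).
  - apply: (@integrable_gw_dom _ 1 C).
      apply: meas; apply: clsM => //; apply: clsM => //; apply: (cls_eq (clsZ (-1) cm)) => y; exact: mulN1r.
    move=> y; rewrite expr1 !normrM normrN [`|gw y|]ger0_norm ?expR_ge0//.
    have [_ hs] := trig_le1 (mdot th y + c).
    apply: le_trans (ler_piMr _ hs) _; first by rewrite mulr_ge0 ?expR_ge0.
    by rewrite ler_wpM2r ?expR_ge0.
  - apply: (@integrable_gw_dom _ 0 `|mdot th V|).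
      by apply: meas; apply: clsM => //; apply: clsM => //; exact: cls_cst.
    move=> y; rewrite expr0 mulr1 !normrM [`|gw y|]ger0_norm ?expR_ge0// mulrC ler_wpM2r ?expR_ge0//.
    by have [hc _] := trig_le1 (mdot th y + c); rewrite ler_piMl.
have ig : leb.-integrable setT (EFin \o (fun y => gw y * cos (mdot th y + c))).
  apply: (@integrable_gw_dom _ 0 1); first exact: meas (clsM cg ccs).
  move=> y; rewrite expr0 mulr1 mul1r normrM ger0_norm ?expR_ge0// ler_piMr ?expR_ge0//.
  by have [] := trig_le1 (mdot th y + c).
rewrite (_ : (fun y => gw y * _) = (fun y => mdot th V * (gw y * cos (mdot th y + c)))); last first.
  by apply/funext => y; rewrite mulrA mulrC.
rewrite RintegralZl// -/(gft c th) => H.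
apply/eqP; rewrite -eqr_opp -H; apply/eqP.
rewrite -mulN1r -RintegralZl//; first by apply: eq_Rintegral => y _; rewrite !mulrA mulN1r.
apply: (@integrable_gw_dom _ 1 C).
  by apply: meas; apply: clsM => //; exact: clsM.
move=> y; rewrite expr1 !normrM [`|gw y|]ger0_norm ?expR_ge0//.
have [_ hs] := trig_le1 (mdot th y + c).
apply: le_trans (ler_piMr _ hs) _; first by rewrite mulr_ge0 ?expR_ge0.
by rewrite ler_wpM2r ?expR_ge0.
Qed.

(** Along the ray t th the transform satisfies f' = - t tau f with tau = th . Sigma th, so e^(tau
    t^2 / 2) f is constant; compare t = 1 with t = 0. *)
Lemma gftE c th : gft c th = cos c * expR (- (1 / 2) * mdot th (Sg *m th)) * \int[leb]_y gw y.
Proof.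
set tau := mdot th (Sg *m th).
have [C C0 hC] := mdot_le_qw th.
have cg := cls_gw; have cm := cls_mdot th.
have ig t : leb.-integrable setT (EFin \o (fun y => gw y * cos (mdot (t *: th) y + c))).
  apply: (@integrable_gw_dom _ 0 1); first exact: meas (clsM cg (cls_trig _ c (@sm1_cos R))).
  move=> y; rewrite expr0 mulr1 mul1r normrM ger0_norm ?expR_ge0// ler_piMr ?expR_ge0//.
  by have [] := trig_le1 (mdot (t *: th) y + c).
have d (t : R) : is_derive t 1 (fun t => gft c (t *: th) : R^o) (- (t * tau * gft c (t *: th))).
  have h := @is_derive_integral R _ _ leb (fun t y => gw y * cos (mdot (t *: th) y + c))
    (fun t y => gw y * (- sin (mdot (t *: th) y + c) * mdot th y)) (fun y => C * qw y ^+ 1 * gw y) t ig.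
  apply: is_derive_eq (h _ _ _ _) _.
  - move=> x y; apply: is_deriveZR.
    have h3 : is_derive x 1 (fun s : R => mdot (s *: th) y + c : R^o) (mdot th y).
      rewrite (_ : (fun s => _) = (fun s => mdot th y * s + c)); last by apply/funext => s; rewrite mdotZl mulrC.
      have h2 : is_derive x 1 (fun=> c : R^o) 0 by exact: is_derive_cst.
      by rewrite -[X in is_derive _ _ _ X]addr0; exact: (is_deriveD (is_derive_linear _ x) h2).
    exact: (@is_derive1_comp _ (@cos R) (fun s => mdot (s *: th) y + c) x _ _ (is_derive_cos _) h3).
  - by move=> y; rewrite !mulr_ge0 ?exprn_ge0 ?qw_ge0 ?expR_ge0.
  - exact: integrable_qw_gw.
  - move=> x y _; rewrite expr1 !normrM normrN [`|gw y|]ger0_norm ?expR_ge0// mulrC.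
    rewrite ler_wpM2r ?expR_ge0//.
    by have [_ hs] := trig_le1 (mdot (x *: th) y + c); apply: le_trans (ler_piMl _ hs) (hC y).
  (* At t = 0 the previous identity cannot be divided by t; the derivative vanishes because (th . y)
     times the weight has integral 0, again by parts. *)
  - have [->|t0] := eqVneq t 0.
      rewrite !mul0r oppr0; rewrite (_ : (fun y => _) = (fun y => - sin c * (mdot th y * gw y))); last first.
        by apply/funext => y; rewrite scale0r mdot0l add0r; ring.
      have := gft_ode_step (pi / 2) 0.
      have e0 : \int[leb]_y (mdot th y * gw y) = 0.
        have e : (fun y => mdot th y * gw y) = (fun y => (-1) * (1 * (- mdot th y * gw y))).
          by apply/funext => y; ring.
        have H := @integral_by_parts_mx R m n gw (fun=> 1) (fun y => - mdot th y * gw y) (fun=> 0) (Sg *m th).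
        have i1 : leb.-integrable setT (EFin \o (fun y => - mdot th y * gw y * 1)).
          apply: (@integrable_gw_dom _ 1 C).
            apply: meas; apply: clsM; last exact: cls_cst.
            apply: clsM => //; apply: (cls_eq (clsZ (-1) cm)) => y; exact: mulN1r.
          by move=> y; rewrite mulr1 expr1 normrM normrN [`|gw y|]ger0_norm ?expR_ge0// ler_wpM2r ?expR_ge0.
        have : \int[leb]_y (- mdot th y * gw y * 1) = - \int[leb]_y (gw y * 0).
          apply: H => //.
          - by move=> y; have := is_derive_gw y (Sg *m th); rewrite mulKmx.
          - exact: cls_cont.
          - exact: cst_continuous.
          - by apply: cls_cont; apply: clsM => //; apply: (cls_eq (clsZ (-1) cm)) => y; exact: mulN1r.
          - exact: cst_continuous.
          - apply: (@integrable_gw_dom _ 0 1); first exact: meas (clsM cg (cls_cst 1)).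
            by move=> y; rewrite mulr1 expr0 mulr1 mul1r ger0_norm ?expR_ge0.
          - apply: (@integrable_gw_dom _ 0 1); first exact: meas (clsM cg (cls_cst 0)).
            by move=> y; rewrite mulr0 normr0 expr0 mulr1 mul1r expR_ge0.
        rewrite (_ : (fun y => gw y * 0) = cst 0); last by apply/funext => y; rewrite mulr0.
        rewrite Rintegral_cst// mul0r oppr0 => H0.
        rewrite e (_ : (fun y => _) = (fun y => (-1) * (- mdot th y * gw y * 1))); last first.
          by apply/funext => y; ring.
        by rewrite RintegralZl// H0 mulr0.
      move=> _; rewrite RintegralZl ?e0 ?mulr0//.
      apply: (@integrable_gw_dom _ 1 C); first exact: meas (clsM cm cg).
      by move=> y; rewrite expr1 normrM [`|gw y|]ger0_norm ?expR_ge0// ler_wpM2r ?expR_ge0.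
    have := gft_ode_step c (t *: th).
    rewrite -scalemxAr mdotZl mdotC mdotZl mdotC -/tau => H.
    have e : (fun y => gw y * (- sin (mdot (t *: th) y + c) * mdot th y)) =
       (fun y => - t^-1 * (mdot (t *: th) y * gw y * sin (mdot (t *: th) y + c))).
      by apply/funext => y; rewrite mdotZl; field.
    rewrite e RintegralZl//; first by rewrite H; field.
    have [C' C'0 hC'] := mdot_le_qw (t *: th).
    apply: (@integrable_gw_dom _ 1 C').
      by apply: meas; apply: clsM; [apply: clsM => //; exact: cls_mdot|exact: cls_trig (@sm1_sin R)].
    move=> y; rewrite expr1 !normrM [`|gw y|]ger0_norm ?expR_ge0//.
    have [_ hs] := trig_le1 (mdot (t *: th) y + c).
    apply: le_trans (ler_piMr _ hs) _; first by rewrite mulr_ge0 ?expR_ge0.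
    by rewrite ler_wpM2r ?expR_ge0.
have d2 (t : R) : is_derive t 1 (fun t => expR (1 / 2 * tau * t ^+ 2) * gft c (t *: th) : R^o) 0.
  have h2 : is_derive t 1 (fun t : R => 1 / 2 * tau * t ^+ 2 : R^o) (tau * t).
    apply: is_derive_eq (is_deriveZR (1 / 2 * tau) (is_deriveMR (is_derive_id t 1) (is_derive_id t 1))) _.
    by field.
  have h3 := @is_derive1_comp _ (@expR R) (fun t => 1 / 2 * tau * t ^+ 2) t _ _ (is_derive_expR _) h2.
  by apply: is_derive_eq (is_deriveMR h3 (d t)) _; rewrite /=; ring.
have := is_derive_eq0 1 0 d2.
rewrite expr1n mulr1 scale1r expr0n/= mulr0 expR0 mul1r scale0r => H.
have g0 : gft c 0 = cos c * \int[leb]_y gw y.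
  rewrite /gft (_ : (fun y => _) = (fun y => cos c * gw y)); last first.
    by apply/funext => y; rewrite mdot0l add0r mulrC.
  rewrite RintegralZl//; apply: (@integrable_gw_dom _ 0 1); first exact: meas.
  by move=> y; rewrite expr0 mulr1 mul1r ger0_norm ?expR_ge0.
rewrite mulrAC -g0 -[gft c 0]mul1r -H mulrAC -expRD.
by rewrite (_ : _ + _ = 0) ?expR0 ?mul1r// /tau; ring.
Qed.

Definition d1gw (V y : M) : R := - mdot (S *m V) y * gw y.

Definition d2gw (V y : M) : R := (mdot (S *m V) y ^+ 2 - mdot (S *m V) V) * gw y.

Lemma is_derive_d1gw y V : is_derive y V (d1gw V : M -> R^o) (d2gw V y).
Proof.
have h := is_deriveMV (is_deriveZV (-1) (is_derive_mdot (S *m V) y V)) (is_derive_gw y V).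
rewrite (_ : d1gw V = (fun z => (-1 * mdot (S *m V) z) * gw z)); last by apply/funext => z; rewrite mulN1r.
by apply: is_derive_eq h _; rewrite /d2gw; ring.
Qed.

Lemma cls_d1gw V : cls (d1gw V).
Proof. by apply: clsM cls_gw; apply: (cls_eq (clsZ (-1) (cls_mdot (S *m V)))) => y; exact: mulN1r. Qed.

Lemma cls_d2gw V : cls (d2gw V).
Proof.
apply: clsM cls_gw; apply: clsD; last exact: cls_cst.
by apply: (cls_eq (f := fun y => mdot (S *m V) y * mdot (S *m V) y)) => [|y]; rewrite ?expr2//; apply: clsM; exact: cls_mdot.
Qed.

Lemma d1gw_bound V : exists2 C, 0 <= C & forall y, `|d1gw V y| <= C * qw y ^+ 1 * gw y.
Proof.
have [C C0 hC] := mdot_le_qw (S *m V); exists C => // y.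
by rewrite expr1 normrM normrN [`|gw y|]ger0_norm ?expR_ge0// ler_wpM2r ?expR_ge0.
Qed.

Lemma d2gw_bound V : exists2 C, 0 <= C & forall y, `|d2gw V y| <= C * qw y ^+ 2 * gw y.
Proof.
have [C C0 hC] := mdot_le_qw (S *m V).
exists (C ^+ 2 + `|mdot (S *m V) V|) => [|y]; first by rewrite addr_ge0 ?sqr_ge0.
rewrite normrM [`|gw y|]ger0_norm ?expR_ge0// ler_wpM2r ?expR_ge0//.
rewrite mulrDl (le_trans (ler_normB _ _))// lerD//.
  by rewrite normrX -exprMn lerXn2r ?nnegrE// mulr_ge0// qw_ge0.
by rewrite ler_peMr// exprn_ege1// qw_ge1.
Qed.

Lemma integrable_gw_trig (f g : M -> R) k C : cls f -> cls g ->
  (forall y, `|f y| <= C * qw y ^+ k * gw y) -> (forall y, `|g y| <= 1) ->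
  leb.-integrable setT (EFin \o (fun y => f y * g y)).
Proof.
move=> cf cg hf hg; apply: (@integrable_gw_dom _ k C); first exact: meas (clsM cf cg).
by move=> y; rewrite normrM; apply: le_trans (ler_piMr _ (hg y)) (hf y).
Qed.

(** Two integrations by parts in the direction V move both derivatives onto the cosine. *)
Lemma gft_d2gw c th V :
  \int[leb]_y (d2gw V y * cos (mdot th y + c)) = - (mdot th V ^+ 2 * gft c th).
Proof.
have [C1 C10 h1] := d1gw_bound V; have [C2 C20 h2] := d2gw_bound V.
have cg := cls_gw.
have csn := cls_trig th c (@sm1_sin R); have ccs := cls_trig th c (@sm1_cos R).
have bs (y : M) : `|sin (mdot th y + c)| <= 1 by have [] := trig_le1 (mdot th y + c).
have bc (y : M) : `|cos (mdot th y + c)| <= 1 by have [] := trig_le1 (mdot th y + c).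
have b0 (y : M) : `|gw y| <= 1 * qw y ^+ 0 * gw y by rewrite expr0 mulr1 mul1r ger0_norm ?expR_ge0.
set a := mdot th V.
have dlin y : is_derive y V (fun y : M => mdot th y + c : R^o) a.
  by rewrite -[X in is_derive _ _ _ X]addr0; apply: is_deriveDV (is_derive_mdot th y V) (is_derive_cst c y V).
have dsn y : is_derive y V (fun y : M => sin (mdot th y + c) : R^o) (a * cos (mdot th y + c)).
  by apply: is_derive_eq (@is_derive_compV _ _ _ (@sin R) (fun y => mdot th y + c) _ _ _ _ (is_derive_sin _) (dlin y)) _; rewrite mulrC.
have dcs y : is_derive y V (fun y : M => cos (mdot th y + c) : R^o) (- a * sin (mdot th y + c)).
  by apply: is_derive_eq (@is_derive_compV _ _ _ (@cos R) (fun y => mdot th y + c) _ _ _ _ (is_derive_cos _) (dlin y)) _; ring.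
have i1s := integrable_gw_trig (cls_d1gw V) csn h1 bs.
have i0c := integrable_gw_trig cg ccs b0 bc.
have e1 : \int[leb]_y (d2gw V y * cos (mdot th y + c)) = - \int[leb]_y (d1gw V y * (- a * sin (mdot th y + c))).
  apply: (@integral_by_parts_mx R m n (d1gw V) (fun y => cos (mdot th y + c)) (d2gw V) _ V).
  - by move=> y; exact: is_derive_d1gw.
  - by apply: cls_cont; exact: cls_d1gw.
  - exact: cls_cont.
  - by apply: cls_cont; exact: cls_d2gw.
  - by apply: cls_cont; exact: clsZ.
  - exact: (integrable_gw_trig (cls_d1gw V) ccs h1 bc).
  - exact: (integrable_gw_trig (cls_d2gw V) ccs h2 bc).
  - rewrite (_ : (fun y => _) = (fun y => - a * (d1gw V y * sin (mdot th y + c)))); first exact: integrableZR.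
    by apply/funext => y; ring.
have e2 : \int[leb]_y (d1gw V y * sin (mdot th y + c)) = - \int[leb]_y (gw y * (a * cos (mdot th y + c))).
  apply: (@integral_by_parts_mx R m n gw (fun y => sin (mdot th y + c)) (d1gw V) _ V).
  - by move=> y; exact: is_derive_gw.
  - exact: cls_cont.
  - exact: cls_cont.
  - by apply: cls_cont; exact: cls_d1gw.
  - by apply: cls_cont; exact: clsZ.
  - exact: (integrable_gw_trig cg csn b0 bs).
  - exact: i1s.
  - rewrite (_ : (fun y => _) = (fun y => a * (gw y * cos (mdot th y + c)))); first exact: integrableZR.
    by apply/funext => y; ring.
rewrite e1 (_ : (fun y => _) = (fun y => - a * (d1gw V y * sin (mdot th y + c)))); last by apply/funext => y; ring.
rewrite RintegralZl// e2 (_ : (fun y => _) = (fun y => a * (gw y * cos (mdot th y + c)))); last by apply/funext => y; ring.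
rewrite RintegralZl// -/(gft c th); ring.
Qed.

End gaussian_weight.

Section maxwellian.
Context {R : realType} {d K : nat}.
Notation M := 'M[R]_(K.+1, d).
Notation leb := (@leb_mx R K.+1 d).
Variable Sg : 'M[R]_K.+1.
Hypothesis sS : spd Sg.
Notation M0 := (@maxwellian R d K Sg).

Definition mw_cst : R := (2 * pi) `^ (- ((d * K.+1)%:R / 2)) * (\det Sg) `^ (- (d%:R / 2)).

Lemma maxwellianE y : M0 y = mw_cst * gw Sg y.
Proof. by []. Qed.

Let det_gt0 : 0 < \det Sg.
Proof. by have [] := gauss_mx d sS. Qed.

Let pi2_gt0 : 0 < 2 * pi :> R.
Proof. by rewrite mulr_gt0// pi_gt0. Qed.

Lemma mw_cst_gt0 : 0 < mw_cst.
Proof. by rewrite mulr_gt0// powR_gt0. Qed.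

Lemma mw_mass : mw_cst * \int[leb]_y gw Sg y = 1.
Proof.
have [_ e] := gauss_mx d (spd_inv sS).
rewrite /Rintegral e /= det_inv invrK.
set a := 2 * pi; set D := \det Sg.
have X0 : 0 <= a ^+ K.+1 * D by rewrite mulr_ge0 ?exprn_ge0 ?ltW.
rewrite -powR12_sqrt// -[(_ `^ _) ^+ d]powR_mulrn ?powR_ge0// -powRrM.
rewrite powRM ?exprn_ge0 ?ltW// -[a ^+ K.+1]powR_mulrn ?ltW// -powRrM /mw_cst -/a -/D.
have -> : K.+1%:R * (2^-1 * d%:R) = (d * K.+1)%:R / 2 :> R by rewrite natrM; field.
have -> : 2^-1 * d%:R = d%:R / 2 :> R by rewrite mulrC.
rewrite !powRN mulrACA !mulVf ?mulr1// gt_eqF// powR_gt0//.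
Qed.

Definition lapM0 (y : M) : R := mw_cst * \sum_(l < d) d2gw Sg (delta_mx ord_max l) y.

Lemma lapM0_ft c th : \int[leb]_y (lapM0 y * cos (mdot th y + c)) =
  - (\sum_(l < d) th ord_max l ^+ 2) * (cos c * expR (- (1 / 2) * mdot th (Sg *m th))).
Proof.
have ci : cls (fun y : M => cos (mdot th y + c)).
  by apply: cls_comp; [exact: sm1_cos|apply: clsD; [exact: cls_mdot|exact: cls_cst]].
have ii l : leb.-integrable setT (EFin \o (fun y => d2gw Sg (delta_mx ord_max l) y * cos (mdot th y + c))).
  have [C C0 h] := d2gw_bound sS (delta_mx ord_max l : M).
  apply: (integrable_gw_trig sS (cls_d2gw Sg _) ci h).
  by move=> y; rewrite ler_norml cos_geN1 cos_le1.
rewrite (_ : (fun y => _) = (fun y => mw_cst * \sum_(l < d) (d2gw Sg (delta_mx ord_max l) y * cos (mdot th y + c)))); last first.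
  by apply/funext => y; rewrite /lapM0 -mulrA mulr_suml.
rewrite RintegralZl//; last exact: integrable_sumR.
rewrite Rintegral_sum//.
under eq_bigr => l _ do rewrite (gft_d2gw sS) mdotC mdot_delta (gftE sS).
have m := mw_mass.
rewrite sumrN -mulr_suml; set s := \sum_(l < d) _; set z := cos c * _.
rewrite -[RHS]mulr1 -m; ring.
Qed.

End maxwellian.

(** * Real and imaginary parts *)

Section complex_parts.
Context {R : realType}.
Implicit Types (z w : R[i]) (x : R).
Notation Re := complex.Re.
Notation Im := complex.Im.

Lemma cReD z w : Re (z + w) = Re z + Re w. Proof. by case: z; case: w. Qed.
Lemma cImD z w : Im (z + w) = Im z + Im w. Proof. by case: z; case: w. Qed.
Lemma cReN z : Re (- z) = - Re z. Proof. by case: z. Qed.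
Lemma cImN z : Im (- z) = - Im z. Proof. by case: z. Qed.
Lemma cReB z w : Re (z - w) = Re z - Re w. Proof. by case: z; case: w. Qed.
Lemma cImB z w : Im (z - w) = Im z - Im w. Proof. by case: z; case: w. Qed.
Lemma cReM z w : Re (z * w) = Re z * Re w - Im z * Im w. Proof. by case: z; case: w. Qed.
Lemma cImM z w : Im (z * w) = Re z * Im w + Im z * Re w. Proof. by case: z; case: w. Qed.
Lemma cReC x : Re x%:C = x. Proof. by []. Qed.
Lemma cImC x : Im x%:C = 0. Proof. by []. Qed.
Lemma cRei : Re 'i = 0 :> R. Proof. by []. Qed.
Lemma cImi : Im 'i = 1 :> R. Proof. by []. Qed.
Lemma cRe0 : Re 0 = 0 :> R. Proof. by []. Qed.
Lemma cIm0 : Im 0 = 0 :> R. Proof. by []. Qed.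
Lemma cRe_sum (I : Type) (r : seq I) (f : I -> R[i]) : Re (\sum_(i <- r) f i) = \sum_(i <- r) Re (f i).
Proof. by elim/big_rec2 : _ => // i x z _ <-; rewrite cReD. Qed.
Lemma cIm_sum (I : Type) (r : seq I) (f : I -> R[i]) : Im (\sum_(i <- r) f i) = \sum_(i <- r) Im (f i).
Proof. by elim/big_rec2 : _ => // i x z _ <-; rewrite cImD. Qed.

Definition cE := (cReD, cImD, cReN, cImN, cReM, cImM, cReC, cImC, cRei, cImi, cRe0, cIm0).

Lemma complex_eq z w : Re z = Re w -> Im z = Im w -> z = w.
Proof. by case: z => a b; case: w => c e /= -> ->. Qed.

Notation normc := ComplexField.Normc.normc.

Lemma normc_sq z : normc z ^+ 2 = Re z ^+ 2 + Im z ^+ 2.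
Proof. by case: z => a b /=; rewrite sqr_sqrtr// addr_ge0 ?sqr_ge0. Qed.

Lemma normc_ge0' z : 0 <= normc z. Proof. by case: z => a b; exact: sqrtr_ge0. Qed.

(** Inside the absolute value stands the real part of z e^(-ix). *)
Lemma pair_le_normc z x : `|Re z * cos x + Im z * sin x| <= normc z.
Proof.
rewrite -(@ler_pXn2r _ 2) ?nnegrE ?normc_ge0'//.
rewrite real_normK ?num_real// normc_sq.
have := cos2Dsin2 x; have := sqr_ge0 (Re z * sin x - Im z * cos x).
move: (cos x) (sin x) (Re z) (Im z) => u v a b h1 h2.
have -> : a ^+ 2 + b ^+ 2 = (a ^+ 2 + b ^+ 2) * (u ^+ 2 + v ^+ 2) by rewrite h2 mulr1.
nra.
Qed.

Lemma normcM' z w : normc (z * w) = normc z * normc w.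
Proof. exact: ComplexField.Normc.normcM. Qed.

End complex_parts.

Lemma is_derive_MVT_itv {R : realType} (f df : R -> R) (a b : R) : a <= b ->
  (forall t : R, a <= t <= b -> is_derive t 1 (f : R -> R^o) (df t)) ->
  exists2 c, a <= c <= b & f b - f a = df c * (b - a).
Proof.
move=> ab h.
have cf : {within `[a, b], continuous f}.
  apply: derivable_within_continuous => x; rewrite in_itv/= => hx.
  by have [] := h x hx.
have hd (x : R) : x \in `]a, b[ -> is_derive x 1 (f : R -> R^o) (df x).
  by rewrite in_itv/= => /andP[/ltW ax /ltW xb]; apply: h; rewrite ax.
have [c] := MVT_segment ab hd cf.
by rewrite in_itv/= => cab e; exists c.
Qed.

(** * The weighted space and test functions *)

Section Hspace.
Context {R : realType} {d K : nat}.
Notation M := 'M[R]_(K.+1, d).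
Notation leb := (@leb_mx R K.+1 d).
Notation normc := ComplexField.Normc.normc.
Notation Re := complex.Re.
Notation Im := complex.Im.
Variable Sg : 'M[R]_K.+1.
Hypothesis sS : spd Sg.
Notation M0 := (@maxwellian R d K Sg).
Implicit Types (u v : M -> R[i]).

Lemma cmeasurable_normc u : cmeasurable u -> measurable_fun setT (fun y => normc (u y)).
Proof.
move=> [mr mi].
rewrite (_ : (fun y => _) = (fun y => Num.sqrt (Re (u y) ^+ 2 + Im (u y) ^+ 2))).
  apply: (measurableT_comp (continuous_measurable_fun (@sqrt_continuous R))).
  by apply: measurable_funD; exact: measurable_funX.
by apply/funext => y; rewrite -normc_sq sqrtr_sqr ger0_norm// normc_ge0'.
Qed.

Lemma M0_gt0 y : 0 < M0 y.
Proof. by rewrite maxwellianE mulr_gt0 ?mw_cst_gt0 ?gw_gt0. Qed.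

Lemma cls_M0 : cls M0.
Proof. exact: clsZ (cls_gw Sg). Qed.

Lemma measurable_M0 : measurable_fun [set: M] M0.
Proof. by apply: continuous_measurable_mx; apply: cls_cont; exact: cls_M0. Qed.

Lemma M0_mass : (\int[leb]_y (M0 y)%:E = 1)%E.
Proof.
have i : leb.-integrable setT (EFin \o M0).
  apply: (@integrable_gw_dom _ _ _ _ sS _ 0 (mw_cst Sg)); first exact: measurable_M0.
  by move=> y; rewrite expr0 mulr1 (ger0_norm (ltW (M0_gt0 y))) maxwellianE.
rewrite -[LHS]fineK; last exact: integrable_fin_num.
rewrite -[fine _]/(\int[leb]_y (mw_cst Sg * gw Sg y)) RintegralZl ?mw_mass//.
apply: (@integrable_gw_dom _ _ _ _ sS _ 0 1).
  by apply: continuous_measurable_mx; apply: cls_cont; exact: cls_gw.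
by move=> y; rewrite expr0 mulr1 mul1r ger0_norm ?(ltW (gw_gt0 _ _)).
Qed.

(** Young's inequality |u| <= |u|^2 / (2 e M_0) + e M_0 / 2, whose defect is a square. Since M_0 has
    mass 1, each term integrates to at most e / 2. This is the embedding of H in L^1 with constant
    1. *)
Lemma H_small u (e : R) : 0 < e -> cmeasurable u -> (H_normsq M0 u <= (e ^+ 2)%:E)%E ->
  leb.-integrable setT (EFin \o (fun y => normc (u y))) /\ \int[leb]_y normc (u y) <= e.
Proof.
move=> e0 mu hu; have mn := cmeasurable_normc mu.
have mq : measurable_fun setT (fun y => normc (u y) ^+ 2 / M0 y).
  have -> : (fun y : M => normc (u y) ^+ 2 / M0 y) =
      (fun y => normc (u y) ^+ 2 * ((@mw_cst R d K Sg)^-1 * expR ((1 / 2) * qform (invmx Sg) y))).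
    by apply/funext => y; rewrite maxwellianE invfM /gw -expRN mulNr opprK.
  apply: measurable_funM; first exact: measurable_funX.
  by apply: measurable_funM => //; apply: continuous_measurable_mx; apply: cls_cont; exact: cls_gauss.
have key : (\int[leb]_y (normc (u y))%:E <= e%:E)%E.
  apply: (@le_trans _ _ (\int[leb]_y ((2 * e)^-1 * (normc (u y) ^+ 2 / M0 y) + e / 2 * M0 y)%:E)%E).
    apply: ge0_le_integral => //.
    - by move=> y _; rewrite lee_fin normc_ge0'.
    - exact/measurable_EFinP.
    - apply/measurable_EFinP; apply: measurable_funD; first exact: measurable_funM.
      by apply: measurable_funM => //; exact: measurable_M0.
    - move=> y _; rewrite lee_fin; have p := M0_gt0 y; have n0 := normc_ge0' (u y).
      move: (normc _) (M0 y) n0 p => a m a0 m0.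
      rewrite -subr_ge0 (_ : _ - a = (a / e - m) ^+ 2 * e / (2 * m)); last by field; rewrite !gt_eqF.
      by apply: divr_ge0; apply: mulr_ge0 => //; rewrite ?sqr_ge0// ltW.
  rewrite (eq_integral (fun y => (((2 * e)^-1)%:E * (normc (u y) ^+ 2 / M0 y)%:E + (e / 2)%:E * (M0 y)%:E)%E)); last first.
    by move=> y _; rewrite -!EFinM -EFinD.
  have p1 y : (0 <= ((2 * e)^-1)%:E * (normc (u y) ^+ 2 / M0 y)%:E)%E.
    apply: mule_ge0; rewrite lee_fin; first by rewrite invr_ge0 mulr_ge0// ltW.
    by apply: divr_ge0; [exact: sqr_ge0|rewrite ltW ?M0_gt0].
  have p2 y : (0 <= (e / 2)%:E * (M0 y)%:E)%E.
    by apply: mule_ge0; rewrite lee_fin; [rewrite divr_ge0// ltW|rewrite ltW ?M0_gt0].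
  rewrite ge0_integralD//; last 2 first.
  - by apply: measurable_funeM; exact/measurable_EFinP.
  - by apply: measurable_funeM; apply/measurable_EFinP; exact: measurable_M0.
  rewrite ge0_integralZl//; last 3 first.
  - exact/measurable_EFinP.
  - by move=> y _; rewrite lee_fin divr_ge0 ?sqr_ge0 ?(ltW (M0_gt0 _)).
  - by rewrite lee_fin invr_ge0 mulr_ge0 ?ltW.
  rewrite ge0_integralZl//; last 3 first.
  - by apply/measurable_EFinP; exact: measurable_M0.
  - by move=> y _; rewrite lee_fin ltW ?M0_gt0.
  - by rewrite lee_fin divr_ge0 ?ltW.
  rewrite M0_mass mule1.
  apply: (@le_trans _ _ (((2 * e)^-1)%:E * (e ^+ 2)%:E + (e / 2)%:E)%E).
    by rewrite leeD2r// lee_wpmul2l// lee_fin invr_ge0 mulr_ge0 ?ltW.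
  rewrite -EFinM -EFinD lee_fin (_ : _ + _ = e)//; field.
  by rewrite gt_eqF.
have i : leb.-integrable setT (EFin \o (fun y => normc (u y))).
  apply/integrableP; split; first exact/measurable_EFinP.
  under eq_integral do rewrite /= ger0_norm ?normc_ge0'//.
  by apply: le_lt_trans key _; rewrite ltry.
split=> //; rewrite -lee_fin; apply: le_trans key.
by rewrite /Rintegral fineK//; exact: integrable_fin_num.
Qed.

Lemma H_integrable u : in_H M0 u -> leb.-integrable setT (EFin \o (fun y => normc (u y))).
Proof.
move=> [mu hu]; have h0 : (0 <= H_normsq M0 u)%E.
  by apply: integral_ge0 => y _; rewrite lee_fin divr_ge0 ?sqr_ge0 ?(ltW (M0_gt0 _)).
have e0 : 0 < 1 + fine (H_normsq M0 u) by rewrite ltr_pwDl ?fine_ge0.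
have [] // := H_small e0 mu.
rewrite -[leLHS]fineK ?ge0_fin_numE// lee_fin.
by have := fine_ge0 h0; move: (fine _) => x x0; nra.
Qed.

(** Real part of the integral of u e^(-i (th . y + c)). *)
Definition fourier_part (c : R) (th : M) u : R :=
  \int[leb]_y (Re (u y) * cos (mdot th y + c) + Im (u y) * sin (mdot th y + c)).

Let mtrig (g : R -> R) c th : sm1 g -> measurable_fun [set: M] (fun y => g (mdot th y + c)).
Proof.
move=> sg; apply: continuous_measurable_mx; apply: cls_cont; apply: cls_comp => //.
by apply: clsD; [exact: cls_mdot|exact: cls_cst].
Qed.

Lemma fourier_part_integrable c th u : cmeasurable u ->
  leb.-integrable setT (EFin \o (fun y => normc (u y))) ->
  leb.-integrable setT (EFin \o (fun y => Re (u y) * cos (mdot th y + c) + Im (u y) * sin (mdot th y + c))).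
Proof.
move=> [mr mi] i; apply: le_integrable i => //.
  apply/measurable_EFinP; apply: measurable_funD; apply: measurable_funM => //.
    exact: mtrig (@sm1_cos R).
  exact: mtrig (@sm1_sin R).
by move=> y _; rewrite /= lee_fin [leRHS]ger0_norm ?normc_ge0' ?pair_le_normc.
Qed.

Lemma fourier_part_le c th u : cmeasurable u ->
  leb.-integrable setT (EFin \o (fun y => normc (u y))) ->
  `|fourier_part c th u| <= \int[leb]_y normc (u y).
Proof.
move=> mu i; have i2 := fourier_part_integrable c th mu i.
apply: le_trans (le_normr_Rintegral measurableT i2) _.
apply: le_Rintegral => //.
  exact: (integrable_abse i2).
by move=> y _; exact: pair_le_normc.
Qed.

Lemma pcB c th u v : cmeasurable u -> cmeasurable v ->
  leb.-integrable setT (EFin \o (fun y => normc (u y))) ->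
  leb.-integrable setT (EFin \o (fun y => normc (v y))) ->
  fourier_part c th (fun y => u y - v y) = fourier_part c th u - fourier_part c th v.
Proof.
move=> mu mv iu iv; rewrite /fourier_part -RintegralB//; try exact: fourier_part_integrable.
by apply: eq_Rintegral => y _; rewrite cReB cImB; ring.
Qed.

End Hspace.

Section continuous_ops.
Context {R : realType} {T : topologicalType}.
Implicit Types f g : T -> R.

Lemma continuous_mulR f g : continuous (f : T -> R^o) -> continuous (g : T -> R^o) ->
  continuous ((fun y => f y * g y) : T -> R^o).
Proof. by move=> cf cg y; exact: (@continuousM R T f g y (cf y) (cg y)). Qed.

Lemma continuous_addR f g : continuous (f : T -> R^o) -> continuous (g : T -> R^o) ->
  continuous ((fun y => f y + g y) : T -> R^o).
Proof. by move=> cf cg y; exact: (@continuousD R R^o T f g y (cf y) (cg y)). Qed.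

Lemma continuous_scaleR c f : continuous (f : T -> R^o) -> continuous ((fun y => c * f y) : T -> R^o).
Proof. by apply: continuous_mulR => y; exact: cvg_cst. Qed.

Lemma continuous_oppR f : continuous (f : T -> R^o) -> continuous ((fun y => - f y) : T -> R^o).
Proof. by move=> cf y; exact: (@continuousN R R^o T f y (cf y)). Qed.

Lemma continuous_sumR (I : Type) (r : seq I) (h : I -> T -> R) :
  (forall i, continuous (h i : T -> R^o)) -> continuous ((fun y => \sum_(i <- r) h i y) : T -> R^o).
Proof.
move=> ch; elim: r => [|i r IH].
  by rewrite (_ : (fun y => _) = cst 0); [move=> y; exact: cvg_cst|apply/funext => y; rewrite big_nil].
rewrite (_ : (fun y => _) = (fun y => h i y + \sum_(j <- r) h j y)); first exact: continuous_addR.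
by apply/funext => y; rewrite big_cons.
Qed.

End continuous_ops.

(** * Pairing test functions with plane waves *)

Section test_pairing.
Context {R : realType} {d K : nat}.
Notation M := 'M[R]_(K.+1, d).
Notation leb := (@leb_mx R K.+1 d).
Notation E k l := (delta_mx k l : M).

(** The compact set is a parameter, so that one set serves the real part, the imaginary part and all
    derivatives of a test function. *)
Definition ctest (Kc : set M) (a : M -> R) :=
  [/\ smooth a, compact Kc, closed Kc & forall y, ~ Kc y -> a y = 0].

Lemma smooth_cont (a : M -> R) : smooth a -> continuous (a : M -> R^o).
Proof. by move=> /(_ [::])[]. Qed.

Lemma smooth_is_derive (a : M -> R) k l y : smooth a ->
  is_derive y (E k l) (a : M -> R^o) ('D_(E k l) (a : M -> R^o) y).
Proof. by move=> /(_ [::])[_ h]; split=> //; exact: h. Qed.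

Lemma smooth_D (a : M -> R) k l : smooth a -> smooth ('D_(E k l) (a : M -> R^o)).
Proof.
move=> ha s; have := ha (rcons s (k, l)).
suff -> : iter_partial (rcons s (k, l)) a = iter_partial s ('D_(E k l) (a : M -> R^o)) by [].
by rewrite /iter_partial foldr_rcons.
Qed.

(** Off the closed set Kc the function vanishes near each point, and so does its derivative. *)
Lemma ctest_D Kc (a : M -> R) k l : ctest Kc a -> ctest Kc ('D_(E k l) (a : M -> R^o)).
Proof.
move=> [sa cK clK a0]; split=> //; first exact: smooth_D.
move=> y Ky; have oK : open (~` Kc) by exact: closed_openC.
have nb : \near y, (fun=> 0 : R^o) y = (a : M -> R^o) y.
  have : nbhs y (~` Kc) by exact: open_nbhs_nbhs.
  by apply: filterS => z Kz; rewrite a0.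
by rewrite -(near_eq_derive _ nb) derive_cst.
Qed.

Lemma ctest_integrable Kc (a g : M -> R) : ctest Kc a -> continuous (g : M -> R^o) ->
  leb.-integrable setT (EFin \o (fun y => a y * g y)).
Proof.
move=> [sa cK _ a0] cg; apply: (@integrable_compact _ _ _ _ Kc) => //.
  by apply: continuous_mulR => //; exact: smooth_cont.
by move=> y Ky; rewrite a0// mul0r.
Qed.

Lemma ctest_ibp Kc (a f g dg : M -> R) k l : ctest Kc a -> cls g -> cls f -> cls dg ->
  (forall y, is_derive y (E k l) (g : M -> R^o) (dg y)) ->
  \int[leb]_y ('D_(E k l) (fun z => f z * a z : R^o) y * g y) = - \int[leb]_y (a y * (f y * dg y)).
Proof.
move=> ha cg cf cdg hg; have [sa _ _ _] := ha; have [sda _ _ _] := ctest_D k l ha.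
have [df cdf hf] := cls_der (E k l) cf.
have hfa y := is_deriveMV (hf y) (smooth_is_derive k l y sa).
have -> : \int[leb]_y ('D_(E k l) (fun z => f z * a z : R^o) y * g y) =
    \int[leb]_y ((df y * a y + f y * 'D_(E k l) (a : M -> R^o) y) * g y).
  by apply: eq_Rintegral => y _; congr (_ * _); exact: (@derive_val _ _ _ _ _ _ _ (hfa y)).
have ca := smooth_cont sa; have cda := smooth_cont sda.
have h := @integral_by_parts_mx R K.+1 d (fun y => f y * a y) g (fun y => df y * a y + f y * 'D_(E k l) (a : M -> R^o) y) dg (E k l) hfa hg.
have -> : \int[leb]_y (a y * (f y * dg y)) = \int[leb]_y ((f y * a y) * dg y).
  by apply: eq_Rintegral => y _; ring.
apply: h.
- by apply: continuous_mulR => //; exact: cls_cont.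
- exact: cls_cont.
- by apply: continuous_addR; apply: continuous_mulR => //; exact: cls_cont.
- exact: cls_cont.
- rewrite (_ : (fun y => _) = (fun y => a y * (f y * g y))); last by apply/funext => y; ring.
  by apply: (ctest_integrable ha); apply: cls_cont; exact: clsM.
- rewrite (_ : (fun y => _) = (fun y => a y * (df y * g y) + 'D_(E k l) (a : M -> R^o) y * (f y * g y))); last by apply/funext => y; ring.
  apply: integrableDR => //.
    by apply: (ctest_integrable ha); apply: cls_cont; exact: clsM.
  by apply: (ctest_integrable (ctest_D k l ha)); apply: cls_cont; exact: clsM.
- rewrite (_ : (fun y => _) = (fun y => a y * (f y * dg y))); last by apply/funext => y; ring.
  by apply: (ctest_integrable ha); apply: cls_cont; exact: clsM.
Qed.

(* The real part of the operator: [B_expr] without the multiplication by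
   - i q . y^1. *)
Definition B_real (A : 'M[R]_K.+1) (g0 : R) (a : M -> R) (y : M) : R :=
  - (\sum_(k < K.+1) \sum_(l < d) 'D_(E k l) (fun z => (A *m z) k l * a z : R^o) y) +
  g0 ^+ 2 / 2 * \sum_(l < d) 'D_(E ord_max l) ('D_(E ord_max l) (a : M -> R^o) : M -> R^o) y.

Lemma cls_mulmx (A : 'M[R]_K.+1) k l : cls (fun z : M => (A *m z) k l).
Proof.
apply: (@cls_eq _ _ _ (fun z => \sum_j A k j * z j l)); last by move=> z; rewrite mxE.
by apply: cls_sum => j; apply: clsZ; exact: cls_coord.
Qed.

Lemma is_derive_cosdot th c (V y : M) : is_derive y V (fun z => cos (mdot th z + c) : R^o)
  (- mdot th V * sin (mdot th y + c)).
Proof.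
have dlin : is_derive y V (fun y : M => mdot th y + c : R^o) (mdot th V).
  by rewrite -[X in is_derive _ _ _ X]addr0; apply: is_deriveDV (is_derive_mdot th y V) (is_derive_cst c y V).
by apply: is_derive_eq (@is_derive_compV _ _ _ (@cos R) (fun y => mdot th y + c) _ _ _ _ (is_derive_cos _) dlin) _; ring.
Qed.

Lemma is_derive_sindot th c (V y : M) : is_derive y V (fun z => sin (mdot th z + c) : R^o)
  (mdot th V * cos (mdot th y + c)).
Proof.
have dlin : is_derive y V (fun y : M => mdot th y + c : R^o) (mdot th V).
  by rewrite -[X in is_derive _ _ _ X]addr0; apply: is_deriveDV (is_derive_mdot th y V) (is_derive_cst c y V).
by apply: is_derive_eq (@is_derive_compV _ _ _ (@sin R) (fun y => mdot th y + c) _ _ _ _ (is_derive_sin _) dlin) _; ring.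
Qed.

Lemma cls_trigdot (g : R -> R) th c : sm1 g -> cls (fun y : M => g (mdot th y + c)).
Proof. by move=> sg; apply: cls_comp => //; apply: clsD; [exact: cls_mdot|exact: cls_cst]. Qed.

Lemma B_real_continuous A g0 Kc a : ctest Kc a -> ctest Kc a /\ continuous (B_real A g0 a : M -> R^o) /\
  (forall y, ~ Kc y -> B_real A g0 a y = 0).
Proof.
move=> ha; split=> //.
have [sa _ _ a0] := ha.
have ep k l y : 'D_(E k l) (fun z => (A *m z) k l * a z : R^o) y =
    'D_(E k l) (fun z : M => (A *m z) k l : R^o) y * a y + (A *m y) k l * 'D_(E k l) (a : M -> R^o) y.
  apply: derive_val.
  exact: is_deriveMV (cls_is_derive _ _ (cls_mulmx A k l)) (smooth_is_derive k l y sa).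
have e k l : 'D_(E k l) (fun z => (A *m z) k l * a z : R^o) =
    (fun y => 'D_(E k l) (fun z : M => (A *m z) k l : R^o) y * a y + (A *m y) k l * 'D_(E k l) (a : M -> R^o) y).
  by apply/funext => y; exact: ep.
split.
  apply: continuous_addR.
    apply: continuous_oppR; apply: continuous_sumR => k; apply: continuous_sumR => l.
    rewrite e; apply: continuous_addR; apply: continuous_mulR.
    - by apply: cls_cont; apply: cls_derive; exact: cls_mulmx.
    - exact: smooth_cont.
    - by apply: cls_cont; exact: cls_mulmx.
    - by apply: smooth_cont; exact: smooth_D.
  apply: continuous_scaleR; apply: continuous_sumR => l.
  by apply: smooth_cont; apply: smooth_D; exact: smooth_D.
move=> y Ky; rewrite /B_real !big1 ?oppr0 ?mulr0 ?addr0//.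
  by move=> l _; have [_ _ _] := ctest_D ord_max l (ctest_D ord_max l ha); apply.
move=> k _; rewrite big1// => l _; rewrite ep a0// mulr0 add0r.
by have [_ _ _ ->//] := ctest_D k l ha; rewrite mulr0.
Qed.

(** All derivatives are moved onto the cosine. The adjoint is (A y) . nabla + (g0^2 / 2)
    Delta_{y^K}: the drift turns the frequency th into A^T th and the Laplacian multiplies by the
    last row of th squared. *)
Lemma B_real_adjoint A g0 Kc a th c : ctest Kc a ->
  \int[leb]_y (B_real A g0 a y * cos (mdot th y + c)) =
  \int[leb]_y (a y * (- mdot (A^T *m th) y * sin (mdot th y + c) -
     (g0 ^+ 2 / 2 * \sum_(l < d) th ord_max l ^+ 2) * cos (mdot th y + c))).
Proof.
move=> ha; have [sa _ _ _] := ha.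
have ccs := cls_trigdot th c (@sm1_cos R); have csn := cls_trigdot th c (@sm1_sin R).
have thE k l : mdot th (E k l) = th k l by rewrite mdotC mdot_delta.
have dcs k l y : is_derive y (E k l) (fun z => cos (mdot th z + c) : R^o) (- th k l * sin (mdot th y + c)).
  by rewrite -thE; exact: is_derive_cosdot.
have dsn k l y : is_derive y (E k l) (fun z => sin (mdot th z + c) : R^o) (th k l * cos (mdot th y + c)).
  by rewrite -thE; exact: is_derive_sindot.
have t1 k l : \int[leb]_y ('D_(E k l) (fun z => (A *m z) k l * a z : R^o) y * cos (mdot th y + c)) =
    \int[leb]_y (a y * ((th k l * (A *m y) k l) * sin (mdot th y + c))).
  rewrite (ctest_ibp ha ccs (cls_mulmx A k l) (clsZ _ csn) (dcs k l)).
  rewrite -mulN1r -RintegralZl//; first by apply: eq_Rintegral => y _; ring.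
  by apply: (ctest_integrable ha); apply: cls_cont; apply: clsM (cls_mulmx A k l) (clsZ _ csn).
have one : @cls R K.+1 d (fun=> 1 : R) := cls_cst 1.
have t2 l : \int[leb]_y ('D_(E ord_max l) ('D_(E ord_max l) (a : M -> R^o) : M -> R^o) y * cos (mdot th y + c)) =
    \int[leb]_y (a y * (- th ord_max l ^+ 2 * cos (mdot th y + c))).
  have o (f : M -> R) : (fun z => 1 * f z) = f by apply/funext => z; rewrite mul1r.
  have h1 := ctest_ibp (ctest_D ord_max l ha) ccs one (clsZ _ csn) (dcs ord_max l).
  have h2 := ctest_ibp ha csn one (clsZ _ ccs) (dsn ord_max l).
  rewrite o in h1; rewrite o in h2; rewrite h1.
  rewrite (_ : \int[leb]_y _ = - th ord_max l * \int[leb]_y ('D_(E ord_max l) (a : M -> R^o) y * sin (mdot th y + c))); last first.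
    rewrite -RintegralZl//; first by apply: eq_Rintegral => y _; ring.
    by apply: (ctest_integrable (ctest_D ord_max l ha)); exact: cls_cont.
  rewrite h2 mulrNN -mulNr -RintegralZl//; first by apply: eq_Rintegral => y _; ring.
  by apply: (ctest_integrable ha); apply: cls_cont; apply: clsM one (clsZ _ ccs).
have i1 k l : leb.-integrable setT (EFin \o (fun y => 'D_(E k l) (fun z => (A *m z) k l * a z : R^o) y * cos (mdot th y + c))).
  have hf := cls_is_derive (E k l) _ (cls_mulmx A k l).
  rewrite (_ : (fun y => _) = (fun y => a y * ('D_(E k l) (fun z : M => (A *m z) k l : R^o) y * cos (mdot th y + c)) +
     'D_(E k l) (a : M -> R^o) y * ((A *m y) k l * cos (mdot th y + c)))); last first.
    apply/funext => y.
    rewrite (@derive_val _ _ _ _ _ _ _ (is_deriveMV (hf y) (smooth_is_derive k l y sa))); ring.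
  apply: integrableDR => //.
    by apply: (ctest_integrable ha); apply: cls_cont; apply: clsM => //; apply: cls_derive; exact: cls_mulmx.
  by apply: (ctest_integrable (ctest_D k l ha)); apply: cls_cont; apply: clsM => //; exact: cls_mulmx.
have i2 l : leb.-integrable setT (EFin \o (fun y => 'D_(E ord_max l) ('D_(E ord_max l) (a : M -> R^o) : M -> R^o) y * cos (mdot th y + c))).
  by apply: (ctest_integrable (ctest_D ord_max l (ctest_D ord_max l ha))); exact: cls_cont.
have j1 k l : leb.-integrable setT (EFin \o (fun y => a y * ((th k l * (A *m y) k l) * sin (mdot th y + c)))).
  by apply: (ctest_integrable ha); apply: cls_cont; apply: clsM => //; apply: clsZ; exact: cls_mulmx.
have j2 l : leb.-integrable setT (EFin \o (fun y => a y * (- th ord_max l ^+ 2 * cos (mdot th y + c)))).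
  by apply: (ctest_integrable ha); apply: cls_cont; exact: clsZ.
have si1 k := integrable_sumR measurableT (index_enum 'I_d) (fun l => i1 k l).
have sj1 k := integrable_sumR measurableT (index_enum 'I_d) (fun l => j1 k l).
have ssi1 := integrable_sumR measurableT (index_enum 'I_K.+1) si1.
have ssj1 := integrable_sumR measurableT (index_enum 'I_K.+1) sj1.
have si2 := integrable_sumR measurableT (index_enum 'I_d) i2.
have sj2 := integrable_sumR measurableT (index_enum 'I_d) j2.
transitivity (-1 * \sum_(k < K.+1) \sum_(l < d) \int[leb]_y ('D_(E k l) (fun z => (A *m z) k l * a z : R^o) y * cos (mdot th y + c)) +
  g0 ^+ 2 / 2 * \sum_(l < d) \int[leb]_y ('D_(E ord_max l) ('D_(E ord_max l) (a : M -> R^o) : M -> R^o) y * cos (mdot th y + c))).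
  under [in RHS]eq_bigr => k _ do rewrite -Rintegral_sum//.
  rewrite -Rintegral_sum// -[in RHS]Rintegral_sum// -RintegralZl// -RintegralZl//.
  rewrite -RintegralD//; [|exact: integrableZR|exact: integrableZR].
  apply: eq_Rintegral => y _; rewrite /B_real mulrDl mulNr mulN1r -mulrA !mulr_suml.
  by congr (- _ + _); apply: eq_bigr => k _; rewrite mulr_suml.
under eq_bigr => k _ do (under eq_bigr => l _ do rewrite t1; rewrite -Rintegral_sum//).
under [X in _ + _ * X]eq_bigr => l _ do rewrite t2.
rewrite -Rintegral_sum// -[in LHS]Rintegral_sum// -RintegralZl// -RintegralZl//.
rewrite -RintegralD//; [|exact: integrableZR|exact: integrableZR].
apply: eq_Rintegral => y _.
rewrite -mdotMr /mdot.
have -> : \sum_(i < K.+1) \sum_(l < d) (a y * (th i l * (A *m y) i l * sin (\sum_i \sum_j th i j * y i j + c))) =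
    a y * ((\sum_i \sum_j th i j * (A *m y) i j) * sin (\sum_i \sum_j th i j * y i j + c)).
  rewrite mulr_suml mulr_sumr; apply: eq_bigr => i _.
  by rewrite mulr_suml mulr_sumr.
have -> : \sum_(i < d) (a y * (- th ord_max i ^+ 2 * cos (\sum_i \sum_j th i j * y i j + c))) =
    a y * (- (\sum_(l < d) th ord_max l ^+ 2) * cos (\sum_i \sum_j th i j * y i j + c)).
  by rewrite -mulr_sumr -mulr_suml sumrN.
ring.
Qed.

End test_pairing.

Lemma continuous_itv_bounded {R : realType} (f : R -> R) (a b : R) : a <= b ->
  continuous (f : R -> R^o) -> exists2 C, 0 <= C & forall x, a <= x <= b -> `|f x| <= C.
Proof.
move=> ab cf.
have cn : {within `[a, b], continuous (fun x => `|f x|)}.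
  by apply: continuous_subspaceT => x; apply: (@continuous_comp _ _ _ f (fun y : R => `|y|)); [exact: cf|exact: norm_continuous].
have [c _ h] := EVT_max ab cn.
by exists `|f c| => // x hx; apply: h; rewrite in_itv/=.
Qed.

(** Triangle inequality passing from an approximant, with values x1 and x2 at two times, to its
    limit, with values x3 and x4. *)
Lemma norm_transfer {R : realDomainType} (x1 x2 x3 x4 x5 x6 e z : R) :
  `|x1 - x3| <= e -> `|x2 - x4| <= e -> `|x1 + x5 - (x2 + x6)| <= z ->
  `|x3 - x4 + (x5 - x6)| <= 2 * e + z.
Proof.
move=> h1 h2 h3.
rewrite (_ : x3 - x4 + _ = (x1 + x5 - (x2 + x6)) - (x1 - x3) + (x2 - x4)); last by ring.
by have := ler_normD (x1 + x5 - (x2 + x6) - (x1 - x3)) (x2 - x4);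
  have := ler_normB (x1 + x5 - (x2 + x6)) (x1 - x3); lra.
Qed.

(** * From an eigenfunction to the dispersion relation *)

Section forward.
Context {R : realType} {d K : nat} (alpha : 'I_K.+1 -> R).
Hypothesis alpha_gt0 : forall k, 0 < alpha k.
Variable g0 : R.
Hypothesis g0_gt0 : 0 < g0.
Variable q : 'rV[R]_d.
Variable lambda : R[i].
Notation M := 'M[R]_(K.+1, d).
Notation leb := (@leb_mx R K.+1 d).
Notation E k l := (delta_mx k l : M).
Notation A := (drift alpha).
Notation Sg := (OU_cov A g0).
Notation M0 := (@maxwellian R d K Sg).
Notation Re := complex.Re.
Notation Im := complex.Im.
Notation normc := ComplexField.Normc.normc.
Notation lr := (Re lambda).
Notation li := (Im lambda).
Let sS : spd Sg. Proof. exact: OU_spd. Qed.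

(* Fourier frequencies along a characteristic of the transport part of the
   operator on the Fourier side. *)
Definition mode_at (t : R) : M := (OU_L alpha t)^T *m q.
Definition Q1 : M := e_first^T *m q.
Let qq := dotp q q.

Lemma dotp_row0 (y : M) : dotp q (row ord0 y) = mdot Q1 y.
Proof.
rewrite /dotp /mdot (bigD1 ord0)//= [X in _ + X]big1 ?addr0.
  by apply: eq_bigr => j _; rewrite !mxE big_ord1 !mxE !eqxx mul1r.
move=> i i0; rewrite big1// => j _; rewrite !mxE big_ord1 !mxE.
by rewrite eq_sym (negbTE i0)/= !mul0r.
Qed.

Let dfq t : M := Q1 + A^T *m mode_at t.

Let mder_mode_at (t : R) : mder mode_at t (dfq t).
Proof.
apply: mder_eq (mderMr q (mderT (mder_L alpha_gt0 t))) _.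
by rewrite linearD/= mulmxDl trmx_mul -mulmxA.
Qed.

Let dfq_cont i j : continuous ((fun t => dfq t i j) : R -> R^o).
Proof.
apply: is_derive_cont => t.
exact: (mderD (mder_cst Q1 t) (mderMl A^T (mder_mode_at t)) i j).
Qed.

Lemma mode_at_last t : \sum_(l < d) mode_at t ord_max l ^+ 2 = OU_CK alpha t ^+ 2 * qq.
Proof.
rewrite /qq /dotp mulr_sumr; apply: eq_bigr => l _.
rewrite mxE big_ord1 mxE exprMn -[q 0 l * _]expr2; congr (_ ^+ 2 * _).
by rewrite /OU_CK /e_last -colE [RHS]mxE.
Qed.

(** The frequency has the rank one form L^T q, so the quadratic form factors. *)
Lemma mode_at_quad t : mdot (mode_at t) (Sg *m mode_at t) = (OU_L alpha t *m Sg *m (OU_L alpha t)^T) 0 0 * qq.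
Proof.
rewrite mdotE /mode_at trmx_mul trmxK.
have -> : q^T *m OU_L alpha t *m (Sg *m ((OU_L alpha t)^T *m q)) =
   q^T *m (OU_L alpha t *m Sg *m (OU_L alpha t)^T) *m q by rewrite !mulmxA.
rewrite [X in q^T *m X *m q]mx11_scalar mul_mx_scalar -scalemxAl mxtraceZ; congr (_ * _).
rewrite /mxtrace /qq /dotp; apply: eq_bigr => j _.
by rewrite mxE big_ord1 mxE.
Qed.

Lemma B_expr_Re h y : Re (B_expr A g0 q h y) = B_real A g0 (fun z => Re (h z)) y + mdot Q1 y * Im (h y).
Proof.
rewrite /B_expr !cE !cRe_sum dotp_row0 !mul0r !subr0 !mulr0 !subr0 ?mul0r ?add0r ?subr0 mul1r opprK.
congr (- _ + _ + _).
  apply: eq_bigr => k _; rewrite cRe_sum; apply: eq_bigr => l _ /=.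
  by congr ('D_(E k l) _ y); apply/funext => z; rewrite !cE mul0r subr0.
Qed.

Lemma B_expr_Im h y : Im (B_expr A g0 q h y) = B_real A g0 (fun z => Im (h z)) y - mdot Q1 y * Re (h y).
Proof.
rewrite /B_expr !cE !cIm_sum dotp_row0 !mul0r !mulr0 !subr0 ?add0r ?addr0 mul1r.
congr (- _ + _ - _).
  apply: eq_bigr => k _; rewrite cIm_sum; apply: eq_bigr => l _ /=.
  by congr ('D_(E k l) _ y); apply/funext => z; rewrite !cE mul0r addr0.
by rewrite mul0r add0r.
Qed.

(** Integrating factor: its logarithmic derivative compensates the multiplications by Re lambda and
    by g0^2 |q|^2 C_K^2 / 2 that lambda - B_n produces on a plane wave. *)
Definition rho_t (t : R) : R := expR (- lr * t - qq / 2 * OU_v alpha g0 t).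

Lemma is_derive_rho_t (t : R) : is_derive t 1 (rho_t : R -> R^o)
  ((- lr - qq / 2 * (g0 ^+ 2 * OU_CK alpha t ^+ 2)) * rho_t t).
Proof.
have h := is_deriveB (is_derive_linear (- lr) t) (is_deriveZR (qq / 2) (is_derive_v alpha_gt0 g0 t)).
apply: is_derive_eq (@is_derive1_comp _ (@expR R) (fun t => - lr * t - qq / 2 * OU_v alpha g0 t) t _ _ (is_derive_expR _) h) _.
by rewrite mulrC.
Qed.

Section test.
Variable h : M -> R[i].
Hypothesis th : test_function h.
Let Kc := closure [set x | h x != 0].
Let a (y : M) := Re (h y).
Let b (y : M) := Im (h y).

Let h0 y : ~ Kc y -> h y = 0.
Proof. by move=> Ky; apply/eqP; apply: contrapT => /negP hy; apply: Ky; exact: subset_closure. Qed.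

Lemma test_ctest : ctest Kc a /\ ctest Kc b.
Proof.
case: th => sa sb cK; split; split=> //; try exact: closed_closure.
  by move=> y Ky; rewrite /a h0.
by move=> y Ky; rewrite /b h0.
Qed.

Let ta : ctest Kc a. Proof. by case: test_ctest. Qed.
Let tb : ctest Kc b. Proof. by case: test_ctest. Qed.
Let ca : continuous (a : M -> R^o). Proof. by apply: smooth_cont; case: ta. Qed.
Let cb : continuous (b : M -> R^o). Proof. by apply: smooth_cont; case: tb. Qed.

Lemma test_cmeasurable : cmeasurable h.
Proof. by split; exact: continuous_measurable_mx. Qed.

Lemma B_expr_cmeasurable : cmeasurable (B_expr A g0 q h).
Proof.
have [_ [ba _]] := B_real_continuous A g0 ta; have [_ [bb _]] := B_real_continuous A g0 tb.
have cm : continuous (mdot Q1 : M -> R^o) by apply: cls_cont; exact: cls_mdot.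
split; apply: continuous_measurable_mx.
  rewrite (_ : (fun y => _) = (fun y => B_real A g0 a y + mdot Q1 y * b y)).
    exact: (continuous_addR ba (continuous_mulR cm cb)).
  by apply/funext => y; exact: B_expr_Re.
rewrite (_ : (fun y => _) = (fun y => B_real A g0 b y + - (mdot Q1 y * a y))).
  exact: (continuous_addR bb (continuous_oppR (continuous_mulR cm ca))).
by apply/funext => y; exact: B_expr_Im.
Qed.

Lemma is_derive_fourier_part (c t : R) :
  is_derive t 1 (fun t => fourier_part (li * t + c) (mode_at t) h : R^o)
   (\int[leb]_y ((b y * cos (mdot (mode_at t) y + (li * t + c)) - a y * sin (mdot (mode_at t) y + (li * t + c))) *
     (mdot (dfq t) y + li))).
Proof.
have /choice[C hC] (ij : 'I_K.+1 * 'I_d) : exists C, 0 <= C /\ forall s, t - 1 <= s <= t + 1 -> `|dfq s ij.1 ij.2| <= C.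
  have [|C C0 hC] := @continuous_itv_bounded R (fun s => dfq s ij.1 ij.2) (t - 1) (t + 1) _ (@dfq_cont ij.1 ij.2); first lra.
  by exists C.
(* W bounds the time derivative of the phase uniformly for times within distance 1 of t; multiplied
   by the compactly supported |a| + |b| it is an integrable majorant. *)
pose W (y : M) := \sum_i \sum_j C (i, j) * `|y i j| + `|li|.
have cn (f : M -> R) : continuous (f : M -> R^o) -> continuous ((fun y => `|f y|) : M -> R^o).
  by move=> cf; apply: (continuous_compR (g := fun x : R => `|x|)) => //; exact: norm_continuous.
have cW : continuous (W : M -> R^o).
  apply: (@continuous_addR R M (fun y => \sum_i \sum_j C (i, j) * `|y i j|) (fun=> `|li|)); last exact: cst_continuous.
  apply: continuous_sumR => i; apply: continuous_sumR => j; apply: continuous_scaleR; apply: cn.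
  by apply: cls_cont; exact: cls_coord.
have W0 y : 0 <= W y.
  rewrite addr_ge0// sumr_ge0// => i _; rewrite sumr_ge0// => j _; rewrite mulr_ge0//.
  by have [] := hC (i, j).
have ctr (g : R -> R) s : sm1 g -> continuous ((fun y : M => g (mdot (mode_at s) y + (li * s + c))) : M -> R^o).
  by move=> sg; apply: cls_cont; exact: cls_trigdot.
apply: (@is_derive_integral R _ _ leb (fun t y => a y * cos (mdot (mode_at t) y + (li * t + c)) + b y * sin (mdot (mode_at t) y + (li * t + c)))
  (fun t y => (b y * cos (mdot (mode_at t) y + (li * t + c)) - a y * sin (mdot (mode_at t) y + (li * t + c))) * (mdot (dfq t) y + li))
  (fun y => (`|a y| + `|b y|) * W y)).
- move=> s; apply: integrableDR => //; [apply: (ctest_integrable ta)|apply: (ctest_integrable tb)]; apply: ctr.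
    exact: sm1_cos.
  exact: sm1_sin.
- move=> s y.
  have hO : is_derive s 1 (fun t => mdot (mode_at t) y + (li * t + c) : R^o) (mdot (dfq s) y + li).
    have h1 : is_derive s 1 (fun t => mdot (mode_at t) y : R^o) (mdot (dfq s) y).
      apply: is_derive_sumR => i; apply: is_derive_sumR => j.
      by apply: is_derive_eq (is_deriveMR (mder_mode_at s i j) (is_derive_cst (y i j) s 1)) _; rewrite mulr0 addr0.
    have h2 : is_derive s 1 (fun t => li * t + c : R^o) (li + 0).
      exact: (is_deriveD (is_derive_linear li s) (is_derive_cst (c : R^o) s 1)).
    by rewrite addr0 in h2; exact: (is_deriveD h1 h2).
  have hc := @is_derive1_comp _ (@cos R) (fun t => mdot (mode_at t) y + (li * t + c)) s _ _ (is_derive_cos _) hO.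
  have hs := @is_derive1_comp _ (@sin R) (fun t => mdot (mode_at t) y + (li * t + c)) s _ _ (is_derive_sin _) hO.
  apply: is_derive_eq (is_deriveD (is_deriveZR (a y) hc) (is_deriveZR (b y) hs)) _.
  by ring.
- by move=> y; apply: mulr_ge0; [exact: addr_ge0|exact: W0].
- apply: (@integrable_compact _ _ _ _ Kc).
  + by apply: continuous_mulR => //; apply: continuous_addR; exact: cn.
  + by case: ta.
  + by move=> y Ky; rewrite /a /b h0// normr0 addr0 mul0r.
- move=> s y /andP[s1 s2]; rewrite normrM ler_pM//.
    apply: le_trans (ler_normB _ _) _; rewrite addrC !normrM lerD// ler_piMr//.
      by rewrite ler_norml sin_geN1 sin_le1.
    by rewrite ler_norml cos_geN1 cos_le1.
  apply: le_trans (ler_normD _ _) _; rewrite lerD2r.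
  apply: le_trans (ler_norm_sum _ _ _) _; apply: ler_sum => i _.
  apply: le_trans (ler_norm_sum _ _ _) _; apply: ler_sum => j _.
  by rewrite normrM ler_wpM2r//; have [_] := hC (i, j); apply; rewrite !ltW.
Qed.

Lemma fourier_part_residual (c : R) (p : M) :
  fourier_part c p (fun y => lambda * h y - B_expr A g0 q h y) =
  (lr + g0 ^+ 2 / 2 * \sum_(l < d) p ord_max l ^+ 2) * fourier_part c p h -
  \int[leb]_y ((b y * cos (mdot p y + c) - a y * sin (mdot p y + c)) * (mdot (Q1 + A^T *m p) y + li)).
Proof.
set kp := g0 ^+ 2 / 2 * _.
have ctr (g : R -> R) : sm1 g -> continuous ((fun y : M => g (mdot p y + c)) : M -> R^o).
  by move=> sg; apply: cls_cont; exact: cls_trigdot.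
have cc := ctr _ (@sm1_cos R); have cs := ctr _ (@sm1_sin R).
have cm (r : M) : continuous (mdot r : M -> R^o) by apply: cls_cont; exact: cls_mdot.
have adjc := B_real_adjoint A g0 p c ta.
(* Shifting the phase by - pi / 2 turns the cosine into a sine, so the adjoint formula for cosines
   also treats the imaginary part. *)
have adjs := B_real_adjoint A g0 p (c - pi / 2) tb.
have esin (y : M) : cos (mdot p y + (c - pi / 2)) = sin (mdot p y + c).
  by rewrite addrA cosD cosN sinN cos_pihalf sin_pihalf mulr0 add0r mulrN mulr1 opprK.
have ecos (y : M) : sin (mdot p y + (c - pi / 2)) = - cos (mdot p y + c).
  by rewrite addrA sinD cosN sinN cos_pihalf sin_pihalf mulr0 add0r mulrN mulr1.
have {}adjs : \int[leb]_y (B_real A g0 b y * sin (mdot p y + c)) =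
    \int[leb]_y (b y * (mdot (A^T *m p) y * cos (mdot p y + c) - kp * sin (mdot p y + c))).
  rewrite (_ : \int[leb]_y (B_real A g0 b y * sin _) = \int[leb]_y (B_real A g0 b y * cos (mdot p y + (c - pi / 2)))).
    by rewrite adjs; apply: eq_Rintegral => y _; rewrite esin ecos /kp; ring.
  by apply: eq_Rintegral => y _; rewrite esin.
have ia (g : M -> R) : continuous (g : M -> R^o) -> leb.-integrable setT (EFin \o (fun y => a y * g y)).
  exact: (ctest_integrable ta).
have ib (g : M -> R) : continuous (g : M -> R^o) -> leb.-integrable setT (EFin \o (fun y => b y * g y)).
  exact: (ctest_integrable tb).
have [_ [cba ba0]] := B_real_continuous A g0 ta; have [_ [cbb bb0]] := B_real_continuous A g0 tb.
have [_ cK _ _] := ta.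
have iBa : leb.-integrable setT (EFin \o (fun y => B_real A g0 a y * cos (mdot p y + c))).
  apply: (@integrable_compact _ _ _ _ Kc) => //; first exact: (continuous_mulR cba cc).
  by move=> y Ky; rewrite ba0// mul0r.
have iBb : leb.-integrable setT (EFin \o (fun y => B_real A g0 b y * sin (mdot p y + c))).
  apply: (@integrable_compact _ _ _ _ Kc) => //; first exact: (continuous_mulR cbb cs).
  by move=> y Ky; rewrite bb0// mul0r.
pose g1 y := lr * cos (mdot p y + c) + (li + mdot Q1 y) * sin (mdot p y + c).
pose g2 y := lr * sin (mdot p y + c) - (li + mdot Q1 y) * cos (mdot p y + c).
have clm : continuous ((fun y => li + mdot Q1 y) : M -> R^o).
  by apply: (@continuous_addR R M (fun=> li) (mdot Q1)) ; [exact: cst_continuous|exact: cm].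
have cg1 : continuous (g1 : M -> R^o).
  apply: continuous_addR; first exact: (@continuous_scaleR R M lr _ cc).
  exact: (continuous_mulR clm cs).
have cg2 : continuous (g2 : M -> R^o).
  apply: continuous_addR; first exact: (@continuous_scaleR R M lr _ cs).
  exact: (continuous_oppR (continuous_mulR clm cc)).
pose k1 y := - mdot (A^T *m p) y * sin (mdot p y + c) - kp * cos (mdot p y + c).
pose k2 y := mdot (A^T *m p) y * cos (mdot p y + c) - kp * sin (mdot p y + c).
have ck1 : continuous (k1 : M -> R^o).
  exact: (continuous_addR (continuous_mulR (continuous_oppR (cm _)) cs) (continuous_oppR (@continuous_scaleR R M kp _ cc))).
have ck2 : continuous (k2 : M -> R^o).
  exact: (continuous_addR (continuous_mulR (cm _) cc) (continuous_oppR (@continuous_scaleR R M kp _ cs))).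
have i1 := integrableDR measurableT (ia _ cg1) (ib _ cg2).
have i2 := integrableDR measurableT iBa iBb.
have i3 := integrableDR measurableT (ia _ ck1) (ib _ ck2).
transitivity (\int[leb]_y (a y * g1 y + b y * g2 y) - \int[leb]_y (a y * k1 y + b y * k2 y)).
  rewrite [X in _ - X]RintegralD//; [|exact: ia|exact: ib].
  rewrite -[X in _ - (X + _)]adjc -[X in _ - (_ + X)]adjs -RintegralD// -RintegralB//.
  apply: eq_Rintegral => y _; rewrite cReB cImB cReM cImM B_expr_Re B_expr_Im /g1 /g2 -/(a y) -/(b y).
  rewrite -[B_real A g0 (fun z => Re (h z)) y]/(B_real A g0 a y) -[B_real A g0 (fun z => Im (h z)) y]/(B_real A g0 b y).
  move: (B_real A g0 a y) (B_real A g0 b y) (mdot Q1 y) (cos _) (sin _) (a y) (b y) lr li => *; ring.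
have clq : continuous ((fun y => mdot (Q1 + A^T *m p) y + li) : M -> R^o).
  by apply: (@continuous_addR R M (mdot _) (fun=> li)); [exact: cm|exact: cst_continuous].
have ic := integrableDR measurableT (ia _ cc) (ib _ cs).
have id : leb.-integrable setT (EFin \o (fun y => (b y * cos (mdot p y + c) - a y * sin (mdot p y + c)) * (mdot (Q1 + A^T *m p) y + li))).
  rewrite (_ : (fun y => _) = (fun y => b y * (cos (mdot p y + c) * (mdot (Q1 + A^T *m p) y + li)) - a y * (sin (mdot p y + c) * (mdot (Q1 + A^T *m p) y + li)))); last first.
    by apply/funext => y; ring.
  by apply: integrableBR => //; [apply: ib|apply: ia]; exact: continuous_mulR.
rewrite -RintegralB// -RintegralZl// -RintegralB//; last exact: integrableZR.
apply: eq_Rintegral => y _; rewrite mdotDl /g1 /g2 /k1 /k2; ring.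
Qed.

(* The phase [c] selects the real ([c = 0]) or imaginary ([c = pi / 2]) part of
   the Fourier transform. *)
Definition weighted_mode c (u : M -> R[i]) t := rho_t t * fourier_part (li * t + c) (mode_at t) u.

(** The frequency moves by [mode_at]' = Q1 + A^T [mode_at]; its two terms account for the
    multiplication by - i q . y^1 and for the drift. The integral in [fourier_part_residual] is
    therefore the time derivative of the mode, and [rho_t] removes the remaining multiplication. *)
Lemma is_derive_weighted_mode (c t : R) : is_derive t 1 (weighted_mode c h : R -> R^o)
  (- weighted_mode c (fun y => lambda * h y - B_expr A g0 q h y) t).
Proof.
apply: is_derive_eq (is_deriveMR (is_derive_rho_t t) (is_derive_fourier_part c t)) _.
rewrite /weighted_mode fourier_part_residual mode_at_last /dfq.
by set I1 := fourier_part _ _ _; set I2 := Rintegral _ _ _; field.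
Qed.
End test.

Variables (phi psi : M -> R[i]) (kappa : R[i]).
Hypothesis cl : closure_graph M0 (B_expr A g0 q) phi psi.
Hypothesis eqn : {ae leb, forall y, lambda * phi y - psi y = kappa * (lapM0 Sg y)%:C}.
Hypothesis lr_gt0 : 0 < lr.

Let G y := lambda * phi y - psi y.

Let cmeasZ (z : R[i]) (u : M -> R[i]) : cmeasurable u -> @cmeasurable _ _ _ (fun y : M => z * u y).
Proof.
move=> [m1 m2]; split.
  rewrite (_ : (fun y => _) = (fun y => Re z * Re (u y) - Im z * Im (u y))); last by apply/funext => y; rewrite cReM.
  by apply: measurable_funB; exact: measurable_funM.
rewrite (_ : (fun y => _) = (fun y => Re z * Im (u y) + Im z * Re (u y))); last by apply/funext => y; rewrite cImM.
by apply: measurable_funD; exact: measurable_funM.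
Qed.

Let cmeasB (u v : M -> R[i]) : cmeasurable u -> cmeasurable v -> @cmeasurable _ _ _ (fun y : M => u y - v y).
Proof.
move=> [m1 m2] [m3 m4]; split.
  rewrite (_ : (fun y => _) = (fun y => Re (u y) - Re (v y))); first exact: measurable_funB.
  by apply/funext => y; rewrite cReB.
rewrite (_ : (fun y => _) = (fun y => Im (u y) - Im (v y))); first exact: measurable_funB.
by apply/funext => y; rewrite cImB.
Qed.

Let nint (u : M -> R[i]) := leb.-integrable setT (EFin \o (fun y => normc (u y))).

Let nint_dom (u v w : M -> R[i]) (c1 c2 : R) : cmeasurable w -> nint u -> nint v ->
  (forall y, normc (w y) <= c1 * normc (u y) + c2 * normc (v y)) ->
  nint w /\ \int[leb]_y normc (w y) <= c1 * \int[leb]_y normc (u y) + c2 * \int[leb]_y normc (v y).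
Proof.
move=> mw iu iv h.
have iz1 := integrableZR measurableT c1 iu; have iz2 := integrableZR measurableT c2 iv.
have i1 := integrableDR measurableT iz1 iz2.
have iw : nint w.
  apply: le_integrable i1 => //; first by apply/measurable_EFinP; exact: cmeasurable_normc.
  by move=> y _; rewrite /= lee_fin ger0_norm ?normc_ge0'// (le_trans (h y))// ler_norm.
split=> //; rewrite -RintegralZl// -[X in _ <= _ + X]RintegralZl// -RintegralD//.
by apply: le_Rintegral => // y _; exact: h.
Qed.

Let phiH : in_H M0 phi. Proof. by case: cl. Qed.
Let psiH : in_H M0 psi. Proof. by case: cl. Qed.
Let mphi : cmeasurable phi. Proof. by case: phiH. Qed.
Let mpsi : cmeasurable psi. Proof. by case: psiH. Qed.
Let iphi : nint phi. Proof. exact: (H_integrable sS phiH). Qed.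
Let ipsi : nint psi. Proof. exact: (H_integrable sS psiH). Qed.
Let mG : cmeasurable G. Proof. by apply: cmeasB => //; exact: cmeasZ. Qed.
Let iG : nint G.
Proof.
have [] // := @nint_dom phi psi G (normc lambda) 1 mG iphi ipsi.
by move=> y; rewrite mul1r (le_trans (le_normcD _ _))// normcM' normcN.
Qed.

(** Closeness in the graph norm is converted by [H_small] into L^1 closeness of both h and its
    residual, the only norm that weighted modes depend on. *)
Let approx (e : R) : 0 < e -> exists h, [/\ test_function h, nint h,
  nint (fun y => h y - phi y), \int[leb]_y normc (h y - phi y) <= e &
  [/\ cmeasurable (fun y => lambda * h y - B_expr A g0 q h y),
      nint (fun y => lambda * h y - B_expr A g0 q h y),
      nint (fun y => (lambda * h y - B_expr A g0 q h y) - G y) &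
      \int[leb]_y normc ((lambda * h y - B_expr A g0 q h y) - G y) <= (normc lambda + 1) * e]].
Proof.
move=> e0; case: cl => _ _ [h_ [th c1 c2]].
have small (u_ : nat -> \bar R) : u_ @ \oo --> 0%E -> \forall j \near \oo, (u_ j < (e ^+ 2)%:E)%E.
  by move=> hu; apply: (hu _ (open_ereal_lt' _)); rewrite lte_fin exprn_gt0.
have [j _ /(_ _ (leqnn j)) [s1 s2]] : \forall j \near \oo, (H_normsq M0 (fun y => h_ j y - phi y)%R < (e ^+ 2)%:E)%E /\
   (H_normsq M0 (fun y => B_expr A g0 q (h_ j) y - psi y)%R < (e ^+ 2)%:E)%E.
  by apply: filterS2 (small _ c1) (small _ c2) => j.
have mh := test_cmeasurable (th j); have mB := B_expr_cmeasurable (th j).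
have m1 := cmeasB mh mphi; have m2 := cmeasB mB mpsi.
have [i1 l1] := H_small sS e0 m1 (ltW s1).
have [i2 l2] := H_small sS e0 m2 (ltW s2).
have mu := cmeasB (cmeasZ lambda mh) mB.
have muG := cmeasB mu mG.
have hw y : normc ((lambda * h_ j y - B_expr A g0 q (h_ j) y) - G y) <=
    normc lambda * normc (h_ j y - phi y) + 1 * normc (B_expr A g0 q (h_ j) y - psi y).
  rewrite -normcM' mul1r (_ : _ - G y = lambda * (h_ j y - phi y) - (B_expr A g0 q (h_ j) y - psi y)).
    by rewrite (le_trans (le_normcD _ _))// normcN.
  by rewrite /G; ring.
have [iuG luG] := nint_dom muG i1 i2 hw.
have iu : nint (fun y => lambda * h_ j y - B_expr A g0 q (h_ j) y).
  have [] // := @nint_dom _ _ (fun y => lambda * h_ j y - B_expr A g0 q (h_ j) y) 1 1 mu iuG iG.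
  by move=> y; rewrite !mul1r -[X in normc X <= _](subrK (G y)); exact: le_normcD.
exists (h_ j); split=> //.
- have [] // := @nint_dom _ _ (h_ j) 1 1 mh i1 iphi.
  by move=> y; rewrite !mul1r -[X in normc X <= _](subrK (phi y)); exact: le_normcD.
- split=> //; apply: le_trans luG _; rewrite mulrDl lerD// ?mul1r//.
  by rewrite ler_wpM2l// normc_ge0'.
Qed.

Definition weighted_source (c t : R) : R := - (OU_CK alpha t ^+ 2 * qq) * expR (- lr * t - qq / 2 * OU_V alpha g0 t) *
  (Re kappa * cos (li * t + c) + Im kappa * sin (li * t + c)).

Let ilap c th (g : R -> R) : sm1 g -> (forall x, `|g x| <= 1) ->
  leb.-integrable setT (EFin \o (fun y => lapM0 Sg y * g (mdot th y + c))).
Proof.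
move=> sg g1.
rewrite (_ : (fun y => _) = (fun y => @mw_cst R d K Sg * \sum_(l < d) (d2gw Sg (E ord_max l) y * g (mdot th y + c)))); last first.
  by apply/funext => y; rewrite /lapM0 -mulrA mulr_suml.
apply: integrableZR => //; apply: integrable_sumR => // l.
have [C C0 h] := d2gw_bound sS (E ord_max l).
exact: (integrable_gw_trig sS (cls_d2gw Sg _) (cls_trigdot th c sg) h (fun y => g1 _)).
Qed.

Lemma weighted_mode_G c t : weighted_mode c G t = weighted_source c t.
Proof.
rewrite /weighted_mode /fourier_part /weighted_source.
move: (li * t + c) => c'.
have c1 (x : R) : `|cos x| <= 1 by rewrite ler_norml cos_geN1 cos_le1.
have s1 (x : R) : `|sin x| <= 1 by rewrite ler_norml sin_geN1 sin_le1.
have ic := ilap c' (mode_at t) (@sm1_cos R) c1.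
have is_ := ilap c' (mode_at t) (@sm1_sin R) s1.
have i1 := integrableZR measurableT (Re kappa) ic.
have i2 := integrableZR measurableT (Im kappa) is_.
have i3 := integrableDR measurableT i1 i2.
rewrite (_ : Rintegral _ _ _ = \int[leb]_y (Re kappa * (lapM0 Sg y * cos (mdot (mode_at t) y + c')) +
    Im kappa * (lapM0 Sg y * sin (mdot (mode_at t) y + c')))); last first.
  rewrite /Rintegral; congr fine; apply: ae_eq_integral => //.
  - by have := measurable_int _ (fourier_part_integrable c' (mode_at t) mG iG).
  - exact: (measurable_int _ i3).
  - apply: filterS eqn => y e _; congr EFin; rewrite /G e !cE; ring.
rewrite RintegralD// !RintegralZl// lapM0_ft//.
(* The sine transform is the cosine transform with phase lowered by pi / 2. *)
have -> : \int[leb]_y (lapM0 Sg y * sin (mdot (mode_at t) y + c')) =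
   - (\sum_(l < d) mode_at t ord_max l ^+ 2) * (sin c' * expR (- (1 / 2) * mdot (mode_at t) (Sg *m mode_at t))).
  have := lapM0_ft sS (c' - pi / 2) (mode_at t).
  rewrite [cos (c' - _)]cosD cosN sinN cos_pihalf sin_pihalf mulr0 add0r mulrN mulr1 opprK => <-.
  apply: eq_Rintegral => y _; congr (_ * _).
  by rewrite addrA cosD cosN sinN cos_pihalf sin_pihalf mulr0 add0r mulrN mulr1 opprK.
rewrite mode_at_last mode_at_quad /rho_t OU_V_decomp.
set Lq := (_ *m _ *m _) 0 0.
have -> : expR (- lr * t - qq / 2 * (OU_v alpha g0 t + Lq)) =
   expR (- lr * t - qq / 2 * OU_v alpha g0 t) * expR (- (1 / 2) * (Lq * qq)).
  by rewrite -expRD; congr expR; field.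
by ring.
Qed.

Let rho_le1 t : 0 <= t -> 0 <= rho_t t <= expR (- lr * t).
Proof.
move=> t0; rewrite expR_ge0 ler_expR gerBl mulr_ge0//; last exact: OU_v_ge0.
by rewrite divr_ge0// sumr_ge0// => j _; rewrite -expr2 sqr_ge0.
Qed.

Let weighted_mode_le c u t : 0 <= t -> cmeasurable u -> nint u ->
  `|weighted_mode c u t| <= expR (- lr * t) * \int[leb]_y normc (u y).
Proof.
move=> t0 mu iu; have /andP[r0 r1] := rho_le1 t0.
rewrite normrM (ger0_norm r0) ler_pM//; exact: fourier_part_le.
Qed.

Let exp_le1 t : 0 <= t -> expR (- lr * t) <= 1.
Proof. by move=> t0; rewrite -expR0 ler_expR mulNr oppr_le0 mulr_ge0// ltW. Qed.

Let PtB c u v t : cmeasurable u -> cmeasurable v -> nint u -> nint v ->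
  weighted_mode c (fun y => u y - v y) t = weighted_mode c u t - weighted_mode c v t.
Proof. by move=> mu mv iu iv; rewrite /weighted_mode pcB// mulrBr. Qed.

Lemma weighted_source_cont c : continuous (weighted_source c : R -> R^o).
Proof.
have cC := is_derive_cont (is_derive_CK alpha_gt0).
have cV := is_derive_cont (is_derive_V alpha_gt0 g0).
have cl1 : continuous ((fun t => li * t + c) : R -> R^o).
  apply: (@is_derive_cont _ _ (fun=> li + 0)) => t.
  exact: (is_deriveD (is_derive_linear li t) (is_derive_cst (c : R^o) t 1)).
have cl2 : continuous ((fun t => - lr * t) : R -> R^o) by apply: (@is_derive_cont _ _ (fun=> - lr)) => t; exact: is_derive_linear.
apply: continuous_mulR.
  apply: continuous_mulR.
    apply: continuous_oppR; apply: continuous_mulR; last exact: cst_continuous.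
    exact: (continuous_mulR cC cC).
  apply: (continuous_compR (@continuous_expR R)).
  apply: (continuous_addR cl2); apply: continuous_oppR; exact: continuous_scaleR.
apply: continuous_addR; apply: continuous_scaleR.
  exact: (continuous_compR (@continuous_cos R) cl1).
exact: (continuous_compR (@continuous_sin R) cl1).
Qed.

Let weighted_source_prim c T0 (t : R) : 0 <= t <= T0 ->
  is_derive t 1 (fun x => \int[@lebesgue_measure R]_(s in `[-1, x]) weighted_source c s : R^o) (weighted_source c t).
Proof.
move=> /andP[t0 tT].
(* The interval is enlarged on both sides so that every t in [0, T0] is interior. *)
have i : (@lebesgue_measure R).-integrable `[-1, T0 + 1] (EFin \o weighted_source c).
  by apply: continuous_compact_integrable; [exact: segment_compact|apply: continuous_subspaceT; exact: weighted_source_cont].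
have [||dd e1] := @continuous_FTC1_closed R (weighted_source c) (-1) t (T0 + 1) _ i _ (@weighted_source_cont c t); [lra|lra|].
by rewrite -e1 derive1E; apply: DeriveDef => //; exact: derivable1_diffP.
Qed.

(** The mode of phi cannot be differentiated directly, phi being only a limit. The identity is
    checked on approximants up to an error proportional to e, uniformly on [0, T0], and e is
    arbitrary. *)
Lemma weighted_mode_evolution c T0 : 0 <= T0 ->
  weighted_mode c phi T0 - weighted_mode c phi 0 = - \int[@lebesgue_measure R]_(t in `[0, T0]) weighted_source c t.
Proof.
move=> T00; pose F x := \int[@lebesgue_measure R]_(s in `[-1, x]) weighted_source c s.
have eF : \int[@lebesgue_measure R]_(t in `[0, T0]) weighted_source c t = F T0 - F 0.
  apply: Rintegral_FTC2 => //; first exact: weighted_source_cont.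
  by move=> x hx; exact: weighted_source_prim hx.
rewrite eF; apply/eqP; rewrite -subr_eq0 opprK -normr_eq0 eq_le normr_ge0 andbT.
set X := `| _ |.
have bd (e : R) : 0 < e -> X <= (2 + (normc lambda + 1) * T0) * e.
  move=> e0; have [h [th ih ihp lhp [mu iu iuG luG]]] := approx e0.
  have mh := test_cmeasurable th.
  have b1 t : 0 <= t -> `|weighted_mode c h t - weighted_mode c phi t| <= e.
    move=> t0; have b0 := weighted_mode_le c t0 (cmeasB mh mphi) ihp.
    rewrite -PtB//; apply: (le_trans b0).
    rewrite -[leRHS]mul1r ler_pM ?expR_ge0 ?exp_le1//.
    by apply: Rintegral_ge0 => y _; exact: normc_ge0'.
  have dD (t : R) : 0 <= t <= T0 -> is_derive t 1 (fun t => weighted_mode c h t + F t : R^o)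
      (- weighted_mode c (fun y => lambda * h y - B_expr A g0 q h y) t + weighted_source c t).
    by move=> ht; exact: (is_deriveD (is_derive_weighted_mode th c t) (weighted_source_prim c ht)).
  (* The derivative is minus the weighted mode of the residual minus G, small in L^1; a bound at one
     intermediate time suffices. *)
  have [t /andP[t0 tT] eD] := is_derive_MVT_itv T00 dD.
  have b2 : `|weighted_mode c h T0 + F T0 - (weighted_mode c h 0 + F 0)| <= (normc lambda + 1) * e * T0.
    rewrite eD subr0 normrM (ger0_norm T00) ler_wpM2r//.
    rewrite -weighted_mode_G addrC -opprB normrN -PtB//.
    have b0 := weighted_mode_le c t0 (cmeasB mu mG) iuG; apply: (le_trans b0).
    apply: le_trans luG; rewrite -[leRHS]mul1r ler_pM ?expR_ge0 ?exp_le1//.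
    by apply: Rintegral_ge0 => y _; exact: normc_ge0'.
  have h1 := b1 T0 T00; have h2 := b1 0 (lexx 0).
  have -> : (2 + (normc lambda + 1) * T0) * e = 2 * e + (normc lambda + 1) * e * T0 by ring.
  exact: (norm_transfer h1 h2 b2).
have C0 : 0 < 2 + (normc lambda + 1) * T0.
  by rewrite ltr_pwDl// mulr_ge0// addr_ge0// normc_ge0'.
rewrite leNgt; apply/negP => X0.
(* With this e the bound reads X <= X / 2, which is impossible for X > 0. *)
have e0 : 0 < X / (2 * (2 + (normc lambda + 1) * T0)) by rewrite divr_gt0 ?mulr_gt0.
move: (bd _ e0) X0; move: C0; move: (2 + _) => C C0.
have -> : C * (X / (2 * C)) = X / 2 by field; rewrite gt_eqF.
lra.
Qed.

Lemma weighted_source_integrable c : (@lebesgue_measure R).-integrable `[0, +oo[ (EFin \o weighted_source c).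
Proof.
have [C hC] := bnd_CK alpha_gt0.
have qq0 : 0 <= qq by rewrite sumr_ge0// => j _; rewrite -expr2 sqr_ge0.
apply: (@integrable_exp_bound _ _ lr (C ^+ 2 * qq * (`|Re kappa| + `|Im kappa|))) => //.
  by apply: measurable_funTS; apply: continuous_measurable_fun; exact: weighted_source_cont.
move=> t t0; rewrite !normrM normrN.
have hV : 0 <= OU_V alpha g0 t.
  rewrite OU_V_decomp addr_ge0 ?OU_v_ge0//.
  by have := spd_ge0 (OU_L alpha t)^T sS; rewrite /quad trmxK.
rewrite -mulrA [C ^+ 2 * qq * _ * _]mulrAC -mulrA -[C ^+ 2 * qq * _]mulrA.
have p1 : `|OU_CK alpha t ^+ 2 * qq| <= C ^+ 2 * qq.
  rewrite normrM (ger0_norm qq0) ler_wpM2r// normrX lerXn2r ?nnegrE ?hC//.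
  exact: le_trans (hC t t0).
have p2 : `|expR (- lr * t - qq / 2 * OU_V alpha g0 t)| <= expR (- lr * t).
  by rewrite ger0_norm ?expR_ge0// ler_expR gerBl mulr_ge0// divr_ge0.
have p3 : `|Re kappa * cos (li * t + c) + Im kappa * sin (li * t + c)| <= `|Re kappa| + `|Im kappa|.
  apply: le_trans (ler_normD _ _) _; rewrite !normrM lerD// ler_piMr//.
    by rewrite ler_norml cos_geN1 cos_le1.
  by rewrite ler_norml sin_geN1 sin_le1.
have := ler_pM (mulr_ge0 (normr_ge0 _) (normr_ge0 _)) (normr_ge0 _) (ler_pM (normr_ge0 _) (normr_ge0 _) p1 p2) p3.
by rewrite !mulrA.
Qed.

(** At t = 0 the frequency and the exponent of [rho_t] vanish, so the weighted mode starts as the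
    plain integral of phi with phase c; it tends to 0 because Re lambda > 0. *)
Lemma fourier_part_phi c : fourier_part c 0 phi = \int[@lebesgue_measure R]_(t in `[0, +oo[) weighted_source c t.
Proof.
have -> : fourier_part c 0 phi = weighted_mode c phi 0.
  have [_ [_ L0]] := mder0_eq0 alpha g0.
  by rewrite /weighted_mode /rho_t OU_v0 !mulr0 subr0 expR0 mul1r add0r /mode_at L0 trmx0 mul0mx.
have l1 := cvg_Rintegral_nat (weighted_source_integrable c).
have l2 : weighted_mode c phi n%:R @[n --> \oo] --> (0 : R).
  have e0 := cvgy_nat (cvg_expRNc lr_gt0).
  apply/norm_cvg0P; apply: (@squeeze_cvgr _ _ _ _ (cst 0) (fun n : nat => expR (- lr * n%:R) * \int[leb]_y normc (phi y))).
  - by apply: nearW => n /=; rewrite normr_ge0 /=; exact: weighted_mode_le.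
  - exact: cvg_cst.
  - by rewrite -[X in _ --> X](mul0r (\int[leb]_y normc (phi y))); apply: cvgMl_tmp || apply: cvgM => //; exact: cvg_cst.
have l3 : (weighted_mode c phi n%:R + \int[@lebesgue_measure R]_(t in `[0, n%:R]) weighted_source c t) @[n --> \oo] -->
   0 + \int[@lebesgue_measure R]_(t in `[0, +oo[) weighted_source c t.
  exact: (cvgD l2 l1).
have e : (fun n : nat => weighted_mode c phi n%:R + \int[@lebesgue_measure R]_(t in `[0, n%:R]) weighted_source c t) = cst (weighted_mode c phi 0).
  apply/funext => n /=; have := weighted_mode_evolution c (ler0n R n); move/eqP; rewrite subr_eq => /eqP ->.
  by rewrite addrAC addNr add0r.
rewrite e add0r in l3; apply: cvg_unique l3 => //.
exact: cvg_cst.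
Qed.

Lemma rho_closure : rho phi = kappa * (- (qq%:C *
  cintegral (@lebesgue_measure R) `[0, +oo[ (fun t => cexp (- lambda * t%:C) *
     (OU_CK alpha t ^+ 2 * expR (- (qq / 2) * OU_V alpha g0 t))%:C))).
Proof.
pose w t := OU_CK alpha t ^+ 2 * expR (- lr * t - qq / 2 * OU_V alpha g0 t).
have hRe t : Re (- lambda * t%:C) = - lr * t by rewrite !cE; ring.
have hIm t : Im (- lambda * t%:C) = - (li * t) by rewrite !cE; ring.
have eE t : expR (- lr * t - qq / 2 * OU_V alpha g0 t) = expR (- lr * t) * expR (- (qq / 2) * OU_V alpha g0 t).
  by rewrite -expRD mulNr [in RHS]mulNr.
have reE t : Re (cexp (- lambda * t%:C) * (OU_CK alpha t ^+ 2 * expR (- (qq / 2) * OU_V alpha g0 t))%:C) =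
    w t * cos (li * t).
  rewrite /cexp hRe hIm cReM cReM /= cosN /w eE; ring.
have imE t : Im (cexp (- lambda * t%:C) * (OU_CK alpha t ^+ 2 * expR (- (qq / 2) * OU_V alpha g0 t))%:C) =
    - (w t * sin (li * t)).
  rewrite /cexp hRe hIm cImM cImM /= sinN /w eE; ring.
have wcont : continuous (w : R -> R^o).
  have cC := is_derive_cont (is_derive_CK alpha_gt0).
  have cV := is_derive_cont (is_derive_V alpha_gt0 g0).
  apply: continuous_mulR; first exact: (continuous_mulR cC cC).
  apply: (continuous_compR (@continuous_expR R)).
  apply: continuous_addR; last by apply: continuous_oppR; exact: continuous_scaleR.
  by apply: (@is_derive_cont _ _ (fun=> - lr)) => t; exact: is_derive_linear.
have clin : continuous ((fun t => li * t) : R -> R^o).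
  by apply: (@is_derive_cont _ _ (fun=> li)) => t; exact: is_derive_linear.
have wi (g : R -> R) : continuous (g : R -> R^o) -> (forall x, `|g x| <= 1) ->
    (@lebesgue_measure R).-integrable `[0, +oo[ (EFin \o (fun t => w t * g (li * t))).
  move=> cg g1; have [C hC] := bnd_CK alpha_gt0.
  apply: (@integrable_exp_bound _ _ lr (C ^+ 2)) => //.
    apply: measurable_funTS; apply: continuous_measurable_fun.
    apply: (continuous_mulR wcont); exact: (continuous_compR cg clin).
  move=> t t0; rewrite normrM /w normrM.
  have hV : 0 <= OU_V alpha g0 t.
    rewrite OU_V_decomp addr_ge0 ?OU_v_ge0//.
    by have := spd_ge0 (OU_L alpha t)^T sS; rewrite /quad trmxK.
  have qq0 : 0 <= qq by rewrite sumr_ge0// => j _; rewrite -expr2 sqr_ge0.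
  have p1 : `|OU_CK alpha t ^+ 2| <= C ^+ 2.
    by rewrite normrX lerXn2r ?nnegrE ?hC//; exact: le_trans (hC t t0).
  have p2 : `|expR (- lr * t - qq / 2 * OU_V alpha g0 t)| <= expR (- lr * t).
    by rewrite ger0_norm ?expR_ge0// ler_expR gerBl mulr_ge0// divr_ge0.
  apply: le_trans (ler_piMr _ (g1 _)) _; first by rewrite mulr_ge0.
  exact: ler_pM.
have wc : (@lebesgue_measure R).-integrable `[0, +oo[ (EFin \o (fun t => w t * cos (li * t))).
  by apply: (wi _ (@continuous_cos R)) => x; rewrite ler_norml cos_geN1 cos_le1.
have ws : (@lebesgue_measure R).-integrable `[0, +oo[ (EFin \o (fun t => w t * sin (li * t))).
  by apply: (wi _ (@continuous_sin R)) => x; rewrite ler_norml sin_geN1 sin_le1.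
have mD : measurable (`[0, +oo[%classic : set (measurableTypeR R)) by exact: measurable_itv.
pose Ic := \int[@lebesgue_measure R]_(t in `[0, +oo[) (w t * cos (li * t)).
pose Is := \int[@lebesgue_measure R]_(t in `[0, +oo[) (w t * sin (li * t)).
have eint : cintegral (@lebesgue_measure R) `[0, +oo[ (fun t => cexp (- lambda * t%:C) *
     (OU_CK alpha t ^+ 2 * expR (- (qq / 2) * OU_V alpha g0 t))%:C) = Ic +i* (- Is).
  congr (_ +i* _); first by apply: eq_Rintegral => t _; exact: reE.
  rewrite -[RHS]mulN1r -RintegralZl//; apply: eq_Rintegral => t _.
  by rewrite mulN1r; exact: imE.
have zero y : mdot (0 : M) y = 0 by exact: mdot0l.
have hkR (x y : R) : Re (kappa * - (qq%:C * (x -i* y))) = - qq * Re kappa * x - qq * Im kappa * y.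
  by rewrite !cE /=; ring.
have hkI (x y : R) : Im (kappa * - (qq%:C * (x -i* y))) = - qq * Im kappa * x - (- qq * Re kappa) * y.
  by rewrite !cE /=; ring.
rewrite eint; apply: complex_eq.
  have := fourier_part_phi 0; rewrite /fourier_part.
  rewrite (_ : Rintegral _ _ _ = Re (rho phi)); last first.
    by apply: eq_Rintegral => y _; rewrite zero addr0 cos0 sin0 mulr1 mulr0 addr0.
  move=> ->; rewrite (_ : Rintegral _ _ _ = - qq * Re kappa * Ic - qq * Im kappa * Is).
    by rewrite hkR.
  rewrite /Ic /Is -RintegralZl// -RintegralZl// -RintegralB//; last 2 first.
  - exact: (integrableZR mD _ wc).
  - exact: (integrableZR mD _ ws).
  by apply: eq_Rintegral => t _; rewrite /weighted_source /w addr0; ring.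
have := fourier_part_phi (pi / 2); rewrite /fourier_part.
rewrite (_ : Rintegral _ _ _ = Im (rho phi)); last first.
  by apply: eq_Rintegral => y _; rewrite zero add0r cos_pihalf sin_pihalf mulr1 mulr0 add0r.
move=> ->; rewrite (_ : Rintegral _ _ _ = - qq * Im kappa * Ic - (- qq * Re kappa) * Is).
  by rewrite hkI.
rewrite /Ic /Is -RintegralZl// -RintegralZl// -RintegralB//; last 2 first.
- exact: (integrableZR mD _ wc).
- exact: (integrableZR mD _ ws).
apply: eq_Rintegral => t _; rewrite /weighted_source /w cosD sinD cos_pihalf sin_pihalf !mulr0 !mulr1 sub0r add0r.
by ring.
Qed.

End forward.

(** * From the dispersion relation to an eigenfunction *)

Section riemann.
Context {R : realType}.

(** A geometric sum of ratio e^(-a / N), bounded uniformly in the mesh because 1 - e^(-a / N) >= a /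
    (N + a). *)
Lemma riemann_geo (a : R) (n m : nat) : 0 < a ->
  \sum_(k < m) n.+1%:R^-1 * expR (- a * (k%:R / n.+1%:R)) <= a^-1 + 1.
Proof.
move=> a0; set N : R := n.+1%:R; have N1 : 1 <= N by rewrite ler1n.
have N0 : 0 < N by rewrite ltr0n.
pose x := expR (- a / N).
have ek k : expR (- a * (k%:R / N)) = x ^+ k.
  by rewrite /x -expRM_natl; congr expR; rewrite -mulr_natl; ring.
have x0 : 0 < x by exact: expR_gt0.
have xl : x * (1 + a / N) <= 1.
  rewrite /x mulNr expRN mulrC ler_pdivrMr ?expR_gt0// mul1r.
  exact: expR_ge1Dx.
have x1 : x < 1 by rewrite /x -expR0 ltr_expR mulNr oppr_lt0 divr_gt0.
under eq_bigr => k _ do rewrite ek.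
rewrite -mulr_sumr.
have geo : (1 - x) * (\sum_(k < m) x ^+ k) = 1 - x ^+ m.
  by rewrite -[in RHS](expr1n _ m) subrXX; congr (_ * _); apply: eq_bigr => k _; rewrite expr1n mul1r.
have g : (1 - x) * \sum_(k < m) x ^+ k <= 1 by rewrite geo gerBl exprn_ge0// ltW.
have s0 : 0 <= \sum_(k < m) x ^+ k by apply: sumr_ge0 => k _; rewrite exprn_ge0// ltW.
have h : N^-1 <= (a^-1 + 1) * (1 - x).
  have h1 : a / (N + a) <= 1 - x.
    rewrite lerBrDr -lerBrDl; have -> : 1 - a / (N + a) = (1 + a / N)^-1.
      have Na : 0 < N + a by rewrite addr_gt0.
      by move: (N) N0 Na => u u0 ua; field; rewrite !gt_eqF.
    by rewrite -[_^-1]mul1r ler_pdivlMr ?addr_gt0 ?divr_gt0.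
  apply: le_trans (ler_wpM2l _ h1); last by rewrite addr_ge0// invr_ge0 ltW.
  rewrite (_ : (a^-1 + 1) * (a / (N + a)) = (1 + a) / (N + a)); last first.
    have Na : 0 < N + a by rewrite addr_gt0.
    by move: (N) N0 Na => u u0 ua; field; rewrite !gt_eqF.
  rewrite ler_pdivlMr ?addr_gt0// mulrDr mulVf ?gt_eqF// lerD2l.
  by rewrite ler_pdivrMl// ler_peMl// ltW.
apply: le_trans (ler_wpM2r s0 h) _; rewrite -mulrA ler_piMr//.
by rewrite addr_ge0// invr_ge0 ltW.
Qed.

(** N^2 cells of width 1 / N cover [0, N], so mesh and truncation improve together. The mean value
    theorem, used for a primitive and then for f, bounds the error of a cell at x by C e^(-a x) /
    N^2, and [riemann_geo] sums these to O(1 / N). *)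
Lemma riemann_cvg (f f' : R -> R) (a C : R) : 0 < a ->
  (forall t : R, is_derive t 1 (f : R -> R^o) (f' t)) ->
  (forall t, 0 <= t -> `|f t| <= C * expR (- a * t)) ->
  (forall t, 0 <= t -> `|f' t| <= C * expR (- a * t)) ->
  \sum_(k < n.+1 * n.+1) n.+1%:R^-1 * f (k%:R / n.+1%:R) @[n --> \oo] -->
    \int[@lebesgue_measure R]_(t in `[0, +oo[) f t.
Proof.
move=> a0 df bf bf'.
have cf := is_derive_cont df.
have if_ : (@lebesgue_measure R).-integrable `[0, +oo[ (EFin \o f).
  apply: (integrable_exp_bound a0 _ bf).
  by apply: measurable_funTS; exact: continuous_measurable_fun.
have C0 : 0 <= C.
  by have := le_trans (normr_ge0 _) (bf 0 (lexx 0)); rewrite mulr0 expR0 mulr1.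
pose F x := \int[@lebesgue_measure R]_(t in `[-1, x]) f t.
have dF (t : R) : 0 <= t -> is_derive t 1 (F : R -> R^o) (f t).
  move=> t0.
  have i : (@lebesgue_measure R).-integrable `[-1, t + 1] (EFin \o f).
    by apply: continuous_compact_integrable; [exact: segment_compact|exact: continuous_subspaceT].
  have [||dd e1] := @continuous_FTC1_closed R f (-1) t (t + 1) _ i _ (@cf t); [lra|lra|].
  by rewrite -e1 derive1E; apply: DeriveDef => //; exact: derivable1_diffP.
have eF T : 0 <= T -> \int[@lebesgue_measure R]_(t in `[0, T]) f t = F T - F 0.
  by move=> T0; apply: Rintegral_FTC2 => // t /andP[t0 _]; exact: dF.
pose D n := \sum_(k < n.+1 * n.+1) n.+1%:R^-1 * f (k%:R / n.+1%:R).
pose I n := \int[@lebesgue_measure R]_(t in `[0, n.+1%:R]) f t.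
have lI : I n @[n --> \oo] --> \int[@lebesgue_measure R]_(t in `[0, +oo[) f t.
  by have := cvg_Rintegral_nat if_; rewrite -(cvg_shiftS _).
have dist n : `|D n - I n| <= C * (a^-1 + 1) * n.+1%:R^-1.
  set N : R := n.+1%:R; have N0 : 0 < N by rewrite ltr0n.
  have -> : I n = \sum_(k < n.+1 * n.+1) (F (k.+1%:R / N) - F (k%:R / N)).
    rewrite /I eF ?ler0n// -(big_mkord xpredT (fun k => F (k.+1%:R / N) - F (k%:R / N))).
    by rewrite telescope_sumr// mul0r natrM mulfK// gt_eqF.
  rewrite /D -sumrB; apply: le_trans (ler_norm_sum _ _ _) _.
  have st (k : nat) : `|N^-1 * f (k%:R / N) - (F (k.+1%:R / N) - F (k%:R / N))| <=
     C * N^-1 * (N^-1 * expR (- a * (k%:R / N))).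
    set x := k%:R / N; have x0 : 0 <= x by rewrite divr_ge0 ?ler0n.
    have -> : k.+1%:R / N = x + N^-1 by rewrite -natr1 mulrDl mul1r.
    have xx : x <= x + N^-1 by rewrite lerDl invr_ge0 ltW.
    have [c /andP[xc cx] ->] := @is_derive_MVT_itv _ F f _ _ xx (fun t ht => dF t (le_trans x0 (proj1 (andP ht)))).
    have [c' /andP[xc' c'x] e] := @is_derive_MVT_itv _ f f' _ _ xc (fun t _ => df t).
    rewrite (_ : x + N^-1 - x = N^-1); last by ring.
    have N'0 : 0 <= N^-1 by rewrite invr_ge0 ltW.
    have c'0 : 0 <= c' by exact: le_trans xc'.
    have p1 : `|f' c'| <= C * expR (- a * x).
      apply: le_trans (bf' _ c'0) _; rewrite ler_wpM2l// ler_expR !mulNr lerN2.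
      by rewrite ler_wpM2l// ltW.
    have p2 : `|c - x| <= N^-1 by rewrite ger0_norm ?subr_ge0// lerBlDr addrC.
    rewrite [f c * _]mulrC -mulrBr -[f x - _]opprB e mulrN normrN normrM (ger0_norm N'0) normrM.
    have := ler_wpM2l N'0 (ler_pM (normr_ge0 _) (normr_ge0 _) p1 p2).
    by rewrite (_ : N^-1 * (C * _ / N) = C / N * (N^-1 * expR (- a * x))) //; move: (expR _) (N^-1) => *; ring.
  apply: (@le_trans _ _ (\sum_(k < n.+1 * n.+1) C * N^-1 * (N^-1 * expR (- a * (k%:R / N))))).
    by apply: ler_sum => k _; exact: st.
  rewrite -mulr_sumr [leRHS]mulrAC.
  have CN : 0 <= C / N by rewrite divr_ge0// ltW.
  apply: (ler_wpM2l CN).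
  exact: riemann_geo.
have l0 : D n - I n @[n --> \oo] --> (0 : R).
  apply/norm_cvg0P; apply: (@squeeze_cvgr _ _ _ _ (cst 0) (fun n => C * (a^-1 + 1) * n.+1%:R^-1)).
  - by apply: nearW => n /=; rewrite normr_ge0 /=; exact: dist.
  - exact: cvg_cst.
  - by rewrite -[X in _ --> X](mulr0 (C * (a^-1 + 1))); apply: cvgM; [exact: cvg_cst|exact: cvg_harmonic].
have -> : (fun n => D n) = (fun n => (D n - I n) + I n) by apply/funext => n; rewrite subrK.
by rewrite -[X in _ --> X]add0r; exact: cvgD.
Qed.

End riemann.

(** * A class of functions of time and phase *)

Section time_class.
Context {R : realType} {d K : nat} (alpha : 'I_K.+1 -> R).
Hypothesis alpha_gt0 : forall k, 0 < alpha k.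
Variable g0 : R.
Hypothesis g0_gt0 : 0 < g0.
Variable q : 'rV[R]_d.
Variable li : R.
Notation M := 'M[R]_(K.+1, d).
Notation A := (drift alpha).
Notation Sg := (OU_cov A g0).
Notation S := (invmx Sg).
Notation sg := (OU_sg alpha g0).
Notation rr := (OU_r alpha g0).
Let qq := dotp q q.
Let sS : spd Sg. Proof. exact: OU_spd. Qed.

(** The term [li * t] absorbs the oscillation of e^(-lambda t), so that only the real damping e^(-Re
    lambda t) is left as a weight in time. *)
Definition theta (t : R) (y : M) : R := mdot (sg t *m q) y + li * t.

(* Functions of time and phase closed under derivatives in both, and at most
   polynomial in y uniformly in time. *)
Inductive tcls : (R -> M -> R) -> Prop :=
| tc_cst c : tcls (fun _ _ => c)
| tc_coord i j : tcls (fun _ y => y i j)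
| tc_sg i : tcls (fun t _ => sg t i 0)
| tc_r i : tcls (fun t _ => rr t i 0)
| tc_m : tcls (fun t _ => OU_m alpha g0 t)
| tc_tau : tcls (fun t _ => OU_tau alpha g0 t)
| tc_om : tcls (fun t _ => expR (- (qq / 2) * OU_om alpha g0 t))
| tc_cos : tcls (fun t y => cos (theta t y))
| tc_sin : tcls (fun t y => sin (theta t y))
| tcD f g : tcls f -> tcls g -> tcls (fun t y => f t y + g t y)
| tcM f g : tcls f -> tcls g -> tcls (fun t y => f t y * g t y).

Lemma tc_eq f g : tcls f -> (forall t y, f t y = g t y) -> tcls g.
Proof. by move=> cf h; rewrite (_ : g = f)//; apply/funext => t; apply/funext => y; rewrite h. Qed.

Lemma tcZ c f : tcls f -> tcls (fun t y => c * f t y).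
Proof. by apply: tcM; exact: tc_cst. Qed.

Lemma tc_sum (I : Type) (r : seq I) (h : I -> R -> M -> R) :
  (forall i, tcls (h i)) -> tcls (fun t y => \sum_(i <- r) h i t y).
Proof.
move=> ch; elim: r => [|i r IH].
  by apply: (tc_eq (tc_cst 0)) => t y; rewrite big_nil.
by apply: (tc_eq (tcD (ch i) IH)) => t y; rewrite big_cons.
Qed.

Lemma tc_mulmx (B : 'M[R]_K.+1) k l : tcls (fun _ y => (B *m y) k l).
Proof.
apply: (@tc_eq (fun _ y => \sum_j B k j * y j l)); last by move=> t y; rewrite mxE.
by apply: tc_sum => j; apply: tcZ; exact: tc_coord.
Qed.

Lemma cls_theta t : cls (theta t).
Proof. by apply: clsD; [exact: cls_mdot|exact: cls_cst]. Qed.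

Lemma tc_cls f t : tcls f -> cls (f t).
Proof.
elim=> {f}; do ?[by move=> *; exact: cls_cst].
- exact: cls_coord.
- by apply: (cls_comp sm1_cos); exact: cls_theta.
- by apply: (cls_comp sm1_sin); exact: cls_theta.
- by move=> f g _ cf _ cg; exact: clsD.
- by move=> f g _ cf _ cg; exact: clsM.
Qed.

Lemma is_derive_theta_y t y V : is_derive y V (theta t : M -> R^o) (mdot (sg t *m q) V).
Proof.
rewrite -[X in is_derive _ _ _ X]addr0.
exact: is_deriveDV (is_derive_mdot _ y V) (is_derive_cst (li * t) y V).
Qed.

Lemma mdot_sgE t (y : M) : mdot (sg t *m q) y = \sum_i sg t i 0 * \sum_j (q 0 j * y i j).
Proof.
apply: eq_bigr => i _; rewrite mulr_sumr; apply: eq_bigr => j _.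
by rewrite mxE big_ord1 mulrA.
Qed.

Lemma tc_der f V : tcls f -> exists2 g, tcls g & forall t y, is_derive y V (f t : M -> R^o) (g t y).
Proof.
have cq : tcls (fun t _ => mdot (sg t *m q) V).
  apply: (@tc_eq (fun t _ => \sum_i sg t i 0 * \sum_j (q 0 j * V i j))).
    by apply: tc_sum => i; apply: tcM; [exact: tc_sg|exact: tc_cst].
  by move=> t y; rewrite mdot_sgE.
elim=> {f}; do ?[by move=> *; exists (fun _ _ => 0); [exact: tc_cst|move=> t y; exact: is_derive_cst]].
- by move=> i j; exists (fun _ _ => V i j); [exact: tc_cst|move=> t y; exact: is_derive_coord].
- exists (fun t y => (-1 * sin (theta t y)) * mdot (sg t *m q) V).
    by apply: tcM => //; apply: tcZ; exact: tc_sin.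
  move=> t y; rewrite mulN1r; apply: is_derive_compV (is_derive_cos _) _.
  exact: is_derive_theta_y.
- exists (fun t y => cos (theta t y) * mdot (sg t *m q) V).
    by apply: tcM => //; exact: tc_cos.
  by move=> t y; apply: is_derive_compV (is_derive_sin _) _; exact: is_derive_theta_y.
- move=> f g cf [f' cf' hf] cg [g' cg' hg].
  by exists (fun t y => f' t y + g' t y); [exact: tcD|move=> t y; exact: is_deriveDV].
- move=> f g cf [f' cf' hf] cg [g' cg' hg].
  exists (fun t y => f' t y * g t y + f t y * g' t y); last by move=> t y; exact: is_deriveMV.
  by apply: tcD; apply: tcM.
Qed.

Lemma tc_D f V : tcls f -> tcls (fun t => 'D_V (f t : M -> R^o)).
Proof.
by move=> /(tc_der V)[g cg hg]; apply: (tc_eq cg) => t y; rewrite derive_val.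
Qed.

Let dsg t := S *m A *m Sg *m sg t + (@e_first R K)^T.
Let dr t := S *m A *m Sg *m rr t.

Lemma is_derive_theta_t (t : R) y : is_derive t 1 (fun s => theta s y : R^o)
  (mdot (dsg t *m q) y + li).
Proof.
have h1 : is_derive t 1 (fun t => mdot (sg t *m q) y : R^o) (mdot (dsg t *m q) y).
  apply: is_derive_sumR => i; apply: is_derive_sumR => j.
  have := mderMr q (mder_sg alpha_gt0 g0_gt0 t) i j => h.
  by apply: is_derive_eq (is_deriveMR h (is_derive_cst (y i j) t 1)) _; rewrite mulr0 addr0.
exact: (is_deriveD h1 (is_derive_linear li t)).
Qed.

(** Closure under time derivatives comes from the ODEs of the coefficients: sg and r solve linear
    systems with constant matrices, and the derivatives of m, tau and om are products of their last
    entries. *)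
Lemma tc_dt f : tcls f -> exists2 g, tcls g & forall (t : R) y, is_derive t 1 (f ^~ y : R -> R^o) (g t y).
Proof.
have lsg (B : 'M[R]_K.+1) i : tcls (fun t _ => (B *m sg t) i 0).
  apply: (@tc_eq (fun t _ => \sum_j B i j * sg t j 0)); last by move=> t y; rewrite mxE.
  by apply: tc_sum => j; apply: tcZ; exact: tc_sg.
have lr (B : 'M[R]_K.+1) i : tcls (fun t _ => (B *m rr t) i 0).
  apply: (@tc_eq (fun t _ => \sum_j B i j * rr t j 0)); last by move=> t y; rewrite mxE.
  by apply: tc_sum => j; apply: tcZ; exact: tc_r.
have cdsg i : tcls (fun t _ => dsg t i 0).
  apply: (@tc_eq (fun t _ => (S *m A *m Sg *m sg t) i 0 + (@e_first R K)^T i 0)); last by move=> t y; rewrite [RHS]mxE.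
  by apply: tcD; [exact: lsg|exact: tc_cst].
have esg : tcls (fun t _ => ((@e_last R K)^T *m sg t) 0 0).
  apply: (@tc_eq (fun t _ => sg t ord_max 0)); first exact: tc_sg.
  by move=> t y; rewrite /e_last trmx_delta -rowE [RHS]mxE.
have er : tcls (fun t _ => ((@e_last R K)^T *m rr t) 0 0).
  apply: (@tc_eq (fun t _ => rr t ord_max 0)); first exact: tc_r.
  by move=> t y; rewrite /e_last trmx_delta -rowE [RHS]mxE.
have cth : tcls (fun t y => mdot (dsg t *m q) y + li).
  apply: tcD; last exact: tc_cst.
  apply: (@tc_eq (fun t y => \sum_i dsg t i 0 * \sum_j (q 0 j * y i j))).
    apply: tc_sum => i; apply: tcM => //; apply: tc_sum => j; apply: tcZ; exact: tc_coord.
  move=> t y; apply: eq_bigr => i _; rewrite mulr_sumr; apply: eq_bigr => j _.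
  by rewrite [in RHS]mxE big_ord1 mulrA.
elim=> {f}; do ?[by move=> *; exists (fun _ _ => 0); [exact: tc_cst|move=> t y; exact: is_derive_cst]].
- by move=> i; exists (fun t _ => dsg t i 0) => // t y; exact: (mder_sg alpha_gt0 g0_gt0 t).
- by move=> i; exists (fun t _ => dr t i 0) => [|t y]; [exact: lr|exact: (mder_r alpha_gt0 g0_gt0 t)].
- exists (fun t _ => g0 ^+ 2 * (((@e_last R K)^T *m rr t) 0 0 * ((@e_last R K)^T *m sg t) 0 0)).
    by apply: tcZ; exact: tcM.
  by move=> t y; exact: is_derive_m.
- exists (fun t _ => -1 * (g0 ^+ 2 * (((@e_last R K)^T *m rr t) 0 0 * ((@e_last R K)^T *m rr t) 0 0))).
    by do 2 apply: tcZ; exact: tcM.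
  by move=> t y; rewrite mulN1r -expr2; exact: is_derive_tau.
- exists (fun t _ => expR (- (qq / 2) * OU_om alpha g0 t) * (- (qq / 2) * (g0 ^+ 2 * (((@e_last R K)^T *m sg t) 0 0 * ((@e_last R K)^T *m sg t) 0 0)))).
    by apply: tcM; [exact: tc_om|do 2 apply: tcZ; exact: tcM].
  move=> t y; rewrite -expr2.
  have := is_deriveZR (- (qq / 2)) (is_derive_om alpha_gt0 g0_gt0 t) => h.
  apply: is_derive_eq (@is_derive1_comp _ (@expR R) _ t _ _ (is_derive_expR _) h) _.
  by rewrite mulrC.
- exists (fun t y => (-1 * sin (theta t y)) * (mdot (dsg t *m q) y + li)).
    by apply: tcM => //; apply: tcZ; exact: tc_sin.
  move=> t y; rewrite mulN1r.
  apply: is_derive_eq (@is_derive1_comp _ (@cos R) _ t _ _ (is_derive_cos _) (is_derive_theta_t t y)) _.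
  by rewrite mulrC.
- exists (fun t y => cos (theta t y) * (mdot (dsg t *m q) y + li)).
    by apply: tcM => //; exact: tc_cos.
  move=> t y.
  apply: is_derive_eq (@is_derive1_comp _ (@sin R) _ t _ _ (is_derive_sin _) (is_derive_theta_t t y)) _.
  by rewrite mulrC.
- move=> f g cf [f' cf' hf] cg [g' cg' hg].
  by exists (fun t y => f' t y + g' t y) => [|t y]; [exact: tcD|exact: (is_deriveD (hf t y) (hg t y))].
- move=> f g cf [f' cf' hf] cg [g' cg' hg].
  exists (fun t y => f' t y * g t y + f t y * g' t y); last by move=> t y; exact: is_deriveMR.
  by apply: tcD; apply: tcM.
Qed.

Lemma tc_bnd f : tcls f -> exists C k, 0 <= C /\ forall t y, 0 <= t -> `|f t y| <= C * qw Sg y ^+ k.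
Proof.
have qq0 : 0 <= qq by rewrite sumr_ge0// => j _; rewrite -expr2 sqr_ge0.
have q1 (y : M) := qw_ge1 sS y; have qk (y : M) k : 1 <= qw Sg y ^+ k by rewrite exprn_ege1.
have b0 (h : R -> M -> R) : (exists C, forall t y, 0 <= t -> `|h t y| <= C) ->
    exists C k, 0 <= C /\ forall t y, 0 <= t -> `|h t y| <= C * qw Sg y ^+ k.
  move=> [C hC]; exists `|C|, 0%N; split=> // t y t0.
  by rewrite expr0 mulr1 (le_trans (hC t y t0))// ler_norm.
elim=> {f}.
- by move=> c; apply: b0; exists `|c|.
- move=> i j; have [C C0 h] := @coord_le_qw R K.+1 d Sg sS i.
  by exists C, 1%N; split=> // t y _; rewrite expr1.
- by move=> i; apply: b0; have [C C0 h] := mbnd_sg alpha_gt0 g0; exists C => t y t0; exact: h.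
- by move=> i; apply: b0; have [C C0 h] := mbnd_r alpha_gt0 g0; exists C => t y t0; exact: h.
- by apply: b0; have [C h] := bnd_m alpha_gt0 g0; exists C => t y t0; exact: h.
- by apply: b0; have [C h] := bnd_tau alpha_gt0 g0; exists C => t y t0; exact: h.
- apply: b0; exists 1 => t y t0; rewrite ger0_norm ?expR_ge0// -expR0 ler_expR mulNr oppr_le0.
  by rewrite mulr_ge0 ?divr_ge0// OU_om_ge0.
- by apply: b0; exists 1 => t y t0; rewrite ler_norml cos_geN1 cos_le1.
- by apply: b0; exists 1 => t y t0; rewrite ler_norml sin_geN1 sin_le1.
- move=> f g _ [C [k [C0 hf]]] _ [C' [k' [C'0 hg]]].
  exists (C + C'), (k + k')%N; split; first exact: addr_ge0.
  move=> t y t0; apply: le_trans (ler_normD _ _) _; rewrite mulrDl lerD//.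
    by apply: le_trans (hf t y t0) _; rewrite ler_wpM2l// exprD ler_peMr// exprn_ge0// qw_ge0.
  by apply: le_trans (hg t y t0) _; rewrite ler_wpM2l// exprD ler_peMl// exprn_ge0// qw_ge0.
- move=> f g _ [C [k [C0 hf]]] _ [C' [k' [C'0 hg]]].
  exists (C * C'), (k + k')%N; split; first exact: mulr_ge0.
  move=> t y t0; rewrite normrM exprD mulrACA.
  by apply: ler_pM => //; [exact: hf|exact: hg].
Qed.

End time_class.

Lemma Dt_alg {F : numFieldType} (f g a b c u v w : F) :
  f * a + g * b + c / 2 * (f * u + g * v + 2 * w) =
  f * (a + c / 2 * u) + g * (b + c / 2 * v) + c * w.
Proof. by field. Qed.

(** The hypotheses are instances of [lyap_trace] and [lyap_quad]; they eliminate the terms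
    proportional to w itself. *)
Lemma B_real_alg {F : numFieldType} (M a n w m D c s k S dd : F) :
  2 * a + c * k = 0 -> 2 * m + c * s = 0 ->
  - (M * (a * n * w - m * w + D)) + c / 2 * (M * ((s + - k * n) * w - 2 * S + dd)) =
  M * (- D - c * S + c / 2 * dd).
Proof.
move=> /eqP; rewrite addr_eq0 => /eqP ha /eqP; rewrite addr_eq0 => /eqP hm.
have -> : a = - (c * k) / 2 by rewrite -ha; field.
have -> : m = - (c * s) / 2 by rewrite -hm; field.
by field.
Qed.

(** * Generators and their carre du champ *)

Section carre_du_champ.
Context {R : realType} {d K : nat}.
Notation M := 'M[R]_(K.+1, d).
Notation E k l := (delta_mx k l : M).
Variables (W : 'M[R]_K.+1) (g0 : R).
Implicit Types (f g h : M -> R) (y : M).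

(** Generator of the diffusion with drift W y and noise of strength g0 in y^K only. *)
Definition Dt f y : R := \sum_k \sum_l (W *m y) k l * 'D_(E k l) (f : M -> R^o) y +
  g0 ^+ 2 / 2 * \sum_l 'D_(E ord_max l) ('D_(E ord_max l) (f : M -> R^o) : M -> R^o) y.

(** Carre du champ of [Dt]: the defect of the Leibniz rule, see [DtM]. *)
Definition Gm f g y : R :=
  g0 ^+ 2 * \sum_l 'D_(E ord_max l) (f : M -> R^o) y * 'D_(E ord_max l) (g : M -> R^o) y.

Let D f V y := 'D_V (f : M -> R^o) y.

Lemma derE f df V y : is_derive y V (f : M -> R^o) df -> 'D_V (f : M -> R^o) y = df.
Proof. by move=> h; exact: derive_val. Qed.

Lemma der2E f df V ddf y : (forall z, is_derive z V (f : M -> R^o) (df z)) ->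
  is_derive y V (df : M -> R^o) ddf ->
  'D_V ('D_V (f : M -> R^o) : M -> R^o) y = ddf.
Proof.
move=> h1 h2; rewrite (_ : 'D_V (f : M -> R^o) = df); first exact: derE.
by apply/funext => z; exact: derE.
Qed.

Lemma Gm_sym f g y : Gm f g y = Gm g f y.
Proof. by congr (_ * _); apply: eq_bigr => l _; rewrite mulrC. Qed.

Lemma DtD f g y : cls f -> cls g -> Dt (fun z => f z + g z) y = Dt f y + Dt g y.
Proof.
move=> cf cg.
have h1 V z := is_deriveDV (cls_is_derive V z cf) (cls_is_derive V z cg).
have h2 V z := is_deriveDV (cls_is_derive V z (cls_derive V cf)) (cls_is_derive V z (cls_derive V cg)).
rewrite /Dt addrACA -mulrDr -!big_split/=; congr (_ + _ * _).
  apply: eq_bigr => k _; rewrite -big_split/=; apply: eq_bigr => l _.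
  by rewrite (derE (h1 _ y)) mulrDr.
by apply: eq_bigr => l _; rewrite (der2E (h1 _) (h2 _ y)).
Qed.

Lemma Dt_cst (c : R) y : Dt (fun=> c) y = 0.
Proof.
have h1 (b : R) (V z : M) : is_derive z V (fun=> b : R^o) (0 : R) by exact: is_derive_cst.
rewrite /Dt !big1 ?mulr0 ?addr0// => [l _|k _].
  by rewrite (der2E (h1 c _) (h1 0 _ y)).
by rewrite big1// => l _; rewrite (derE (h1 c _ y)) mulr0.
Qed.

Lemma DtM f g y : cls f -> cls g ->
  Dt (fun z => f z * g z) y = f y * Dt g y + g y * Dt f y + Gm f g y.
Proof.
move=> cf cg.
have h1 V z := is_deriveMV (cls_is_derive V z cf) (cls_is_derive V z cg).
have h2 V z := is_deriveDV (is_deriveMV (cls_is_derive V z (cls_derive V cf)) (cls_is_derive V z cg))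
   (is_deriveMV (cls_is_derive V z cf) (cls_is_derive V z (cls_derive V cg))).
have e1 : \sum_k \sum_l (W *m y) k l * 'D_(E k l) (fun z => f z * g z : R^o) y =
   f y * (\sum_k \sum_l (W *m y) k l * 'D_(E k l) (g : M -> R^o) y) +
   g y * (\sum_k \sum_l (W *m y) k l * 'D_(E k l) (f : M -> R^o) y).
  rewrite !mulr_sumr -big_split/=; apply: eq_bigr => k _; rewrite !mulr_sumr -big_split/=.
  apply: eq_bigr => l _; rewrite (derE (h1 _ y)).
  move: ((W *m y) k l) ('D__ (f : M -> R^o) y) ('D__ (g : M -> R^o) y) (f y) (g y) => *; ring.
have e2 : \sum_l 'D_(E ord_max l) ('D_(E ord_max l) (fun z => f z * g z : R^o) : M -> R^o) y =
   f y * (\sum_l 'D_(E ord_max l) ('D_(E ord_max l) (g : M -> R^o) : M -> R^o) y) +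
   g y * (\sum_l 'D_(E ord_max l) ('D_(E ord_max l) (f : M -> R^o) : M -> R^o) y) +
   2 * \sum_l 'D_(E ord_max l) (f : M -> R^o) y * 'D_(E ord_max l) (g : M -> R^o) y.
  rewrite !mulr_sumr -!big_split/=; apply: eq_bigr => l _.
  rewrite (der2E (h1 _) (h2 _ y)).
  move: ('D__ ('D__ (f : M -> R^o) : M -> R^o) y) ('D__ ('D__ (g : M -> R^o) : M -> R^o) y).
  by move: ('D__ (f : M -> R^o) y) ('D__ (g : M -> R^o) y) (f y) (g y) => *; ring.
apply: etrans (congr2 (fun a b => a + g0 ^+ 2 / 2 * b) e1 e2) _; rewrite /Dt /Gm.
exact: Dt_alg.
Qed.

Lemma DtZ c f y : cls f -> Dt (fun z => c * f z) y = c * Dt f y.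
Proof.
move=> cf; rewrite (DtM y (cls_cst c) cf) Dt_cst mulr0 addr0 /Gm big1 ?mulr0 ?addr0// => l _.
by rewrite (derE (is_derive_cst _ _ _)) mul0r.
Qed.

Lemma Dt_sum (I : Type) (r : seq I) (h : I -> M -> R) y : (forall i, cls (h i)) ->
  Dt (fun z => \sum_(i <- r) h i z) y = \sum_(i <- r) Dt (h i) y.
Proof.
move=> ch; elim: r => [|i r IH].
  rewrite big_nil -[RHS](Dt_cst 0 y); congr (Dt _ y).
  by apply/funext => z; rewrite big_nil.
rewrite [RHS]big_cons -IH -(DtD y (ch i) (cls_sum r ch)).
by congr (Dt _ y); apply/funext => z; rewrite big_cons.
Qed.

Lemma Dt_comp (b b' b'' : R -> R) f y :
  (forall x : R, is_derive x 1 (b : R -> R^o) (b' x)) ->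
  (forall x : R, is_derive x 1 (b' : R -> R^o) (b'' x)) -> cls f ->
  Dt (fun z => b (f z)) y = b' (f y) * Dt f y + b'' (f y) / 2 * Gm f f y.
Proof.
move=> hb hb' cf.
have h1 V z := is_derive_compV (hb (f z)) (cls_is_derive V z cf).
have h2 V z := is_deriveMV (is_derive_compV (hb' (f z)) (cls_is_derive V z cf)) (cls_is_derive V z (cls_derive V cf)).
have e1 : \sum_k \sum_l (W *m y) k l * 'D_(E k l) (fun z => b (f z) : R^o) y =
   b' (f y) * (\sum_k \sum_l (W *m y) k l * 'D_(E k l) (f : M -> R^o) y).
  rewrite mulr_sumr; apply: eq_bigr => k _; rewrite mulr_sumr; apply: eq_bigr => l _.
  by rewrite (derE (h1 _ y)) mulrCA.
have e2 : \sum_l 'D_(E ord_max l) ('D_(E ord_max l) (fun z => b (f z) : R^o) : M -> R^o) y =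
   b' (f y) * (\sum_l 'D_(E ord_max l) ('D_(E ord_max l) (f : M -> R^o) : M -> R^o) y) +
   b'' (f y) * (\sum_l 'D_(E ord_max l) (f : M -> R^o) y * 'D_(E ord_max l) (f : M -> R^o) y).
  rewrite !mulr_sumr -!big_split/=; apply: eq_bigr => l _.
  by rewrite (der2E (h1 _) (h2 _ y)) addrC mulrA.
apply: etrans (congr2 (fun a b => a + g0 ^+ 2 / 2 * b) e1 e2) _; rewrite /Dt /Gm.
by move: (\sum_k _) (\sum_l _) (\sum_l _) => *; field.
Qed.

Lemma GmD f g h y : cls f -> cls g -> Gm (fun z => f z + g z) h y = Gm f h y + Gm g h y.
Proof.
move=> cf cg; rewrite /Gm -mulrDr -big_split/=; congr (_ * _); apply: eq_bigr => l _.
by rewrite (derE (is_deriveDV (cls_is_derive _ y cf) (cls_is_derive _ y cg))) mulrDl.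
Qed.

Lemma Gm_cst (c : R) h y : Gm (fun=> c) h y = 0.
Proof.
rewrite /Gm big1 ?mulr0// => l _.
by rewrite (derE (is_derive_cst _ _ _)) mul0r.
Qed.

Lemma GmM f g h y : cls f -> cls g -> Gm (fun z => f z * g z) h y = f y * Gm g h y + g y * Gm f h y.
Proof.
move=> cf cg; rewrite /Gm mulrCA [g y * _]mulrCA -mulrDr; congr (_ * _).
rewrite !mulr_sumr -big_split/=; apply: eq_bigr => l _.
rewrite (derE (is_deriveMV (cls_is_derive _ y cf) (cls_is_derive _ y cg))); ring.
Qed.

Lemma GmZ c f h y : cls f -> Gm (fun z => c * f z) h y = c * Gm f h y.
Proof. by move=> cf; rewrite (GmM h y (cls_cst c) cf) Gm_cst mulr0 addr0. Qed.

Lemma Gm_sum (I : Type) (r : seq I) (f : I -> M -> R) h y : (forall i, cls (f i)) ->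
  Gm (fun z => \sum_(i <- r) f i z) h y = \sum_(i <- r) Gm (f i) h y.
Proof.
move=> ch; elim: r => [|i r IH].
  rewrite big_nil -[RHS](Gm_cst 0 h y); congr (Gm _ _ y).
  by apply/funext => z; rewrite big_nil.
rewrite [RHS]big_cons -IH -(GmD h y (ch i) (cls_sum r ch)).
by congr (Gm _ _ y); apply/funext => z; rewrite big_cons.
Qed.

Lemma Gm_comp (b b' : R -> R) f h y :
  (forall x : R, is_derive x 1 (b : R -> R^o) (b' x)) -> cls f ->
  Gm (fun z => b (f z)) h y = b' (f y) * Gm f h y.
Proof.
move=> hb cf; rewrite /Gm [RHS]mulrCA; congr (_ * _); rewrite mulr_sumr; apply: eq_bigr => l _.
by rewrite (derE (is_derive_compV (hb (f y)) (cls_is_derive _ y cf))) mulrA.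
Qed.

Lemma Gm_mdot (th th' : M) y :
  Gm (mdot th) (mdot th') y = g0 ^+ 2 * \sum_l th ord_max l * th' ord_max l.
Proof.
congr (_ * _); apply: eq_bigr => l _.
by rewrite !(derE (is_derive_mdot _ y _)) ![mdot _ (E _ _)]mdotC !mdot_delta.
Qed.

Lemma Dt_mdot (th : M) y : Dt (mdot th) y = mdot (W^T *m th) y.
Proof.
have h1 V z := is_derive_mdot th z V.
have h2 V : is_derive y V (fun=> mdot th V : R^o) (0 : R) by exact: is_derive_cst.
rewrite /Dt [X in _ + _ * X]big1 => [|l _]; last by rewrite (der2E (h1 _) (h2 _)).
rewrite mulr0 addr0 -mdotMr; apply: eq_bigr => k _; apply: eq_bigr => l _.
by rewrite (derE (h1 _ y)) [mdot th (E _ _)]mdotC mdot_delta mulrC.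
Qed.

End carre_du_champ.

(** * Conjugation by the stationary density *)

Section conjugation.
Context {R : realType} {d K : nat} (alpha : 'I_K.+1 -> R).
Hypothesis alpha_gt0 : forall k, 0 < alpha k.
Variable g0 : R.
Hypothesis g0_gt0 : 0 < g0.
Notation M := 'M[R]_(K.+1, d).
Notation A := (drift alpha).
Notation Sg := (OU_cov A g0).
Notation S := (invmx Sg).
Notation E k l := (delta_mx k l : M).
Notation M0 := (@maxwellian R d K Sg).
Notation e := (@e_last R K).
Let sS : spd Sg. Proof. exact: OU_spd. Qed.
Let uS : Sg \in unitmx. Proof. exact: spd_unit. Qed.
Let ST : S^T = S. Proof. by have [] := spd_inv sS. Qed.

(* Transposed drift of the time-reversed process: conjugation of the
   Fokker-Planck operator by the stationary density reverses time. *)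
Definition Wrev : 'M[R]_K.+1 := (S *m A *m Sg)^T.

Lemma WrevE : Wrev = - A - g0 ^+ 2 *: (e *m e^T *m S).
Proof.
have h := congr1 (fun X => X *m Sg) (lyap_inv alpha_gt0 g0_gt0).
rewrite /= mulmxDl -[A^T *m S *m Sg]mulmxA mulVmx// mulmx1 mulNmx -scalemxAl in h.
have -> : Wrev = (- (g0 ^+ 2 *: (S *m e *m (S *m e)^T *m Sg)) - A^T)^T.
  by rewrite /Wrev -h addrK.
rewrite linearB/= trmxK linearN/= linearZ/= addrC; congr (- _ - _ *: _).
by rewrite !trmx_mul !trmxK ST (proj1 sS) !mulmxA mulmxV// mul1mx.
Qed.

(** Trace of the inverse Lyapunov equation times Sigma. With [lyap_quad] it expresses that M_0 is
    stationary: this identity kills the constant zeroth-order term, the other one the quadratic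
    term. *)
Lemma lyap_trace : 2 * \tr A + g0 ^+ 2 * S ord_max ord_max = 0.
Proof.
have h := congr1 (fun X => \tr (X *m Sg)) (lyap_inv alpha_gt0 g0_gt0).
have e1 : \tr (S *m A *m Sg) = \tr A by rewrite mxtrace_mulC mulmxA mulmxV// mul1mx.
have e2 : \tr (S *m e *m (S *m e)^T *m Sg) = S ord_max ord_max.
  rewrite -mulmxA mxtrace_mulC trmx_mul ST -[e^T *m S *m Sg]mulmxA mulVmx// mulmx1.
  rewrite /e_last trmx_delta -rowE -colE trace_mx11 mxE mxE//.
move: h; rewrite /= mulmxDl mxtraceD e1 -mulmxA mulVmx// mulmx1 mxtrace_tr.
rewrite mulNmx -scalemxAl linearN linearZ/= e2; lra.
Qed.

(** The inverse Lyapunov equation evaluated as a quadratic form on the columns of y. *)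
Lemma lyap_quad (y : M) : 2 * mdot (A *m y) (S *m y) + g0 ^+ 2 * \sum_l (S *m y) ord_max l ^+ 2 = 0.
Proof.
have h := congr1 (fun X => \tr (y^T *m X *m y)) (lyap_inv alpha_gt0 g0_gt0).
have e1 : \tr (y^T *m (A^T *m S) *m y) = mdot (A *m y) (S *m y).
  by rewrite mdotE trmx_mul !mulmxA.
have e0 : \tr (y^T *m (S *m A) *m y) = mdot (A *m y) (S *m y).
  by rewrite mdotC mdotE trmx_mul ST !mulmxA.
have e2 : \tr (y^T *m (S *m e *m (S *m e)^T) *m y) = \sum_l (S *m y) ord_max l ^+ 2.
  rewrite !mulmxA -[_ *m (S *m e)^T *m y]mulmxA mxtrace_mulC.
  have -> : (S *m e)^T *m y = row ord_max (S *m y).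
    by rewrite trmx_mul ST -mulmxA /e_last trmx_delta -rowE.
  have -> : y^T *m S *m e = (row ord_max (S *m y))^T.
    by rewrite -[in LHS]ST -trmx_mul /e_last -colE tr_row.
  rewrite /mxtrace big_ord1 mxE; apply: eq_bigr => l _.
  by rewrite [X in _ * X]mxE [row _ _ _ _]mxE expr2.
move: h; rewrite /= mulmxDr mulmxDl mxtraceD e1 e0 mulmxN mulNmx -scalemxAr -scalemxAl.
rewrite linearN linearZ/= e2; lra.
Qed.

Lemma is_derive_M0 (y V : M) : is_derive y V (M0 : M -> R^o) (- mdot (S *m V) y * M0 y).
Proof.
rewrite (_ : (M0 : M -> R^o) = (fun z => @mw_cst R d K Sg * gw Sg z)); last first.
  by apply/funext => z; exact: maxwellianE.
by apply: is_derive_eq (is_deriveZV _ (is_derive_gw sS y V)) _; rewrite mulrCA.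
Qed.

Lemma mdot_SE k l (y : M) : mdot (S *m E k l) y = (S *m y) k l.
Proof. by rewrite -[in LHS]ST -mdotMr mdot_delta. Qed.

(** No zeroth-order term survives since M_0 is stationary. The cross term of the diffusion, - g0^2
    (S y) in the last row, joins - A y to form the reversed drift [Wrev]. *)
Lemma B_real_M0 (w : M -> R) y : cls w ->
  B_real A g0 (fun z => M0 z * w z) y = M0 y * Dt Wrev g0 w y.
Proof.
move=> cw.
have h0 k l z : is_derive z (E k l) (M0 : M -> R^o) (- (S *m z) k l * M0 z).
  by rewrite -mdot_SE; exact: is_derive_M0.
have hA k l z : is_derive z (E k l) (fun z : M => (A *m z) k l : R^o) (A k k).
  rewrite (_ : (fun z : M => _) = (fun z : M => \sum_j A k j * z j l)); last by apply/funext => x; rewrite mxE.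
  apply: is_derive_eq (is_derive_sumV _ (fun j => is_deriveZV (A k j) (is_derive_coord j l z (E k l)))) _.
  rewrite (bigD1 k)//= [X in _ * X]mxE !eqxx mulr1 big1 ?addr0// => j jk.
  by rewrite [X in _ * X]mxE (negbTE jk) mulr0.
have hS k l z : is_derive z (E k l) (fun z : M => (S *m z) k l : R^o) (S k k).
  rewrite (_ : (fun z : M => _) = (fun z : M => \sum_j S k j * z j l)); last by apply/funext => x; rewrite mxE.
  apply: is_derive_eq (is_derive_sumV _ (fun j => is_deriveZV (S k j) (is_derive_coord j l z (E k l)))) _.
  rewrite (bigD1 k)//= [X in _ * X]mxE !eqxx mulr1 big1 ?addr0// => j jk.
  by rewrite [X in _ * X]mxE (negbTE jk) mulr0.
have hw V z := cls_is_derive V z cw.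
have hww V z := cls_is_derive V z (cls_derive V cw).
have h1 k l z := is_deriveMV (h0 k l z) (hw (E k l) z).
have e1 k l : 'D_(E k l) (fun z => (A *m z) k l * (M0 z * w z) : R^o) y =
   M0 y * (A k k * w y - (A *m y) k l * (S *m y) k l * w y + (A *m y) k l * 'D_(E k l) (w : M -> R^o) y).
  by rewrite (derE (is_deriveMV (hA k l y) (h1 k l y))); ring.
have e2 l : 'D_(E ord_max l) ('D_(E ord_max l) (fun z => M0 z * w z : R^o) : M -> R^o) y =
  M0 y * (((S *m y) ord_max l ^+ 2 - S ord_max ord_max) * w y -
     2 * ((S *m y) ord_max l * 'D_(E ord_max l) (w : M -> R^o) y) +
     'D_(E ord_max l) ('D_(E ord_max l) (w : M -> R^o) : M -> R^o) y).
  have h2 z := is_deriveMV (is_deriveZV (-1) (hS ord_max l z)) (h0 ord_max l z).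
  have h3 := is_deriveDV (is_deriveMV (h2 y) (hw (E ord_max l) y)) (is_deriveMV (h0 ord_max l y) (hww (E ord_max l) y)).
  rewrite (der2E (df := fun z => -1 * (S *m z) ord_max l * M0 z * w z + M0 z * 'D_(E ord_max l) (w : M -> R^o) z) _ h3).
    by ring.
  by move=> z; rewrite mulN1r; exact: h1.
rewrite /B_real.
under eq_bigr => k _ do (under eq_bigr => l _ do rewrite e1; rewrite -mulr_sumr !big_split/= sumrN -!mulr_suml sumr_const card_ord).
under [X in _ + _ * X]eq_bigr => l _ do rewrite e2.
rewrite -!mulr_sumr !big_split/= !sumrN -!mulr_suml -!mulr_sumr big_split/= sumr_const card_ord.
rewrite -/(mdot (A *m y) (S *m y)).
rewrite /Dt.
have -> : \sum_k \sum_l (Wrev *m y) k l * 'D_(E k l) (w : M -> R^o) y =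
   - (\sum_k \sum_l (A *m y) k l * 'D_(E k l) (w : M -> R^o) y) -
   g0 ^+ 2 * \sum_l (S *m y) ord_max l * 'D_(E ord_max l) (w : M -> R^o) y.
  transitivity (\sum_k \sum_l (- ((A *m y) k l * 'D_(E k l) (w : M -> R^o) y) -
     g0 ^+ 2 * ((k == ord_max)%:R * ((S *m y) k l * 'D_(E k l) (w : M -> R^o) y)))).
    apply: eq_bigr => k _; apply: eq_bigr => l _.
    rewrite WrevE mulmxBl mulNmx -scalemxAl mxaddE !mxoppE mxscaleE.
    have -> : (e *m e^T *m S *m y) k l = (k == ord_max)%:R * (S *m y) k l.
      rewrite -!mulmxA [LHS]mxE big_ord1 [X in X * _]mxE andbT.
      case: (k =P ord_max) => [->|_]; last by rewrite !mul0r.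
      by rewrite !mul1r /e_last trmx_delta -rowE [LHS]mxE.
    by move: ((A *m y) k l) ((S *m y) k l) ('D__ _ _) (_%:R) => *; ring.
  under eq_bigr => k _ do rewrite big_split/= !sumrN -!mulr_sumr.
  rewrite big_split/= !sumrN -mulr_sumr; congr (_ - _ * _).
  rewrite (bigD1 ord_max)//= eqxx mul1r [X in _ + X]big1 ?addr0// => k km.
  by rewrite (negbTE km) mul0r.
by rewrite sumrMnl -[X in X * w y - _]mulr_natr -[- _ *+ d]mulr_natr; apply: B_real_alg (lyap_quad y); exact: lyap_trace.
Qed.

Section kernel_evolution.
Variables (q : 'rV[R]_d) (li : R).
Let qq := dotp q q.
Notation tc := (tcls alpha g0 q li).
Notation sg := (OU_sg alpha g0).
Notation rr := (OU_r alpha g0).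
Notation th := (theta alpha g0 q li).
Notation mt := (OU_m alpha g0).
Notation tau := (OU_tau alpha g0).
Notation om := (OU_om alpha g0).
Notation DtW := (Dt Wrev g0).
Notation GmW := (@Gm R d K g0).

Definition rl (l : 'I_d) t : M -> R := mdot (rr t *m (delta_mx 0 l : 'rV[R]_d)).
Definition sl t : M -> R := mdot (rr t *m q).
(** Start from the shifted density M_0(y - e_K p) with p in R^d. Since Y_t and the integral of Y^1
    remain jointly Gaussian, the solution divided by M_0 equals a factor independent of p times
    exp(sum_l p_l (r . y_l - i m q_l) - tau |p|^2 / 2). Its Laplacian in p at p = 0 brings down the
    polynomial [Xt] - i [Yt]. *)
Definition Xt t (y : M) : R := \sum_l rl l t y * rl l t y + (- qq * mt t ^+ 2 - d%:R * tau t).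
Definition Yt t (y : M) : R := 2 * mt t * sl t y.
Definition Et t : R := expR (- (qq / 2) * om t).
(* e^(- Re lambda t) ([vRe] + i [vIm]) is e^(- lambda t) u(t) / M_0, where u solves
   d_t u = B_n u with u(0) = Delta_{y^K} M_0; here [li] = Im lambda. *)
Definition vRe t (y : M) : R := Et t * (Xt t y * cos (th t y) + - 1 * (Yt t y * sin (th t y))).
Definition vIm t (y : M) : R := - Et t * (Xt t y * sin (th t y) + Yt t y * cos (th t y)).

Let eE (c : 'cV[R]_K.+1) : (e^T *m c) 0 0 = c ord_max 0.
Proof. by rewrite /e_last trmx_delta -rowE [LHS]mxE. Qed.

Let thrE (c : 'cV[R]_K.+1) (p : 'rV[R]_d) l : (c *m p) ord_max l = c ord_max 0 * p 0 l.
Proof. by rewrite [LHS]mxE big_ord1. Qed.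

Let mder_mdot (F : R -> 'cV[R]_K.+1) (t : R) F' (p : 'rV[R]_d) (y : M) : mder F t F' ->
  is_derive t 1 (fun s => mdot (F s *m p) y : R^o) (mdot (F' *m p) y).
Proof.
move=> h; apply: is_derive_sumR => i; apply: is_derive_sumR => j.
have h1 := mderMr p h i j.
by apply: is_derive_eq (is_deriveMR h1 (is_derive_cst (y i j) t 1)) _; rewrite mulr0 addr0.
Qed.

Let Dt_r t (p : 'rV[R]_d) y : DtW (mdot (rr t *m p)) y = mdot (S *m A *m Sg *m rr t *m p) y.
Proof. by rewrite Dt_mdot /Wrev trmxK !mulmxA. Qed.

Let Dt_th t y : DtW (th t) y = mdot ((S *m A *m Sg *m sg t + (@e_first R K)^T) *m q) y - mdot (@Q1 R d K q) y.
Proof.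
have := cls_mdot (sg t *m q) => c1.
rewrite (DtD Wrev g0 y c1 (cls_cst _)) Dt_cst addr0 Dt_mdot /Wrev trmxK mulmxDl mdotDl !mulmxA.
by rewrite /Q1 addrK.
Qed.

Let mdot_col (c : 'cV[R]_K.+1) (p : 'rV[R]_d) (y : M) :
  mdot (c *m p) y = \sum_l (c^T *m y) 0 l * p 0 l.
Proof.
rewrite mdotE trmx_mul -mulmxA mxtrace_mulC /mxtrace big_ord1 mxE.
by apply: eq_bigr => l _; rewrite [p^T _ _]mxE.
Qed.

Let mdot_col1 (c : 'cV[R]_K.+1) l (y : M) : mdot (c *m (delta_mx 0 l : 'rV[R]_d)) y = (c^T *m y) 0 l.
Proof.
rewrite mdot_col (bigD1 l)//= [X in _ + X]big1 ?addr0 => [|j /negbTE jl].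
  by rewrite [X in _ * X]mxE !eqxx mulr1.
by rewrite [X in _ * X]mxE eqxx jl mulr0.
Qed.

Let slE t y : sl t y = \sum_l rl l t y * q 0 l.
Proof. by rewrite /sl mdot_col; apply: eq_bigr => l _; rewrite /rl mdot_col1. Qed.

Let crl l t : cls (rl l t). Proof. exact: cls_mdot. Qed.
Let csl t : cls (sl t). Proof. exact: cls_mdot. Qed.
Let cth t : cls (th t). Proof. exact: cls_theta. Qed.
Let crl2 t l : cls (fun y => rl l t y * rl l t y). Proof. exact: clsM. Qed.
Let cX t : cls (Xt t).
Proof. by apply: clsD; [apply: cls_sum => l|exact: cls_cst]. Qed.
Let cY t : cls (Yt t). Proof. exact: clsZ. Qed.
Let ccos t : cls (fun y => cos (th t y)). Proof. exact: cls_comp sm1_cos _. Qed.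
Let csin t : cls (fun y => sin (th t y)). Proof. exact: cls_comp sm1_sin _. Qed.

Let Gth t f y : GmW (th t) f y = GmW (mdot (sg t *m q)) f y.
Proof. by rewrite (GmD g0 f y (cls_mdot _) (cls_cst _)) Gm_cst addr0. Qed.

Let G_thth t y : GmW (th t) (th t) y = g0 ^+ 2 * sg t ord_max 0 ^+ 2 * qq.
Proof.
rewrite Gth Gm_sym Gth Gm_mdot -mulrA; congr (_ * _); rewrite mulr_sumr; apply: eq_bigr => l _.
by rewrite !thrE; ring.
Qed.

Let G_slth t y : GmW (th t) (sl t) y = g0 ^+ 2 * (sg t ord_max 0 * rr t ord_max 0) * qq.
Proof.
rewrite Gth Gm_mdot -mulrA; congr (_ * _); rewrite mulr_sumr; apply: eq_bigr => l _.
by rewrite !thrE; ring.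
Qed.

Let delta1 l j : (delta_mx 0 l : 'rV[R]_d) 0 j = (j == l)%:R.
Proof. by rewrite mxE eqxx. Qed.

Let G_rlth l t y : GmW (th t) (rl l t) y = g0 ^+ 2 * (sg t ord_max 0 * rr t ord_max 0) * q 0 l.
Proof.
rewrite Gth Gm_mdot -mulrA; congr (_ * _); rewrite (bigD1 l)//= [X in _ + X]big1 ?addr0 => [|j /negbTE jl].
  by rewrite !thrE delta1 eqxx mulr1; ring.
by rewrite !thrE delta1 jl !mulr0.
Qed.

Let G_rlrl l t y : GmW (rl l t) (rl l t) y = g0 ^+ 2 * rr t ord_max 0 ^+ 2.
Proof.
rewrite Gm_mdot; congr (_ * _); rewrite (bigD1 l)//= [X in _ + X]big1 ?addr0 => [|j /negbTE jl].
  by rewrite !thrE delta1 eqxx mulr1 expr2.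
by rewrite !thrE delta1 jl !mulr0.
Qed.

Let G_Xth t y : GmW (th t) (Xt t) y = 2 * (g0 ^+ 2 * (sg t ord_max 0 * rr t ord_max 0)) * sl t y.
Proof.
have cs : cls (fun y => \sum_l rl l t y * rl l t y) by apply: cls_sum => l; exact: crl2.
rewrite Gm_sym (GmD g0 (th t) y cs (cls_cst _)) Gm_cst addr0 (Gm_sum g0 _ _ _ (crl2 t)).
rewrite slE mulr_sumr; apply: eq_bigr => l _.
rewrite (GmM g0 (th t) y (crl l t) (crl l t)) Gm_sym G_rlth; ring.
Qed.

Let G_Yth t y : GmW (th t) (Yt t) y = 2 * mt t * (g0 ^+ 2 * (sg t ord_max 0 * rr t ord_max 0) * qq).
Proof. by rewrite Gm_sym (GmZ g0 _ _ y (csl t)) Gm_sym G_slth. Qed.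

Let drl l t y := mdot (S *m A *m Sg *m rr t *m (delta_mx 0 l : 'rV[R]_d)) y.
Let dsl t y := mdot (S *m A *m Sg *m rr t *m q) y.
Let dth t y := mdot ((S *m A *m Sg *m sg t + (@e_first R K)^T) *m q) y.

Let D_X t y : DtW (Xt t) y = 2 * (\sum_l rl l t y * drl l t y) + d%:R * (g0 ^+ 2 * rr t ord_max 0 ^+ 2).
Proof.
have cs : cls (fun y => \sum_l rl l t y * rl l t y) by apply: cls_sum => l; exact: crl2.
rewrite (DtD _ g0 y cs (cls_cst _)) Dt_cst addr0 (Dt_sum _ g0 _ y (crl2 t)).
rewrite (_ : d%:R * _ = \sum_(l < d) (g0 ^+ 2 * rr t ord_max 0 ^+ 2)); last by rewrite sumr_const card_ord mulr_natl.
rewrite mulr_sumr -big_split/=; apply: eq_bigr => l _.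
rewrite (DtM _ g0 y (crl l t) (crl l t)) G_rlrl Dt_r -/(drl l t y); ring.
Qed.

Let D_Y t y : DtW (Yt t) y = 2 * mt t * dsl t y.
Proof. by rewrite (DtZ _ g0 _ y (csl t)) Dt_r. Qed.

Let cosN' (x : R) : is_derive x 1 ((fun x => - sin x) : R -> R^o) (- cos x).
Proof. exact: is_deriveN (is_derive_sin x). Qed.

Let D_cos t y : DtW (fun z => cos (th t z)) y = - sin (th t y) * (dth t y - mdot (@Q1 R d K q) y) -
  cos (th t y) / 2 * (g0 ^+ 2 * sg t ord_max 0 ^+ 2 * qq).
Proof.
by rewrite (Dt_comp _ g0 y (@is_derive_cos R) cosN' (cth t)) G_thth Dt_th !mulNr.
Qed.

Let D_sin t y : DtW (fun z => sin (th t z)) y = cos (th t y) * (dth t y - mdot (@Q1 R d K q) y) -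
  sin (th t y) / 2 * (g0 ^+ 2 * sg t ord_max 0 ^+ 2 * qq).
Proof.
by rewrite (Dt_comp _ g0 y (@is_derive_sin R) (@is_derive_cos R) (cth t)) G_thth Dt_th !mulNr.
Qed.

Let dX (t : R) y : is_derive t 1 (Xt ^~ y : R -> R^o) (2 * (\sum_l rl l t y * drl l t y) +
  (- qq * (2 * (mt t * (g0 ^+ 2 * (rr t ord_max 0 * sg t ord_max 0)))) + d%:R * (g0 ^+ 2 * rr t ord_max 0 ^+ 2))).
Proof.
have h l := mder_mdot (delta_mx 0 l : 'rV[R]_d) y (mder_r alpha_gt0 g0_gt0 t).
have h1 l := is_deriveMR (h l) (h l).
have hm := is_derive_m alpha_gt0 g0_gt0 t.
have ht := is_derive_tau alpha_gt0 g0_gt0 t.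
have hc := is_deriveB (is_deriveZR (- qq) (is_deriveMR hm hm)) (is_deriveZR d%:R ht).
have h2 := is_deriveD (is_derive_sumR (index_enum 'I_d) h1) hc.
rewrite (_ : Xt ^~ y = (fun t => \sum_l rl l t y * rl l t y + (- qq * (mt t * mt t) - d%:R * tau t))); last first.
  by apply/funext => s; rewrite /Xt expr2.
apply: is_derive_eq h2 _; rewrite !eE.
rewrite mulr_sumr; congr (_ + _); first by apply: eq_bigr => l _; rewrite /rl /drl; ring.
by move: (rr t _ _) (sg t _ _) (mt t) (d%:R) qq => *; ring.
Qed.

Let dY (t : R) y : is_derive t 1 (Yt ^~ y : R -> R^o)
  (2 * (g0 ^+ 2 * (rr t ord_max 0 * sg t ord_max 0)) * sl t y + 2 * mt t * dsl t y).
Proof.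
have h := mder_mdot q y (mder_r alpha_gt0 g0_gt0 t).
have hm := is_derive_m alpha_gt0 g0_gt0 t.
by apply: is_derive_eq (is_deriveMR (is_deriveZR 2 hm) h) _; rewrite !eE.
Qed.

Let dE (t : R) : is_derive t 1 (Et : R -> R^o) (Et t * (- (qq / 2) * (g0 ^+ 2 * sg t ord_max 0 ^+ 2))).
Proof.
have h := is_deriveZR (- (qq / 2)) (is_derive_om alpha_gt0 g0_gt0 t); rewrite eE in h.
by apply: is_derive_eq (@is_derive1_comp _ (@expR R) _ t _ _ (is_derive_expR _) h) _; rewrite mulrC.
Qed.

Let dcos (t : R) y : is_derive t 1 (fun s => cos (th s y) : R^o) (- sin (th t y) * (dth t y + li)).
Proof.
by apply: is_derive_eq (@is_derive1_comp _ (@cos R) _ t _ _ (is_derive_cos _) (is_derive_theta_t alpha_gt0 g0_gt0 q li t y)) _; rewrite mulrC.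
Qed.

Let dsin (t : R) y : is_derive t 1 (fun s => sin (th s y) : R^o) (cos (th t y) * (dth t y + li)).
Proof.
by apply: is_derive_eq (@is_derive1_comp _ (@sin R) _ t _ _ (is_derive_sin _) (is_derive_theta_t alpha_gt0 g0_gt0 q li t y)) _; rewrite mulrC.
Qed.

(** Transport terms match because r and sg follow the reversed drift. Each carre du champ term is,
    up to sign and a constant factor, the time derivative of a coefficient: that of r . r belongs to
    tau, that of r . sg to m, and that of sg . sg to om. *)
Lemma is_derive_vRe (t : R) y : is_derive t 1 (vRe ^~ y : R -> R^o)
  (DtW (vRe t) y + mdot (@Q1 R d K q) y * vIm t y + li * vIm t y).
Proof.
have h : is_derive t 1 (fun s => Xt s y * cos (th s y) + - 1 * (Yt s y * sin (th s y)) : R^o) _ :=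
  is_deriveD (is_deriveMR (dX t y) (dcos t y)) (is_deriveZR (-1) (is_deriveMR (dY t y) (dsin t y))).
apply: is_derive_eq (is_deriveMR (dE t) h) _.
have c1 := clsM (cX t) (ccos t); have c2 := clsM (cY t) (csin t).
rewrite /vRe (DtZ _ g0 _ y (clsD c1 (clsZ _ c2))) (DtD _ g0 y c1 (clsZ _ c2)) (DtZ _ g0 _ y c2).
rewrite (DtM _ g0 y (cX t) (ccos t)) (DtM _ g0 y (cY t) (csin t)).
rewrite ![GmW _ (fun z => _ (th t z)) y]Gm_sym (Gm_comp g0 _ y (@is_derive_cos R) (cth t)) (Gm_comp g0 _ y (@is_derive_sin R) (cth t)).
rewrite G_Xth G_Yth D_X D_Y D_cos D_sin /vIm /Yt.
move: (rr t _ _) (sg t _ _) (mt t) (d%:R) qq (Xt t y) (sl t y) (dsl t y) (dth t y) (cos _) (sin _) (mdot _ y) (Et t) (\sum_l _) => *.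
by field.
Qed.

Lemma is_derive_vIm (t : R) y : is_derive t 1 (vIm ^~ y : R -> R^o)
  (DtW (vIm t) y - mdot (@Q1 R d K q) y * vRe t y - li * vRe t y).
Proof.
have h : is_derive t 1 (fun s => Xt s y * sin (th s y) + Yt s y * cos (th s y) : R^o) _ :=
  is_deriveD (is_deriveMR (dX t y) (dsin t y)) (is_deriveMR (dY t y) (dcos t y)).
have hE : is_derive t 1 (fun s => - Et s : R^o) _ := is_deriveN (dE t).
apply: is_derive_eq (is_deriveMR hE h) _.
have c1 := clsM (cX t) (csin t); have c2 := clsM (cY t) (ccos t).
rewrite /vIm (DtZ _ g0 _ y (clsD c1 c2)) (DtD _ g0 y c1 c2).
rewrite (DtM _ g0 y (cX t) (csin t)) (DtM _ g0 y (cY t) (ccos t)).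
rewrite ![GmW _ (fun z => _ (th t z)) y]Gm_sym (Gm_comp g0 _ y (@is_derive_cos R) (cth t)) (Gm_comp g0 _ y (@is_derive_sin R) (cth t)).
rewrite G_Xth G_Yth D_X D_Y D_cos D_sin /vRe /Yt.
move: (rr t _ _) (sg t _ _) (mt t) (d%:R) qq (Xt t y) (sl t y) (dsl t y) (dth t y) (cos _) (sin _) (mdot _ y) (Et t) (\sum_l _) => *.
by field.
Qed.

Let tc_mdot_r (p : 'rV[R]_d) : tc (fun t y => mdot (rr t *m p) y).
Proof.
apply: (@tc_eq _ _ _ _ _ _ _ (fun t y => \sum_i rr t i 0 * \sum_j (p 0 j * y i j))).
  by apply: tc_sum => i; apply: tcM; [exact: tc_r|apply: tc_sum => j; apply: tcZ; exact: tc_coord].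
move=> t y; apply: eq_bigr => i _; rewrite mulr_sumr; apply: eq_bigr => j _.
by rewrite [in RHS]mxE big_ord1 mulrA.
Qed.

Let tc_X : tc Xt.
Proof.
apply: tcD; first by apply: tc_sum => l; apply: tcM; exact: tc_mdot_r.
apply: (@tc_eq _ _ _ _ _ _ _ (fun t _ => - qq * (mt t * mt t) + - d%:R * tau t)).
  by apply: tcD; apply: tcZ; [apply: tcM; exact: tc_m|exact: tc_tau].
by move=> t y; rewrite expr2 mulNr.
Qed.

Let tc_Y : tc Yt.
Proof. by apply: tcM; [apply: tcZ; exact: tc_m|exact: tc_mdot_r]. Qed.

Lemma tc_vRe : tc vRe.
Proof.
apply: tcM; first exact: tc_om.
by apply: tcD; [|apply: tcZ]; apply: tcM => //; [exact: tc_cos|exact: tc_sin].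
Qed.

Lemma tc_vIm : tc vIm.
Proof.
apply: (@tc_eq _ _ _ _ _ _ _ (fun t y => -1 * Et t * (Xt t y * sin (th t y) + Yt t y * cos (th t y)))).
  apply: tcM; first by apply: tcZ; exact: tc_om.
  by apply: tcD; apply: tcM => //; [exact: tc_sin|exact: tc_cos].
by move=> t y; rewrite mulN1r.
Qed.

Lemma v0E y : M0 y * vRe 0 y = lapM0 Sg y /\ vIm 0 y = 0.
Proof.
have t0 : th 0 y = 0 by rewrite /theta OU_sg0 mul0mx mdot0l mulr0 addr0.
rewrite /vRe /vIm /Xt /Yt OU_m0 mulr0 !mul0r t0 sin0 cos0 !mulr0 addr0 mulr1 addr0 mulr0; split=> //.
rewrite /Et OU_om0 mulr0 expR0 mul1r expr0n mulr0 sub0r OU_tau0.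
rewrite maxwellianE /lapM0 -mulrA; congr (_ * _).
rewrite (_ : d%:R * _ = \sum_(l < d) (e^T *m S *m e) 0 0); last by rewrite sumr_const card_ord mulr_natl.
rewrite -sumrB mulr_sumr; apply: eq_bigr => l _.
rewrite /d2gw mulrC; congr (_ * _); rewrite /rl OU_r0 -expr2.
have -> : S *m e *m (delta_mx 0 l : 'rV[R]_d) = S *m E ord_max l.
  by rewrite -mulmxA /e_last mul_delta_mx.
congr (_ - _).
rewrite mdot_SE -[e^T *m S *m e]mulmxA eE.
rewrite (_ : E ord_max l = e *m (delta_mx 0 l : 'rV[R]_d)); last by rewrite /e_last mul_delta_mx.
by rewrite mulmxA thrE delta1 eqxx mulr1.
Qed.

End kernel_evolution.
End conjugation.

Lemma box_compact {R : realType} m n (C : R) :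
  compact [set y : 'M[R]_(m, n) | forall i j, `|y i j| <= C].
Proof.
have cv : continuous (vec_mx : 'rV[R]_(m * n) -> 'M[R]_(m, n)).
  move=> v; apply: (@cvg_mxP _ _ _ _ (nbhs v) (nbhs_filter v)) => i j; rewrite mxE.
  rewrite (_ : (fun k => _) = (fun w : 'rV[R]_(m * n) => w 0 (mxvec_index i j))); first exact: coord_continuous.
  by apply/funext => w; rewrite mxE.
rewrite (_ : [set y | _] = vec_mx @` [set v : 'rV[R]_(m * n) | forall i, `[- C, C]%classic (v ord0 i)]).
  apply: continuous_compact; first exact: continuous_subspaceT.
  by apply: (@rV_compact _ _ (fun=> `[- C, C]%classic)) => _; exact: segment_compact.
apply/seteqP; split=> [y hy|_ [v hv <-] i j].
  exists (mxvec y); last exact: mxvecK.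
  move=> k /=; rewrite in_itv/= -ler_norml; case/mxvec_indexP: k => i j.
  by rewrite mxvecE.
by rewrite mxE ler_norml; have := hv (mxvec_index i j); rewrite /= in_itv.
Qed.

(** * Polynomial multiples of the Maxwellian in the weighted space *)

Section weighted.
Context {R : realType} {d K : nat}.
Notation M := 'M[R]_(K.+1, d).
Notation leb := (@leb_mx R K.+1 d).
Notation normc := ComplexField.Normc.normc.
Variable Sg : 'M[R]_K.+1.
Hypothesis sS : spd Sg.
Notation M0 := (@maxwellian R d K Sg).

Definition wpair (a b : M -> R) (y : M) : R[i] := (M0 y * a y) +i* (M0 y * b y).

Lemma wpair_cmeasurable a b : measurable_fun setT a -> measurable_fun setT b ->
  cmeasurable (wpair a b).
Proof.
move=> ma mb; have mM := @measurable_M0 R d K Sg.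
by split; apply: (measurable_funM mM).
Qed.

Let wnE a b y : normc (wpair a b y) ^+ 2 / M0 y = (a y ^+ 2 + b y ^+ 2) * M0 y.
Proof.
have /gt_eqF m0 := M0_gt0 sS y.
rewrite normc_sq -[complex.Re _]/(M0 y * a y) -[complex.Im _]/(M0 y * b y) ![(M0 y * _) ^+ 2]exprMn.
by move: (M0 y) m0 => m m0; field; rewrite m0.
Qed.

Let dom_bound (a b : M -> R) C k : 0 <= C -> (forall y, `|a y| <= C * qw Sg y ^+ k) ->
  (forall y, `|b y| <= C * qw Sg y ^+ k) -> forall y,
  `|(a y ^+ 2 + b y ^+ 2) * M0 y| <= 2 * C ^+ 2 * @mw_cst R d K Sg * qw Sg y ^+ (k + k) * gw Sg y.
Proof.
move=> C0 ha hb y.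
have q0 := qw_ge0 sS y.
have m0 := M0_gt0 sS y.
have sq (x : R) : `|x| <= C * qw Sg y ^+ k -> x ^+ 2 <= C ^+ 2 * qw Sg y ^+ (k + k).
  move=> h; rewrite -(real_normK (num_real x)) exprD -expr2 -exprMn.
  by rewrite lerXn2r ?nnegrE ?mulr_ge0 ?exprn_ge0.
rewrite ger0_norm; last by rewrite mulr_ge0 ?addr_ge0 ?sqr_ge0// ltW.
rewrite (_ : 2 * C ^+ 2 * _ * _ * _ = (2 * (C ^+ 2 * qw Sg y ^+ (k + k))) * M0 y); last first.
  by rewrite maxwellianE; ring.
rewrite ler_wpM2r ?(ltW m0)//.
by have := sq _ (ha y); have := sq _ (hb y); lra.
Qed.

(* [qw] grows like |y|^2, so polynomially bounded multiples of M_0 lie in H. *)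
Lemma wpair_in_H (a b : M -> R) C k : measurable_fun setT a -> measurable_fun setT b -> 0 <= C ->
  (forall y, `|a y| <= C * qw Sg y ^+ k) -> (forall y, `|b y| <= C * qw Sg y ^+ k) ->
  in_H M0 (wpair a b).
Proof.
move=> ma mb C0 ha hb; split; first exact: wpair_cmeasurable.
rewrite /H_normsq (eq_integral (fun y : M => ((a y ^+ 2 + b y ^+ 2) * M0 y)%:E)); last first.
  by move=> y _; rewrite wnE.
have mM := @measurable_M0 R d K Sg.
have i : leb.-integrable setT (EFin \o (fun y => (a y ^+ 2 + b y ^+ 2) * M0 y)).
  apply: (integrable_gw_dom sS _ (dom_bound C0 ha hb)).
  by apply: measurable_funM => //; apply: measurable_funD; exact: measurable_funX.
have := integrable_fin_num measurableT i.
by rewrite fin_numE => /andP[_]; rewrite -ltey.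
Qed.

(** Dominated convergence: in the norm of H the weight cancels one of the two factors M_0, so a
    polynomial times a Gaussian is an integrable majorant. *)
Lemma wpair_cvg (a b : nat -> M -> R) C k :
  (forall n, measurable_fun setT (a n)) -> (forall n, measurable_fun setT (b n)) -> 0 <= C ->
  (forall n y, `|a n y| <= C * qw Sg y ^+ k) -> (forall n y, `|b n y| <= C * qw Sg y ^+ k) ->
  (forall y, a n y @[n --> \oo] --> (0 : R)) -> (forall y, b n y @[n --> \oo] --> (0 : R)) ->
  H_normsq M0 (wpair (a n) (b n)) @[n --> \oo] --> 0%E.
Proof.
move=> ma mb C0 ha hb la lb.
have mM := @measurable_M0 R d K Sg.
pose fn n (y : M) := ((a n y ^+ 2 + b n y ^+ 2) * M0 y)%:E.
have [|||||_ _] := @dominated_convergence _ _ R leb setT measurableT fn (fun=> 0%E)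
  (EFin \o (fun y : M => 2 * C ^+ 2 * @mw_cst R d K Sg * qw Sg y ^+ (k + k) * gw Sg y)).
- move=> n; apply/measurable_EFinP; apply: measurable_funM => //.
  by apply: measurable_funD; exact: measurable_funX.
- exact: measurable_cst.
- apply: aeW => y _; apply: cvg_EFin; first exact: nearW.
  rewrite -[X in _ --> X](mul0r (M0 y)); apply: cvgM; last exact: cvg_cst.
  rewrite -[X in _ --> X](addr0 (0 : R)); apply: cvgD.
    by rewrite -[X in _ --> X](mulr0 (0 : R)); under eq_fun do rewrite expr2; exact: cvgM.
  by rewrite -[X in _ --> X](mulr0 (0 : R)); under eq_fun do rewrite expr2; exact: cvgM.
- exact: integrable_qw_gw.
- by apply: aeW => y n _; rewrite /= lee_fin; exact: dom_bound.
rewrite integral0; apply: cvg_trans; apply: near_eq_cvg; apply: nearW => n.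
by apply: eq_integral => y _; rewrite wnE.
Qed.

End weighted.

(** * Cutoff in the phase variable *)

Section cutoff.
Context {R : realType} {d K : nat} (alpha : 'I_K.+1 -> R).
Hypothesis alpha_gt0 : forall k, 0 < alpha k.
Variable g0 : R.
Hypothesis g0_gt0 : 0 < g0.
Notation M := 'M[R]_(K.+1, d).
Notation A := (drift alpha).
Notation Sg := (OU_cov A g0).
Notation S := (invmx Sg).
Notation M0 := (@maxwellian R d K Sg).
Variables (q : 'rV[R]_d) (li : R).
Notation tc := (tcls alpha g0 q li).
Notation DtW := (Dt (Wrev alpha g0) g0).
Notation GmW := (@Gm R d K g0).
Let sS : spd Sg. Proof. exact: OU_spd. Qed.

Lemma tc_Dt f : tc f -> tc (fun t => DtW (f t)).
Proof.
move=> cf; apply: tcD.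
  apply: tc_sum => k; apply: tc_sum => l; apply: tcM; first exact: tc_mulmx.
  exact: tc_D.
by apply: tcZ; apply: tc_sum => l; apply: tc_D; exact: tc_D.
Qed.

Lemma tc_Gm f g : tc f -> tc g -> tc (fun t => GmW (f t) (g t)).
Proof.
by move=> cf cg; apply: tcZ; apply: tc_sum => l; apply: tcM; exact: tc_D.
Qed.

Lemma tc_qform : tc (fun _ => qform S).
Proof.
apply: (@tc_eq _ _ _ _ _ _ _ (fun _ y => \sum_l \sum_i \sum_j y i l * S i j * y j l)).
  apply: tc_sum => l; apply: tc_sum => i; apply: tc_sum => j.
  by apply: tcM; [apply: tcM; [exact: tc_coord|exact: tc_cst]|exact: tc_coord].
move=> t y; have := cls_qform; rewrite /qform => _.
apply: eq_bigr => l _; rewrite /quad -mulmxA mxE; apply: eq_bigr => i _.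
by rewrite !mxE mulr_sumr; apply: eq_bigr => j _; rewrite !mxE mulrA.
Qed.

Notation b0 := (expbump (1 : {poly R})).
Notation b1 := (expbump (expbump_deriv (1 : {poly R}))).
Notation b2 := (expbump (expbump_deriv (expbump_deriv (1 : {poly R})))).

Lemma bump_bounded p : exists2 C, 0 <= C & forall x : R, `|expbump p x| <= C.
Proof.
have [C C0 h] := poly_expRN_bounded p; exists C => // x; rewrite /expbump.
by case: ifPn => x0; [apply: h; rewrite invr_ge0 ltW|rewrite normr0].
Qed.

Lemma bump1_gt0 : 0 < b0 1.
Proof. by rewrite /expbump ltr01 hornerC mul1r expR_gt0. Qed.

Definition chi_arg n (y : M) : R := 1 + - n.+1%:R^-1 * qform S y.
(** The bump is smooth and vanishes where the argument is nonpositive, that is for S-form at least n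
    + 1; division by its value at 1 makes the limit 1. Every derivative of the cutoff brings out a
    factor 1 / (n + 1), so its commutators with the generator are small. *)
Definition chi n (y : M) : R := (b0 1)^-1 * b0 (chi_arg n y).

Let cls_arg n : cls (chi_arg n).
Proof. by apply: clsD; [exact: cls_cst|apply: clsZ; exact: cls_qform]. Qed.

Let cls_b p n : cls (fun y => expbump p (chi_arg n y)).
Proof. by apply: cls_comp => //; exact: sm1_bump. Qed.

Lemma cls_chi n : cls (chi n).
Proof. by apply: clsZ; exact: cls_b. Qed.

Lemma chi_bounded : exists2 C, 0 <= C & forall n y, `|chi n y| <= C.
Proof.
have [C C0 h] := bump_bounded 1; exists ((b0 1)^-1 * C).
  by rewrite mulr_ge0// invr_ge0 ltW// bump1_gt0.
move=> n y; rewrite normrM ger0_norm ?invr_ge0 ?(ltW bump1_gt0)//.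
by rewrite ler_wpM2l// invr_ge0 ltW// bump1_gt0.
Qed.

Lemma chi_cvg y : chi n y @[n --> \oo] --> (1 : R).
Proof.
rewrite -[X in _ --> X](mulVf (lt0r_neq0 bump1_gt0)); apply: cvgM; first exact: cvg_cst.
have cb : {for (1 : R), continuous (b0 : R -> R^o)} by apply: sm1_cont; exact: sm1_bump.
suff l : chi_arg n y @[n --> \oo] --> (1 : R) by exact: (cvg_comp _ _ l cb).
rewrite -[X in _ --> X](addr0 (1 : R)); apply: cvgD; first exact: cvg_cst.
rewrite -[X in _ --> X](mul0r (qform S y)); apply: cvgM; last exact: cvg_cst.
by rewrite -oppr0; apply: cvgN; exact: cvg_harmonic.
Qed.

Lemma chi_supp n y : chi n y != 0 -> qform S y <= n.+1%:R.
Proof.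
rewrite /chi {2}/expbump; case: ifPn => [h _|_]; last by rewrite mulr0 eqxx.
by move: h; rewrite /chi_arg mulNr subr_gt0 ltr_pdivrMl ?ltr0n// mulr1 => /ltW.
Qed.

Lemma chi_compact n (h : M -> R[i]) : (forall y, chi n y = 0 -> h y = 0) ->
  compact (closure [set y | h y != 0]).
Proof.
(* The 1 added to C ensures C >= 1, so that y_ij^2 <= C implies |y_ij| <= C. *)
move=> h0; pose C := \sum_i Sg i i * n.+1%:R + 1 : R.
have s0 i : 0 <= Sg i i.
  by have := spd_ge0 (delta_mx i 0 : 'cV[R]_K.+1) sS; rewrite /quad trmx_delta -rowE -colE !mxE.
have C1 : 1 <= C by rewrite lerDr sumr_ge0// => i _; rewrite mulr_ge0.
have box := @box_compact R K.+1 d C.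
apply: (subclosed_compact _ box); first exact: closed_closure.
have cb : closed [set y : M | forall i j, `|y i j| <= C].
  by apply: compact_closed => //; exact: norm_hausdorff.
rewrite [X in _ `<=` X](_ : _ = closure [set y : M | forall i j, `|y i j| <= C]); last exact/closure_id.
apply: closureS => y /= hy i j.
have /chi_supp qy : chi n y != 0 by apply: contra hy => /eqP /h0 ->.
have h1 := coord_sq_qform sS y i j.
have h2 : y i j ^+ 2 <= C.
  apply: (le_trans h1); apply: (@le_trans _ _ (Sg i i * n.+1%:R)); first exact: ler_wpM2l.
  rewrite /C (bigD1 i)//= -addrA lerDl addr_ge0// sumr_ge0// => k _; by rewrite mulr_ge0.
rewrite -(@ler_pXn2r _ 2) ?nnegrE//; last exact: le_trans C1.
rewrite real_normK ?num_real//; apply: (le_trans h2).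
by rewrite expr2 ler_peMr// (le_trans ler01).
Qed.

Lemma Gm_chi n h y : cls h -> GmW (chi n) h y =
  (b0 1)^-1 * (b1 (chi_arg n y) * (- n.+1%:R^-1 * GmW (qform S) h y)).
Proof.
move=> ch; rewrite (GmZ g0 _ h y (cls_b _ n)) (Gm_comp g0 h y (is_derive_bump 1) (cls_arg n)).
rewrite (GmD g0 h y (cls_cst _) (clsZ _ (@cls_qform R K.+1 d S))) Gm_cst add0r.
by rewrite (GmZ g0 _ h y (@cls_qform R K.+1 d S)).
Qed.

Lemma Dt_chi n y : DtW (chi n) y = (b0 1)^-1 *
  (b1 (chi_arg n y) * (- n.+1%:R^-1 * DtW (qform S) y) +
   b2 (chi_arg n y) / 2 * (n.+1%:R^-1 * (n.+1%:R^-1 * GmW (qform S) (qform S) y))).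
Proof.
have cq := @cls_qform R K.+1 d S.
rewrite (DtZ _ g0 _ y (cls_b _ n)).
rewrite (Dt_comp _ g0 y (is_derive_bump 1) (is_derive_bump _) (cls_arg n)).
rewrite (DtD _ g0 y (cls_cst _) (clsZ _ cq)) Dt_cst add0r (DtZ _ g0 _ y cq).
rewrite (GmD g0 _ y (cls_cst _) (clsZ _ cq)) Gm_cst add0r (GmZ g0 _ _ y cq).
rewrite Gm_sym (GmD g0 _ y (cls_cst _) (clsZ _ cq)) Gm_cst add0r (GmZ g0 _ _ y cq).
by rewrite !mulNr mulrN opprK.
Qed.

Lemma Dt_chi_bound : exists C k, 0 <= C /\
  forall n y, `|DtW (chi n) y| <= n.+1%:R^-1 * (C * qw Sg y ^+ k).
Proof.
have [C1 C10 h1] := bump_bounded (expbump_deriv 1).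
have [C2 C20 h2] := bump_bounded (expbump_deriv (expbump_deriv 1)).
(* One function of the class, D^2 + G^2 + 1, bounds both |D| and |G| and thus gives both a common
   polynomial bound. *)
have tcs : tc (fun _ y => DtW (qform S) y * DtW (qform S) y + (GmW (qform S) (qform S) y * GmW (qform S) (qform S) y + 1)).
  have t1 := tc_Dt tc_qform; have t2 := tc_Gm tc_qform tc_qform.
  by apply: tcD; [exact: tcM|apply: tcD; [exact: tcM|exact: tc_cst]].
have [C [k [C0 h]]] := tc_bnd alpha_gt0 g0_gt0 tcs.
have i0 : 0 <= (b0 1)^-1 by rewrite invr_ge0 ltW// bump1_gt0.
exists ((b0 1)^-1 * (C1 + C2) * C), k; split.
  by rewrite mulr_ge0// mulr_ge0// addr_ge0.
move=> n y; rewrite Dt_chi; have := h 0 y (lexx 0).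
move: (DtW _ y) (GmW _ _ y) => D G; rewrite [X in X <= _]ger0_norm; last first.
  by rewrite -!expr2 addr_ge0 ?sqr_ge0// addr_ge0 ?sqr_ge0.
move=> hDG.
set N := n.+1%:R^-1; have N0 : 0 <= N by rewrite invr_ge0.
have N1 : N <= 1 by rewrite invf_le1 ?ler1n ?ltr0n.
have dD : `|D| <= C * qw Sg y ^+ k.
  apply: le_trans hDG; rewrite -!expr2.
  by have := sqr_ge0 (`|D| - 1); have := sqr_ge0 G; have := real_normK (num_real D); nra.
have dG : `|G| <= C * qw Sg y ^+ k.
  apply: le_trans hDG; rewrite -!expr2.
  by have := sqr_ge0 (`|G| - 1); have := sqr_ge0 D; have := real_normK (num_real G); nra.
rewrite normrM (ger0_norm i0) -!mulrA [leRHS]mulrCA ler_wpM2l//.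
apply: le_trans (ler_normD _ _) _.
have P0 : 0 <= C * qw Sg y ^+ k by exact: le_trans dD.
have e1 : `|b1 (chi_arg n y) * (- N * D)| <= C1 * (N * (C * qw Sg y ^+ k)).
  by rewrite normrM ler_pM// normrM normrN (ger0_norm N0) ler_wpM2l.
have e2 : `|b2 (chi_arg n y) / 2 * (N * (N * G))| <= C2 * (N * (C * qw Sg y ^+ k)).
  rewrite normrM ler_pM//.
    rewrite normrM (ger0_norm (_ : 0 <= 2^-1)) ?invr_ge0//.
    by apply: le_trans (h2 (chi_arg n y)); rewrite ler_piMr// invf_le1 ?ler1n.
  rewrite normrM (ger0_norm N0) ler_wpM2l// normrM (ger0_norm N0).
  by apply: le_trans dG; rewrite ler_piMl.
rewrite -mulrA in e2; apply: (le_trans (lerD e1 e2)); by rewrite -mulrDl mulrCA.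
Qed.

End cutoff.

Lemma resolvent_alg {R : realType} (l : R[i]) (m u v a b : R) :
  l * ((m * u) +i* (m * v)) - ((m * a) +i* (m * b)) =
  (m * (complex.Re l * u - complex.Im l * v - a)) +i* (m * (complex.Re l * v + complex.Im l * u - b)).
Proof.
have hR (x y : R) : complex.Re (x +i* y) = x by [].
have hI (x y : R) : complex.Im (x +i* y) = y by [].
by apply: complex_eq; rewrite ?(cReB, cImB, cReM, cImM, hR, hI); ring.
Qed.

(** * Laplace transform in time and closure of the graph *)

Section closure.
Context {R : realType} {d K : nat} (alpha : 'I_K.+1 -> R).
Hypothesis alpha_gt0 : forall k, 0 < alpha k.
Variable g0 : R.
Hypothesis g0_gt0 : 0 < g0.
Variable q : 'rV[R]_d.
Variable lambda : R[i].
Notation M := 'M[R]_(K.+1, d).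
Notation leb1 := (@lebesgue_measure R).
Notation A := (drift alpha).
Notation Sg := (OU_cov A g0).
Notation S := (invmx Sg).
Notation M0 := (@maxwellian R d K Sg).
Notation Re := complex.Re.
Notation Im := complex.Im.
Notation lr := (Re lambda).
Notation li := (Im lambda).
Notation tc := (tcls alpha g0 q li).
Notation DtW := (Dt (Wrev alpha g0) g0).
Notation GmW := (@Gm R d K g0).
Notation Q y := (mdot (@Q1 R d K q) y).
Hypothesis lr_gt0 : 0 < lr.
Let sS : spd Sg. Proof. exact: OU_spd. Qed.

(** The damping is the real exponential; the oscillating factor of e^(-lambda t) already sits in the
    functions f to which this is applied. *)
Definition laplace (f : R -> M -> R) (y : M) : R :=
  \int[leb1]_(t in `[0, +oo[) (expR (- lr * t) * f t y).

Definition lap_sum n (f : R -> M -> R) (y : M) : R :=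
  \sum_(k < n.+1 * n.+1) n.+1%:R^-1 * (expR (- lr * (k%:R / n.+1%:R)) * f (k%:R / n.+1%:R) y).

Lemma cls_lap_sum n f : tc f -> cls (lap_sum n f).
Proof.
by move=> cf; apply: cls_sum => k; do 2 apply: clsZ; exact: (tc_cls _ cf).
Qed.

Let is_derive_decay f : tc f -> exists2 g, tc g & forall (t : R) y,
  is_derive t 1 (fun s => expR (- lr * s) * f s y : R^o) (expR (- lr * t) * (g t y - lr * f t y)).
Proof.
move=> /(tc_dt alpha_gt0 g0_gt0)[g cg hg]; exists g => // s z.
by apply: is_derive_eq (is_deriveMR (is_derive_expRc (- lr) s) (hg s z)) _; ring.
Qed.

Let decay_bnd f : tc f -> exists C k, 0 <= C /\ forall t y, 0 <= t ->
  `|expR (- lr * t) * f t y| <= C * qw Sg y ^+ k * expR (- lr * t).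
Proof.
move=> /(tc_bnd alpha_gt0 g0_gt0)[C [k [C0 h]]]; exists C, k; split=> // t y t0.
by rewrite normrM ger0_norm ?expR_ge0// mulrC ler_wpM2r ?expR_ge0// h.
Qed.

Let tcB f g : tc f -> tc g -> tc (fun t y => f t y - g t y).
Proof.
move=> cf cg; apply: (@tc_eq _ _ _ _ _ _ _ (fun t y => f t y + -1 * g t y)).
  by apply: tcD => //; exact: tcZ.
by move=> t y; rewrite mulN1r.
Qed.

Lemma decay_integrable f y : tc f ->
  leb1.-integrable `[0, +oo[ (EFin \o (fun t => expR (- lr * t) * f t y)).
Proof.
move=> cf; have [C [k [C0 h]]] := decay_bnd cf.
have [g cg hg] := is_derive_decay cf.
apply: (@integrable_exp_bound _ _ lr (C * qw Sg y ^+ k)) => //.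
  apply: measurable_funTS; apply: continuous_measurable_fun.
  exact: is_derive_cont (fun t => hg t y).
by move=> t t0; exact: h.
Qed.

Lemma lap_sum_cvg f y : tc f -> lap_sum n f y @[n --> \oo] --> laplace f y.
Proof.
move=> cf; have [g cg hg] := is_derive_decay cf.
have [C [k [C0 hC]]] := decay_bnd cf.
have [C' [k' [C'0 hC']]] := decay_bnd (tcB cg (tcZ lr cf)).
have q0 := qw_ge0 sS y.
apply: (riemann_cvg (C := C * qw Sg y ^+ k + C' * qw Sg y ^+ k') lr_gt0 (fun t => hg t y)) => t t0.
  apply: (le_trans (hC t y t0)); rewrite ler_wpM2r ?expR_ge0// lerDl mulr_ge0// exprn_ge0//.
apply: (le_trans (hC' t y t0)); rewrite ler_wpM2r ?expR_ge0// lerDr mulr_ge0// exprn_ge0//.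
Qed.

Lemma lap_sum_bnd f : tc f -> exists C k, 0 <= C /\ forall n y, `|lap_sum n f y| <= C * qw Sg y ^+ k.
Proof.
move=> cf; have [C [k [C0 h]]] := decay_bnd cf.
exists (C * (lr^-1 + 1)), k; split; first by rewrite mulr_ge0// addr_ge0// invr_ge0 ltW.
move=> n y; have P0 : 0 <= C * qw Sg y ^+ k by rewrite mulr_ge0// exprn_ge0// qw_ge0.
apply: le_trans (ler_norm_sum _ _ _) _.
apply: (@le_trans _ _ (\sum_(j < n.+1 * n.+1) C * qw Sg y ^+ k * (n.+1%:R^-1 * expR (- lr * (j%:R / n.+1%:R))))).
  apply: ler_sum => j _; rewrite normrM ger0_norm ?invr_ge0// [leRHS]mulrCA ler_wpM2l ?invr_ge0//.
  by apply: h; rewrite divr_ge0.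
rewrite -mulr_sumr [leRHS]mulrAC; apply: (ler_wpM2l P0); exact: riemann_geo.
Qed.

Lemma laplace_bnd f : tc f -> exists C k, 0 <= C /\ forall y, `|laplace f y| <= C * qw Sg y ^+ k.
Proof.
move=> cf; have [C [k [C0 h]]] := lap_sum_bnd cf; exists C, k; split=> // y.
have l : `|lap_sum n f y| @[n --> \oo] --> `|laplace f y| by apply: cvg_norm; exact: lap_sum_cvg.
by apply: (cvgr_to_le l); apply: nearW => n; exact: h.
Qed.

(** A pointwise limit of Riemann sums, each of which is continuous in y. *)
Lemma laplace_measurable f : tc f -> measurable_fun setT (laplace f).
Proof.
move=> cf; apply: (@measurable_fun_cvg _ _ _ _ (fun n => lap_sum n f)).
  by move=> n; apply: continuous_measurable_mx; apply: cls_cont; exact: cls_lap_sum.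
by move=> y _; exact: lap_sum_cvg.
Qed.

Lemma lap_sumD n f g y : lap_sum n (fun t y => f t y + g t y) y = lap_sum n f y + lap_sum n g y.
Proof. by rewrite -big_split/=; apply: eq_bigr => k _; rewrite !mulrDr. Qed.

Lemma lap_sumZ n (c : R) f y : lap_sum n (fun t y => c * f t y) y = c * lap_sum n f y.
Proof. by rewrite mulr_sumr; apply: eq_bigr => k _; ring. Qed.

Lemma lap_sum_Dt n f y : tc f -> DtW (lap_sum n f) y = lap_sum n (fun t => DtW (f t)) y.
Proof.
move=> cf; rewrite Dt_sum; last by move=> k; do 2 apply: clsZ; exact: (tc_cls _ cf).
apply: eq_bigr => k _; rewrite DtZ; last by apply: clsZ; exact: (tc_cls _ cf).
by rewrite DtZ//; exact: (tc_cls _ cf).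
Qed.

Lemma lap_sum_Gm n f h y : tc f -> GmW h (lap_sum n f) y = lap_sum n (fun t => GmW h (f t)) y.
Proof.
move=> cf; rewrite Gm_sym Gm_sum; last by move=> k; do 2 apply: clsZ; exact: (tc_cls _ cf).
apply: eq_bigr => k _; rewrite GmZ; last by apply: clsZ; exact: (tc_cls _ cf).
by rewrite GmZ; [rewrite Gm_sym|exact: (tc_cls _ cf)].
Qed.

Lemma laplaceD f g y : tc f -> tc g -> laplace (fun t y => f t y + g t y) y = laplace f y + laplace g y.
Proof.
move=> cf cg; rewrite /laplace -RintegralD//; [|exact: decay_integrable|exact: decay_integrable].
by apply: eq_Rintegral => t _; rewrite mulrDr.
Qed.

Lemma laplaceZ c f y : tc f -> laplace (fun t y => c * f t y) y = c * laplace f y.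
Proof.
move=> cf; rewrite /laplace -RintegralZl//; last exact: decay_integrable.
by apply: eq_Rintegral => t _; rewrite mulrCA.
Qed.

(** Integration by parts in time; for fixed y the function f is bounded on t >= 0, so the boundary
    term at infinity is killed by the damping. *)
Lemma laplace_der f g y : tc f -> tc g ->
  (forall t : R, is_derive t 1 (f ^~ y : R -> R^o) (g t y)) ->
  laplace g y = lr * laplace f y - f 0 y.
Proof.
move=> cf cg hg.
have h0 : \int[leb1]_(t in `[0, +oo[) (expR (- lr * t) * (g t y - lr * f t y)) = 0 - f 0 y.
  have e : f 0 y = expR (- lr * 0) * f 0 y by rewrite mulr0 expR0 mul1r.
  rewrite {1}e; apply: (@Rintegral_FTC2y _ (fun t => expR (- lr * t) * f t y)).
  - exact: (decay_integrable y (tcB cg (tcZ lr cf))).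
  - have [g' _ hg'] := is_derive_decay (tcB cg (tcZ lr cf)).
    exact: is_derive_cont (fun t => hg' t y).
  - move=> t; apply: is_derive_eq (is_deriveMR (is_derive_expRc (- lr) t) (hg t)) _; ring.
  - have [C [k [C0 h]]] := decay_bnd cf.
    apply/norm_cvg0P; apply: (@squeeze_cvgr _ _ _ _ (cst 0) (fun n : nat => C * qw Sg y ^+ k * expR (- lr * n%:R))).
    + by apply: nearW => n /=; rewrite normr_ge0 /=; exact: h.
    + exact: cvg_cst.
    + rewrite -[X in _ --> X](mulr0 (C * qw Sg y ^+ k)); apply: cvgM; first exact: cvg_cst.
      exact: (cvgy_nat (cvg_expRNc lr_gt0)).
have e : laplace g y = \int[leb1]_(t in `[0, +oo[) (expR (- lr * t) * (g t y - lr * f t y)) + lr * laplace f y.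
  rewrite -laplaceZ// /laplace -RintegralD//.
  - by apply: eq_Rintegral => t _; ring.
  - exact: (decay_integrable y (tcB cg (tcZ lr cf))).
  - exact: (decay_integrable y (tcZ lr cf)).
by rewrite e h0 sub0r addrC.
Qed.

Variables f g : R -> M -> R.
Hypotheses (cf : tc f) (cg : tc g).
Hypothesis df : forall (t : R) y, is_derive t 1 (f ^~ y : R -> R^o) (DtW (f t) y + Q y * g t y + li * g t y).
Hypothesis dg : forall (t : R) y, is_derive t 1 (g ^~ y : R -> R^o) (DtW (g t) y - Q y * f t y - li * f t y).

Let phi := wpair Sg (laplace f) (laplace g).
Let psi y := lambda * phi y - wpair Sg (f 0) (g 0) y.
Let tf t (y : M) := DtW (f t) y + Q y * g t y.
Let tg t (y : M) := DtW (g t) y - Q y * f t y.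

Let tcQ : tc (fun _ y => Q y).
Proof. by apply: tc_sum => i; apply: tc_sum => j; apply: tcZ; exact: tc_coord. Qed.
Let ctf : tc tf. Proof. by apply: tcD; [exact: tc_Dt|exact: tcM]. Qed.
Let ctg : tc tg. Proof. by apply: tcB; [exact: tc_Dt|exact: tcM]. Qed.

(** [psi] is defined so that the resolvent equation holds at once. This identifies it with the
    Laplace transform of the operator applied to the kernel, the form in which it appears as the
    limit of the images of the approximants. *)
Let psiE : psi = wpair Sg (laplace tf) (laplace tg).
Proof.
have lf y : laplace tf y = lr * laplace f y - li * laplace g y - f 0 y.
  have h : tc (fun t y => tf t y + li * g t y) by apply: tcD => //; exact: tcZ.
  have := laplace_der cf h (fun t => df t y).
  rewrite laplaceD//; last exact: tcZ.
  by rewrite laplaceZ// => /eqP; rewrite eq_sym -subr_eq => /eqP <-; rewrite addrAC.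
have lg y : laplace tg y = lr * laplace g y + li * laplace f y - g 0 y.
  have h : tc (fun t y => tg t y + - li * f t y) by apply: tcD => //; exact: tcZ.
  have dg' (t : R) : is_derive t 1 (g ^~ y : R -> R^o) (tg t y + - li * f t y).
    by rewrite mulNr; exact: dg.
  have := laplace_der cg h dg'.
  rewrite laplaceD//; last exact: tcZ.
  by rewrite laplaceZ// mulNr => /eqP; rewrite subr_eq => /eqP ->; rewrite addrAC.
apply/funext => y; rewrite /psi /phi /wpair lf lg.
move: (M0 y) (laplace f y) (laplace g y) (f 0 y) (g 0 y) => m u v a b.
exact: resolvent_alg.
Qed.

Let bndD (a b : nat -> M -> R) :
  (exists C k, 0 <= C /\ forall n y, `|a n y| <= C * qw Sg y ^+ k) ->
  (exists C k, 0 <= C /\ forall n y, `|b n y| <= C * qw Sg y ^+ k) ->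
  exists C k, 0 <= C /\ forall n y, `|a n y + b n y| <= C * qw Sg y ^+ k.
Proof.
move=> [C [k [C0 h]]] [C' [k' [C'0 h']]]; exists (C + C'), (k + k')%N; split; first exact: addr_ge0.
move=> n y; have q1 (j : nat) : 1 <= qw Sg y ^+ j by rewrite exprn_ege1// qw_ge1.
have q0 (j : nat) : 0 <= qw Sg y ^+ j by exact: le_trans (q1 j).
apply: le_trans (ler_normD _ _) _; rewrite mulrDl exprD lerD//.
  by apply: le_trans (h n y) _; rewrite ler_wpM2l// ler_peMr.
by apply: le_trans (h' n y) _; rewrite ler_wpM2l// ler_peMl.
Qed.

Let bndM (a b : nat -> M -> R) :
  (exists C k, 0 <= C /\ forall n y, `|a n y| <= C * qw Sg y ^+ k) ->
  (exists C k, 0 <= C /\ forall n y, `|b n y| <= C * qw Sg y ^+ k) ->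
  exists C k, 0 <= C /\ forall n y, `|a n y * b n y| <= C * qw Sg y ^+ k.
Proof.
move=> [C [k [C0 h]]] [C' [k' [C'0 h']]]; exists (C * C'), (k + k')%N; split; first exact: mulr_ge0.
by move=> n y; rewrite normrM exprD mulrACA ler_pM.
Qed.

Let bndN (a : nat -> M -> R) :
  (exists C k, 0 <= C /\ forall n y, `|a n y| <= C * qw Sg y ^+ k) ->
  exists C k, 0 <= C /\ forall n y, `|- a n y| <= C * qw Sg y ^+ k.
Proof. by move=> [C [k [C0 h]]]; exists C, k; split=> // n y; rewrite normrN. Qed.

Let common (a b : nat -> M -> R) :
  (exists C k, 0 <= C /\ forall n y, `|a n y| <= C * qw Sg y ^+ k) ->
  (exists C k, 0 <= C /\ forall n y, `|b n y| <= C * qw Sg y ^+ k) ->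
  exists C k, [/\ 0 <= C, forall n y, `|a n y| <= C * qw Sg y ^+ k &
     forall n y, `|b n y| <= C * qw Sg y ^+ k].
Proof.
move=> [C [k [C0 h]]] [C' [k' [C'0 h']]]; exists (C + C'), (k + k')%N.
have q1 (j : nat) (y : M) : 1 <= qw Sg y ^+ j by rewrite exprn_ege1// qw_ge1.
have q0 (j : nat) (y : M) : 0 <= qw Sg y ^+ j by exact: (le_trans ler01 (q1 j y)).
split=> [|n y|n y]; first exact: addr_ge0.
  by apply: le_trans (h n y) _; rewrite exprD ler_pM// ?lerDl// ler_peMr.
by apply: le_trans (h' n y) _; rewrite exprD ler_pM// ?lerDr// ler_peMl.
Qed.

Let bnd_cst (a : M -> R) : (exists C k, 0 <= C /\ forall y, `|a y| <= C * qw Sg y ^+ k) ->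
  exists C k, 0 <= C /\ forall (n : nat) y, `|a y| <= C * qw Sg y ^+ k.
Proof. by move=> [C [k [C0 h]]]; exists C, k. Qed.

Let wpair_laplace_H a b : tc a -> tc b -> in_H M0 (wpair Sg (laplace a) (laplace b)).
Proof.
move=> ca cb; have [C [k [C0 ha hb]]] := common (bnd_cst (laplace_bnd ca)) (bnd_cst (laplace_bnd cb)).
apply: (wpair_in_H sS _ _ C0 (ha 0%N) (hb 0%N)); exact: laplace_measurable.
Qed.

Let small_bnd (a : nat -> M -> R) :
  (exists C k, 0 <= C /\ forall n y, `|a n y| <= n.+1%:R^-1 * (C * qw Sg y ^+ k)) ->
  (exists C k, 0 <= C /\ forall n y, `|a n y| <= C * qw Sg y ^+ k) /\
  (forall y, a n y @[n --> \oo] --> (0 : R)).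
Proof.
move=> [C [k [C0 h]]]; split.
  exists C, k; split=> // n y; apply: le_trans (h n y) _.
  by rewrite ler_piMl ?mulr_ge0 ?exprn_ge0 ?qw_ge0// invf_le1 ?ler1n ?ltr0n.
move=> y; apply/norm_cvg0P.
apply: (@squeeze_cvgr _ _ _ _ (cst 0) (fun n => n.+1%:R^-1 * (C * qw Sg y ^+ k))).
- by apply: nearW => n /=; rewrite normr_ge0 /=.
- exact: cvg_cst.
- rewrite -[X in _ --> X](mul0r (C * qw Sg y ^+ k)); apply: cvgM; last exact: cvg_cst.
  exact: cvg_harmonic.
Qed.

Let chi_bnd : exists C k, 0 <= C /\ forall n (y : M), `|chi alpha g0 n y| <= C * qw Sg y ^+ k.
Proof.
have [C C0 h] := @chi_bounded R d K alpha g0; exists C, 0%N; split=> // n y.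
by rewrite expr0 mulr1.
Qed.

Let Gm_chi_small a : tc a -> exists C k, 0 <= C /\
  forall n y, `|GmW (chi alpha g0 n) (lap_sum n a) y| <= n.+1%:R^-1 * (C * qw Sg y ^+ k).
Proof.
move=> ca; have [C1 C10 h1] := @bump_bounded R (expbump_deriv 1).
have [C [k [C0 h]]] := lap_sum_bnd (tc_Gm (tc_qform alpha g0 q li) ca).
have i0 : 0 <= (expbump 1 1)^-1 :> R by rewrite invr_ge0 ltW// bump1_gt0.
exists ((expbump 1 1)^-1 * C1 * C), k; split; first by rewrite !mulr_ge0.
move=> n y; rewrite Gm_chi; last exact: cls_lap_sum.
rewrite (lap_sum_Gm _ _ _ ca) normrM (ger0_norm i0) -!mulrA [leRHS]mulrCA ler_wpM2l//.
have N0 : 0 <= n.+1%:R^-1 :> R by rewrite invr_ge0.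
rewrite normrM [leRHS]mulrCA ler_pM// normrM normrN (ger0_norm N0).
by rewrite ler_wpM2l.
Qed.

Let cchi n : cls (chi alpha g0 n : M -> R). Proof. exact: cls_chi. Qed.

(** With M_0 divided out, the distance between the image of an approximant and [psi]; the bracket
    collects the commutator of the cutoff with the generator. *)
Let res a b n (y : M) := chi alpha g0 n y * lap_sum n b y +
  (lap_sum n a y * DtW (chi alpha g0 n) y + GmW (chi alpha g0 n) (lap_sum n a) y) - laplace b y.

Let res_spec a b : tc a -> tc b ->
  [/\ forall n, measurable_fun setT (res a b n),
      exists C k, 0 <= C /\ forall n y, `|res a b n y| <= C * qw Sg y ^+ k &
      forall y, res a b n y @[n --> \oo] --> (0 : R)].
Proof.
move=> ca cb; have [bg lg] := small_bnd (Gm_chi_small ca).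
have [bd ld] := small_bnd (Dt_chi_bound alpha_gt0 g0_gt0 q li).
have ba := lap_sum_bnd ca; have bb := lap_sum_bnd cb; have bL := laplace_bnd cb.
split.
- move=> n; apply: measurable_funB; last exact: laplace_measurable.
  apply: continuous_measurable_mx; apply: cls_cont; apply: clsD.
    by apply: clsM => //; exact: cls_lap_sum.
  apply: clsD.
    apply: clsM; first exact: cls_lap_sum.
    apply: clsD.
      apply: cls_sum => k; apply: cls_sum => l; apply: clsM; first exact: cls_mulmx.
      exact: cls_derive.
    by apply: clsZ; apply: cls_sum => l; do 2 apply: cls_derive.
  apply: clsZ; apply: cls_sum => l; apply: clsM; apply: cls_derive => //; exact: cls_lap_sum.
- apply: bndD; last by apply: bndN; exact: bnd_cst.
  by apply: bndD; [exact: bndM|apply: bndD => //; exact: bndM].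
- move=> y; rewrite -[X in _ --> X](subrr (laplace b y)); apply: cvgB; last exact: cvg_cst.
  rewrite -[X in _ --> X](addr0 (laplace b y)); apply: cvgD.
    rewrite -[X in _ --> X](mul1r (laplace b y)); apply: cvgM; [exact: chi_cvg|exact: lap_sum_cvg].
  rewrite -[X in _ --> X](addr0 (0 : R)); apply: cvgD => //.
  rewrite -[X in _ --> X](mulr0 (laplace a y)); apply: cvgM => //; exact: lap_sum_cvg.
Qed.

Lemma laplace_closure : closure_graph M0 (B_expr A g0 q) phi psi.
Proof.
split; [exact: wpair_laplace_H|by rewrite psiE; exact: wpair_laplace_H|].
pose X n (a : R -> M -> R) (y : M) := chi alpha g0 n y * lap_sum n a y.
have cX n a : tc a -> cls (X n a) by move=> ca; apply: clsM => //; exact: cls_lap_sum.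
have cM0 := @cls_M0 R d K Sg.
(* Riemann sums of the Laplace integral, cut off in y, are test functions. *)
exists (fun n => wpair Sg (X n f) (X n g)); split.
- move=> n; split.
  + by apply: cls_smooth; apply: (clsM cM0); exact: cX.
  + by apply: cls_smooth; apply: (clsM cM0); exact: cX.
  + apply: (chi_compact alpha_gt0 g0_gt0 (n := n)) => y e.
    by rewrite /wpair /X e !mul0r mulr0.
- pose dX a n y := X n a y - laplace a y.
  have sp a : tc a -> [/\ forall n, measurable_fun setT (dX a n),
      exists C k, 0 <= C /\ forall n y, `|dX a n y| <= C * qw Sg y ^+ k &
      forall y, dX a n y @[n --> \oo] --> (0 : R)].
    move=> ca; split.
    + move=> n; apply: measurable_funB; last exact: laplace_measurable.
      by apply: continuous_measurable_mx; apply: cls_cont; exact: cX.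
    + apply: bndD; last by apply: bndN; apply: bnd_cst; exact: laplace_bnd.
      by apply: bndM => //; exact: lap_sum_bnd.
    + move=> y; rewrite -[X in _ --> X](subrr (laplace a y)); apply: cvgB; last exact: cvg_cst.
      rewrite -[X in _ --> X](mul1r (laplace a y)); apply: cvgM; [exact: chi_cvg|exact: lap_sum_cvg].
  have [m1 b1 l1] := sp f cf; have [m2 b2 l2] := sp g cg.
  have [C [k [C0 ha hb]]] := common b1 b2.
  have := wpair_cvg sS m1 m2 C0 ha hb l1 l2; apply: cvg_trans; apply: near_eq_cvg; apply: nearW => n.
  congr (H_normsq _ _); apply/funext => y; rewrite /wpair /dX.
  by apply: complex_eq; rewrite /= mulrBr.
- have [m1 b1 l1] := res_spec cf ctf; have [m2 b2 l2] := res_spec cg ctg.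
  have [C [k [C0 ha hb]]] := common b1 b2.
  have := wpair_cvg sS m1 m2 C0 ha hb l1 l2; apply: cvg_trans; apply: near_eq_cvg; apply: nearW => n.
  congr (H_normsq _ _); apply/funext => y.
  have DX a : tc a -> DtW (X n a) y = chi alpha g0 n y * lap_sum n (fun t => DtW (a t)) y +
      lap_sum n a y * DtW (chi alpha g0 n) y + GmW (chi alpha g0 n) (lap_sum n a) y.
    move=> ca; rewrite DtM//; last exact: cls_lap_sum.
    by rewrite lap_sum_Dt.
  have eQ a : lap_sum n (fun t y => Q y * a t y) y = Q y * lap_sum n a y.
    by rewrite mulr_sumr; apply: eq_bigr => j _; move: (expR _) => E; ring.
  rewrite psiE; apply: complex_eq.
    rewrite cReB B_expr_Re [X in B_real _ _ X](_ : _ = (fun z => M0 z * X n f z))//.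
    rewrite (B_real_M0 alpha_gt0 g0_gt0 y (cX n f cf)) DX// /res /wpair /=.
    rewrite /tf lap_sumD eQ /X.
    move: (M0 y) (chi _ _ _ _) (lap_sum _ _ _) (lap_sum _ _ _) (lap_sum _ _ _) => *; ring.
  rewrite cImB B_expr_Im [X in B_real _ _ X](_ : _ = (fun z => M0 z * X n g z))//.
  rewrite (B_real_M0 alpha_gt0 g0_gt0 y (cX n g cg)) DX// /res /wpair /=.
  have -> : lap_sum n tg y = lap_sum n (fun t => DtW (g t)) y - Q y * lap_sum n f y.
    by rewrite -eQ -mulN1r -lap_sumZ -lap_sumD; apply: eq_bigr => j _; rewrite /tg mulN1r.
  rewrite /X.
  move: (M0 y) (chi _ _ _ _) (lap_sum _ _ _) (lap_sum _ _ _) (lap_sum _ _ _) => *; ring.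
Qed.

End closure.

Lemma cintegral_eq {R : realType} dsp (T : measurableType dsp) (mu : {measure set T -> \bar R})
    (D : set T) (f g : T -> R[i]) : (forall x, D x -> f x = g x) ->
  cintegral mu D f = cintegral mu D g.
Proof.
by move=> h; congr (_ +i* _); apply: eq_Rintegral => x; rewrite inE => /h ->.
Qed.

(** * Solving the resolvent equation *)

Section existence.
Context {R : realType} {d K : nat} (alpha : 'I_K.+1 -> R).
Hypothesis alpha_gt0 : forall k, 0 < alpha k.
Variable g0 : R.
Hypothesis g0_gt0 : 0 < g0.
Variable q : 'rV[R]_d.
Variables (lambda kappa : R[i]).
Notation M := 'M[R]_(K.+1, d).
Notation A := (drift alpha).
Notation Sg := (OU_cov A g0).
Notation M0 := (@maxwellian R d K Sg).
Notation Re := complex.Re.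
Notation Im := complex.Im.
Notation li := (Im lambda).
Hypothesis lr_gt0 : 0 < Re lambda.
Let sS : spd Sg. Proof. exact: OU_spd. Qed.
Let u : R -> M -> R := vRe alpha g0 q li.
Let v : R -> M -> R := vIm alpha g0 q li.
Let cu : tcls alpha g0 q li u. Proof. exact: tc_vRe. Qed.
Let cv : tcls alpha g0 q li v. Proof. exact: tc_vIm. Qed.

Lemma resolvent_exists : exists phi psi, closure_graph M0 (B_expr A g0 q) phi psi /\
  forall y, lambda * phi y - psi y = kappa * (lapM0 Sg y)%:C.
Proof.
(* f + i g = kappa (u + i v): multiplication by the complex constant kappa preserves the linear
   evolution. *)
pose f t y := Re kappa * u t y + - Im kappa * v t y.
pose g t y := Re kappa * v t y + Im kappa * u t y.
have cf : tcls alpha g0 q li f by apply: tcD; exact: tcZ.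
have cg : tcls alpha g0 q li g by apply: tcD; exact: tcZ.
have df (t : R) y := is_derive_vRe alpha_gt0 g0_gt0 q li t y.
have dg (t : R) y := is_derive_vIm alpha_gt0 g0_gt0 q li t y.
have cut t := tc_cls t cu; have cvt t := tc_cls t cv.
have Df t y : Dt (Wrev alpha g0) g0 (f t) y = Re kappa * Dt (Wrev alpha g0) g0 (u t) y - Im kappa * Dt (Wrev alpha g0) g0 (v t) y.
  by rewrite (DtD _ g0 y (clsZ _ (cut t)) (clsZ _ (cvt t))) (DtZ _ g0 _ y (cut t)) (DtZ _ g0 _ y (cvt t)) mulNr.
have Dg t y : Dt (Wrev alpha g0) g0 (g t) y = Re kappa * Dt (Wrev alpha g0) g0 (v t) y + Im kappa * Dt (Wrev alpha g0) g0 (u t) y.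
  by rewrite (DtD _ g0 y (clsZ _ (cvt t)) (clsZ _ (cut t))) (DtZ _ g0 _ y (cut t)) (DtZ _ g0 _ y (cvt t)).
have hf (t : R) y : is_derive t 1 (f ^~ y : R -> R^o)
    (Dt (Wrev alpha g0) g0 (f t) y + mdot (@Q1 R d K q) y * g t y + li * g t y).
  apply: is_derive_eq (is_deriveD (is_deriveZR (Re kappa) (df t y)) (is_deriveZR (- Im kappa) (dg t y))) _.
  rewrite Df /f /g -/u -/v.
  move: (u t y) (v t y) (Dt _ _ (u t) y) (Dt _ _ (v t) y) (mdot _ y) => *; ring.
have hg (t : R) y : is_derive t 1 (g ^~ y : R -> R^o)
    (Dt (Wrev alpha g0) g0 (g t) y - mdot (@Q1 R d K q) y * f t y - li * f t y).
  apply: is_derive_eq (is_deriveD (is_deriveZR (Re kappa) (dg t y)) (is_deriveZR (Im kappa) (df t y))) _.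
  rewrite Dg /f /g -/u -/v.
  move: (u t y) (v t y) (Dt _ _ (u t) y) (Dt _ _ (v t) y) (mdot _ y) => *; ring.
have := laplace_closure alpha_gt0 g0_gt0 lr_gt0 cf cg hf hg.
set phi := wpair _ _ _ => cl; eexists; eexists; split; first exact: cl.
move=> y; rewrite opprB addrCA subrr addr0 /wpair.
have [e1 e2] := v0E alpha_gt0 g0_gt0 q li y.
rewrite /f /g /u /v e2 !mulr0 addr0 add0r mulrCA e1.
by rewrite [M0 y * _]mulrCA e1; apply: complex_eq; rewrite !cE /= mulr0 ?subr0 ?add0r.
Qed.

Lemma laplacian_last_M0 y : laplacian_last (fun z => (M0 z)%:C) y = (lapM0 Sg y)%:C.
Proof.
have h1 (V z : M) : is_derive z V (M0 : M -> R^o) (@mw_cst R d K Sg * d1gw Sg V z).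
  rewrite (_ : (M0 : M -> R^o) = (fun z => @mw_cst R d K Sg * gw Sg z)); last first.
    by apply/funext => x; exact: maxwellianE.
  exact: is_deriveZV (is_derive_gw sS z V).
have h2 (V z : M) := is_deriveZV (@mw_cst R d K Sg) (is_derive_d1gw sS z V).
have h0 (V z : M) : is_derive z V (fun=> 0 : R^o) (0 : R) by exact: is_derive_cst.
rewrite /laplacian_last /lapM0; apply: complex_eq.
  rewrite cRe_sum cReC mulr_sumr; apply: eq_bigr => l _.
  exact: (der2E (h1 _) (h2 _ y)).
rewrite cIm_sum cImC big1// => l _.
exact: (der2E (h0 _) (h0 _ y)).
Qed.

End existence.

(* [K.+1] is the number of variables y^k. *)
Theorem mainTheorem2 (R : realType) (d K : nat) (d_gt0 : (0 < d)%N)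
  (alpha : 'I_K.+1 -> R) (alpha_gt0 : forall k, 0 < alpha k)
  (rho0 : R) (rho0_gt0 : 0 < rho0)
  (G : R -> R)
  (G_gt0 : forall x : R, 0 <= x -> 0 < G x)
  (G_bounded : exists M, forall x : R, 0 <= x -> G x <= M)
  (G_decreasing : forall x y : R, 0 <= x -> x <= y -> G y <= G x)
  (G_derivable : derivable G rho0 1)
  (dG_lt0 : derive1 G rho0 < 0)
  (w : 'rV[R]_d -> R) (w_profile : interaction_profile w)
  (w_mass : \int[leb_mx 1 d]_(x in unit_cell) periodize w x = 1)
  (dsp : measure_display) (T : measurableType dsp) (P : probability T R)
  (B : R -> T -> R) (Y : R -> T -> 'cV[R]_K.+1)
  (OU_Y : stationary_OU P (drift alpha) (G rho0) B Y)
  (n : 'rV[int]_d) (n_neq0 : n != 0)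
  (lambda : R[i]) (Re_lambda_gt0 : 0 < complex.Re lambda) :
  let A := drift alpha in
  let g0 := G rho0 in
  let g1 := derive1 G rho0 in
  let q := wave n in
  let What := fourier_coeff (periodize w) n in
  (exists phi : 'M[R]_(K.+1, d) -> R[i],
     eigen_solution A g0 q ((rho0 * g0 * g1)%:C * What) lambda phi /\
     rho phi != 0)
  <->
  - ((rho0 * g0 * g1)%:C * What * (dotp q q)%:C *
     cintegral (@lebesgue_measure R) `[0, +oo[
       (fun t => cexp (- lambda * t%:C) *
                 (C_first A t ^+ 2 *
                  expR (- (dotp q q / 2) * V_first P Y t))%:C)) = 1.
Proof.
move=> A g0 g1 q What; set c := _ * What.
have g0_gt0 : 0 < g0 by apply: G_gt0; exact: ltW.
set I := cintegral _ _ _.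
have eI : I = cintegral (@lebesgue_measure R) `[0, +oo[ (fun t => cexp (- lambda * t%:C) *
     (OU_CK alpha t ^+ 2 * expR (- (dotp q q / 2) * OU_V alpha g0 t))%:C).
  apply: cintegral_eq => t; rewrite /= in_itv/= andbT => t0.
  have eC : C_first A t = OU_CK alpha t by exact: C_firstE.
  have eV : V_first P Y t = OU_V alpha g0 t by exact: (V_firstE alpha_gt0 g0_gt0 OU_Y t0).
  by rewrite eC eV.
have lapE := @laplacian_last_M0 R d K alpha alpha_gt0 g0 g0_gt0.
have rhoE phi psi kappa (cl : closure_graph (maxwellian (OU_cov A g0)) (B_expr A g0 q) phi psi)
    (e : {ae leb_mx K.+1 d, forall y, lambda * phi y - psi y = kappa * (lapM0 (OU_cov A g0) y)%:C}) :
    rho phi = kappa * - ((dotp q q)%:C * I).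
  by rewrite eI; exact: (rho_closure alpha_gt0 g0_gt0 cl e Re_lambda_gt0).
split=> [[phi [[psi cl e] r0]]|disp].
  have := rhoE phi psi (c * rho phi) cl.
  have e' : {ae leb_mx K.+1 d, forall y, lambda * phi y - psi y = c * rho phi * (lapM0 (OU_cov A g0) y)%:C}.
    by apply: filterS e => y; rewrite lapE.
  (* [h] expresses rho[phi] as itself times the dispersion integral; the nonzero factor is
     cancelled. *)
  move=> /(_ e') h; apply: (mulIf r0); rewrite mul1r [RHS]h.
  by ring.
(* The source is given the constant c without the factor rho[phi]. The dispersion relation then
   yields rho[phi] = 1, which restores the nonlocal term. *)
have [phi [psi [cl e]]] := resolvent_exists alpha_gt0 g0_gt0 q c Re_lambda_gt0.
have r1 : rho phi = 1.
  by rewrite (rhoE phi psi c cl) ?mulrN ?mulrA//; exact: aeW.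
exists phi; rewrite r1 oner_neq0; split=> //.
by exists psi => //; apply: aeW => y; rewrite r1 mulr1 e lapE.
Qed.
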